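(* Let $\Omega\subset\mathbb R^2$ be a bounded Lipschitz domain that is simply connected with connected boundary. Then $$\boldsymbol H^{-2}(\operatorname{rot}\mathbf{rot},\Omega;\mathbb S)=\boldsymbol\varepsilon\,\boldsymbol L^2(\Omega;\mathbb R^2)\oplus\mathbf{curl}\operatorname{curl}H_0^2(\Omega)$$ (direct sum).
   Context: $\mathbb S$ is the space of symmetric $2\times2$ matrices. $\boldsymbol H^{-2}(\operatorname{rot}\mathbf{rot},\Omega;\mathbb S):=\{\boldsymbol\tau\in\boldsymbol H^{-1}(\Omega;\mathbb S):\operatorname{rot}\mathbf{rot}\boldsymbol\tau\in H^{-2}(\Omega)\}$ with squared norm $\|\boldsymbol\tau\|_{-1}^2+\|\operatorname{rot}\mathbf{rot}\boldsymbol\tau\|_{-2}^2$. Here $\operatorname{rot}\boldsymbol\phi=\partial_1\phi_2-\partial_2\phi_1$ for a vector field, $\mathbf{rot}$ is $\operatorname{rot}$ applied row-wise to a matrix field; $\operatorname{curl}v=(\partial_2v,-\partial_1v)^{\intercal}$ for a scalar $v$, and $\mathbf{curl}$ is $\operatorname{curl}$ applied to each component of a vector field, giving the rows of a matrix field; $\boldsymbol\varepsilon(\boldsymbol u)=(\nabla\boldsymbol u+(\nabla\boldsymbol u)^{\intercal})/2$ is the symmetric gradient. Derivatives are distributional. *)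

(* Defs.v *)
From HB Require Import structures.
From mathcomp Require Import all_boot all_order all_algebra.
From mathcomp Require Import all_classical all_reals all_analysis.

Set Implicit Arguments.
Unset Strict Implicit.
Unset Printing Implicit Defensive.

Import Order.TTheory GRing.Theory Num.Theory.
Import numFieldNormedType.Exports.

Local Open Scope classical_set_scope.
Local Open Scope ring_scope.

(* The plane is R * R, which carries canonically both the product topology and
   the product sigma-algebra.  Coordinates are indexed by 'I_2, from 0. *)

Section Domains.
Context {R : realType}.
Implicit Types Om : set (R * R).

Definition boundary Om : set (R * R) := closure Om `\` interior Om.

(* Near each boundary point, in suitable Cartesian coordinates (translation
   and rotation of angle with cosine c and sine s), Om is the strict epigraph
   of a Lipschitz function. *)
Definition lipschitz_boundary Om := forall x, boundary Om x ->
  exists c s r h : R, exists f : R -> R,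
  [/\ c ^+ 2 + s ^+ 2 = 1, 0 < r, 0 < h, lipschitz f &
      forall y1 y2 : R, `|y1| < r -> `|y2| < h ->
        Om (x.1 + (c * y1 - s * y2), x.2 + (s * y1 + c * y2)) <-> f y1 < y2].

Definition bounded_lipschitz_domain Om :=
  [/\ Om !=set0, open Om, connected Om, bounded_set Om & lipschitz_boundary Om].

Definition simply_connected Om :=
  (forall x y, Om x -> Om y -> exists g : R -> R * R,
    [/\ {within `[0, 1], continuous g}, g @` `[0, 1] `<=` Om,
        g 0 = x & g 1 = y]) /\
  (forall g : R -> R * R, {within `[0, 1], continuous g} ->
    g @` `[0, 1] `<=` Om -> g 0 = g 1 ->
    exists H : R * R -> R * R,
    [/\ {within `[0, 1] `*` `[0, 1], continuous H},
        H @` (`[0, 1] `*` `[0, 1]) `<=` Om,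
        {in `[0, 1], forall t, H (0, t) = g t /\ H (1, t) = g 0} &
        {in `[0, 1], forall t, H (t, 0) = g 0 /\ H (t, 1) = g 0}]).

End Domains.

Section TestFunctions.
Context {R : realType}.
Implicit Types (f g : R * R -> R) (Om : set (R * R)) (i : 'I_2) (s : seq 'I_2).

Definition basis2 i : R * R := if i == 0 then (1, 0) else (0, 1).

Definition partial i f : R * R -> R := fun x => 'D_(basis2 i) f x.

Definition smooth f := forall s, continuous (foldr partial f s) /\
  forall i x, derivable (foldr partial f s) x (basis2 i).

Definition supp f : set (R * R) := closure [set x | f x != 0].

Definition is_test Om f := [/\ smooth f, compact (supp f) & supp f `<=` Om].

Lemma smooth_partial i f : smooth f -> smooth (partial i f).
Proof. by move=> sf s; have := sf (rcons s i); rewrite foldr_rcons. Qed.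

Lemma smooth_lin (a : R) f g : smooth f -> smooth g -> smooth (a *: f + g).
Proof.
move=> sf sg s.
have -> : foldr partial (a *: f + g) s =
          a *: foldr partial f s + foldr partial g s.
  elim: s => //= i s ->; apply/funext => x.
  have [[_ df] [_ dg]] := (sf s, sg s).
  rewrite /partial deriveD//; last exact: derivableZ.
  by rewrite deriveZ.
have [[cf df] [cg dg]] := (sf s, sg s); split => [x|i x].
  by apply: continuousD; [exact: continuousZr (cf x) | exact: cg].
by apply: derivableD => //; exact: derivableZ.
Qed.

Lemma smooth0 : smooth (0 : R * R -> R).
Proof.
move=> s; have -> : foldr partial (0 : R * R -> R) s = cst 0.
  elim: s => //= i s ->; apply/funext => x.
  by rewrite /partial derive_cst.
by split=> [x|i x]; [exact: cst_continuous | exact: derivable_cst].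
Qed.

Lemma supp0 : supp (0 : R * R -> R) = set0.
Proof.
rewrite /supp (_ : [set x | _] = set0) ?closure0//.
by apply/seteqP; split => x //=; rewrite eqxx.
Qed.

Lemma supp_lin (a : R) f g : supp (a *: f + g) `<=` supp f `|` supp g.
Proof.
rewrite /supp -closureU; apply: closureS => x /=.
have [fx|? _] := eqVneq (f x) 0; last by left.
have [gx|? _] := eqVneq (g x) 0; last by right.
suff -> : (a *: f + g) x = 0 by rewrite eqxx.
by rewrite -[LHS]/(a * f x + g x) fx gx mulr0 addr0.
Qed.

Lemma supp_partial i f : supp (partial i f) `<=` supp f.
Proof.
have cf : closed (supp f) by exact: closed_closure.
rewrite /supp [X in _ `<=` X](closure_id (supp f)).1//.
apply: closureS => x /=; apply: contraNP => fx.
have nf : \forall y \near x, f y = cst 0 y.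
  have : nbhs x (~` supp f) by apply: open_nbhs_nbhs; split => //; exact: closed_openC.
  apply: filterS => y fy; apply/eqP; apply: contra_notT fy.
  exact: (@subset_closure _ [set x | f x != 0]).
by rewrite /partial (near_eq_derive _ nf) derive_cst.
Qed.

Lemma sub_supp_compact f (K : set (R * R)) :
  compact K -> supp f `<=` K -> compact (supp f).
Proof. by move=> cK; apply: subclosed_compact => //; exact: closed_closure. Qed.

Lemma is_test_partial Om i f : is_test Om f -> is_test Om (partial i f).
Proof.
move=> [sf cf fOm]; have ff := @supp_partial i f.
by split; [exact: smooth_partial|exact: sub_supp_compact ff
          |exact: subset_trans fOm].
Qed.

Definition testfun_pred Om : {pred R * R -> R} := mem [set f | is_test Om f].

Record testfun Om := TestFun {
  testfun_val :> R * R -> R ;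
  testfunP : testfun_val \in testfun_pred Om }.

HB.instance Definition _ Om := [isSub for @testfun_val Om].
HB.instance Definition _ Om := [Choice of testfun Om by <:].

Lemma testfun_submod_closed Om : submod_closed (testfun_pred Om).
Proof.
split=> [|a f g].
  rewrite inE /= /is_test supp0; split; [exact: smooth0|exact: compact0|].
  exact: sub0set.
rewrite !inE => -[sf cf fOm] [sg cg gOm]; have fg := @supp_lin a f g.
split; [exact: smooth_lin| |].
  by apply: sub_supp_compact fg; exact: compactU.
by apply: (subset_trans fg) => x [/fOm|/gOm].
Qed.

HB.instance Definition _ Om := GRing.isSubmodClosed.Build R (R * R -> R)
  (testfun_pred Om) (@testfun_submod_closed Om).
HB.instance Definition _ Om := [SubChoice_isSubLmodule of testfun Om by <:].

Lemma partial_subproof Om i (phi : testfun Om) :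
  partial i phi \in testfun_pred Om.
Proof. by apply: mem_set; apply: is_test_partial; exact: set_mem (testfunP phi). Qed.

Definition testfun_partial Om i (phi : testfun Om) : testfun Om :=
  TestFun (partial_subproof i phi).

End TestFunctions.

Section Distributions.
Context {R : realType} (Om : set (R * R)).
Implicit Types (f v : R * R -> R) (T : testfun Om -> R) (i : 'I_2).
Implicit Types (phi : testfun Om).

Definition lebesgue2 := (@lebesgue_measure R \x @lebesgue_measure R)%E.

(* Functions on Om are given on the whole plane; only their values on Om
   matter, and f \_ Om is the extension by zero of f restricted to Om. *)
Definition L2 f : Prop := f \_ Om \in Lfun lebesgue2 2%:E.

Definition L2norm f : \bar R := 'N[lebesgue2]_2%:E[EFin \o (f \_ Om)]%E.

Definition distr_of f : testfun Om -> R := fun phi =>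
  \int[lebesgue2]_(x in Om) (f x * phi x).

Definition distr_partial i T : testfun Om -> R := fun phi =>
  - T (testfun_partial i phi).

(* The families (g a b) below are indexed by the multi-index (a, b). *)
Definition sobolev_norm k (g : nat -> nat -> R * R -> R) : \bar R :=
  ((\sum_(a < k.+1) \sum_(b < k.+1 | (a + b <= k)%N) L2norm (g a b) ^+ 2)
     `^ 2^-1)%E.

Definition test_derivs phi a b : R * R -> R :=
  iter a (partial 0) (iter b (partial 1) phi).

Definition distr_derivs T a b : testfun Om -> R :=
  iter a (distr_partial 0) (iter b (distr_partial 1) T).

Definition weak_derivs k v (g : nat -> nat -> R * R -> R) := forall a b,
  (a + b <= k)%N -> L2 (g a b) /\ distr_of (g a b) = distr_derivs (distr_of v) a b.

(* Closure of the test functions in H^k(Om). *)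
Definition H0 k : set (R * R -> R) := [set v | L2 v /\
  exists2 g, weak_derivs k v g & forall e : R, 0 < e ->
    exists phi : testfun Om,
      (sobolev_norm k (fun a b => g a b \- test_derivs phi a b)%R < e%:E)%E].

(* The dual of H^k_0(Om), realized as a space of distributions by restriction
   to the dense subspace of test functions.  The estimate implies continuity
   for the usual topology of test functions. *)
Definition Hminus k : set (testfun Om -> R) := [set T | scalar T /\
  exists C : R, forall phi,
    ((`|T phi|)%:E <= C%:E * sobolev_norm k (test_derivs phi))%E].

End Distributions.

Arguments distr_of {R} Om f phi.

Section DifferentialOperators.
Context {R : realType} {Om : set (R * R)}.
Local Notation distr := (testfun Om -> R).
Implicit Types (T : distr) (u : 'cV[distr]_2) (tau : 'M[distr]_2).

Definition rot2 u : distr := distr_partial 0 (u 1 0) - distr_partial 1 (u 0 0).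

Definition rot2_rows tau : 'cV[distr]_2 := \col_i rot2 (row i tau)^T.

Definition curl2 T : 'cV[distr]_2 :=
  \col_i (if i == 0 then distr_partial 1 T else - distr_partial 0 T).

Definition curl2_rows u : 'M[distr]_2 := \matrix_(i, j) curl2 (u i 0) j 0.

Definition grad u : 'M[distr]_2 := \matrix_(i, j) distr_partial j (u i 0).

Definition sym_grad u : 'M[distr]_2 :=
  map_mx (GRing.scale 2^-1) (grad u + (grad u)^T).

End DifferentialOperators.

Section Spaces.
Context {R : realType} (Om : set (R * R)).
Local Notation distr := (testfun Om -> R).

Definition Hrotrot : set 'M[distr]_2 := [set tau |
  [/\ tau^T = tau, forall i j, Hminus 1 (tau i j) &
      Hminus 2 (rot2 (rot2_rows tau))]].

Definition sym_grad_L2 : set 'M[distr]_2 :=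
  [set sym_grad (\col_i distr_of Om (u i)) | u in
    [set u : 'I_2 -> R * R -> R | forall i, L2 Om (u i)]].

Definition curl_curl_H02 : set 'M[distr]_2 :=
  [set curl2_rows (curl2 (distr_of Om v)) | v in H0 Om 2].

(* A is the internal direct sum of B and C; meant for additive subgroups. *)
Definition direct_sum (V : zmodType) (A B C : set V) :=
  A = [set x + y | x in B & y in C] /\ B `&` C = [set 0].

End Spaces.

Arguments Hrotrot {R} Om _.
Arguments sym_grad_L2 {R} Om _.
Arguments curl_curl_H02 {R} Om _.

(* Main.v *)
From HB Require Import structures.
Require Import Defs.
From mathcomp Require Import all_boot all_order all_algebra.
From mathcomp Require Import all_classical all_reals all_analysis.
From mathcomp Require Import measurable_realfun.
From mathcomp Require Import ring lra.

Set Implicit Arguments.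
Unset Strict Implicit.
Unset Printing Implicit Defensive.

Import Order.TTheory GRing.Theory Num.Theory.
Import numFieldNormedType.Exports.

Local Open Scope classical_set_scope.
Local Open Scope ring_scope.

(** A field tau of H^{-2}(rot rot) is split by solving a biharmonic problem. The
    functional F = rot rot tau is bounded for the norm of H^2, so the Riesz
    theorem for the energy, the sum over i and j of the inner products of
    d_i d_j f and d_i d_j g, gives v in H^2_0 whose bilaplacian is F
    (biharmonic_solution). The double rotation of curl curl v is the
    bilaplacian of v, hence s = tau - curl curl v is symmetric with rot rot s = 0.

    Such an s is a symmetric gradient (saint_venant). The rows of s have a
    curl-free rotation, so this rotation is the gradient of some p; correcting
    the rows by the skew-symmetric field with entry p makes them curl-free, and
    their primitives are the components of a displacement u. Primitives of
    curl-free distributions (poincare_lemma) are found on squares, where every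
    test function is explicitly a sum of two derivatives and a multiple of a fixed
    function. Two of them differ by a multiple of the integral on an overlap;
    these multiples form a cocycle, which is summed along paths, and simple
    connectedness makes the sum independent of the path (monodromy). The
    normalized primitives are glued by partitions of unity (gluing).

    It remains to see that u is square integrable (l2_estimate). The second
    derivatives of u are first derivatives of s, so u applied to d_i d_j f is
    bounded by the norm N2 of H^2. Near a boundary point, the
    Lipschitz condition gives two directions a and b along which small
    translations stay in the domain. Smoothing a test function f at dyadic
    scales by kernels carried by the parallelogram of a and b, with vanishing
    first moment, telescopes into second differences:
    f minus its smoothing is d_a d_a psi_1 + d_b d_b psi_2, and the norms N2 of
    psi_1 and psi_2 are at most a constant times the L2 norm of f (multiscale).
    This constant does not depend on the number of scales because the squares of
    the band-pass parts of f telescope by the parallelogram law (bp_pythagoras).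
    The smoothed function is then moved into a compact subset by a second difference
    along a third direction (patch), and there u is of order two. A bound of u by
    the L2 norm gives a square integrable representative (riesz_L2).

    The converse inclusion is a computation (compose). If a symmetric gradient
    equals curl curl v, then its double rotation, the bilaplacian of v, vanishes,
    and so does the energy of v (biharmonic0).

    Functions of H^2_0 and L2 are handled through sequences of test functions that
    are Cauchy at dyadic rate; a bound by C 2^-n for all n replaces each passage to
    the limit. Distributions are mostly functionals u on plain functions, linear on
    the class Tc Om of test functions. *)

(** * Smooth functions on the plane *)

(** The sealed form of the smoothness predicate, which is a universally
    quantified statement and would otherwise be unfolded by automation. *)
HB.lock Definition Smooth {R : realType} (f : R * R -> R) : Prop := smooth f.

Lemma SmoothE {R : realType} (f : R * R -> R) : Smooth f = smooth f.
Proof. by rewrite Smooth.unlock. Qed.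

Section Calculus.
Context {R : realType}.
Implicit Types (f g : R * R -> R) (i j : 'I_2) (x v w : R * R) (s : seq 'I_2).

Lemma smooth_continuous f : Smooth f -> continuous f.
Proof. by rewrite SmoothE => sf; exact: (sf [::]).1. Qed.

Lemma Smooth_partial i f : Smooth f -> Smooth (partial i f).
Proof. by rewrite !SmoothE; exact: smooth_partial. Qed.

Arguments Smooth_partial i [f].

Lemma Smooth0 : Smooth (0 : R * R -> R).
Proof. by rewrite SmoothE; exact: smooth0. Qed.

Lemma Smooth_lin (a : R) f g : Smooth f -> Smooth g -> Smooth (a *: f + g).
Proof. by rewrite !SmoothE; exact: smooth_lin. Qed.

Lemma smooth_derivable f i x : Smooth f -> derivable f x (basis2 i).
Proof. by rewrite SmoothE => sf; exact: (sf [::]).2. Qed.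

Arguments smooth_derivable [f] i x.

(** Smoothness is proved by coinduction: it suffices to exhibit a class of
    functions that is stable under both partial derivatives. *)
Lemma smooth_coind (C : (R * R -> R) -> Prop) :
  (forall g, C g -> continuous g /\ forall i,
     (forall x, derivable g x (basis2 i)) /\ C (partial i g)) ->
  forall f, C f -> Smooth f.
Proof.
move=> CC f Cf; rewrite SmoothE => s.
have Cs : C (foldr partial f s).
  by elim: s => //= i s IH; have [_ /(_ i)[_]] := CC _ IH.
by have [cg dg] := CC _ Cs; split=> // i x; exact: (dg i).1.
Qed.

Inductive mulclass : (R * R -> R) -> Prop :=
| MulclassM f g of Smooth f & Smooth g : mulclass (fun x => f x * g x)
| MulclassD a b of mulclass a & mulclass b : mulclass (fun x => a x + b x).

Lemma partialM i f g : Smooth f -> Smooth g ->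
  partial i (fun x => f x * g x) =
  fun x => f x * partial i g x + partial i f x * g x.
Proof.
move=> sf sg; apply/funext => x; rewrite /partial.
have -> : (fun x => f x * g x) = f * g by [].
rewrite deriveM; [|exact: smooth_derivable..].
by rewrite -!/(partial _ _ _) /GRing.scale/= [in X in _ + X]mulrC.
Qed.

Lemma smoothM f g : Smooth f -> Smooth g -> Smooth (fun x => f x * g x).
Proof.
move=> sf sg; apply: (@smooth_coind mulclass); last exact: MulclassM.
move=> h; elim=> {f g sf sg h} [f g sf sg|a b _ [ca da] _ [cb db]].
  split=> [x|i]; first by apply: continuousM; exact: smooth_continuous.
  split=> [x|].
    by apply: (@derivableM _ _ f g); exact: smooth_derivable.
  rewrite partialM//; apply: MulclassD; apply: MulclassM => //;
    exact: Smooth_partial.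
split=> [x|i]; first by apply: continuousD; [exact: ca|exact: cb].
have [[da1 da2] [db1 db2]] := (da i, db i).
split=> [x|]; first exact: (@derivableD _ _ _ a b).
have -> : partial i (fun x => a x + b x) =
    fun x => partial i a x + partial i b x.
  by apply/funext => x; rewrite /partial (@deriveD _ _ _ a b).
exact: MulclassD.
Qed.

Lemma smoothD f g : Smooth f -> Smooth g -> Smooth (f + g).
Proof. by move=> sf sg; rewrite -[f]scale1r; exact: Smooth_lin. Qed.

Lemma smoothZ (a : R) f : Smooth f -> Smooth (a *: f).
Proof. by move=> sf; rewrite -[_ *: _]addr0; apply: Smooth_lin => //; exact: Smooth0. Qed.

Lemma smoothN f : Smooth f -> Smooth (- f).
Proof. by move=> sf; rewrite -scaleN1r; exact: smoothZ. Qed.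

Lemma smoothB f g : Smooth f -> Smooth g -> Smooth (f - g).
Proof. by move=> sf sg; apply: smoothD => //; exact: smoothN. Qed.

Lemma partialD i f g : Smooth f -> Smooth g ->
  partial i (f + g) = partial i f + partial i g.
Proof.
by move=> sf sg; apply/funext => x; rewrite /partial deriveD//; exact: smooth_derivable.
Qed.

Lemma partialZ i (a : R) f : Smooth f -> partial i (a *: f) = a *: partial i f.
Proof.
by move=> sf; apply/funext => x; rewrite /partial deriveZ//; exact: smooth_derivable.
Qed.

Lemma partialN i f : Smooth f -> partial i (- f) = - partial i f.
Proof. by move=> sf; rewrite -scaleN1r partialZ// scaleN1r. Qed.

Lemma partialB i f g : Smooth f -> Smooth g ->
  partial i (f - g) = partial i f - partial i g.
Proof. by move=> sf sg; rewrite partialD ?partialN//; exact: smoothN. Qed.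

Lemma partial0 i : partial i (0 : R * R -> R) = 0.
Proof. by apply/funext => x; rewrite /partial derive_cst. Qed.

Lemma smooth_sum (I : Type) (r : seq I) (P : pred I) (F : I -> R * R -> R) :
  (forall k, P k -> Smooth (F k)) -> Smooth (\sum_(k <- r | P k) F k).
Proof.
by move=> sF; apply: (big_ind Smooth) => //; [exact: Smooth0|exact: smoothD].
Qed.

Lemma partial_sum (I : Type) i (r : seq I) (F : I -> R * R -> R) :
  (forall k, Smooth (F k)) ->
  partial i (\sum_(k <- r) F k) = \sum_(k <- r) partial i (F k).
Proof.
move=> sF; elim: r => [|k r IH]; first by rewrite !big_nil partial0.
by rewrite !big_cons partialD ?IH//; exact: smooth_sum.
Qed.

Lemma derivable_line f v : (forall x, derivable f x v) -> forall x (r : R),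
  is_derive r (1 : R) (fun r : R => f (r *: v + x)) ('D_v f (r *: v + x)).
Proof.
move=> df x r.
have E : (fun h : R => h^-1 *: ((((fun r : R => f (r *: v + x)) \o shift r) (h *: 1 : R)) - f (r *: v + x)))
   = (fun h : R => h^-1 *: ((f \o shift (r *: v + x)) (h *: v) - f (r *: v + x))).
  apply/funext => h /=; congr (_ *: (f _ - _)).
  by rewrite scalerDl addrA /GRing.scale/= mulr1.
split; first by rewrite /derivable E; exact: df.
by rewrite /derive E.
Qed.

(** The mean value theorem between 0 and t, for t of either sign. *)
Lemma MVT0 (g dg : R -> R) (t : R) : (forall r : R, is_derive r (1 : R) g (dg r)) ->
  exists2 c : R, `|c| <= `|t| & g t - g 0 = dg c * t.
Proof.
move=> dgP.
have cg A : {within A, continuous g}.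
  apply: continuous_subspaceT => r; apply: differentiable_continuous.
  by apply/derivable1_diffP; exact: ex_derive.
case: (lerP 0 t) => t0.
  have [c] := MVT_segment t0 (fun r _ => dgP r) (cg _).
  rewrite in_itv/= subr0 => /andP[c0 ct] ->; exists c => //.
  by rewrite !ger0_norm.
have [c] := MVT_segment (ltW t0) (fun r _ => dgP r) (cg _).
rewrite in_itv/= => /andP[c0 ct] E; exists c; last first.
  by rewrite -opprB E sub0r mulrN opprK.
by rewrite !ler0_norm ?lerN2// ltW.
Qed.

Lemma ball_pairE (x y : R * R) (e : R) :
  ball x e y <-> `|x.1 - y.1| < e /\ `|x.2 - y.2| < e.
Proof. by split; [case|move=> [? ?]; split]. Qed.

Definition dir v f : R * R -> R :=
  fun x => v.1 * partial 0 f x + v.2 * partial 1 f x.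

Lemma scale_pairE (r : R) x : r *: x = (r * x.1, r * x.2).
Proof. by case: x. Qed.

Lemma add_pairE x y : x + y = (x.1 + y.1, x.2 + y.2).
Proof. by case: x; case: y. Qed.

Lemma cont_ball f x (e : R) : continuous f -> 0 < e ->
  exists2 d : R, 0 < d & forall y, `|x.1 - y.1| < d -> `|x.2 - y.2| < d -> `|f x - f y| < e.
Proof.
move=> cf e0; have /cvgrPdist_lt/(_ _ e0) := cf x.
move=> /nbhs_ballP[d /= d0 H]; exists d => // y y1 y2.
by apply: H; exact/ball_pairE.
Qed.

Lemma partial_line0 f (x : R * R) r : Smooth f ->
  is_derive r (1 : R) (fun t : R => f (x.1 + t, x.2)) (partial 0 f (x.1 + r, x.2)).
Proof.
move=> sf; have := derivable_line (fun y => smooth_derivable 0 y sf) x r.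
rewrite -/(partial 0 f _) (_ : (fun _ => _) = fun t : R => f (x.1 + t, x.2)).
  by rewrite scale_pairE add_pairE/= mulr1 mulr0 add0r addrC.
by apply/funext => t; rewrite scale_pairE add_pairE/= mulr1 mulr0 add0r addrC.
Qed.

Lemma partial_line1 f (x : R * R) r : Smooth f ->
  is_derive r (1 : R) (fun t : R => f (x.1, x.2 + t)) (partial 1 f (x.1, x.2 + r)).
Proof.
move=> sf; have := derivable_line (fun y => smooth_derivable 1 y sf) x r.
rewrite -/(partial 1 f _) (_ : (fun _ => _) = fun t : R => f (x.1, x.2 + t)).
  by rewrite scale_pairE add_pairE/= mulr1 mulr0 add0r addrC.
by apply/funext => t; rewrite scale_pairE add_pairE/= mulr1 mulr0 add0r addrC.
Qed.

Opaque partial.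

(** The increment along v splits into one increment along each axis, and the
    mean value theorem applies to both. *)
Lemma dir_derive0 f v x : Smooth f ->
  is_derive (0 : R) (1 : R) (fun r : R => f (x + r *: v)) (dir v f x).
Proof.
move=> sf.
suff L : h^-1 *: (((fun r : R => f (x + r *: v)) \o shift 0) (h *: 1 : R) - f (x + 0 *: v))
      @[h --> 0^'] --> dir v f x.
  by split; [apply/cvg_ex; exists (dir v f x)|exact: cvg_lim L].
apply/cvgrPdist_le => e e0.
pose K := `|v.1| + `|v.2| + 1.
have K0 : 0 < K by rewrite /K ltr_wpDl// addr_ge0.
have eK : 0 < e / K by rewrite divr_gt0.
have [d0 d00 H0] := cont_ball x (smooth_continuous (Smooth_partial 0 sf)) eK.
have [d1 d10 H1] := cont_ball x (smooth_continuous (Smooth_partial 1 sf)) eK.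
pose d := Num.min d0 d1; have dp : 0 < d by rewrite lt_min d00 d10.
near=> h.
have hn0 : h != 0 by near: h; exact: nbhs_dnbhs_neq.
have hd : `|h| * K < d.
  rewrite -ltr_pdivlMr//; near: h; apply: dnbhs0_lt; exact: divr_gt0.
rewrite /= addr0 scale0r addr0 (_ : h *: (1 : R) = h); last exact: mulr1.
have [c0 c0h E0] := MVT0 (h * v.1) (fun r => partial_line0 (x.1, x.2 + h * v.2) r sf).
have [c1 c1h E1] := MVT0 (h * v.2) (fun r => partial_line1 x r sf).
have hv1 : `|h * v.1| < d.
  apply: le_lt_trans hd; rewrite normrM ler_wpM2l// /K; have := normr_ge0 v.2; lra.
have hv2 : `|h * v.2| < d.
  apply: le_lt_trans hd; rewrite normrM ler_wpM2l// /K; have := normr_ge0 v.1; lra.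
have B0 : `|partial 0 f x - partial 0 f (x.1 + c0, x.2 + h * v.2)| < e / K.
  apply: H0; rewrite /= opprD addNKr normrN.
    by apply: le_lt_trans c0h (lt_le_trans hv1 _); rewrite ge_min lexx.
  by apply: (lt_le_trans hv2 _); rewrite ge_min lexx.
have B1 : `|partial 1 f x - partial 1 f (x.1, x.2 + c1)| < e / K.
  apply: H1; rewrite /= ?subrr ?normr0 ?opprD ?addNKr ?normrN//.
  by apply: le_lt_trans c1h (lt_le_trans hv2 _); rewrite ge_min lexx orbT.
move: E0 E1; rewrite /= !addr0 => E0 E1.
have -> : f (x + h *: v) - f x = h * (v.1 * partial 0 f (x.1 + c0, x.2 + h * v.2) + v.2 * partial 1 f (x.1, x.2 + c1)).
  rewrite scale_pairE add_pairE/=.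
  have -> : f (x.1 + h * v.1, x.2 + h * v.2) - f x =
    (f (x.1 + h * v.1, x.2 + h * v.2) - f (x.1, x.2 + h * v.2)) + (f (x.1, x.2 + h * v.2) - f (x.1, x.2)).
    by rewrite addrA subrK; case: (x).
  by rewrite E0 E1; ring.
rewrite (_ : forall y : R, h^-1 *: (h * y) = y); last first.
  by move=> y; exact: mulKf.
rewrite /dir.
set p0 := partial 0 f x in B0 *; set p1 := partial 1 f x in B1 *.
set q0 := partial 0 f _ in B0 *; set q1 := partial 1 f _ in B1 *.
have -> : v.1 * p0 + v.2 * p1 - (v.1 * q0 + v.2 * q1) = v.1 * (p0 - q0) + v.2 * (p1 - q1) by ring.
apply: le_trans (ler_normD _ _) _; rewrite !normrM.
apply: (@le_trans _ _ (`|v.1| * (e / K) + `|v.2| * (e / K))).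
  by apply: lerD; apply: ler_wpM2l => //; exact: ltW.
rewrite -mulrDl mulrCA ger_pMr// ler_pdivrMr// mul1r /K; lra.
Unshelve. all: by end_near.
Qed.

Lemma dir_line f v x r : Smooth f ->
  is_derive r (1 : R) (fun r : R => f (x + r *: v)) (dir v f (x + r *: v)).
Proof.
move=> sf; have [D V] := dir_derive0 v (x + r *: v) sf.
have E : (fun h : R => h^-1 *: ((((fun r0 : R => f (x + r0 *: v)) \o shift r) (h *: 1 : R)) - f (x + r *: v)))
   = (fun h : R => h^-1 *: (((fun r0 : R => f (x + r *: v + r0 *: v)) \o shift 0) (h *: 1 : R) - f (x + r *: v + 0 *: v))).
  apply/funext => h /=; rewrite scale0r addr0 -addrA -scalerDl addr0.
  by rewrite [r + _]addrC.
by split; [rewrite /derivable E|rewrite /derive E].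
Qed.

Lemma norm_half (e a b c : R) :
  `|a - c| < e / 2 -> `|b - c| < e / 2 -> `|b - a| <= e.
Proof.
move=> H H'; rewrite (_ : b - a = (b - c) - (a - c)); last by ring.
by rewrite (le_trans (ler_normB _ _))// (splitr e) lerD// ltW.
Qed.

Lemma ord2P i : i = 0 \/ i = 1.
Proof. by case: i => -[|[|//]] ?; [left|right]; exact/val_inj. Qed.

(** Both mixed partial derivatives are limits of the same second difference
    quotient. *)
Lemma partialC i j f : Smooth f -> partial i (partial j f) = partial j (partial i f).
Proof.
move=> sf.
suff H : partial 0 (partial 1 f) = partial 1 (partial 0 f).
  case: (ord2P i) => ->; case: (ord2P j) => ->; [reflexivity|exact: H|exact: (esym H)|reflexivity].
apply/funext => x; apply/eqP; rewrite -subr_eq0 -normr_le0; apply/ler_addgt0Pl => e e0.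
have e2 : 0 < e / 2 by rewrite divr_gt0.
have s0 := Smooth_partial 0 sf; have s1 := Smooth_partial 1 sf.
have [d0 d00 H0] := cont_ball x (smooth_continuous (Smooth_partial 1 s0)) e2.
have [d1 d10 H1] := cont_ball x (smooth_continuous (Smooth_partial 0 s1)) e2.
pose h := Num.min d0 d1 / 2.
have h0 : 0 < h by rewrite divr_gt0// lt_min d00 d10.
have hd0 : `|h| < d0.
  by rewrite gtr0_norm// /h ltr_pdivrMr// (le_lt_trans (_ : _ <= d0))// ?ge_min ?lexx// mulr_natr mulr2n ltrDl.
have hd1 : `|h| < d1.
  by rewrite gtr0_norm// /h ltr_pdivrMr// (le_lt_trans (_ : _ <= d1))// ?ge_min ?lexx ?orbT// mulr_natr mulr2n ltrDl.
pose Q := f (x.1 + h, x.2 + h) - f (x.1 + h, x.2) - (f (x.1, x.2 + h) - f x).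
have [a ah Ea] : exists2 a, `|a| <= `|h| & Q = (partial 0 f (x.1 + a, x.2 + h) - partial 0 f (x.1 + a, x.2)) * h.
  have [a ah E] := MVT0 h (fun r => is_deriveB (partial_line0 (x.1, x.2 + h) r sf) (partial_line0 x r sf)).
  exists a => //; rewrite -E /= !fctE/= !addr0 /Q; case: (x) => ? ? /=; ring.
have [b bh Eb] := MVT0 h (fun r => partial_line1 (x.1 + a, x.2) r s0).
have [a' ah' Ea'] : exists2 a, `|a| <= `|h| & Q = (partial 1 f (x.1 + h, x.2 + a) - partial 1 f (x.1, x.2 + a)) * h.
  have [a' ah' E] := MVT0 h (fun r => is_deriveB (partial_line1 (x.1 + h, x.2) r sf) (partial_line1 x r sf)).
  exists a' => //; rewrite -E /= !fctE/= !addr0 /Q; case: (x) => ? ? /=; ring.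
have [b' bh' Eb'] := MVT0 h (fun r => partial_line0 (x.1, x.2 + a') r s1).
move: Eb Eb'; rewrite /= !addr0 => Eb Eb'.
have EE : partial 1 (partial 0 f) (x.1 + a, x.2 + b) = partial 0 (partial 1 f) (x.1 + b', x.2 + a').
  have gen (q A A' B B' : R) : q = A * h -> A = A' * h -> q = B * h -> B = B' * h ->
      A' = B'.
    move=> -> -> /(mulIf (lt0r_neq0 h0)) E E'; apply: (mulIf (lt0r_neq0 h0)).
    by rewrite E.
  exact: gen Ea Eb Ea' Eb'.
have B0 := H0 (x.1 + a, x.2 + b); have B1 := H1 (x.1 + b', x.2 + a').
move: B0 B1; rewrite /= !opprD !addNKr !normrN => /(_ (le_lt_trans ah hd0) (le_lt_trans bh hd0)) B0.
move=> /(_ (le_lt_trans bh' hd1) (le_lt_trans ah' hd1)) B1.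
rewrite EE in B0; exact: norm_half B0 B1.
Qed.

End Calculus.

(** * Smooth functions of one variable and a smooth step *)

Opaque partial.

HB.lock Definition Smooth1 {R : realType} (g : R -> R) : Prop :=
  exists2 C : (R -> R) -> Prop, C g & forall h, C h ->
    exists2 h' : R -> R, C h' & forall x, is_derive x (1 : R) h (h' x).

Lemma Smooth1P {R : realType} (g : R -> R) : Smooth1 g <->
  exists2 C : (R -> R) -> Prop, C g & forall h, C h ->
    exists2 h' : R -> R, C h' & forall x, is_derive x (1 : R) h (h' x).
Proof. by rewrite Smooth1.unlock. Qed.

Section Smooth1.
Context {R : realType}.
Implicit Types (g h : R -> R).

Lemma Smooth1_derive g : Smooth1 g ->
  exists2 g' : R -> R, Smooth1 g' & forall x, is_derive x (1 : R) g (g' x).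
Proof.
move=> /Smooth1P[C Cg CC]; have [g' Cg' dg] := CC _ Cg.
by exists g' => //; apply/Smooth1P; exists C.
Qed.

Lemma derive_continuous1 g (g' : R -> R) :
  (forall x, is_derive x (1 : R) g (g' x)) -> continuous g.
Proof.
by move=> dg x; apply/differentiable_continuous/derivable1_diffP; exact: ex_derive.
Qed.

Lemma Smooth1_continuous g : Smooth1 g -> continuous g.
Proof. by move=> /Smooth1_derive[g' _]; exact: derive_continuous1. Qed.

Lemma Smooth1_cst (c : R) : Smooth1 (fun _ : R => c).
Proof.
apply/Smooth1P; exists (fun g => exists d, g = fun=> d); first by exists c.
by move=> _ [d ->]; exists (fun=> 0); [exists 0|move=> x; exact: is_derive_cst].
Qed.

Lemma Smooth1_prim g g' : Smooth1 g' -> (forall x, is_derive x (1 : R) g (g' x)) ->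
  Smooth1 g.
Proof.
move=> /Smooth1P[C Cg' CC] dg; apply/Smooth1P.
exists (fun h => h = g \/ C h); first by left.
move=> h [->|/CC[h' Ch' dh]]; first by exists g' => //; right.
by exists h' => //; right.
Qed.

Lemma dD1 g h x (a b : R) : is_derive x (1 : R) g a -> is_derive x (1 : R) h b ->
  is_derive x (1 : R) (fun y => g y + h y) (a + b).
Proof. by move=> dg dh; exact: (is_deriveD dg dh). Qed.

Lemma dM1 g h x (a b : R) : is_derive x (1 : R) g a -> is_derive x (1 : R) h b ->
  is_derive x (1 : R) (fun y => g y * h y) (a * h x + g x * b).
Proof.
move=> dg dh; apply: is_derive_eq (is_deriveM dg dh) _.
by rewrite addrC /GRing.scale/=; congr (_ + _); exact: mulrC.
Qed.

Lemma dZ1 g x (k a : R) : is_derive x (1 : R) g a ->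
  is_derive x (1 : R) (fun y => k * g y) (k * a).
Proof. by move=> dg; exact: (is_deriveZ k dg). Qed.

Lemma dC1 g h x (a b : R) : is_derive x (1 : R) g a -> is_derive (g x) (1 : R) h b ->
  is_derive x (1 : R) (fun y => h (g y)) (a * b).
Proof.
move=> dg dh; have H := @is_derive1_comp _ h g _ _ _ dh dg.
by apply: is_derive_eq H _; exact: mulrC.
Qed.

Lemma Smooth1M_aux (g h : R -> R) : Smooth1 g -> Smooth1 h ->
  exists2 C : (R -> R) -> Prop, C (g * h) & forall u, C u ->
    exists2 u' : R -> R, C u' & forall x, is_derive x (1 : R) u (u' x).
Proof.
move=> sg sh.
pose C := fun u => exists2 s : seq ((R -> R) * (R -> R)),
  (forall p, List.In p s -> Smooth1 p.1 /\ Smooth1 p.2) &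
  u = \sum_(p <- s) (p.1 * p.2).
exists C.
  by exists [:: (g, h)]; [move=> p [<-|[]]|rewrite big_seq1].
move=> _ [s sP ->]; elim: s sP => [|p s IH] sP.
  exists 0; first by exists [::] => //; rewrite big_nil.
  by move=> x; rewrite big_nil; exact: is_derive_cst.
have [u' [s' s'P ->] du'] := IH (fun q qs => sP _ (or_intror qs)).
have [sp1 sp2] := sP p (or_introl erefl).
have [p1' sp1' dp1] := Smooth1_derive sp1.
have [p2' sp2' dp2] := Smooth1_derive sp2.
exists (p.1 * p2' + (p1' * p.2 + \sum_(q <- s') (q.1 * q.2))).
  exists [:: (p.1, p2'), (p1', p.2) & s']; last by rewrite !big_cons.
  by move=> q [<-|[<-|/s'P]].
move=> x; rewrite big_cons.
have H := @is_deriveD _ _ _ (p.1 * p.2) _ _ _ _ _ (is_deriveM (dp1 x) (dp2 x)) (du' x).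
apply: is_derive_eq H _; rewrite /GRing.scale/= !fctE addrA; congr (_ + _ + _).
exact: mulrC.
Qed.

Lemma Smooth1M (g h : R -> R) : Smooth1 g -> Smooth1 h -> Smooth1 (fun x => g x * h x).
Proof. by move=> sg sh; apply/Smooth1P; exact: Smooth1M_aux. Qed.

Lemma Smooth1_affine g (a b : R) : Smooth1 g -> Smooth1 (fun x => g (a * x + b)).
Proof.
move=> sg; apply/Smooth1P.
exists (fun u => exists k h, Smooth1 h /\ u = fun x => k * h (a * x + b)).
  by exists 1, g; split => //; apply/funext => x; rewrite mul1r.
move=> _ [k [h [sh ->]]]; have [h' sh' dh] := Smooth1_derive sh.
exists (fun x => (k * a) * h' (a * x + b)); first by exists (k * a), h'.
move=> x.
have dl : is_derive x (1 : R) (fun y => a * y + b) (a * 1 + 0).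
  exact: (dD1 (dZ1 a (is_derive_id x 1)) (is_derive_cst b x 1)).
rewrite mulr1 addr0 in dl.
by have := dZ1 k (dC1 dl (dh (a * x + b))); rewrite mulrA.
Qed.

(** Every function P(1/x) exp(-1/x), extended by zero, has a derivative of the
    same form: this class witnesses the smoothness of exp(-1/x). *)
Definition flat (p : {poly R}) : R -> R :=
  fun x => if 0 < x then p.[x^-1] * expR (- x^-1) else 0.

(** One term of the exponential series bounds the power, which makes the flat
    functions vanish to every order at the origin. *)
Lemma pow_expN (n : nat) (y : R) : 0 <= y -> y ^+ n * expR (- y) <= n`!%:R.
Proof.
move=> y0; rewrite expRN ler_pdivrMr ?expR_gt0//.
case: n => [|n]; first by rewrite expr0 fact0 mul1r; have := expR_ge1Dx y; lra.
rewrite mulrC -ler_pdivrMr ?ltr0n ?fact_gt0//.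
by apply: le_trans (expR_ge1Dxn n y0); rewrite lerDr.
Qed.

Lemma horner_expN (p : {poly R}) :
  exists2 C : R, 0 < C & forall y, 0 <= y -> `|p.[y] * expR (- y)| <= C.
Proof.
exists (1 + \sum_(i < size p) `|p`_i| * i`!%:R).
  by rewrite ltr_pwDl// sumr_ge0// => i _; rewrite mulr_ge0.
move=> y y0; rewrite horner_coef mulr_suml ler_wpDl// (le_trans (ler_norm_sum _ _ _))//.
apply: ler_sum => i _; rewrite -mulrA normrM ler_wpM2l//.
by rewrite ger0_norm ?pow_expN// mulr_ge0 ?exprn_ge0// expR_ge0.
Qed.

Lemma flat_derive (p : {poly R}) (x : R) :
  is_derive x (1 : R) (flat p) (flat ('X^2 * (p - p^`())) x).
Proof.
have [x0|x0|->] := ltgtP x 0.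
- rewrite {2}/flat ltNge ltW//=.
  apply: (near_eq_is_derive (f := fun=> 0)).
  near=> y; rewrite /flat ltNge ltW//=.
  by near: y; exact: lt_nbhsl.
- apply: (near_eq_is_derive (f := fun y : R => p.[y^-1] * expR (- y^-1))).
    near=> y; rewrite /flat (_ : 0 < y)//; near: y; exact: lt_nbhsr.
  rewrite /flat x0.
  have dV : is_derive x (1 : R) (fun y : R => y^-1) (- x ^- 2).
    have H := @is_deriveV _ id x 1 1 (lt0r_neq0 x0) (is_derive_id _ _).
    by apply: is_derive_eq H _; exact: mulr1.
  have dp := dC1 dV (is_derive_poly p x^-1).
  have dN := dZ1 (-1) dV.
  have de := dC1 dN (is_derive_expR (-1 * x^-1)).
  have H := dM1 dp de; rewrite (_ : (fun y => p.[y^-1] * expR (- y^-1)) =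
    (fun y => p.[y^-1] * expR (-1 * y^-1))); last by apply/funext => y; rewrite mulN1r.
  apply: is_derive_eq H _; rewrite !(hornerM, hornerD, hornerN, hornerX) -exprVn [X in expR X]mulN1r.
  ring.
- have [C C0 CP] := horner_expN ('X^2 * p).
  rewrite {2}/flat ltxx.
  apply/is_derive1_caratheodory.
  pose G (z : R) := if 0 < z then z * ((('X^2 * p).[z^-1]) * expR (- z^-1)) else 0.
  exists G; split.
  + move=> z; rewrite /G /flat ltxx !subr0; case: ifPn => z0; last by rewrite mul0r.
    rewrite !(hornerM, hornerX); field.
    by rewrite gt_eqF.
  + have GC z : `|G z| <= `|z| * C.
      rewrite /G; case: ifPn => z0; last by rewrite normr0 mulr_ge0// ltW.
      by rewrite normrM ler_wpM2l// CP// invr_ge0 ltW.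
    have G0 : G 0 = 0 by rewrite /G ltxx.
    have : G z @[z --> (0 : R)] --> (0 : R).
      apply/cvgrPdist_le => e e0; apply/nbhs_ballP.
      exists (e / C); first exact: divr_gt0.
      move=> z; rewrite /ball/= !sub0r !normrN => /ltW zC.
      by rewrite (le_trans (GC z))// -ler_pdivlMr.
    by rewrite -{2}G0.
  + by rewrite /G ltxx.
Unshelve. all: end_near.
Qed.

Lemma Smooth1_flat (p : {poly R}) : Smooth1 (flat p).
Proof.
apply/Smooth1P; exists (fun g => exists q, g = flat q); first by exists p.
move=> _ [q ->]; exists (flat ('X^2 * (q - q^`()))); first by eexists.
by move=> x; exact: flat_derive.
Qed.

Definition bump : R -> R := fun x => flat 1 (1 * x + 1) * flat 1 ((-1) * x + 1).

Lemma Smooth1_bump : Smooth1 bump.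
Proof. by apply: Smooth1M; apply: Smooth1_affine; exact: Smooth1_flat. Qed.

Lemma flat1_ge0 x : 0 <= flat 1 x.
Proof. by rewrite /flat; case: ifP => // _; rewrite hornerC mul1r expR_ge0. Qed.

Lemma bump_ge0 x : 0 <= bump x.
Proof. by rewrite mulr_ge0// flat1_ge0. Qed.

Lemma bump_gt0 x : `|x| < 1 -> 0 < bump x.
Proof.
rewrite ltr_norml => /andP[x1 x2].
rewrite /bump /flat !hornerC !mul1r.
have -> : 0 < x + 1 by lra.
have -> : 0 < -1 * x + 1 by lra.
by rewrite mulr_gt0// expR_gt0.
Qed.

Lemma bump_eq0 x : 1 <= `|x| -> bump x = 0.
Proof.
rewrite ler_normr /bump /flat => /orP[x1|x1].
  by rewrite [X in _ * X]ifF ?mulr0//; apply/negbTE; rewrite -leNgt; lra.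
by rewrite ifF ?mul0r//; apply/negbTE; rewrite -leNgt; lra.
Qed.

(** A primitive of the bump; -2 may be any point to the left of its support. *)
Definition bump_prim (x : R) : R := \int[lebesgue_measure]_(t in `[-2, x]) bump t.

Lemma bump_integrable (A : set R) : compact A -> lebesgue_measure.-integrable A (EFin \o bump).
Proof.
move=> cA; apply: continuous_compact_integrable => //.
by apply: continuous_subspaceT; exact: Smooth1_continuous Smooth1_bump.
Qed.

Lemma bump_prim_left x : x <= -1 -> bump_prim x = 0.
Proof.
move=> x1; rewrite /bump_prim.
rewrite (@eq_Rintegral _ _ _ _ _ (fun=> 0)); first by rewrite Rintegral_cst// mul0r.
move=> t /set_mem /=; rewrite in_itv/= => /andP[_ tx].
by apply: bump_eq0; rewrite ler_normr; apply/orP; right; lra.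
Qed.

Lemma bump_prim_derive (x : R) : is_derive x (1 : R) bump_prim (bump x).
Proof.
have [x1|x1] := ltrP x (-1).
  rewrite bump_eq0; last by rewrite ler_normr; apply/orP; right; lra.
  apply: (near_eq_is_derive (f := fun=> 0)).
  near=> y; rewrite bump_prim_left//; apply: ltW.
  by near: y; exact: lt_nbhsl.
have i2 : lebesgue_measure.-integrable [set` Interval (BLeft (-2)) (BRight (x + 1))] (EFin \o bump).
  by apply: bump_integrable; exact: segment_compact.
have cb := @Smooth1_continuous bump Smooth1_bump x.
have x2 : -2 < x by lra.
have xx : x < x + 1 by rewrite ltrDl.
have [] := @continuous_FTC1_closed R bump (-2) x (x + 1) xx i2 x2 cb.
move=> D E; exact: (DeriveDef D (etrans (esym (derive1E _ _)) E)).
Unshelve. all: by end_near.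
Qed.

Lemma bump_prim_incr : {homo bump_prim : x y / x <= y}.
Proof.
move=> x y xy; rewrite le_eqVlt in xy; case/predU1P : xy => [->//|xy].
have [] := MVT xy (fun z _ => bump_prim_derive z).
  by apply: continuous_subspaceT; exact: (derive_continuous1 bump_prim_derive).
by move=> c _ E; rewrite -subr_ge0 E mulr_ge0 ?bump_ge0 ?subr_ge0 ?ltW.
Qed.

Lemma bump_prim_right x : 1 <= x -> bump_prim x = bump_prim 1.
Proof.
rewrite le_eqVlt => /predU1P[<-//|x1].
have [] := MVT x1 (fun z _ => bump_prim_derive z).
  by apply: continuous_subspaceT; exact: (derive_continuous1 bump_prim_derive).
move=> c; rewrite in_itv/= => /andP[c1 _] E; apply/eqP; rewrite -subr_eq0 E.
by rewrite bump_eq0 ?mul0r// ler_normr ltW.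
Qed.

Lemma bump_prim1_gt0 : 0 < bump_prim 1.
Proof.
have h1 : (- 2^-1 : R) < 2^-1 by lra.
have [] := MVT h1 (fun z _ => bump_prim_derive z).
  by apply: continuous_subspaceT; exact: (derive_continuous1 bump_prim_derive).
move=> c; rewrite in_itv/= => /andP[c1 c2] E.
have : 0 < bump_prim 2^-1 - bump_prim (- 2^-1).
  rewrite E; apply: mulr_gt0; last by lra.
  by apply: bump_gt0; rewrite ltr_norml; lra.
have := @bump_prim_incr (-1) (- 2^-1) => H1.
have := @bump_prim_incr 2^-1 1 => H2.
have {}H1 : bump_prim (-1) <= bump_prim (- 2^-1) by apply: H1; lra.
have {}H2 : bump_prim 2^-1 <= bump_prim 1 by apply: H2; lra.
rewrite bump_prim_left// in H1; lra.
Qed.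

(** A smooth step from 0 to 1; differences of its translates form a partition
    of unity by telescoping. *)
Definition step (x : R) : R := bump_prim x / bump_prim 1.

Lemma Smooth1_step : Smooth1 step.
Proof.
have sp := Smooth1_prim Smooth1_bump bump_prim_derive.
by apply: Smooth1M; [exact: sp|exact: Smooth1_cst].
Qed.

Lemma step_left x : x <= -1 -> step x = 0.
Proof. by move=> x1; rewrite /step bump_prim_left// mul0r. Qed.

Lemma step_right x : 1 <= x -> step x = 1.
Proof.
by move=> x1; rewrite /step bump_prim_right// divff// gt_eqF// bump_prim1_gt0.
Qed.

End Smooth1.

Section Smooth12.
Context {R : realType}.
Implicit Types (g h : R -> R) (f : R * R -> R).

Lemma derive_fst g g' : (forall x, is_derive x (1 : R) g (g' x)) ->
  forall (x : R * R) i, is_derive x (basis2 i) (fun y => g y.1) (if i == 0 then g' x.1 else 0).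
Proof.
move=> dg x i.
have [->/=|->/=] := ord2P i; last first.
    have E : (fun h : R => h^-1 *: (((fun y : R * R => g y.1) \o shift x) (h *: basis2 1) - g x.1)) = fun=> 0.
    by apply/funext => h; rewrite /comp/shift scale_pairE add_pairE/= mulr0 add0r subrr scaler0.
  have L : h^-1 *: (((fun y : R * R => g y.1) \o shift x) (h *: basis2 1) - g x.1) @[h --> 0^'] --> (0 : R).
    by rewrite E; exact: cvg_cst.
  by split; [apply/cvg_ex; exists 0|exact: cvg_lim L].
have [D V] := dg x.1.
have E : (fun h : R => h^-1 *: (((fun y : R * R => g y.1) \o shift x) (h *: basis2 0) - g x.1)) =
  (fun h : R => h^-1 *: ((g \o shift x.1) (h *: (1 : R)) - g x.1)).
  by apply/funext => h; rewrite /comp/shift scale_pairE add_pairE/=.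
by split; [rewrite /derivable E|rewrite /derive E].
Qed.

Lemma derive_snd g g' : (forall x, is_derive x (1 : R) g (g' x)) ->
  forall (x : R * R) i, is_derive x (basis2 i) (fun y => g y.2) (if i == 0 then 0 else g' x.2).
Proof.
move=> dg x i.
have [->/=|->/=] := ord2P i.
  have E : (fun h : R => h^-1 *: (((fun y : R * R => g y.2) \o shift x) (h *: basis2 0) - g x.2)) = fun=> 0.
    by apply/funext => h; rewrite /comp/shift scale_pairE add_pairE/= mulr0 add0r subrr scaler0.
  have L : h^-1 *: (((fun y : R * R => g y.2) \o shift x) (h *: basis2 0) - g x.2) @[h --> 0^'] --> (0 : R).
    by rewrite E; exact: cvg_cst.
  by split; [apply/cvg_ex; exists 0|exact: cvg_lim L].
have [D V] := dg x.2.
have E : (fun h : R => h^-1 *: (((fun y : R * R => g y.2) \o shift x) (h *: basis2 1) - g x.2)) =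
  (fun h : R => h^-1 *: ((g \o shift x.2) (h *: (1 : R)) - g x.2)).
  by apply/funext => h; rewrite /comp/shift scale_pairE add_pairE/=.
by split; [rewrite /derivable E|rewrite /derive E].
Qed.

Lemma partial_fst g g' : (forall x, is_derive x (1 : R) g (g' x)) ->
  partial 0 (fun y : R * R => g y.1) = (fun y => g' y.1) /\ partial 1 (fun y : R * R => g y.1) = 0.
Proof.
Transparent partial.
by move=> dg; split; apply/funext => x; rewrite /partial (derive_val (is_derive := derive_fst dg x _)).
Qed.

Lemma partial_snd g g' : (forall x, is_derive x (1 : R) g (g' x)) ->
  partial 0 (fun y : R * R => g y.2) = 0 /\ partial 1 (fun y : R * R => g y.2) = (fun y => g' y.2).
Proof.
by move=> dg; split; apply/funext => x; rewrite /partial (derive_val (is_derive := derive_snd dg x _)).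
Qed.
Opaque partial.

Lemma Smooth_fst g : Smooth1 g -> Smooth (fun y : R * R => g y.1).
Proof.
move=> sg; apply: (@smooth_coind R (fun f => f = 0 \/ exists2 g, Smooth1 g & f = fun y => g y.1)); last by right; exists g.
move=> _ [->|{sg} [{}g sg ->]].
  split=> [x|i]; first exact: cst_continuous.
  by split=> [x|]; [exact: derivable_cst|rewrite partial0; left].
split=> [x|i].
  by apply: (continuous_comp (f := fst) (g := g)); [exact: cvg_fst|exact: Smooth1_continuous].
have [g' sg' dg] := Smooth1_derive sg.
split=> [x|]; first by have [] := derive_fst dg x i.
have [p0 p1] := partial_fst dg.
by have [->|->] := ord2P i; [rewrite p0; right; exists g'|rewrite p1; left].
Qed.

Lemma Smooth_snd g : Smooth1 g -> Smooth (fun y : R * R => g y.2).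
Proof.
move=> sg; apply: (@smooth_coind R (fun f => f = 0 \/ exists2 g, Smooth1 g & f = fun y => g y.2)); last by right; exists g.
move=> _ [->|{sg} [{}g sg ->]].
  split=> [x|i]; first exact: cst_continuous.
  by split=> [x|]; [exact: derivable_cst|rewrite partial0; left].
split=> [x|i].
  by apply: (continuous_comp (f := snd) (g := g)); [exact: cvg_snd|exact: Smooth1_continuous].
have [g' sg' dg] := Smooth1_derive sg.
split=> [x|]; first by have [] := derive_snd dg x i.
have [p0 p1] := partial_snd dg.
by have [->|->] := ord2P i; [rewrite p0; left|rewrite p1; right; exists g'].
Qed.

End Smooth12.

(** * Averages along a vector *)

Section Average.
Context {R : realType}.
Implicit Types (f g : R * R -> R) (i j : 'I_2) (x y v w : R * R).
Local Notation mu := (@lebesgue_measure R).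

Lemma isd_derivable (V W : normedModType R) (F : V -> W) (x v : V) d :
  is_derive x v F d -> derivable F x v.
Proof. by case. Qed.

Lemma contZ (a : R) f : continuous f -> continuous (a *: f).
Proof. by move=> cf x; apply: cvgZ; [exact: cvg_cst|exact: cf]. Qed.

Lemma contD f g : continuous f -> continuous g -> continuous (f + g).
Proof. by move=> cf cg x; apply: cvgD; [exact: cf|exact: cg]. Qed.

Definition tr v f : R * R -> R := fun x => f (x - v).

(** The convolution with the uniform probability measure on the segment from 0
    to v. With the translation tr it replaces mollification throughout. *)
Definition Av v f : R * R -> R := fun x =>
  \int[mu]_(r in `[0, 1]) f (x - r *: v).

Lemma derive_tr v f x w : 'D_w (tr v f) x = 'D_w f (x - v).
Proof. by rewrite /derive /tr /comp /shift; under eq_fun do rewrite -addrA. Qed.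

Lemma derivable_tr v f x w : derivable f (x - v) w -> derivable (tr v f) x w.
Proof. by rewrite /derivable /tr /comp /shift; under [in X in _ -> X]eq_fun do rewrite -addrA. Qed.

Lemma partial_tr i v f : partial i (tr v f) = tr v (partial i f).
Proof.
by apply/funext => x; rewrite /tr -[RHS](derive_tr v f x (basis2 i)).
Qed.

Lemma continuous_tr v f : continuous f -> continuous (tr v f).
Proof.
move=> cf x; apply: (continuous_comp (f := fun x => x - v) (g := f)); last exact: cf.
by apply: cvgB; [exact: cvg_id|exact: cvg_cst].
Qed.

Lemma Smooth_tr v f : Smooth f -> Smooth (tr v f).
Proof.
move=> sf; apply: (@smooth_coind R (fun g => exists2 h, Smooth h & g = tr v h)); last by exists f.
move=> _ [h sh ->]; split; first exact: continuous_tr (smooth_continuous sh).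
move=> i; split => [x|]; first by apply: derivable_tr; exact: smooth_derivable.
by rewrite partial_tr; exists (partial i h) => //; exact: Smooth_partial.
Qed.

Lemma trD v f g : tr v (f + g) = tr v f + tr v g. Proof. by []. Qed.
Lemma trZ v (a : R) f : tr v (a *: f) = a *: tr v f. Proof. by []. Qed.
Lemma trB v f g : tr v (f - g) = tr v f - tr v g. Proof. by []. Qed.
Lemma tr0 f : tr 0 f = f. Proof. by apply/funext => x; rewrite /tr subr0. Qed.
Lemma tr_tr v w f : tr v (tr w f) = tr (v + w) f.
Proof. by apply/funext => x; rewrite /tr opprD addrA. Qed.

Definition box (B : R) : set (R * R) := [set x | `|x.1| <= B /\ `|x.2| <= B].

Lemma box_compact B : compact (box B).
Proof.
have -> : box B = `[- B, B]%classic `*` `[- B, B]%classic.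
  apply/seteqP; split=> x; rewrite /box/= !in_itv/= -!ler_norml; first by case=> -> ->.
  by case.
by apply: compact_setX; exact: segment_compact.
Qed.

Lemma bounded_box f B : continuous f ->
  exists2 M : R, 0 < M & forall x, box B x -> `|f x| <= M.
Proof.
move=> cf.
have : compact (f @` box B).
  by apply: continuous_compact; [exact: continuous_subspaceT|exact: box_compact].
move=> /compact_bounded [M [_ HM]].
exists (`|M| + 1); first by rewrite ltr_wpDl.
move=> x Bx; apply: (HM (`|M| + 1)); last by exists x.
by rewrite (le_lt_trans (ler_norm M))// ltrDl.
Qed.

Lemma box_sub B x v (r : R) : box B x -> 0 <= r <= 1 ->
  box (B + (`|v.1| + `|v.2|)) (x - r *: v).
Proof.
move=> [x1 x2] /andP[r0 r1]; rewrite /box/=.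
have rv (t : R) : `|r * t| <= `|t| by rewrite normrM (ger0_norm r0) ler_piMl.
split; rewrite (le_trans (ler_normB _ _))// lerD//.
  by rewrite (le_trans (rv _))// lerDl.
by rewrite (le_trans (rv _))// lerDr.
Qed.

Lemma continuous_seg f x v : continuous f -> continuous (fun r : R => f (x - r *: v)).
Proof.
move=> cf r; apply: (continuous_comp (f := fun r : R => x - r *: v) (g := f)); last exact: cf.
apply: cvgB; first exact: cvg_cst.
by apply: cvgZr_tmp; exact: cvg_id.
Qed.

Lemma integrable_seg f x v : continuous f ->
  mu.-integrable `[0, 1] (EFin \o (fun r : R => f (x - r *: v))).
Proof.
move=> cf; apply: continuous_compact_integrable; first exact: segment_compact.
by apply: continuous_subspaceT; exact: continuous_seg.
Qed.

Lemma mu01 : fine (mu `[0, 1]%classic) = 1.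
Proof. by rewrite lebesgue_measure_itv/= lte_fin ltr01/= oppr0 addr0. Qed.

Lemma AvD v f g : continuous f -> continuous g -> Av v (f + g) = Av v f + Av v g.
Proof.
by move=> cf cg; apply/funext => x; apply: RintegralD => //; exact: integrable_seg.
Qed.

Lemma AvZ v (a : R) f : continuous f -> Av v (a *: f) = a *: Av v f.
Proof.
by move=> cf; apply/funext => x; rewrite /Av -[RHS]RintegralZl//; exact: integrable_seg.
Qed.

Lemma contB f g : continuous f -> continuous g -> continuous (f - g).
Proof. by move=> cf cg; rewrite -scaleN1r; apply: contD => //; exact: contZ. Qed.

Lemma AvB v f g : continuous f -> continuous g -> Av v (f - g) = Av v f - Av v g.
Proof.
move=> cf cg; rewrite -scaleN1r AvD//; last exact: contZ.
by rewrite AvZ// scaleN1r.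
Qed.

Lemma Av_le v f x (M : R) : continuous f ->
  (forall r : R, 0 <= r <= 1 -> `|f (x - r *: v)| <= M) -> `|Av v f x| <= M.
Proof.
move=> cf fM; rewrite /Av (le_trans (le_normr_Rintegral _ _))//; first exact: integrable_seg.
have E : M = \int[mu]_(r in `[0, 1]) M by rewrite Rintegral_cst// mu01 mulr1.
rewrite [leRHS]E; apply: le_Rintegral => //.
- by apply: integrable_norm => //; exact: integrable_seg.
- apply: continuous_compact_integrable; first exact: segment_compact.
  by apply: continuous_subspaceT; exact: cst_continuous.
Qed.

Lemma Av_cst_seg v f x (c : R) :
  (forall r : R, 0 <= r <= 1 -> f (x - r *: v) = c) -> Av v f x = c.
Proof.
move=> fc; rewrite /Av (@eq_Rintegral _ _ _ _ _ (fun=> c)).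
  by rewrite Rintegral_cst// mu01 mulr1.
by move=> r /set_mem; rewrite /= in_itv/=; exact: fc.
Qed.

Lemma smooth_lip_box f B : Smooth f -> exists2 M : R, 0 < M & forall x y,
  box B x -> box B y -> `|f x - f y| <= M * (`|x.1 - y.1| + `|x.2 - y.2|).
Proof.
move=> sf.
have [M0 M0p H0] := bounded_box (3 * B) (smooth_continuous (Smooth_partial 0 sf)).
have [M1 M1p H1] := bounded_box (3 * B) (smooth_continuous (Smooth_partial 1 sf)).
exists (M0 + M1); first exact: addr_gt0.
move=> x y [x1 x2] [y1 y2].
have B0 : 0 <= B by exact: le_trans (normr_ge0 _) x1.
have [c ch E] := MVT0 (y.1 - x.1) (fun r => partial_line0 x r sf).
have [d dh E'] := MVT0 (y.2 - x.2) (fun r => partial_line1 (y.1, x.2) r sf).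
have small (p q k : R) : `|p| <= B -> `|q| <= B -> `|k| <= `|q - p| -> `|p + k| <= 3 * B.
  move=> pB qB kq; have := ler_normB q p; have := ler_normD p k; lra.
move: E E'; rewrite /= !addr0 !(addrC _ (_ - _)) !subrK => E E'.
have -> : f x - f y = - ((f (y.1, y.2) - f (y.1, x.2)) + (f (y.1, x.2) - f (x.1, x.2))).
  by rewrite -!surjective_pairing; ring.
rewrite E E' normrN (le_trans (ler_normD _ _))// !normrM.
have b0 : `|partial 0 f (x.1 + c, x.2)| <= M0.
  by apply: H0; split => /=; [exact: small ch|lra].
have b1 : `|partial 1 f (y.1, x.2 + d)| <= M1.
  by apply: H1; split => /=; [lra|exact: small dh].
rewrite (distrC x.1) (distrC x.2).
have n1 := normr_ge0 (y.1 - x.1); have n2 := normr_ge0 (y.2 - x.2).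
move: b0 b1; set P0 := `|partial 0 f _|; set P1 := `|partial 1 f _|.
move: n1 n2; set a := `|y.1 - _|; set b := `|y.2 - _| => *.
have : P1 * b <= M1 * b by exact: ler_wpM2r.
have : P0 * a <= M0 * a by exact: ler_wpM2r.
have : 0 <= M0 * b by rewrite mulr_ge0// ltW.
have : 0 <= M1 * a by rewrite mulr_ge0// ltW.
by rewrite mulrDl !mulrDr; lra.
Qed.

Lemma sub_shift (V : zmodType) (p q u : V) : p - u - (p - q) = q - u.
Proof. by rewrite opprB addrC addrA subrK. Qed.

Lemma norm_near (a b : R) : `|a - b| < 1 -> `|b| <= `|a| + 1.
Proof.
move=> h; rewrite -{1}(subrK a b) addrC (le_trans (ler_normD _ _))// lerD2l.
by rewrite distrC ltW.
Qed.

Lemma le_half_sum (M e a b : R) : 0 < M -> a < e / (2 * M) -> b < e / (2 * M) ->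
  M * (a + b) <= e.
Proof. by move=> M0; rewrite !ltr_pdivlMr ?mulr_gt0//; lra. Qed.

Lemma Smooth_Av_continuous v f : Smooth f -> continuous (Av v f).
Proof.
move=> sf x; apply/cvgrPdist_le => e e0.
pose B := `|x.1| + `|x.2| + 1.
have [M M0 HM] := smooth_lip_box (B + (`|v.1| + `|v.2|)) sf.
have eM : 0 < e / (2 * M) by rewrite divr_gt0// mulr_gt0.
have dp : 0 < Num.min 1 (e / (2 * M)) by rewrite lt_min ltr01 eM.
apply: filterS (nbhsx_ballx x _ dp) => y /ball_pairE; rewrite !lt_min => -[/andP[y1 y1'] /andP[y2 y2']].
have cf := smooth_continuous sf.
have Bx : box B x by rewrite /box/B/=; have := normr_ge0 x.1; have := normr_ge0 x.2; lra.
have By : box B y.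
  rewrite /box/B/=; move: (norm_near y1) (norm_near y2); have := normr_ge0 x.1; have := normr_ge0 x.2.
  by move: `|x.1| `|x.2| `|y.1| `|y.2| => *; split; lra.
have -> : Av v f x - Av v f y = Av v (f - tr (x - y) f) x.
  rewrite (AvB v cf (continuous_tr cf)); congr (_ - _).
  rewrite /Av /tr; apply: eq_Rintegral => r _; congr f.
  by rewrite sub_shift.
apply: Av_le; first exact: contB cf (continuous_tr cf).
move=> r r01; rewrite /tr -/(GRing.opp _).
change (`|f (x - r *: v) - f (x - r *: v - (x - y))| <= e).
rewrite sub_shift.
rewrite (le_trans (HM _ _ (box_sub v Bx r01) (box_sub v By r01)))//=.
rewrite !opprB !addrA !subrK.
exact: le_half_sum.
Qed.

Lemma partial_is_derive i f x (r : R) : Smooth f ->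
  is_derive r (1 : R) (fun t : R => f (t *: basis2 i + x)) (partial i f (r *: basis2 i + x)).
Proof.
Transparent partial.
by move=> sf; exact: (derivable_line (fun y => @smooth_derivable R f i y sf)).
Qed.
Opaque partial.

(** Differentiation under the integral sign, by the Lipschitz bound of the
    partial derivative on a box. *)
Lemma Av_derive v f i x : Smooth f ->
  is_derive x (basis2 i) (Av v f) (Av v (partial i f) x).
Proof.
move=> sf.
pose F (h r : R) := f (h *: basis2 i + (x - r *: v)).
have dF (h r : R) : is_derive h (1 : R) (F ^~ r) (partial i f (h *: basis2 i + (x - r *: v))).
  exact: partial_is_derive.
pose B := `|x.1| + `|x.2| + 1 + (`|v.1| + `|v.2|).
have [M M0 HM] := bounded_box B (smooth_continuous (Smooth_partial i sf)).
have I0 : `](-1 : R), 1[%classic (0 : R) by rewrite /= in_itv/=; apply/andP; split; lra.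
have intF (h : R) : `](-1 : R), 1[%classic h -> mu.-integrable `[0, 1] (EFin \o F h).
  move=> _; have := integrable_seg (h *: basis2 i + x) v (smooth_continuous sf).
  by congr (_.-integrable _ _); apply/funext => r; rewrite /F/= addrA.
have derF (h r : R) : `](-1 : R), 1[%classic h -> `[(0 : R), 1]%classic r -> derivable (F ^~ r) h 1.
  by move=> _ _; exact: isd_derivable (dF h r).
have intG : mu.-integrable `[0, 1] (EFin \o (fun=> M)).
  apply: continuous_compact_integrable; first exact: segment_compact.
  by apply: continuous_subspaceT; exact: cst_continuous.
have ubG (h r : R) : `](-1 : R), 1[%classic h -> `[(0 : R), 1]%classic r -> `|partial1of2 F h r| <= M.
  rewrite /= !in_itv/= => /andP[h1 h2] r01.
  rewrite partial1of2E (derive_val (is_derive := dF h r)) HM// addrA.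
  apply: box_sub => //.
  have hn : `|h| <= 1 by rewrite ler_norml; apply/andP; split; exact: ltW.
  rewrite scale_pairE add_pairE /box/=.
  have hb (b a : R) : `|b| <= 1 -> `|h * b + a| <= 1 + `|a|.
    move=> b1; rewrite (le_trans (ler_normD _ _))// lerD2r normrM.
    by rewrite -[leRHS]mulr1 ler_pM.
  have b1 : `|(basis2 i : R * R).1| <= 1 by rewrite /basis2; case: ifP => _ /=; rewrite ?normr1 ?normr0.
  have b2 : `|(basis2 i : R * R).2| <= 1 by rewrite /basis2; case: ifP => _ /=; rewrite ?normr1 ?normr0.
  have := hb _ x.1 b1; have := hb _ x.2 b2; have := normr_ge0 x.1; have := normr_ge0 x.2; lra.
have m01 : measurable (`[(0 : R), 1]%classic : set (measurableTypeR R)) by [].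
have L := @cvg_differentiation_under_integral R _ _ mu F _ m01 0 (-1) 1 I0 intF derF (fun=> M) (fun=> ltW M0) intG ubG.
have E : \int[mu]_(r in `[0, 1]) partial1of2 F 0 r = Av v (partial i f) x.
  apply: eq_Rintegral => r _.
  by rewrite partial1of2E (derive_val (is_derive := dF 0 r)) scale0r add0r.
rewrite E in L.
have {}L : h^-1 *: ((Av v f \o shift x) (h *: basis2 i) - Av v f x) @[h --> 0^'] --> Av v (partial i f) x.
  apply: cvg_trans L; apply: near_eq_cvg; near=> h.
  rewrite /= addr0; congr (_ *: (_ - _)); apply: eq_Rintegral => r _.
    by rewrite /F addrA.
  by rewrite /F scale0r add0r.
by split; [apply/cvg_ex; eexists; exact: L|exact: cvg_lim L].
Unshelve. all: by end_near.
Qed.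

Lemma partial_Av i v f : Smooth f -> partial i (Av v f) = Av v (partial i f).
Proof.
Transparent partial.
by move=> sf; apply/funext => x; rewrite /partial (derive_val (is_derive := Av_derive v i x sf)).
Qed.
Opaque partial.

Lemma Smooth_Av v f : Smooth f -> Smooth (Av v f).
Proof.
move=> sf; apply: (@smooth_coind R (fun g => exists2 h, Smooth h & g = Av v h)); last by exists f.
move=> _ [h sh ->]; split; first exact: Smooth_Av_continuous.
move=> i; split => [x|]; first exact: isd_derivable (Av_derive v i x sh).
by rewrite partial_Av//; exists (partial i h) => //; exact: Smooth_partial.
Qed.

Lemma dirE v f : dir v f = v.1 *: partial 0 f + v.2 *: partial 1 f.
Proof. by []. Qed.

Lemma dirD v f g : Smooth f -> Smooth g -> dir v (f + g) = dir v f + dir v g.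
Proof.
by move=> sf sg; rewrite !dirE !partialD// !scalerDr addrACA.
Qed.

Lemma Smooth_dir v f : Smooth f -> Smooth (dir v f).
Proof.
by move=> sf; rewrite dirE; apply: smoothD; apply: smoothZ; exact: Smooth_partial.
Qed.

Lemma dir_Av w v f : Smooth f -> dir w (Av v f) = Av v (dir w f).
Proof.
move=> sf; have s i := smooth_continuous (Smooth_partial i sf).
rewrite !dirE !partial_Av// AvD; first by rewrite !AvZ.
  exact: contZ (s 0).
exact: contZ (s 1).
Qed.

Lemma dir_tr w v f : dir w (tr v f) = tr v (dir w f).
Proof. by rewrite !dirE !partial_tr. Qed.

(** Averaging along v inverts the derivative along v up to a difference. *)
Lemma Av_dir v f : Smooth f -> Av v (dir v f) = f - tr v f.
Proof.
move=> sf; apply/funext => x.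
have dF (r : R) : is_derive r (1 : R) (fun r : R => - f (x - r *: v)) (dir v f (x - r *: v)).
  have := @dir_line R f (- v) x r sf.
  have -> : (fun r : R => f (x + r *: - v)) = (fun r : R => f (x - r *: v)).
    by apply/funext => t; rewrite scalerN.
  move=> H; have := is_deriveN H; rewrite scalerN => {}H.
  apply: is_derive_eq H _; rewrite /dir/=; ring.
have cF := derive_continuous1 dF.
have cd : continuous (fun r : R => dir v f (x - r *: v)).
  exact: continuous_seg (smooth_continuous (Smooth_dir v sf)).
have H := @continuous_FTC2 R (fun r : R => dir v f (x - r *: v)) (fun r : R => - f (x - r *: v)) 0 1 ltr01 (continuous_subspaceT cd).
rewrite /Av /Rintegral H.
- rewrite -EFinB/= scale0r subr0 scale1r -[RHS]/(f x - f (x - v)); ring.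
- split => [r _||].
  + exact: isd_derivable (dF r).
  + by apply: cvg_at_right_filter; exact: cF.
  + by apply: cvg_at_left_filter; exact: cF.
- by move=> r _; rewrite derive1E (derive_val (is_derive := dF r)).
Qed.

Lemma dir_AvE v f : Smooth f -> dir v (Av v f) = f - tr v f.
Proof. by move=> sf; rewrite dir_Av// Av_dir. Qed.

Lemma Av_tr v w f : Av v (tr w f) = tr w (Av v f).
Proof.
by apply/funext => x; apply: eq_Rintegral => r _; rewrite /tr addrAC.
Qed.

End Average.

(** * Integration over the plane *)

Section Plane.
Context {R : realType}.
Implicit Types (f g : R * R -> R) (i j : 'I_2) (x y v w : R * R) (B : R).
Local Notation mu := (@lebesgue_measure R).
Local Notation mu2 := (@lebesgue2 R).
Local Notation MP := (measurableTypeR R * measurableTypeR R)%type.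

(** An open set is the union of the balls with rational center and radius that
    it contains; this relates the product topology to the product of the Borel
    sigma-algebras. *)
Lemma open_measurable2 (U : set (R * R)) : open U -> measurable (U : set MP).
Proof.
move=> oU.
have -> : U = \bigcup_(q : rat * rat * rat)
    (if pselect (ball (ratr q.1.1 : R, ratr q.1.2 : R) (ratr q.2) `<=` U)
     then ball (ratr q.1.1 : R) (ratr q.2) `*` ball (ratr q.1.2 : R) (ratr q.2) else set0).
  apply/seteqP; split => [x Ux|x [q _]]; last first.
    by case: pselect => // qU [? ?]; apply: qU; apply/ball_pairE.
  have /nbhs_ballP[d /= d0 dU] : nbhs x U by exact: open_nbhs_nbhs.
  have d4 : 0 < d / 4 by rewrite divr_gt0.
  have [q1 /andP[q1l q1r]] : exists q, x.1 - d / 4 < ratr q < x.1 + d / 4.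
    by have [q] := @rat_in_itvoo R (x.1 - d / 4) (x.1 + d / 4) ltac:(lra); rewrite in_itv/=; exists q.
  have [q2 /andP[q2l q2r]] : exists q, x.2 - d / 4 < ratr q < x.2 + d / 4.
    by have [q] := @rat_in_itvoo R (x.2 - d / 4) (x.2 + d / 4) ltac:(lra); rewrite in_itv/=; exists q.
  have [q3 /andP[q3l q3r]] : exists q, d / 4 < ratr q < d / 2.
    by have [q] := @rat_in_itvoo R (d / 4) (d / 2) ltac:(lra); rewrite in_itv/=; exists q.
  exists (q1, q2, q3); first by [].
  case: (pselect _) => [qU|] /=.
    by split; rewrite /ball/= ltr_norml; apply/andP; split; lra.
  case=> y /ball_pairE; rewrite /=  !ltr_norml => -[/andP[? ?] /andP[? ?]].
  by apply: dU; apply/ball_pairE; rewrite !ltr_norml; split; apply/andP; split; lra.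
apply: countable_bigcupT_measurable; first exact: countableP.
by move=> q; case: pselect => [qU|nU] //=; apply: measurableX; exact: measurable_ball.
Qed.

Lemma continuous_measurable2 f : continuous f -> measurable_fun (setT : set MP) f.
Proof.
move=> cf; apply: (measurability _ (mathcomp.analysis.measurable_realfun.RGenOInfty.measurableE R)).
move=> _ [_ [a ->] <-]; rewrite setTI.
apply: open_measurable2; apply: open_comp; first by move=> x _; exact: cf.
exact: interval_open.
Qed.

Lemma box_measurable B : measurable (box B : set MP).
Proof.
have -> : box B = `[- B, B]%classic `*` `[- B, B]%classic.
  apply/seteqP; split=> x; rewrite /box/= !in_itv/= -!ler_norml; first by case=> -> ->.
  by case.
by apply: measurableX; exact: measurable_itv.
Qed.

Lemma box_measure B : (mu2 (box B) < +oo)%E.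
Proof.
have -> : box B = `[- B, B]%classic `*` `[- B, B]%classic.
  apply/seteqP; split=> x; rewrite /box/= !in_itv/= -!ler_norml; first by case=> -> ->.
  by case.
rewrite /lebesgue2 product_measure1E//= !lebesgue_measure_itv/=.
by case: ifP => _; rewrite ?mule0// -EFinB -EFinM ltry.
Qed.

(** Supports are controlled through a set outside which the function vanishes,
    which need not be closed. *)
Definition zoff (K : set (R * R)) f := forall x, ~ K x -> f x = 0.

Lemma box_integrable f B : measurable_fun (setT : set MP) f -> zoff (box B) f ->
  (exists M, forall x, `|f x| <= M) -> mu2.-integrable setT (EFin \o f).
Proof.
move=> mf zf [M fM]; apply/integrableP; split; first exact/measurable_EFinP.
have -> : (\int[mu2]_x `|(EFin \o f) x| = \int[mu2]_(x in box B) `|(EFin \o f) x|)%E.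
  rewrite [RHS]integral_mkcond; apply: eq_integral => x _; rewrite patchE.
  by case: ifPn => // /negP; rewrite inE => /zf; rewrite /= => ->; rewrite normr0.
apply: (@le_lt_trans _ _ (\int[mu2]_(x in box B) (cst M%:E x))%E); last first.
  rewrite integral_cst; last exact: box_measurable.
  have M0 : 0 <= M := le_trans (normr_ge0 _) (fM 0).
  by rewrite lte_mul_pinfty ?lee_fin// box_measure.
apply: ge0_le_integral => //; first exact: box_measurable.
- apply/measurableT_comp => //; apply/measurable_EFinP.
  exact: (measurable_funS measurableT).
- by move=> x _; rewrite /= lee_fin.
Qed.

Lemma cs_bounded f B : continuous f -> zoff (box B) f ->
  exists2 M : R, 0 < M & forall x, `|f x| <= M.
Proof.
move=> cf zf; have [M M0 HM] := bounded_box B cf; exists M => // x.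
have [xB|xB] := pselect (box B x); first exact: HM.
by rewrite zf// normr0 ltW.
Qed.

Lemma cs_integrable f B : continuous f -> zoff (box B) f -> mu2.-integrable setT (EFin \o f).
Proof.
move=> cf zf; have [M M0 HM] := cs_bounded cf zf.
by apply: (box_integrable (continuous_measurable2 cf) zf); exists M.
Qed.

(** Smooth functions with bounded support. *)
Definition Tf f := Smooth f /\ exists B, zoff (box B) f.

Definition I f : R := \int[mu2]_x f x.

Lemma Tf_integrable f : Tf f -> mu2.-integrable setT (EFin \o f).
Proof. by move=> [/smooth_continuous cf [B]]; exact: cs_integrable. Qed.

Lemma Tf_smooth f : Tf f -> Smooth f. Proof. by case. Qed.

Lemma zoff_sub K K' f : K `<=` K' -> zoff K f -> zoff K' f.
Proof. by move=> KK zf x Kx; apply: zf => /KK. Qed.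

Lemma box_le B B' : B <= B' -> box B `<=` box B'.
Proof. by move=> BB x [x1 x2]; split; exact: le_trans BB. Qed.

Lemma zoff_partial K i f : closed K -> zoff K f -> zoff K (partial i f).
Proof.
move=> cK zf x Kx.
have nf : \forall y \near x, f y = cst 0 y.
  have : nbhs x (~` K) by apply: open_nbhs_nbhs; split => //; exact: closed_openC.
  by apply: filterS => y; exact: zf.
Transparent partial.
by rewrite /partial (near_eq_derive _ nf) derive_cst.
Qed.
Opaque partial.

Lemma box_closed B : closed (box B : set (R * R)).
Proof. apply: compact_closed; [exact: norm_hausdorff|exact: box_compact]. Qed.

Lemma Tf0 : Tf 0. Proof. by split; [exact: Smooth0|exists 0]. Qed.

Lemma TfD f g : Tf f -> Tf g -> Tf (f + g).
Proof.
move=> [sf [B fB]] [sg [B' gB]]; split; first exact: smoothD.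
exists (Num.max B B') => x Bx.
rewrite -[LHS]/(f x + g x) fB ?gB ?addr0// => Bx'; apply: Bx; apply: box_le Bx'; by rewrite le_max lexx ?orbT.
Qed.

Lemma TfZ (a : R) f : Tf f -> Tf (a *: f).
Proof.
move=> [sf [B fB]]; split; first exact: smoothZ.
by exists B => x Bx; rewrite -[LHS]/(a * f x) fB// mulr0.
Qed.

Lemma TfN f : Tf f -> Tf (- f).
Proof. by move=> tf; rewrite -scaleN1r; exact: TfZ. Qed.

Lemma TfB f g : Tf f -> Tf g -> Tf (f - g).
Proof. by move=> tf tg; apply: TfD => //; exact: TfN. Qed.

Lemma Tf_sum (J : Type) (r : seq J) (P : pred J) (F : J -> R * R -> R) :
  (forall k, P k -> Tf (F k)) -> Tf (\sum_(k <- r | P k) F k).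
Proof. by move=> sF; apply: (big_ind Tf) => //; [exact: Tf0|exact: TfD]. Qed.

Lemma TfM f g : Smooth f -> Tf g -> Tf (fun x => f x * g x).
Proof.
move=> sf [sg [B gB]]; split; first exact: smoothM.
by exists B => x Bx; rewrite gB// mulr0.
Qed.

Lemma Tf_partial i f : Tf f -> Tf (partial i f).
Proof.
move=> [sf [B fB]]; split; first exact: Smooth_partial.
by exists B; apply: zoff_partial fB; exact: box_closed.
Qed.

Lemma Tf_dir v f : Tf f -> Tf (dir v f).
Proof. by move=> tf; rewrite dirE; apply: TfD; apply: TfZ; exact: Tf_partial. Qed.

Lemma box_shift B x v (r : R) : 0 <= r <= 1 -> box B (x - r *: v) ->
  box (B + (`|v.1| + `|v.2|)) x.
Proof.
move=> r01 /(@box_sub _ _ _ (- v) r)/(_ r01).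
by rewrite scalerN opprK subrK !normrN.
Qed.

Lemma Tf_tr v f : Tf f -> Tf (tr v f).
Proof.
move=> [sf [B fB]]; split; first exact: Smooth_tr.
exists (B + (`|v.1| + `|v.2|)) => x Bx; apply: fB => Bx'; apply: Bx.
by apply: (@box_shift _ _ _ 1); rewrite ?ler01 ?lexx// scale1r.
Qed.

Lemma Tf_Av v f : Tf f -> Tf (Av v f).
Proof.
move=> [sf [B fB]]; split; first exact: Smooth_Av.
exists (B + (`|v.1| + `|v.2|)) => x Bx; apply: Av_cst_seg => r r01.
by apply: fB => Bx'; apply: Bx; exact: box_shift Bx'.
Qed.

Lemma ID f g : Tf f -> Tf g -> I (f + g) = I f + I g.
Proof. by move=> tf tg; apply: RintegralD => //; exact: Tf_integrable. Qed.

Lemma IZ (a : R) f : Tf f -> I (a *: f) = a * I f.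
Proof. by move=> tf; apply: RintegralZl => //; exact: Tf_integrable. Qed.

Lemma I0 : I 0 = 0.
Proof. by rewrite /I (@Rintegral_cst _ _ _ _ setT)// mul0r. Qed.

Lemma I_ge0 f : (forall x, 0 <= f x) -> 0 <= I f.
Proof. by move=> f0; exact: Rintegral_ge0. Qed.

Lemma I_box f B (M : R) : Tf f -> zoff (box B) f -> (forall x, `|f x| <= M) ->
  `|I f| <= M * fine (mu2 (box B)).
Proof.
move=> tf zf fM; rewrite /I (le_trans (le_normr_Rintegral _ (Tf_integrable tf)))//.
have -> : M * fine (mu2 (box B)) = \int[mu2]_(x in box B) M by rewrite Rintegral_cst//; exact: box_measurable.
have -> : \int[mu2]_(x in setT) `|f x| = \int[mu2]_(x in box B) `|f x|.
  rewrite [RHS]Rintegral_mkcond; apply: eq_Rintegral => x _; rewrite patchE.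
  by case: ifPn => // /negP; rewrite inE => /zf ->; rewrite normr0.
apply: le_Rintegral => //; first exact: box_measurable.
- apply: (integrableS measurableT) => //; first exact: box_measurable.
  by apply: integrable_norm => //; exact: Tf_integrable.
- apply: (eq_integrable _ (cst M%:E)) => //; first exact: box_measurable.
  apply/integrableP; split => //; rewrite integral_cst ?lte_mul_pinfty ?box_measure//; exact: box_measurable.
Qed.

Lemma int1_derive (g g' : R -> R) (B : R) : 0 < B -> (forall t, is_derive t (1 : R) g (g' t)) ->
  continuous g' -> (forall t, B <= `|t| -> g t = 0) -> (forall t, B <= `|t| -> g' t = 0) ->
  (\int[mu]_t (g' t)%:E = 0)%E.
Proof.
move=> B0 dg cg' zg zg'.
have -> : (\int[mu]_t (g' t)%:E = \int[mu]_(t in `[(- B)%R, B]) (g' t)%:E)%E.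
  rewrite [RHS]integral_mkcond; apply: eq_integral => t _; rewrite patchE.
  case: ifPn => // /negP; rewrite inE/= in_itv/= -ler_norml => /negP.
  by rewrite -ltNge => /ltW/zg' ->.
have BB : - B < B by lra.
rewrite (@continuous_FTC2 R g' g _ _ BB (continuous_subspaceT cg')).
- by rewrite !zg ?normrN ?ger0_norm ?subee// ltW.
- have cg := derive_continuous1 dg; split => [r _||].
  + exact: isd_derivable (dg r).
  + by apply: cvg_at_right_filter; exact: cg.
  + by apply: cvg_at_left_filter; exact: cg.
- by move=> r _; rewrite derive1E (derive_val (is_derive := dg r)).
Qed.

(** The divergence theorem without boundary term. *)
Lemma I_partial i f : Tf f -> I (partial i f) = 0.
Proof.
move=> tf; have tp := Tf_partial i tf; have ip := Tf_integrable tp.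
case: (tf) => sf [B' zf']; case: (tp) => sp [B'' zp'].
pose B := Num.max 1 (Num.max B' B'') + 1.
have B0 : 0 < B by rewrite ltr_wpDl// le_max ler01.
have zz (h : R * R -> R) b (x : R * R) : zoff (box b) h -> b < B -> B <= `|x.1| \/ B <= `|x.2| -> h x = 0.
  by move=> zh bB [xB|xB]; apply: zh => -[x1 x2]; move: bB xB x1 x2; lra.
have B'B : B' < B by rewrite ltr_pwDr// !le_max lexx orbT.
have B''B : B'' < B by rewrite ltr_pwDr// !le_max lexx !orbT.
rewrite /I /Rintegral; have [i0|i1] := ord2P i.
- rewrite -(@integral21_prod_meas1 _ _ _ _ _ mu mu _ ip) integral0_eq//= => y _.
  rewrite /fubini_G/= i0.
  apply: (@int1_derive (fun t => f (t, y)) (fun t => partial 0 f (t, y)) B) => //.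
  + by move=> t; have := @partial_line0 R f (0, y) t sf; rewrite /= add0r; under eq_fun do rewrite add0r.
  + apply: (derive_continuous1 (g' := fun t => partial 0 (partial 0 f) (t, y))) => t.
    have := @partial_line0 R (partial 0 f) (0, y) t (Smooth_partial 0 sf).
    by rewrite /= add0r; under eq_fun do rewrite add0r.
  + by move=> t tB; apply: (zz _ _ (t, y) zf') => //; left.
  + by move=> t tB; rewrite -i0; apply: (zz _ _ (t, y) zp') => //; left.
- rewrite -(@integral12_prod_meas1 _ _ _ _ _ mu mu _ ip) integral0_eq//= => y _.
  rewrite /fubini_F/= i1.
  apply: (@int1_derive (fun t => f (y, t)) (fun t => partial 1 f (y, t)) B) => //.
  + by move=> t; have := @partial_line1 R f (y, 0) t sf; rewrite /= add0r; under eq_fun do rewrite add0r.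
  + apply: (derive_continuous1 (g' := fun t => partial 1 (partial 1 f) (y, t))) => t.
    have := @partial_line1 R (partial 1 f) (y, 0) t (Smooth_partial 1 sf).
    by rewrite /= add0r; under eq_fun do rewrite add0r.
  + by move=> t tB; apply: (zz _ _ (y, t) zf') => //; right.
  + by move=> t tB; rewrite -i1; apply: (zz _ _ (y, t) zp') => //; right.
Qed.

Lemma I_dir v f : Tf f -> I (dir v f) = 0.
Proof.
move=> tf; rewrite dirE ID ?IZ ?I_partial ?mulr0 ?addr0//;
  by [apply: Tf_partial|apply: TfZ; exact: Tf_partial].
Qed.

Lemma IB f g : Tf f -> Tf g -> I (f - g) = I f - I g.
Proof. by move=> tf tg; rewrite -scaleN1r ID ?IZ ?mulN1r//; exact: TfZ. Qed.

(** Translation invariance: f - tr v f is a derivative along v. *)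
Lemma I_tr v f : Tf f -> I (tr v f) = I f.
Proof.
move=> tf; apply/eqP; rewrite eq_sym -subr_eq0 -IB//; last exact: Tf_tr.
by rewrite -dir_AvE ?I_dir//; [exact: Tf_Av|exact: Tf_smooth].
Qed.

End Plane.

(** * The inner product of test functions *)

Opaque Av tr.

Section InnerProduct.
Context {R : realType}.
Implicit Types (f g h : R * R -> R) (i j : 'I_2) (x y v w : R * R) (B : R).

Definition ip f g : R := I (fun x => f x * g x).
Definition nrm f : R := Num.sqrt (ip f f).

Lemma TfMM f g : Tf f -> Tf g -> Tf (fun x => f x * g x).
Proof. by move=> tf tg; apply: TfM => //; exact: Tf_smooth. Qed.

Lemma ipC f g : ip f g = ip g f.
Proof. by congr I; apply/funext => x; rewrite mulrC. Qed.

Lemma ipDl f g h : Tf f -> Tf g -> Tf h -> ip (f + g) h = ip f h + ip g h.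
Proof.
move=> tf tg th; rewrite /ip -ID; [|exact: TfMM..].
by congr I; apply/funext => x; rewrite /= -[RHS]/(f x * h x + g x * h x) -mulrDl.
Qed.

Lemma ipZl (a : R) f g : Tf f -> Tf g -> ip (a *: f) g = a * ip f g.
Proof.
move=> tf tg; rewrite /ip -IZ; last exact: TfMM.
by congr I; apply/funext => x; rewrite -[RHS]/(a * (f x * g x)) mulrA.
Qed.

Lemma ipBl f g h : Tf f -> Tf g -> Tf h -> ip (f - g) h = ip f h - ip g h.
Proof. by move=> tf tg th; rewrite -scaleN1r ipDl ?ipZl ?mulN1r//; exact: TfZ. Qed.

Lemma ip0l f : ip 0 f = 0.
Proof. by rewrite /ip -[RHS](@I0 R); congr I; apply/funext => x; exact: mul0r. Qed.

Lemma ipDr f g h : Tf f -> Tf g -> Tf h -> ip h (f + g) = ip h f + ip h g.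
Proof. by move=> *; rewrite ipC ipDl// !(ipC h). Qed.

Lemma ipZr (a : R) f g : Tf f -> Tf g -> ip g (a *: f) = a * ip g f.
Proof. by move=> *; rewrite ipC ipZl// (ipC g). Qed.

Lemma ipBr f g h : Tf f -> Tf g -> Tf h -> ip h (f - g) = ip h f - ip h g.
Proof. by move=> *; rewrite ipC ipBl// !(ipC h). Qed.

Lemma ip_suml (J : Type) (r : seq J) (F : J -> R * R -> R) g :
  (forall k, Tf (F k)) -> Tf g -> ip (\sum_(k <- r) F k) g = \sum_(k <- r) ip (F k) g.
Proof.
move=> tF tg; elim: r => [|k r IH]; first by rewrite !big_nil ip0l.
by rewrite !big_cons ipDl ?IH//; exact: Tf_sum.
Qed.

Lemma ip_ge0 f : 0 <= ip f f.
Proof. by apply: I_ge0 => x; rewrite -expr2 sqr_ge0. Qed.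

Lemma nrm_ge0 f : 0 <= nrm f. Proof. exact: sqrtr_ge0. Qed.

Lemma nrm_sqr f : nrm f ^+ 2 = ip f f. Proof. by rewrite sqr_sqrtr// ip_ge0. Qed.

Lemma quad_disc (a b c : R) : 0 <= a -> 0 <= c ->
  (forall t : R, 0 <= a + 2 * t * b + t ^+ 2 * c) -> b ^+ 2 <= a * c.
Proof.
move=> a0 c0 H; have [cz|cz] := eqVneq c 0.
  have [->|b0] := eqVneq b 0; first by rewrite cz expr0n mulr0.
  have := H (- (a + 1) / (2 * b)); rewrite cz mulr0 addr0.
  rewrite (_ : 2 * _ * b = - (a + 1)); last by field.
  by rewrite opprD addrA subrr sub0r oppr_ge0 ler10.
have cp : 0 < c by rewrite lt_neqAle eq_sym cz.
have := H (- b / c); rewrite (_ : _ + _ = (a * c - b ^+ 2) / c); last by field.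
by rewrite pmulr_lge0 ?invr_gt0// subr_ge0.
Qed.

Lemma cauchy_schwarz f g : Tf f -> Tf g -> `|ip f g| <= nrm f * nrm g.
Proof.
move=> tf tg; rewrite -(ler_pXn2r (n := 2))// ?nnegrE ?mulr_ge0 ?nrm_ge0//.
rewrite -normrX ger0_norm ?sqr_ge0// exprMn !nrm_sqr.
apply: quad_disc; [exact: ip_ge0|exact: ip_ge0|move=> t].
have := ip_ge0 (f + t *: g).
have tz := TfZ t tg; have tD := TfD tf tz.
rewrite ipDl// ipDr// (ipDr tf tz tz) !ipZl// !ipZr// (ipC g f).
by set A := ip f f; set C := ip g g; move=> H; apply: le_trans H _; rewrite le_eqVlt; apply/orP; left; apply/eqP; ring.
Qed.

Lemma nrmZ (a : R) f : Tf f -> nrm (a *: f) = `|a| * nrm f.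
Proof.
move=> tf; have tz := TfZ a tf.
by rewrite /nrm ipZl// ipZr// mulrA -expr2 sqrtrM ?sqr_ge0// sqrtr_sqr.
Qed.

Lemma nrmN f : Tf f -> nrm (- f) = nrm f.
Proof. by move=> tf; rewrite -scaleN1r nrmZ// normrN1 mul1r. Qed.

Lemma nrmD f g : Tf f -> Tf g -> nrm (f + g) <= nrm f + nrm g.
Proof.
move=> tf tg; have tD := TfD tf tg.
rewrite -(ler_pXn2r (n := 2))// ?nnegrE ?addr_ge0 ?nrm_ge0//.
rewrite nrm_sqr ipDl// !ipDr// (ipC g f) sqrrD !nrm_sqr.
have := le_trans (ler_norm _) (cauchy_schwarz tf tg); lra.
Qed.

Lemma nrmB f g : Tf f -> Tf g -> nrm (f - g) <= nrm f + nrm g.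
Proof. by move=> tf tg; rewrite -(nrmN tg); apply: nrmD => //; exact: TfN. Qed.

Lemma ip_tr v f g : Tf f -> Tf g -> ip (tr v f) (tr v g) = ip f g.
Proof.
by move=> tf tg; rewrite /ip -[RHS](I_tr v (TfMM tf tg)).
Qed.

Lemma nrm_tr v f : Tf f -> nrm (tr v f) = nrm f.
Proof. by move=> tf; rewrite /nrm ip_tr. Qed.

Lemma ip_trl v f g : Tf f -> Tf g -> ip (tr v f) g = ip f (tr (- v) g).
Proof.
by move=> tf tg; rewrite -(ip_tr v tf) ?tr_tr ?subrr ?tr0//; exact: Tf_tr.
Qed.

Lemma ip_partial i f g : Tf f -> Tf g -> ip (partial i f) g = - ip f (partial i g).
Proof.
move=> tf tg; have := I_partial i (TfMM tf tg).
rewrite partialM; [|exact: Tf_smooth..].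
have -> : (fun x => f x * partial i g x + partial i f x * g x) =
  (fun x => f x * partial i g x) + (fun x => partial i f x * g x) by [].
rewrite ID; [|by apply: TfMM => //; exact: Tf_partial..].
by rewrite -/(ip f _) -/(ip (partial i f) g) addrC => /eqP; rewrite addr_eq0 => /eqP.
Qed.

Lemma nrm_box f B (M : R) : Tf f -> zoff (box B) f -> 0 <= M -> (forall x, `|f x| <= M) ->
  nrm f <= M * Num.sqrt (fine (lebesgue2 (box B))).
Proof.
move=> tf zf M0 fM.
have -> : M = Num.sqrt (M ^+ 2) by rewrite sqrtr_sqr ger0_norm.
rewrite -sqrtrM ?sqr_ge0// ler_sqrt; last by rewrite mulr_ge0 ?sqr_ge0 ?fine_ge0.
apply: le_trans (ler_norm _) _; apply: I_box; first exact: TfMM.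
- by move=> x Bx; rewrite zf// mulr0.
- by move=> x; rewrite normrM expr2 ler_pM.
Qed.

(** A function with bounded support that is constant along a direction
    vanishes. *)
Lemma dir_inj v f : Tf f -> v != 0 -> dir v f = 0 -> f = 0.
Proof.
move=> [sf [B zf]] v0 df; apply/funext => x.
have dl (r : R) : is_derive r (1 : R) (fun r : R => f (x + r *: v)) 0.
  by have := dir_line v x r sf; rewrite df.
have E r : f x = f (x + r *: v).
  by have := is_derive_0_is_cst 0 r dl; rewrite /= scale0r addr0.
have [k [k0 kx]] : exists k : R, k != 0 /\ forall r, `|r * k| > `|B| + `|x.1| + `|x.2| -> ~ box B (x + r *: v).
  have [v1|v1] := eqVneq v.1 0.
    exists v.2; split.
      by apply: contra_neq v0 => v2; rewrite (surjective_pairing v) v1 v2.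
    move=> r rk [_]; rewrite scale_pairE add_pairE/=.
    have := ler_normB (x.2 + r * v.2) x.2; rewrite (addrC x.2) addrK.
    have := ler_norm B; have := normr_ge0 x.1; lra.
  exists v.1; split => // r rk [+ _]; rewrite scale_pairE add_pairE/=.
  have := ler_normB (x.1 + r * v.1) x.1; rewrite (addrC x.1) addrK.
  have := ler_norm B; have := normr_ge0 x.2; lra.
rewrite (E ((`|B| + `|x.1| + `|x.2| + 1) / k)) zf//; apply: kx.
rewrite divfK// [ltRHS]ger0_norm; first by rewrite ltrDl.
by apply: addr_ge0 => //; apply: addr_ge0 => //; apply: addr_ge0.
Qed.

Lemma Av0 f : Av 0 f = f.
Proof. by apply/funext => x; apply: Av_cst_seg => r _; rewrite scaler0 subr0. Qed.

Lemma dirB v f g : Smooth f -> Smooth g -> dir v (f - g) = dir v f - dir v g.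
Proof. by move=> sf sg; rewrite !dirE !partialB// !scalerBr addrACA -opprD. Qed.

Lemma dirZ v (a : R) f : Smooth f -> dir v (a *: f) = a *: dir v f.
Proof. by move=> sf; rewrite !dirE !partialZ// scalerDr !scalerA !(mulrC a). Qed.

Lemma dir_scale (a : R) v f : dir (a *: v) f = a *: dir v f.
Proof. by rewrite !dirE scalerDr !scalerA. Qed.

Lemma eq_dir v f g : Tf f -> Tf g -> v != 0 -> dir v f = dir v g -> f = g.
Proof.
move=> tf tg v0 E; apply/eqP; rewrite -subr_eq0; apply/eqP.
apply: (dir_inj (TfB tf tg) v0); rewrite dirB ?E ?subrr//; exact: Tf_smooth.
Qed.

(** The average over a segment is the mean of the averages over its halves. *)
Lemma Av_half v f : Tf f ->
  Av (2 *: v) f = 2^-1 *: (Av v f + tr v (Av v f)).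
Proof.
move=> tf; have ta := Tf_Av v tf; have tt := Tf_tr v ta; have td := TfD ta tt.
have [->|v0] := eqVneq v 0.
  rewrite scaler0 !Av0 tr0 scalerDr -scalerDl (_ : 2^-1 + 2^-1 = 1) ?scale1r//.
  by field.
apply: (eq_dir (v := v)) => //; [exact: Tf_Av|exact: TfZ|].
have -> : dir v (Av (2 *: v) f) = 2^-1 *: (f - tr (2 *: v) f).
  by rewrite -dir_AvE ?dir_scale ?scalerA ?mulVf ?scale1r//; exact: Tf_smooth.
rewrite dirZ; last exact: Tf_smooth.
rewrite dirD; [|exact: Tf_smooth..].
rewrite dir_tr dir_AvE; last exact: Tf_smooth.
rewrite trB tr_tr addrA subrK (_ : 2 *: v = v + v)//.
by rewrite scaler_nat mulr2n.
Qed.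

Lemma AvC v w f : Tf f -> Av v (Av w f) = Av w (Av v f).
Proof.
move=> tf; have [->|v0] := eqVneq v 0; first by rewrite !Av0.
have sf := Tf_smooth tf.
apply: (eq_dir (Tf_Av v (Tf_Av w tf)) (Tf_Av w (Tf_Av v tf)) v0).
rewrite (dir_AvE v (Smooth_Av w sf)) (dir_Av v w (Smooth_Av v sf)).
rewrite dir_AvE// AvB ?Av_tr//; first exact: smooth_continuous.
exact: smooth_continuous (Smooth_tr v sf).
Qed.

Lemma small_le0 (a C : R) : (forall n, a <= C * 2^-1 ^+ n) -> a <= 0.
Proof.
move=> H; rewrite leNgt; apply/negP => a0.
have C0 : 0 < C by have := H 0%N; rewrite expr0 mulr1; exact: lt_le_trans.
have := H (Num.bound (C / a)); apply/negP; rewrite -ltNge.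
rewrite exprVn ltr_pdivrMr ?exprn_gt0// mulrC -ltr_pdivrMr//.
apply: lt_trans (archi_boundP _) _; first by rewrite divr_ge0// ltW.
by rewrite -natrX ltr_nat ltn_expl.
Qed.

(** The average over a segment of length t moves f by at most t times the
    derivative of f along the segment. *)
Lemma Av_small v f : Tf f ->
  exists2 C : R, 0 <= C & forall t : R, 0 <= t <= 1 -> nrm (Av (t *: v) f - f) <= C * t.
Proof.
move=> tf; have [sf [B zf]] := tf; have cf := smooth_continuous sf.
have [sd [B' zd]] := Tf_dir v tf.
have [M M0 HM] := cs_bounded (smooth_continuous sd) zd.
pose B2 := B + (`|v.1| + `|v.2|).
exists (M * Num.sqrt (fine (lebesgue2 (box B2)))).
  by rewrite mulr_ge0 ?sqrtr_ge0// ltW.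
move=> t /andP[t0 t1]; rewrite mulrAC.
have tA := Tf_Av (t *: v) tf.
apply: nrm_box; first exact: TfB.
- move=> x Bx; rewrite -[LHS]/(Av (t *: v) f x - f x) (Av_cst_seg (c := 0)).
    rewrite zf ?subrr// => Bx'; apply: Bx; apply: box_le Bx'.
    by rewrite lerDl addr_ge0.
  move=> r /andP[r0 r1]; apply: zf; rewrite scalerA => Bx'; apply: Bx.
  by apply: box_shift Bx'; rewrite mulr_ge0// mulr_ile1.
- by rewrite mulr_ge0// ltW.
- move=> x.
  have cc : continuous (cst (f x) : R * R -> R) by move=> z; exact: cst_continuous.
  have -> : (Av (t *: v) f - f) x = Av (t *: v) (f - cst (f x)) x.
    rewrite (AvB (t *: v) cf cc) -[LHS]/(Av (t *: v) f x - f x).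
    by rewrite -[RHS]/(Av (t *: v) f x - Av (t *: v) (cst (f x)) x) (Av_cst_seg (f := cst (f x)) (c := f x)).
  apply: Av_le; first exact: contB.
  move=> r /andP[r0 r1]; change (`|f (x - r *: (t *: v)) - f x| <= M * t).
  have [c _ E] := MVT0 (- (r * t)) (fun s => dir_line v x s sf).
  move: E; rewrite scale0r addr0 scaleNr scalerA => ->.
  rewrite normrM normrN ler_pM// ger0_norm ?mulr_ge0//.
  by rewrite ler_piMl.
Qed.

(** The average is the mean of the average over half the segment and of a
    translate of it, so the norm of the average does not decrease when the
    segment is halved; over short segments the average is close to f. *)
Lemma nrm_Av v f : Tf f -> nrm (Av v f) <= nrm f.
Proof.
move=> tf; have [C C0 HC] := Av_small v tf.
rewrite -subr_le0; apply: (@small_le0 _ C) => n; rewrite lerBlDl.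
have step (w : R * R) : nrm (Av (2 *: w) f) <= nrm (Av w f).
  have ta := Tf_Av w tf; have tt := Tf_tr w ta.
  rewrite Av_half// nrmZ; last exact: TfD.
  rewrite ger0_norm ?invr_ge0// ler_pdivrMl// mulrC mulr_natr mulr2n.
  by apply: le_trans (nrmD ta tt) _; rewrite (nrm_tr _ ta).
have H : nrm (Av v f) <= nrm (Av (2^-1 ^+ n *: v) f).
  elim: n => [|n IH]; first by rewrite expr0 scale1r.
  apply: le_trans IH _; have := step (2^-1 ^+ n.+1 *: v).
  by rewrite scalerA exprS mulrA divff ?mul1r.
apply: le_trans H _; have p2 : 0 <= (2^-1 : R) ^+ n <= 1.
  by rewrite exprn_ge0// exprn_ile1// invf_le1 ?ler1n.
rewrite -(subrK f (Av _ f)) addrC (le_trans (nrmD _ _))//.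
  by apply: TfB => //; exact: Tf_Av.
by rewrite lerD2l HC.
Qed.

(** Averaging along v is adjoint to averaging along -v: halve the segment
    until both averages are close to the identity. *)
Lemma ip_Av v f g : Tf f -> Tf g -> ip (Av v f) g = ip f (Av (- v) g).
Proof.
move=> tf tg.
have [C C0 HC] := Av_small v tf; have [D D0 HD] := Av_small (- v) tg.
pose d (w : R * R) (h : R * R -> R) := ip (Av w f) h - ip f (Av (- w) h).
have dH w h : Tf h -> d (2 *: w) h = 2^-1 * (d w h + d w (tr (- w) h)).
  move=> th; have ta := Tf_Av w tf; have tb := Tf_Av (- w) th.
  have tta := Tf_tr w ta; have ttb := Tf_tr (- w) tb.
  rewrite /d -scalerN !Av_half// ipZl//; last exact: TfD.
  rewrite ipZr//; last exact: TfD.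
  rewrite (ipDl ta tta th) (ipDr tb ttb tf) (ip_trl _ ta th) Av_tr.
  rewrite -mulrBr; congr (_ * _); rewrite opprD addrACA; reflexivity.
have key n w : `|d (2^-1 ^+ n *: v) (tr w g)| <= (C * nrm g + nrm f * D) * 2^-1 ^+ n.
  have p2 : 0 <= (2^-1 : R) ^+ n <= 1.
    by rewrite exprn_ge0// exprn_ile1// invf_le1 ?ler1n.
  have tw := Tf_tr w tg; set u := _ *: v.
  have ta := Tf_Av u tf; have tb := Tf_Av (- u) tw.
  have -> : d u (tr w g) = ip (Av u f - f) (tr w g) - ip f (Av (- u) (tr w g) - tr w g).
    rewrite /d ipBl// ipBr//; ring.
  rewrite (le_trans (ler_normB _ _))// mulrDl lerD//.
    rewrite (le_trans (cauchy_schwarz _ _))//; first exact: TfB.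
    by rewrite nrm_tr// mulrAC ler_wpM2r ?nrm_ge0// HC.
  rewrite (le_trans (cauchy_schwarz _ _))//; first exact: TfB.
  rewrite -mulrA ler_wpM2l ?nrm_ge0// Av_tr -trB nrm_tr; last by apply: TfB => //; exact: Tf_Av.
  by rewrite /u -scalerN HD.
have key2 n w : `|d v (tr w g)| <= (C * nrm g + nrm f * D) * 2^-1 ^+ n.
  suff H m u : (m <= n)%N -> `|d (2^-1 ^+ (n - m) *: v) (tr u g)| <= (C * nrm g + nrm f * D) * 2^-1 ^+ n.
    by have := H n w (leqnn n); rewrite subnn expr0 scale1r.
  elim: m u => [|m IH] u mn; first by rewrite subn0.
  have -> : 2^-1 ^+ (n - m.+1) *: v = 2 *: (2^-1 ^+ (n - m) *: v).
    by rewrite subnS -{2}(prednK (_ : 0 < n - m)%N) ?subn_gt0// exprS scalerA mulrA divff ?mul1r.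
  rewrite dH; last exact: Tf_tr.
  rewrite normrM ger0_norm ?invr_ge0// ler_pdivrMl// tr_tr.
  by rewrite (le_trans (ler_normD _ _))// mulr_natl mulr2n lerD// IH// ltnW.
apply/eqP; rewrite -subr_eq0 -normr_le0; apply: (@small_le0 _ (C * nrm g + nrm f * D)) => n.
by have := key2 n 0; rewrite tr0.
Qed.

End InnerProduct.

(** * Convolution operators carried by a parallelogram *)

Opaque ip nrm.

Section Multipliers.
Context {R : realType}.
Variables a b : R * R.
Implicit Types (f g h : R * R -> R) (i j : 'I_2) (x y v w u : R * R) (c r t : R).
Implicit Types (T : (R * R -> R) -> (R * R -> R)) (K : set (R * R)).

Definition cone_rect r t : set (R * R) :=
  [set al *: a + be *: b | al in `[0, r]%classic & be in `[0, t]%classic].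

Definition msum (A B : set (R * R)) : set (R * R) := [set x + y | x in A & y in B].

(** The properties of convolution with a measure of mass at most c carried by
    the parallelogram cone_rect r t. They are stated without the measure, since
    only sums and compositions of translations and averages occur. *)
Record mult c r t T : Prop := Mult {
  mult_Tf : forall f, Tf f -> Tf (T f) ;
  mult_lin : forall l f g, Tf f -> Tf g -> T (l *: f + g) = l *: T f + T g ;
  mult_nrm : forall f, Tf f -> nrm (T f) <= c * nrm f ;
  mult_tr : forall u f, Tf f -> T (tr u f) = tr u (T f) ;
  mult_Av : forall u f, Tf f -> T (Av u f) = Av u (T f) ;
  mult_partial : forall i f, Tf f -> partial i (T f) = T (partial i f) ;
  mult_zoff : forall K f, zoff K f -> zoff (msum K (cone_rect r t)) (T f) }.

Lemma mult0 c r t T : mult c r t T -> T 0 = 0.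
Proof.
move=> mT; have := mult_lin mT (-1) (@Tf0 R) (@Tf0 R).
by rewrite scaleN1r oppr0 addr0 scaleN1r addNr.
Qed.

Lemma multD c r t T f g : mult c r t T -> Tf f -> Tf g -> T (f + g) = T f + T g.
Proof. by move=> mT tf tg; rewrite -[f]scale1r (mult_lin mT)// !scale1r. Qed.

Lemma multZ c r t T l f : mult c r t T -> Tf f -> T (l *: f) = l *: T f.
Proof.
by move=> mT tf; rewrite -[_ *: f]addr0 (mult_lin mT)//; [rewrite (mult0 mT) addr0|exact: Tf0].
Qed.

Lemma multB c r t T f g : mult c r t T -> Tf f -> Tf g -> T (f - g) = T f - T g.
Proof.
move=> mT tf tg; rewrite -scaleN1r (multD mT)//; last exact: TfZ.
by rewrite (multZ _ mT)// scaleN1r.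
Qed.

Lemma mult_dir c r t T u f : mult c r t T -> Tf f -> dir u (T f) = T (dir u f).
Proof.
move=> mT tf; rewrite !dirE !(mult_partial mT)// (multD mT); [|by apply: TfZ; exact: Tf_partial..].
by rewrite !(multZ _ mT)//; exact: Tf_partial.
Qed.

Lemma cone_rect_le r t r' t' : r <= r' -> t <= t' -> cone_rect r t `<=` cone_rect r' t'.
Proof.
move=> rr tt _ [al + [be + <-]]; rewrite /= !in_itv/= => /andP[a0 ar] /andP[b0 bt].
by exists al; [rewrite /= in_itv/= a0 (le_trans ar)|exists be => //; rewrite /= in_itv/= b0 (le_trans bt)].
Qed.

Lemma msumS A B A' B' : A `<=` A' -> B `<=` B' -> msum A B `<=` msum A' B'.
Proof. by move=> AA BB _ [x Ax [y By <-]]; exists x; [exact: AA|exists y => //; exact: BB]. Qed.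

Lemma mult_weaken c r t c' r' t' T : mult c r t T -> c <= c' -> r <= r' -> t <= t' ->
  mult c' r' t' T.
Proof.
move=> mT cc rr tt; split; try by case: mT.
- by move=> f tf; rewrite (le_trans (mult_nrm mT tf))// ler_wpM2r ?nrm_ge0.
- move=> K f zf; apply: zoff_sub (mult_zoff mT zf).
  by apply: msumS => //; exact: cone_rect_le.
Qed.

Lemma mult_comp c r t T c' r' t' T' : 0 <= c -> mult c r t T -> mult c' r' t' T' ->
  mult (c * c') (r + r') (t + t') (T \o T').
Proof.
move=> c0 mT mT'; split => /=.
- by move=> f tf; apply: (mult_Tf mT); exact: (mult_Tf mT').
- move=> l f g tf tg; rewrite (mult_lin mT')// (mult_lin mT)//; exact: (mult_Tf mT').
- move=> f tf; rewrite (le_trans (mult_nrm mT (mult_Tf mT' tf)))// -mulrA ler_wpM2l//.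
  exact: (mult_nrm mT').
- by move=> u f tf; rewrite (mult_tr mT')// (mult_tr mT)//; exact: (mult_Tf mT').
- by move=> u f tf; rewrite (mult_Av mT')// (mult_Av mT)//; exact: (mult_Tf mT').
- by move=> i f tf; rewrite (mult_partial mT) ?(mult_partial mT')//; exact: (mult_Tf mT').
- move=> K f zf; apply: zoff_sub (mult_zoff mT (mult_zoff mT' zf)).
  move=> _ [_ [x Kx [_ [al' al'0 [be' be'0 <-]] <-]] [_ [al al0 [be be0 <-]] <-]].
  exists x => //; exists ((al + al') *: a + (be + be') *: b); last first.
    by rewrite -[RHS]addrA; congr (_ + _); rewrite addrACA -!scalerDl (addrC al') (addrC be').
  move: al'0 be'0 al0 be0; rewrite /= !in_itv/= => /andP[? ?] /andP[? ?] /andP[? ?] /andP[? ?].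
  exists (al + al'); first by rewrite /= in_itv/= addr_ge0// lerD.
  by exists (be + be') => //; rewrite /= in_itv/= addr_ge0// lerD.
Qed.

Lemma mult_add c r t T c' T' : mult c r t T -> mult c' r t T' ->
  mult (c + c') r t (fun f => T f + T' f).
Proof.
move=> mT mT'; split => /=.
- by move=> f tf; apply: TfD; [exact: (mult_Tf mT)|exact: (mult_Tf mT')].
- by move=> l f g tf tg; rewrite (mult_lin mT')// (mult_lin mT)// scalerDr addrACA.
- move=> f tf; rewrite (le_trans (nrmD (mult_Tf mT tf) (mult_Tf mT' tf)))// mulrDl.
  by rewrite lerD ?(mult_nrm mT) ?(mult_nrm mT').
- by move=> u f tf; rewrite (mult_tr mT')// (mult_tr mT)// trD.
- move=> u f tf; rewrite (mult_Av mT')// (mult_Av mT)// AvD//; apply: smooth_continuous; apply: Tf_smooth.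
    exact: (mult_Tf mT).
  exact: (mult_Tf mT').
- move=> i f tf; rewrite partialD ?(mult_partial mT') ?(mult_partial mT)//; apply: Tf_smooth.
    exact: (mult_Tf mT).
  exact: (mult_Tf mT').
- move=> K f zf x Kx; rewrite -[LHS]/(T f x + T' f x).
  by rewrite (mult_zoff mT zf)// (mult_zoff mT' zf)// addr0.
Qed.

Lemma mult_scale c r t T l : mult c r t T -> mult (`|l| * c) r t (fun f => l *: T f).
Proof.
move=> mT; split => /=.
- by move=> f tf; apply: TfZ; exact: (mult_Tf mT).
- by move=> k f g tf tg; rewrite (mult_lin mT)// scalerDr !scalerA mulrC.
- move=> f tf; rewrite nrmZ; last exact: (mult_Tf mT).
  by rewrite -mulrA ler_wpM2l// (mult_nrm mT).
- by move=> u f tf; rewrite (mult_tr mT)// trZ.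
- move=> u f tf; rewrite (mult_Av mT)// AvZ//; apply: smooth_continuous; apply: Tf_smooth.
  exact: (mult_Tf mT).
- move=> i f tf; rewrite partialZ ?(mult_partial mT)//; apply: Tf_smooth.
  exact: (mult_Tf mT).
- by move=> K f zf x Kx; rewrite -[LHS]/(l * T f x) (mult_zoff mT zf)// mulr0.
Qed.

Lemma cone_rect0 r t : 0 <= r -> 0 <= t -> cone_rect r t 0.
Proof.
move=> r0 t0; exists 0; first by rewrite /= in_itv/= lexx.
by exists 0; [rewrite /= in_itv/= lexx|rewrite !scale0r addr0].
Qed.

Lemma mult_id : mult 1 0 0 idfun.
Proof.
split; try by [].
  by move=> f tf; rewrite mul1r.
move=> K f zf; apply: zoff_sub zf => x Kx; exists x => //; exists 0; last by rewrite addr0.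
exact: cone_rect0.
Qed.

Lemma mult_trc r t al be : 0 <= al <= r -> 0 <= be <= t -> mult 1 r t (tr (al *: a + be *: b)).
Proof.
move=> /andP[a0 ar] /andP[b0 bt]; split.
- by move=> f; exact: Tf_tr.
- by move=> l f g _ _; rewrite trD trZ.
- by move=> f tf; rewrite mul1r nrm_tr.
- by move=> u f tf; rewrite !tr_tr addrC.
- by move=> u f tf; rewrite Av_tr.
- by move=> i f tf; rewrite partial_tr.
Transparent tr.
- move=> K f zf x Kx; apply: zf => Kx'; apply: Kx; exists (x - (al *: a + be *: b)) => //.
  exists (al *: a + be *: b); last by rewrite subrK.
  exists al; first by rewrite /= in_itv/= a0.
  by exists be => //; rewrite /= in_itv/= b0.
Qed.
Opaque tr.

Lemma mult_Avc r t al be : 0 <= al <= r -> 0 <= be <= t -> mult 1 r t (Av (al *: a + be *: b)).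
Proof.
move=> /andP[a0 ar] /andP[b0 bt].
have cf f : Tf f -> continuous f by move=> /Tf_smooth/smooth_continuous.
split.
- by move=> f; exact: Tf_Av.
- move=> l f g tf tg; rewrite AvD; [|exact: cf (TfZ l tf)|exact: cf tg].
  by rewrite AvZ//; exact: cf tf.
- by move=> f tf; rewrite mul1r nrm_Av.
- by move=> u f tf; rewrite Av_tr.
- by move=> u f tf; rewrite AvC.
- by move=> i f tf; rewrite partial_Av//; exact: Tf_smooth.
- move=> K f zf x Kx; apply: Av_cst_seg => k /andP[k0 k1]; apply: zf => Kx'; apply: Kx.
  exists (x - k *: (al *: a + be *: b)) => //.
  exists (k *: (al *: a + be *: b)); last by rewrite subrK.
  exists (k * al); first by rewrite /= in_itv/= mulr_ge0// (le_trans _ ar)// ler_piMl.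
  exists (k * be); first by rewrite /= in_itv/= mulr_ge0// (le_trans _ bt)// ler_piMl.
  by rewrite scalerDr !scalerA.
Qed.

(** The band-pass operator at scale v. *)
Definition bp v f := Av v f - tr v (Av v f).

Lemma Tf_bp v f : Tf f -> Tf (bp v f).
Proof. by move=> tf; apply: TfB; [|apply: Tf_tr]; exact: Tf_Av. Qed.

(** The parallelogram law: halving the scale of an average adds the square of
    a band-pass component, so that these squares telescope. *)
Lemma bp_pythagoras v f : Tf f ->
  ip (bp v f) (bp v f) = 4 * (ip (Av v f) (Av v f) - ip (Av (2 *: v) f) (Av (2 *: v) f)).
Proof.
move=> tf; have ta := Tf_Av v tf; have tt := Tf_tr v ta; have tD := TfD ta tt.
rewrite Av_half// ipZl ?ipZr//; last exact: TfZ.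
rewrite /bp ipBl ?ipBr//; try exact: TfB.
rewrite !ipDl// !ipDr// (ip_tr v ta ta) (ipC (tr v (Av v f))).
by set A := ip _ _; set B := ip _ _; field.
Qed.

(** The dyadic scales of a vector. *)
Definition sc v (k : nat) : R * R := 2^-1 ^+ k *: v.

Lemma scS v k : 2 *: sc v k.+1 = sc v k.
Proof. by rewrite /sc exprS !scalerA mulrA divff ?mul1r. Qed.

Lemma sc0 v : sc v 0 = v. Proof. by rewrite /sc expr0 scale1r. Qed.

Lemma telescope4 (X Y : nat -> R) n : (forall k, X k = 4 * (Y k.+1 - Y k)) ->
  \sum_(k < n) X k = 4 * (Y n - Y 0%N).
Proof.
move=> H; elim: n => [|n IH]; first by rewrite big_ord0 subrr mulr0.
by rewrite big_ord_recr/= IH H; ring.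
Qed.

Lemma bp_square v f n : Tf f ->
  \sum_(k < n) ip (bp (sc v k.+1) f) (bp (sc v k.+1) f) <= 4 * ip f f.
Proof.
move=> tf.
have H k : ip (bp (sc v k.+1) f) (bp (sc v k.+1) f) =
    4 * (ip (Av (sc v k.+1) f) (Av (sc v k.+1) f) - ip (Av (sc v k) f) (Av (sc v k) f)).
  by rewrite (bp_pythagoras _ tf) scS.
rewrite (telescope4 n H) sc0.
rewrite ler_pM2l// lerBlDr (le_trans (_ : _ <= ip f f)) ?lerDl ?ip_ge0//.
by rewrite -!nrm_sqr ler_pXn2r ?nnegrE ?nrm_ge0 ?nrm_Av.
Qed.

Lemma ip_bp v f g : Tf f -> Tf g -> ip (bp v f) g = ip f (bp (- v) g).
Proof.
move=> tf tg; have ta := Tf_Av v tf; have tb := Tf_Av (- v) tg.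
rewrite /bp ipBl//; last exact: Tf_tr.
rewrite ipBr//; last exact: Tf_tr.
by rewrite (ip_trl _ ta tg) (ip_Av v tf tg) (ip_Av v tf (Tf_tr _ tg)) Av_tr.
Qed.

(** Sums of operators that are band-pass on both sides are bounded uniformly
    in the number of scales. *)
Lemma bp_sum_bound c r t v w n (C : nat -> (R * R -> R) -> R * R -> R) f : 0 <= c ->
  (forall k, mult c r t (C k)) -> Tf f ->
  nrm (\sum_(k < n) bp (sc v k.+1) (C k (bp (sc w k.+1) f))) <= 4 * c * nrm f.
Proof.
move=> c0 mC tf; set F := \sum_(k < n) _.
have tk (k : 'I_n) : Tf (C k (bp (sc w k.+1) f)) by apply: (mult_Tf (mC k)); exact: Tf_bp.
have tF : Tf F by apply: Tf_sum => k _; exact: Tf_bp.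
have H1 : ip F F <= \sum_(k < n) (2 * c ^+ 2 * ip (bp (sc w k.+1) f) (bp (sc w k.+1) f)
    + ip (bp (sc (- v) k.+1) F) (bp (sc (- v) k.+1) F) / 8).
  rewrite {1}/F ip_suml//; last by move=> k; exact: Tf_bp.
  apply: ler_sum => k _; rewrite ip_bp// /sc -scalerN -/(sc _ _).
  have t1 : Tf (bp (sc (- v) k.+1) F) by exact: Tf_bp.
  have t2 : Tf (bp (sc w k.+1) f) by exact: Tf_bp.
  apply: le_trans (ler_norm _) _; apply: le_trans (cauchy_schwarz (tk k) t1) _.
  have := mult_nrm (mC k) t2; rewrite -!nrm_sqr.
  move: (nrm_ge0 (C k (bp (sc w k.+1) f))) (nrm_ge0 (bp (sc w k.+1) f)) (nrm_ge0 (bp (sc (- v) k.+1) F)).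
  move: (nrm _) (nrm _) (nrm _) => Z Y X X0 Y0 Z0 XY.
  apply: (@le_trans _ _ (c * Y * Z)); first by rewrite ler_wpM2r.
  rewrite -subr_ge0 (_ : _ - _ = 2 * (c * Y - Z / 4) ^+ 2); first by rewrite mulr_ge0// sqr_ge0.
  by field.
rewrite big_split/= -mulr_sumr -mulr_suml in H1.
have H2 := bp_square w n tf; have H3 := bp_square (- v) n tF.
rewrite -(ler_pXn2r (n := 2))// ?nnegrE ?nrm_ge0 ?mulr_ge0 ?nrm_ge0//.
rewrite exprMn !nrm_sqr.
have c2 : 0 <= 2 * c ^+ 2 by rewrite mulr_ge0 ?sqr_ge0.
have H4 := ler_wpM2l c2 H2.
move: H1 H3 H4; move: (\sum_(k < n) _) (\sum_(k < n) _) (ip F F) (ip f f) => A B X Y.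
by rewrite exprMn; lra.
Qed.

End Multipliers.

(** * Multiscale smoothing *)

Opaque dir bp.

Section Multiscale.
Context {R : realType}.
Variables a b : R * R.
Implicit Types (f g h : R * R -> R) (i j : 'I_2) (x y v w u : R * R) (c r t l : R).
Implicit Types (T : (R * R -> R) -> (R * R -> R)) (K : set (R * R)).

Definition sca l f : R * R -> R := l *: f.
(** Horner steps: with T the operator of a polynomial in the translation tr v,
    hn v l T is l plus tr v times T. The operators below are polynomials p in
    s = tr v, written in this form so that identities between them are
    identities between polynomials. *)
Definition hn v l T f : R * R -> R := l *: f + tr v (T f).

Definition short v := (exists2 al, 0 <= al <= 1 & v = al *: a) \/
  (exists2 be, 0 <= be <= 1 & v = be *: b).

Lemma short_tr v : short v -> mult a b 1 1 1 (tr v).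
Proof.
case=> -[al al01 ->].
  by have := @mult_trc R a b 1 1 al 0 al01; rewrite scale0r addr0; apply; rewrite lexx ler01.
by have := @mult_trc R a b 1 1 0 al; rewrite scale0r add0r; apply; rewrite ?lexx ?ler01.
Qed.

Lemma short_Av v : short v -> mult a b 1 1 1 (Av v).
Proof.
case=> -[al al01 ->].
  by have := @mult_Avc R a b 1 1 al 0 al01; rewrite scale0r addr0; apply; rewrite lexx ler01.
by have := @mult_Avc R a b 1 1 0 al; rewrite scale0r add0r; apply; rewrite ?lexx ?ler01.
Qed.

(* Size and reach of an operator, with the constants forgotten except for an
   integer bound of the reach. *)
Definition mulN (c : R) (n : nat) T := 0 <= c /\ mult a b c n%:R n%:R T.

Lemma mulN_weaken c n m T : mulN c n T -> (n <= m)%N -> mulN c m T.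
Proof.
by move=> [c0 mT] nm; split=> //; apply: mult_weaken mT _ _ _; rewrite ?ler_nat.
Qed.

Lemma mulN_comp c n T c' n' T' : mulN c n T -> mulN c' n' T' -> mulN (c * c') (n + n') (T \o T').
Proof.
by move=> [c0 mT] [c'0 mT']; split; [exact: mulr_ge0|rewrite natrD; exact: mult_comp].
Qed.

Lemma mulN_sca l : mulN `|l| 0 (sca l).
Proof. by split => //; have := mult_scale l (mult_id a b); rewrite mulr1. Qed.

Lemma mulN_hn v l T c n : short v -> mulN c n T -> mulN (`|l| + c) n.+1 (hn v l T).
Proof.
move=> sv mT; split; first by rewrite addr_ge0//; case: mT.
apply: mult_add.
  by have [_] := mulN_weaken (mulN_sca l) (leq0n n.+1).
have [_] := mulN_comp (conj ler01 (short_tr sv) : mulN 1 1 (tr v)) mT.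
by rewrite mul1r.
Qed.

Lemma mulN_Av v : short v -> mulN 1 1 (Av v).
Proof. by move=> sv; split; [exact: ler01|exact: short_Av]. Qed.

Definition Z4 v f := Av v (Av v (Av v (Av v f))).

Lemma mulN_Z4 v : short v -> mulN 1 4 (Z4 v).
Proof.
move=> sv; have m1 := mulN_Av sv.
by have := mulN_comp m1 (mulN_comp m1 (mulN_comp m1 m1)); rewrite !mul1r.
Qed.

(** The polynomials 3 - 2 s, its value 3 - 2 s^2 at the double scale, (1 + s)/2,
    and the quotient of 3 - 2 s - ((1 + s)/2)^4 (3 - 2 s^2) by (1 - s)^2. The
    factor 3 - 2 s cancels the first moment of the fourth power of an average,
    which is what makes this division exact. *)
Definition th v := hn v 3 (sca (-2)).
Definition th2 v := hn v 3 (hn v 0 (sca (-2))).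
Definition half v := hn v 2^-1 (sca 2^-1).
Definition qq v := hn v (45 / 16) (hn v (46 / 16) (hn v (31 / 16) (hn v (12 / 16) (sca (2 / 16))))).
Definition half4 v f := half v (half v (half v (half v (th2 v f)))).

Lemma mulN_th v : short v -> exists2 c, c = 5 & mulN c 1 (th v).
Proof.
move=> sv; eexists; last exact: mulN_hn sv (mulN_sca _).
by rewrite normrN !ger0_norm//; lra.
Qed.

Lemma mulN_qq v : short v -> exists2 c, c = 136 / 16 & mulN c 4 (qq v).
Proof.
move=> sv; eexists; last by do 4 apply: (mulN_hn _ sv); exact: mulN_sca.
rewrite !ger0_norm; lra.
Qed.

Lemma mulN_le c c' n T : mulN c n T -> c <= c' -> mulN c' n T.
Proof.
move=> [c0 mT] cc; split; first exact: le_trans cc.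
by apply: mult_weaken mT cc _ _; exact: lexx.
Qed.

Lemma mulN_th2 v : short v -> mulN (`|3 : R| + (`|0 : R| + `|-2 : R|)) 2 (th2 v).
Proof. by move=> sv; do 2 apply: (mulN_hn _ sv); exact: mulN_sca. Qed.

Lemma mulN_half4 v : short v -> exists2 c, c = 5 & mulN c 6 (half4 v).
Proof.
move=> sv; have mh : mulN 1 1 (half v).
  have -> : (1 : R) = `|2^-1| + `|2^-1| by rewrite ger0_norm//; lra.
  exact: mulN_hn sv (mulN_sca _).
have m2 : mulN 5 2 (th2 v).
  apply: (mulN_le (c := `|3 : R| + (`|0 : R| + `|-2 : R|))); first exact: mulN_th2.
  by rewrite normrN !ger0_norm//; lra.
exists 5 => //.
by have := mulN_comp mh (mulN_comp mh (mulN_comp mh (mulN_comp mh m2))); rewrite !mul1r.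
Qed.

Lemma mulN_mult c n T : mulN c n T -> mult a b c n%:R n%:R T.
Proof. by case. Qed.

Lemma mulN_T c n T f : mulN c n T -> Tf f -> Tf (T f).
Proof. by move=> [_ mT]; exact: (mult_Tf mT). Qed.

Lemma mulN_Avc c n T f u : mulN c n T -> Tf f -> T (Av u f) = Av u (T f).
Proof. by move=> [_ mT]; exact: (mult_Av mT). Qed.

Opaque mulN.

(** Smoothing at scale v by a kernel of mass 1, carried by nonnegative multiples
    of v, whose first moment vanishes. A kernel of this sort is not positive. *)
Definition smooth_at v f := Z4 v (th v f).

(** The average over a segment is the average over its half composed with the
    mean of the identity and of a translation. *)
Lemma Av_half_hn v f : short v -> Tf f -> Av (2 *: v) f = Av v (half v f).
Proof.
move=> sv tf; have mA := mulN_mult (mulN_Av sv).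
rewrite Av_half// /half /hn /sca scalerDr -trZ (multD mA); [|exact: TfZ|apply: Tf_tr; exact: TfZ].
by rewrite (mult_tr mA) ?(multZ _ mA)//; exact: TfZ.
Qed.

Lemma Z4_double v f : short v -> Tf f ->
  Z4 (2 *: v) f = Z4 v (half v (half v (half v (half v f)))).
Proof.
move=> sv tf; rewrite /Z4.
have mh : mulN (`|2^-1| + `|2^-1|) 1 (half v) by exact: mulN_hn sv (mulN_sca _).
have ta g : Tf g -> Tf (Av v g) by exact: Tf_Av.
have H g : Tf g -> Av (2 *: v) g = Av v (half v g) by exact: Av_half_hn.
have ch g : Tf g -> half v (Av v g) = Av v (half v g) by exact: (mulN_Avc v mh).
have h1 := mulN_T mh tf; have h2 := mulN_T mh h1; have h3 := mulN_T mh h2.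
rewrite (H _ tf) (H _ (ta _ h1)) (ch _ h1).
rewrite (H _ (ta _ (ta _ h2))) (ch _ (ta _ h2)) (ch _ h2).
by rewrite (H _ (ta _ (ta _ (ta _ h3)))) (ch _ (ta _ (ta _ h3))) (ch _ (ta _ h3)) (ch _ h3).
Qed.

Lemma smooth_at_double v f : short v -> Tf f -> smooth_at (2 *: v) f = Z4 v (half4 v f).
Proof.
move=> sv tf.
have -> : smooth_at (2 *: v) f = Z4 (2 *: v) (th2 v f).
  congr Z4; rewrite /th /th2 /hn /sca scale0r add0r tr_tr.
  by rewrite (_ : 2 *: v = v + v)// scaler_nat mulr2n.
by rewrite (Z4_double sv (mulN_T (mulN_th2 sv) tf)).
Qed.

Lemma hnE v l T f x : hn v l T f x = l * f x + T f (x - v).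
Proof.
Transparent tr.
by [].
Qed.

Lemma scaE l f x : sca l f x = l * f x.
Proof. by []. Qed.

(** The difference of two consecutive scales is a second difference. *)
Lemma th_half4 v f : th v f - half4 v f = qq v f - 2 *: tr v (qq v f) + tr v (tr v (qq v f)).
Proof.
apply/funext => x.
rewrite -[LHS]/(th v f x - half4 v f x).
rewrite -[RHS]/(qq v f x - 2 * qq v f (x - v) + qq v f (x - v - v)).
rewrite /half4 /th /half /th2 /qq !(hnE, scaE).
by field.
Qed.
Opaque tr th th2 half qq half4 hn sca.

Lemma dir2_Av2 v f : Tf f ->
  dir v (dir v (Av v (Av v f))) = f - 2 *: tr v f + tr v (tr v f).
Proof.
move=> tf; have ta := Tf_Av v tf.
rewrite dir_AvE; last exact: Tf_smooth.
rewrite dirB; [|exact: Tf_smooth|by apply: Tf_smooth; exact: Tf_tr].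
rewrite dir_tr dir_AvE; last exact: Tf_smooth.
by rewrite trB scaler_nat mulr2n !opprB opprD !addrA [in RHS]addrAC.
Qed.

Lemma smooth_at_diff v f : short v -> Tf f ->
  smooth_at v f - smooth_at (2 *: v) f = dir v (dir v (Av v (Av v (Z4 v (qq v f))))).
Proof.
move=> sv tf; rewrite smooth_at_double//.
have [c1 _ mt] := mulN_th sv; have [c2 _ m4] := mulN_half4 sv; have [c3 _ mq] := mulN_qq sv.
have mZ := mulN_Z4 sv; have mZ' := mulN_mult mZ.
have t1 := mulN_T mt tf; have t2 := mulN_T m4 tf; have t3 := mulN_T mq tf.
rewrite /smooth_at -(multB mZ' t1 t2) th_half4 (dir2_Av2 v (mulN_T mZ t3)).
have tt := Tf_tr v t3; have ttt := Tf_tr v tt; have t2t := TfZ 2 tt.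
by rewrite (multD mZ' (TfB t3 t2t) ttt) (multB mZ' t3 t2t) (multZ _ mZ' tt) !(mult_tr mZ').
Qed.

Lemma mulN_Avc2 c n T g u : mulN c n T -> Tf g -> T (Av u (Av u g)) = Av u (Av u (T g)).
Proof.
by move=> m tg; rewrite (mulN_Avc u m (Tf_Av u tg)) (mulN_Avc u m tg).
Qed.

Lemma mulN_Z4c c n T g u : mulN c n T -> Tf g -> T (Z4 u g) = Z4 u (T g).
Proof.
move=> m tg; have t1 := Tf_Av u tg; have t2 := Tf_Av u t1; have t3 := Tf_Av u t2.
rewrite /Z4 (mulN_Avc u m t3) (mulN_Avc u m t2) (mulN_Avc u m t1) (mulN_Avc u m tg).
reflexivity.
Qed.

Opaque Z4.

Lemma short_sca k : short (sc a k).
Proof.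
by left; exists (2^-1 ^+ k) => //; rewrite exprn_ge0 ?exprn_ile1// invf_le1 ?ler1n.
Qed.

Lemma short_scb k : short (sc b k).
Proof.
by right; exists (2^-1 ^+ k) => //; rewrite exprn_ge0 ?exprn_ile1// invf_le1 ?ler1n.
Qed.

(* Bounded factors of the two potentials, at each scale. *)
Definition Ca k f := Av (sc a k) (Av (sc a k) (qq (sc a k) (th (sc b k) f))).
Definition Cb k f := half4 (sc a k) (Av (sc b k) (Av (sc b k) (qq (sc b k) f))).

(** The factors Z4 have one average to spare for each derivative that will fall
    on the potential: each derivative turns an average into a difference. *)
Definition pot (C : nat -> (R * R -> R) -> (R * R -> R)) k f :=
  (2^-1 ^+ k) ^+ 2 *: Z4 (sc a k) (Z4 (sc b k) (C k f)).

Lemma mulN_Ca k : mulN 60 20 (Ca k).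
Proof.
have [c1 e1 m1] := mulN_th (short_scb k); have [c2 e2 m2] := mulN_qq (short_sca k).
have mA := mulN_Av (short_sca k).
have m := mulN_comp mA (mulN_comp mA (mulN_comp m2 m1)).
have {}m := mulN_weaken m (isT : 1 + (1 + (4 + 1)) <= 20)%N.
by apply: mulN_le m _; rewrite e1 e2; lra.
Qed.

Lemma mulN_Cb k : mulN 60 20 (Cb k).
Proof.
have [c1 e1 m1] := mulN_half4 (short_sca k); have [c2 e2 m2] := mulN_qq (short_scb k).
have mA := mulN_Av (short_scb k).
have m := mulN_comp m1 (mulN_comp mA (mulN_comp mA m2)).
have {}m := mulN_weaken m (isT : 6 + (1 + (1 + 4)) <= 20)%N.
by apply: mulN_le m _; rewrite e1 e2; lra.
Qed.

Definition smoothing k f := smooth_at (sc a k) (smooth_at (sc b k) f).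

Lemma mulN_smooth_at v : short v -> mulN 5 5 (smooth_at v).
Proof.
move=> sv; have [c e m] := mulN_th sv.
by have := mulN_comp (mulN_Z4 sv) m; rewrite e mul1r.
Qed.

Lemma dir_sc2 v k f : Tf f ->
  dir (sc v k) (dir (sc v k) f) = dir v (dir v ((2^-1 ^+ k) ^+ 2 *: f)).
Proof.
move=> tf; rewrite /sc !dir_scale !dirZ; try by apply: Tf_smooth; try exact: Tf_dir.
by rewrite scalerA expr2.
Qed.

Opaque smooth_at.

(** The product of the smoothings along a and b is telescoped one direction at
    a time. *)
Lemma smoothing_diff k f : Tf f -> smoothing k.+1 f - smoothing k f =
  dir a (dir a (pot Ca k.+1 f)) + dir b (dir b (pot Cb k.+1 f)).
Proof.
move=> tf; rewrite /smoothing -(scS a k) -(scS b k).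
set v := sc a k.+1; set w := sc b k.+1.
have sv : short v by exact: short_sca. have sw : short w by exact: short_scb.
have mv := mulN_smooth_at sv; have mw := mulN_smooth_at sw.
have tw := mulN_T mw tf.
have s2w : short (2 *: w) by rewrite /w scS; exact: short_scb.
have s2v : short (2 *: v) by rewrite /v scS; exact: short_sca.
have m2w := mulN_smooth_at s2w; have m2v := mulN_mult (mulN_smooth_at s2v).
have t2w := mulN_T m2w tf.
rewrite -[LHS](subrKA (smooth_at (2 *: v) (smooth_at w f))).
have [c1 _ mt] := mulN_th sw; have [c2 _ m4] := mulN_half4 sv.
have [c3 _ mqv] := mulN_qq sv; have [c4 _ mqw] := mulN_qq sw.
have mZv := mulN_Z4 sv; have mZw := mulN_Z4 sw.
have mAv := mulN_Av sv; have mAw := mulN_Av sw.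
have C c n T : mulN c n T -> forall g, Tf g -> T (Av v g) = Av v (T g) by move=> m g tg; exact: mulN_Avc m tg.
have D c n T : mulN c n T -> forall g, Tf g -> T (Av w g) = Av w (T g) by move=> m g tg; exact: mulN_Avc m tg.
have Zc c n T u : mulN c n T -> short u -> forall g, Tf g -> T (Z4 u g) = Z4 u (T g).
  by move=> m su g tg; exact: mulN_Z4c m tg.
have tt := mulN_T mt tf; have tqw := mulN_T mqw tf.
have tq1 := mulN_T mqv tt.
congr (_ + _).
  rewrite (smooth_at_diff sv tw).
Transparent smooth_at.
  rewrite {1}/smooth_at.
Opaque smooth_at.
  have tz1 := mulN_T mZw tq1; have ta1 := Tf_Av v tq1.
  have ta2 := Tf_Av v ta1.
  have tX : Tf (Z4 v (Z4 w (Av v (Av v (qq v (th w f)))))).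
    by apply: (mulN_T mZv); apply: (mulN_T mZw).
  have tzq := mulN_T mZv tz1.
  have -> : Av v (Av v (Z4 v (qq v (Z4 w (th w f))))) =
      Z4 v (Z4 w (Av v (Av v (qq v (th w f))))).
    have e1 : qq v (Z4 w (th w f)) = Z4 w (qq v (th w f)) by exact: (mulN_Z4c w mqv tt).
    have e2 : Z4 w (Av v (Av v (qq v (th w f)))) = Av v (Av v (Z4 w (qq v (th w f)))).
      exact: (mulN_Avc2 v mZw tq1).
    rewrite e1 e2.
    exact: esym (mulN_Avc2 v mZv tz1).
  rewrite (dir_sc2 a k.+1 tX).
  reflexivity.
rewrite -(multB m2v tw t2w) (smooth_at_diff sw tf).
have tz : Tf (Av w (Av w (Z4 w (qq w f)))) by do 2 apply: Tf_Av; exact: (mulN_T mZw).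
rewrite -(mult_dir w m2v (Tf_dir w tz)) -(mult_dir w m2v tz).
rewrite (dir_sc2 b k.+1 (mult_Tf m2v tz)).
rewrite (smooth_at_double sv tz).
have ta2 := Tf_Av w tqw; have ta3 := Tf_Av w ta2.
have -> : Av w (Av w (Z4 w (qq w f))) = Z4 w (Av w (Av w (qq w f))).
  exact: esym (mulN_Avc2 w mZw tqw).
have -> : half4 v (Z4 w (Av w (Av w (qq w f)))) = Z4 w (half4 v (Av w (Av w (qq w f)))).
  exact: (mulN_Z4c w m4 ta3).
reflexivity.
Qed.

(** The norm of H^2 of the plane, up to constants, on test functions. *)
Definition N2 f := \sum_(i : 'I_2) \sum_(j : 'I_2) nrm (partial i (partial j f)).

Transparent bp Z4 smooth_at.

Lemma bpE v f : Tf f -> bp v f = dir v (Av v (Av v f)).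
Proof. by move=> tf; rewrite dir_AvE//; apply: Tf_smooth; exact: Tf_Av. Qed.

Lemma mulN_bp c n T v f : mulN c n T -> Tf f -> T (bp v f) = bp v (T f).
Proof.
move=> m tf; have ta := Tf_Av v tf; have mT := mulN_mult m.
by rewrite /bp (multB mT ta (Tf_tr v ta)) (mult_tr mT _ ta) (mult_Av mT _ tf).
Qed.

Lemma Z4_dir2 v f : Tf f -> dir v (dir v (Z4 v f)) = bp v (bp v f).
Proof.
move=> tf; have t1 := Tf_Av v tf; have t2 := Tf_Av v t1; have t3 := Tf_Av v t2.
rewrite [in RHS](bpE _ (Tf_bp v tf)) (bpE _ tf).
rewrite -(dir_Av v v (Tf_smooth t2)) -(dir_Av v v (Tf_smooth t3)).
reflexivity.
Qed.

Lemma Z4_dir1 v f : Tf f -> dir v (Z4 v f) = bp v (Av v (Av v f)).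
Proof. by move=> tf; rewrite bpE//; do 2 apply: Tf_Av. Qed.

Opaque bp Z4.

Lemma dir_sc_ab k f : Tf f ->
  dir (sc a k) (dir (sc b k) f) = dir a (dir b ((2^-1 ^+ k) ^+ 2 *: f)).
Proof.
move=> tf; have sf := Tf_smooth tf; have sd := Smooth_dir b sf.
by rewrite /sc !dir_scale (dirZ b _ sf) (dirZ a _ sd) (dirZ a _ sd) scalerA expr2.
Qed.

Lemma mulN_dir c n T u f : mulN c n T -> Tf f -> dir u (T f) = T (dir u f).
Proof. by move=> m; exact: mult_dir (mulN_mult m). Qed.

Section Potential.
Variables (c : R) (C : nat -> (R * R -> R) -> R * R -> R).
Hypothesis mC : forall k, mulN c 20 (C k).

Lemma Tf_pot k f : Tf f -> Tf (pot C k f).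
Proof.
move=> tf; apply: TfZ; apply: (mulN_T (mulN_Z4 (short_sca k))).
by apply: (mulN_T (mulN_Z4 (short_scb k))); exact: (mulN_T (mC k)).
Qed.

Definition Caa k f := Z4 (sc b k) (C k f).
Definition Cab k f := Av (sc a k) (Av (sc a k) (Av (sc b k) (Av (sc b k) (C k f)))).
Definition Cbb k f := Z4 (sc a k) (C k f).

Lemma mulN_Caa k : mulN c 30 (Caa k).
Proof.
have m := mulN_comp (mulN_Z4 (short_scb k)) (mC k).
rewrite mul1r in m; exact: (mulN_weaken m (isT : 4 + 20 <= 30)%N).
Qed.

Lemma mulN_Cbb k : mulN c 30 (Cbb k).
Proof.
have m := mulN_comp (mulN_Z4 (short_sca k)) (mC k).
rewrite mul1r in m; exact: (mulN_weaken m (isT : 4 + 20 <= 30)%N).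
Qed.

Lemma mulN_Cab k : mulN c 30 (Cab k).
Proof.
have mA := mulN_Av (short_sca k); have mB := mulN_Av (short_scb k).
have m := mulN_comp mA (mulN_comp mA (mulN_comp mB (mulN_comp mB (mC k)))).
rewrite !mul1r in m; exact: (mulN_weaken m (isT : 1 + (1 + (1 + (1 + 20))) <= 30)%N).
Qed.

Lemma pot_aa k f : Tf f ->
  dir a (dir a (pot C k f)) = bp (sc a k) (Caa k (bp (sc a k) f)).
Proof.
move=> tf; have tC := mulN_T (mC k) tf; have tZ := mulN_T (mulN_Z4 (short_scb k)) tC.
rewrite /pot -dir_sc2; last exact: (mulN_T (mulN_Z4 (short_sca k))).
rewrite (Z4_dir2 _ tZ) (mulN_bp _ (mulN_Caa k) tf).
reflexivity.
Qed.

Lemma pot_bb k f : Tf f ->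
  dir b (dir b (pot C k f)) = bp (sc b k) (Cbb k (bp (sc b k) f)).
Proof.
move=> tf; have tC := mulN_T (mC k) tf; have mZ := mulN_Z4 (short_sca k).
have tZ := mulN_T (mulN_Z4 (short_scb k)) tC.
rewrite /pot -dir_sc2; last exact: (mulN_T mZ).
rewrite (mulN_dir _ mZ tZ) (mulN_dir _ mZ (Tf_dir _ tZ)) (Z4_dir2 _ tC).
rewrite (mulN_bp _ (mulN_Cbb k) tf) (mulN_bp _ mZ (Tf_bp _ tC)) (mulN_bp _ mZ tC).
reflexivity.
Qed.

Lemma pot_ab k f : Tf f ->
  dir a (dir b (pot C k f)) = bp (sc a k) (Cab k (bp (sc b k) f)).
Proof.
move=> tf; have tC := mulN_T (mC k) tf; have mZ := mulN_Z4 (short_sca k).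
have tZ := mulN_T (mulN_Z4 (short_scb k)) tC.
rewrite /pot -dir_sc_ab; last exact: (mulN_T mZ).
rewrite (mulN_dir _ mZ tZ) (Z4_dir1 _ (Tf_dir _ tZ)) (Z4_dir1 _ tC).
have mB := mulN_Av (short_scb k).
have m2 := mulN_comp mB (mulN_comp mB (mC k)).
have := mulN_bp (sc b k) m2 tf; rewrite /comp => <-.
reflexivity.
Qed.

Lemma dir_sum (J : Type) u (r : seq J) (F : J -> R * R -> R) :
  (forall k, Tf (F k)) -> dir u (\sum_(k <- r) F k) = \sum_(k <- r) dir u (F k).
Proof.
move=> tF; have sF k := Tf_smooth (tF k).
rewrite dirE !partial_sum// !scaler_sumr -big_split/=.
by apply: eq_bigr => k _; rewrite -dirE.
Qed.

Lemma mulN_ge0 c' n T : mulN c' n T -> 0 <= c'.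
Proof.
Transparent mulN.
by case.
Qed.
Opaque mulN.

(** Each second derivative of a potential is band-pass on both sides, so the
    bound is independent of the number of scales. *)
Lemma pot_sum_bound n f : Tf f -> let Psi := \sum_(k < n) pot C k.+1 f in
  [/\ nrm (dir a (dir a Psi)) <= 4 * c * nrm f,
      nrm (dir a (dir b Psi)) <= 4 * c * nrm f &
      nrm (dir b (dir b Psi)) <= 4 * c * nrm f].
Proof.
move=> tf Psi; have c0 := mulN_ge0 (mC 0).
have tp (k : 'I_n) : Tf (pot C k.+1 f) by exact: Tf_pot.
have H u u' : dir u (dir u' Psi) = \sum_(k < n) dir u (dir u' (pot C k.+1 f)).
  by rewrite dir_sum// dir_sum// => k; exact: Tf_dir.
rewrite !H; split.
- rewrite (eq_bigr _ (fun (k : 'I_n) _ => pot_aa k.+1 tf)).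
  exact: (bp_sum_bound a a n c0 (fun k => mulN_mult (mulN_Caa k.+1)) tf).
- rewrite (eq_bigr _ (fun (k : 'I_n) _ => pot_ab k.+1 tf)).
  exact: (bp_sum_bound a b n c0 (fun k => mulN_mult (mulN_Cab k.+1)) tf).
- rewrite (eq_bigr _ (fun (k : 'I_n) _ => pot_bb k.+1 tf)).
  exact: (bp_sum_bound b b n c0 (fun k => mulN_mult (mulN_Cbb k.+1)) tf).
Qed.

Lemma nrm_bp v f : Tf f -> nrm (bp v f) <= 2 * nrm f.
Proof.
move=> tf; have ta := Tf_Av v tf; apply: le_trans (nrmB ta (Tf_tr v ta)) _.
rewrite (nrm_tr _ ta); have := nrm_Av v tf; lra.
Qed.

Lemma mulN_nrm c' n T f : mulN c' n T -> Tf f -> nrm (T f) <= c' * nrm f.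
Proof. by move=> m tf; exact: (mult_nrm (mulN_mult m) tf). Qed.

Lemma bp_bp_bound v w c' n T f : mulN c' n T -> Tf f -> nrm (bp v (T (bp w f))) <= 4 * c' * nrm f.
Proof.
move=> m tf; have tb := Tf_bp w tf; apply: le_trans (nrm_bp v (mulN_T m tb)) _.
have := mulN_nrm m tb; have := ler_wpM2l (mulN_ge0 m) (nrm_bp w tf); lra.
Qed.

Lemma pot_bound k f : Tf f -> let Psi := pot C k f in
  [/\ nrm (dir a (dir a Psi)) <= 4 * c * nrm f,
      nrm (dir a (dir b Psi)) <= 4 * c * nrm f &
      nrm (dir b (dir b Psi)) <= 4 * c * nrm f].
Proof.
move=> tf Psi; rewrite /Psi pot_aa// pot_ab// pot_bb//; split.
- exact: bp_bp_bound (mulN_Caa k) tf.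
- exact: bp_bp_bound (mulN_Cab k) tf.
- exact: bp_bp_bound (mulN_Cbb k) tf.
Qed.

End Potential.

Hypothesis ab_indep : a.1 * b.2 - a.2 * b.1 != 0.

Transparent dir.

Lemma basis_coord i : exists al be : R, forall f, Smooth f ->
  partial i f = al *: dir a f + be *: dir b f.
Proof.
pose D := a.1 * b.2 - a.2 * b.1.
have [->|->] := ord2P i.
  exists (b.2 / D), (- a.2 / D) => f sf; apply/funext => x.
  rewrite -[RHS]/(b.2 / D * dir a f x + - a.2 / D * dir b f x) /dir.
  by move: (partial 0 f x) (partial 1 f x) => p q; rewrite /D; field.
exists (- b.1 / D), (a.1 / D) => f sf; apply/funext => x.
rewrite -[RHS]/(- b.1 / D * dir a f x + a.1 / D * dir b f x) /dir.
by move: (partial 0 f x) (partial 1 f x) => p q; rewrite /D; field.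
Qed.

Lemma dirC u v f : Smooth f -> dir u (dir v f) = dir v (dir u f).
Proof.
move=> sf; have pd w i : partial i (dir w f) = dir w (partial i f).
  have s0 := Smooth_partial 0 sf; have s1 := Smooth_partial 1 sf.
  rewrite !dirE (partialD _ (smoothZ w.1 s0) (smoothZ w.2 s1)) (partialZ _ _ s0) (partialZ _ _ s1).
  by rewrite (partialC i 0 sf) (partialC i 1 sf).
apply/funext => x; rewrite /dir -!/(dir _ _) !pd /dir (partialC 1 0 sf).
move: (partial 0 (partial 0 f) x) (partial 0 (partial 1 f) x) (partial 1 (partial 1 f) x).
by move: u.1 u.2 v.1 v.2 => ? ? ? ? ? ? ?; ring.
Qed.
Opaque dir.

End Multiscale.

(** * The smoothing error in terms of second derivatives *)

Opaque mulN Z4 th th2 half qq half4 hn sca smooth_at.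

Section Estimate.
Context {R : realType}.
Variables a b : R * R.
Implicit Types (f g h : R * R -> R) (i j : 'I_2) (x y v w u : R * R) (c r t l : R).
Implicit Types (T : (R * R -> R) -> (R * R -> R)) (K : set (R * R)).
Local Notation mulN := (mulN a b).
Local Notation short := (short a b).
Local Notation pot := (pot a b).
Local Notation Ca := (Ca a b).
Local Notation Cb := (Cb a b).
Local Notation smoothing := (smoothing a b).
Hypothesis ab_indep : a.1 * b.2 - a.2 * b.1 != 0.

Lemma sum4_le (p q p' q' M A B C : R) : 0 <= p -> 0 <= q -> 0 <= p' -> 0 <= q' ->
  A <= M -> B <= M -> C <= M ->
  p * p' * A + p * q' * B + (q * p' * B + q * q' * C) <= (p + q) * (p' + q') * M.
Proof.
move=> p0 q0 p0' q0' AM BM CM.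
rewrite (_ : _ * M = p * p' * M + p * q' * M + (q * p' * M + q * q' * M)); last by ring.
by apply: lerD; apply: lerD; apply: ler_wpM2l => //; exact: mulr_ge0.
Qed.

Lemma sum_ord2 (F : 'I_2 -> R) : \sum_(i : 'I_2) F i = F 0 + F 1.
Proof. by rewrite big_ord_recl big_ord1; congr (_ + F _); exact/val_inj. Qed.

Lemma N2E f : N2 f = nrm (partial 0 (partial 0 f)) + nrm (partial 0 (partial 1 f)) +
  (nrm (partial 1 (partial 0 f)) + nrm (partial 1 (partial 1 f))).
Proof.
rewrite /N2 sum_ord2.
exact: (congr2 (fun p q : R => p + q) (sum_ord2 _) (sum_ord2 _)).
Qed.

Lemma sum4_eq (p q M : R) : p * p * M + p * q * M + (q * p * M + q * q * M) = (p + q) * (p + q) * M.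
Proof. by ring. Qed.

Lemma N2_dir : exists2 C0 : R, 0 <= C0 & forall f (M : R), Tf f ->
  nrm (dir a (dir a f)) <= M -> nrm (dir a (dir b f)) <= M -> nrm (dir b (dir b f)) <= M ->
  N2 f <= C0 * M.
Proof.
have [al0 [be0 E0]] := basis_coord ab_indep 0; have [al1 [be1 E1]] := basis_coord ab_indep 1.
pose k0 := `|al0| + `|be0|; pose k1 := `|al1| + `|be1|.
have H al be al' be' f (M : R) (g : R * R -> R) : Tf f -> nrm (dir a (dir a f)) <= M ->
    nrm (dir a (dir b f)) <= M -> nrm (dir b (dir b f)) <= M ->
    g = al *: dir a (al' *: dir a f + be' *: dir b f) + be *: dir b (al' *: dir a f + be' *: dir b f) ->
    nrm g <= (`|al| + `|be|) * (`|al'| + `|be'|) * M.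
  move=> tf Maa Mab Mbb ->; have sf := Tf_smooth tf.
  have ta := Tf_dir a tf; have tb := Tf_dir b tf.
  have sa := Tf_smooth ta; have sb := Tf_smooth tb.
  rewrite !(dirD _ (smoothZ al' sa) (smoothZ be' sb)) !(dirZ _ _ sa) !(dirZ _ _ sb).
  rewrite (dirC b a sf) (scalerDr al) (scalerDr be) !(scalerA al) !(scalerA be).
  have t1 := Tf_dir a ta; have t2 := Tf_dir a tb; have t3 := Tf_dir b tb.
  have z1 := TfZ (al * al') t1; have z2 := TfZ (al * be') t2.
  have z3 := TfZ (be * al') t2; have z4 := TfZ (be * be') t3.
  apply: le_trans (nrmD (TfD z1 z2) (TfD z3 z4)) _.
  apply: le_trans (lerD (nrmD z1 z2) (nrmD z3 z4)) _.
  rewrite !nrmZ// !normrM.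
  by apply: sum4_le; first [exact: normr_ge0 | assumption].
exists ((k0 + k1) * (k0 + k1)).
  by rewrite mulr_ge0 ?addr_ge0.
move=> f M tf Maa Mab Mbb; have sf := Tf_smooth tf.
have P i al be j al' be' : (forall f, Smooth f -> partial i f = al *: dir a f + be *: dir b f) ->
    (forall f, Smooth f -> partial j f = al' *: dir a f + be' *: dir b f) ->
    nrm (partial i (partial j f)) <= (`|al| + `|be|) * (`|al'| + `|be'|) * M.
  move=> Ei Ej; apply: (H al be al' be' f M _ tf Maa Mab Mbb).
  rewrite -(Ej f sf) (Ei _ (Smooth_partial j sf)).
  reflexivity.
have P00 := P 0 _ _ 0 _ _ E0 E0; have P01 := P 0 _ _ 1 _ _ E0 E1.
have P10 := P 1 _ _ 0 _ _ E1 E0; have P11 := P 1 _ _ 1 _ _ E1 E1.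
rewrite N2E -sum4_eq.
exact: lerD (lerD P00 P01) (lerD P10 P11).
Qed.

Lemma zoff_sum (J : Type) K (r : seq J) (F : J -> R * R -> R) :
  (forall k, zoff K (F k)) -> zoff K (\sum_(k <- r) F k).
Proof.
move=> zF; elim: r => [|k r IH] x Kx; first by rewrite big_nil.
by rewrite big_cons -[LHS]/(F k x + (\sum_(k <- r) F k) x) zF// IH// addr0.
Qed.

Lemma mulN_zoff c n T K f : mulN c n T -> zoff K f -> zoff (msum K (cone_rect a b n%:R n%:R)) (T f).
Proof. by move=> m zf; exact: (mult_zoff (mulN_mult m) zf). Qed.

Lemma pot_zoff c C K k f : (forall k, mulN c 20 (C k)) -> zoff K f ->
  zoff (msum K (cone_rect a b 30 30)) (pot C k f).
Proof.
move=> mC zf x Kx; rewrite /pot.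
have m := mulN_comp (mulN_Z4 ((short_sca a b) k)) (mulN_comp (mulN_Z4 ((short_scb a b) k)) (mC k)).
have {}m := mulN_weaken m (isT : 4 + (4 + 20) <= 30)%N.
have E := mulN_zoff m zf Kx.
by rewrite -[LHS]/(_ * Z4 _ _ x) [X in _ * X]E mulr0.
Qed.

Lemma mulN_smoothing k : mulN 25 10 (smoothing k).
Proof.
have := mulN_comp (mulN_smooth_at ((short_sca a b) k)) (mulN_smooth_at ((short_scb a b) k)).
by rewrite -natrM.
Qed.

Lemma dir_sum2 n u (F : 'I_n -> R * R -> R) : (forall k, Tf (F k)) ->
  dir u (dir u (\sum_(k < n) F k)) = \sum_(k < n) dir u (dir u (F k)).
Proof.
move=> tF; rewrite (dir_sum u _ tF); apply: dir_sum => k; exact: Tf_dir.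
Qed.

Lemma telesc (V : zmodType) (F : nat -> V) n : F 0%N + \sum_(k < n) (F k.+1 - F k) = F n.
Proof.
elim: n => [|n IH]; first by rewrite big_ord0 addr0.
by rewrite big_ord_recr/= addrA IH addrC subrK.
Qed.

(** The difference of two smoothings is a sum of two second derivatives of
    potentials whose own second derivatives are controlled by the L2 norm of
    the function itself. *)
Lemma multiscale : exists2 C0 : R, 0 <= C0 & forall n f, Tf f -> exists psi1 psi2,
  [/\ Tf psi1, Tf psi2,
      smoothing n f = smoothing 0 f + dir a (dir a psi1) + dir b (dir b psi2),
      N2 psi1 <= C0 * nrm f /\ N2 psi2 <= C0 * nrm f &
      forall K, zoff K f -> zoff (msum K (cone_rect a b 30 30)) psi1 /\
                            zoff (msum K (cone_rect a b 30 30)) psi2].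
Proof.
have [C0 C00 H] := N2_dir; exists (C0 * (4 * 60)); first by rewrite mulr_ge0.
move=> n f tf; exists (\sum_(k < n) pot Ca k.+1 f), (\sum_(k < n) pot Cb k.+1 f).
have ta (k : 'I_n) : Tf (pot Ca k.+1 f) by exact: Tf_pot (mulN_Ca a b) _ _ tf.
have tb (k : 'I_n) : Tf (pot Cb k.+1 f) by exact: Tf_pot (mulN_Cb a b) _ _ tf.
have tsa : Tf (\sum_(k < n) pot Ca k.+1 f) by exact: Tf_sum.
have tsb : Tf (\sum_(k < n) pot Cb k.+1 f) by exact: Tf_sum.
split => //.
- rewrite (dir_sum2 a ta) (dir_sum2 b tb) -addrA -big_split.
  rewrite (eq_bigr (fun k : 'I_n => smoothing k.+1 f - smoothing k f)); last first.
    by move=> k _; exact: esym (smoothing_diff a b k tf).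
  exact: esym (telesc (smoothing^~ f) n).
- split.
    have [] := pot_sum_bound (mulN_Ca a b) n tf; rewrite -!mulrA; exact: H.
  have [] := pot_sum_bound (mulN_Cb a b) n tf; rewrite -!mulrA; exact: H.
- by move=> K zf; split; apply: zoff_sum => k; apply: pot_zoff zf; [exact: (mulN_Ca a b)|exact: (mulN_Cb a b)].
Qed.

Lemma smoothing0_bound : exists2 C0 : R, 0 <= C0 & forall f, Tf f ->
  N2 (smoothing 0 f) <= C0 * nrm f.
Proof.
have [C0 C00 H] := N2_dir; exists (C0 * (4 * 25)); first by rewrite mulr_ge0.
move=> f tf.
have [c1 e1 m1] := mulN_th ((short_sca a b) 0); have [c2 e2 m2] := mulN_th ((short_scb a b) 0).
have mC : forall k : nat, mulN 25 20 (fun f => th (sc a 0) (th (sc b 0) f)).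
  move=> _; have m := mulN_comp m1 m2; rewrite e1 e2 -natrM in m.
  exact: (mulN_weaken m (isT : 1 + 1 <= 20)%N).
have t2 := mulN_T m2 tf.
have -> : smoothing 0 f = pot (fun=> fun f => th (sc a 0) (th (sc b 0) f)) 0 f.
  rewrite /pot expr0 expr1n scale1r -(mulN_Z4c _ m1 t2).
Transparent smooth_at.
  reflexivity.
Opaque smooth_at.
have [] := pot_bound mC 0 tf; rewrite -!mulrA; apply: H.
exact: Tf_pot mC 0 _ tf.
Qed.

Lemma tr_small v f : Tf f -> exists2 C0 : R, 0 <= C0 & forall n, nrm (tr (sc v n) f - f) <= C0 * 2^-1 ^+ n.
Proof.
move=> tf; exists (nrm (dir v f)); first exact: nrm_ge0.
move=> n; have ta := Tf_Av (sc v n) tf.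
rewrite -opprB -dir_AvE ?nrmN; [|exact: Tf_dir|exact: Tf_smooth].
rewrite (dir_Av _ _ (Tf_smooth tf)) {1}/sc dir_scale.
rewrite AvZ; last by apply: smooth_continuous; apply: Tf_smooth; exact: Tf_dir.
rewrite nrmZ; last by apply: Tf_Av; exact: Tf_dir.
rewrite ger0_norm ?exprn_ge0// mulrC ler_wpM2r ?exprn_ge0//.
exact: nrm_Av (Tf_dir v tf).
Qed.

(** Convergence to the identity at dyadic rate. *)
Definition approx1 (T : nat -> (R * R -> R) -> (R * R -> R)) := forall f, Tf f ->
  exists2 C0 : R, 0 <= C0 & forall n, nrm (T n f - f) <= C0 * 2^-1 ^+ n.

Lemma approx1_comp c (r : nat) (T T' : nat -> (R * R -> R) -> R * R -> R) : approx1 T -> approx1 T' -> (forall n, mulN c r (T n)) ->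
  (forall n f, Tf f -> Tf (T' n f)) -> approx1 (fun n f => T n (T' n f)).
Proof.
move=> aT aT' mT tT' f tf; have [C1 C10 H1] := aT f tf; have [C2 C20 H2] := aT' f tf.
have c0 := mulN_ge0 (mT 0).
exists (c * C2 + C1); first by rewrite addr_ge0// mulr_ge0.
move=> n; have t' := tT' n f tf; have t1 := mulN_T (mT n) tf.
have tB := TfB t' tf.
rewrite -(subrKA (T n f)) -(multB (mulN_mult (mT n)) t' tf).
apply: le_trans (nrmD (mulN_T (mT n) tB) (TfB t1 tf)) _.
rewrite mulrDl lerD// (le_trans (mulN_nrm (mT n) tB))// -mulrA.
exact: ler_wpM2l (H2 n).
Qed.

Lemma approx1_Av v : approx1 (fun n => Av (sc v n)).
Proof.
move=> f tf; have [C0 C00 H] := Av_small v tf; exists C0 => // n.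
by apply: H; rewrite exprn_ge0 ?exprn_ile1// invf_le1 ?ler1n.
Qed.

Transparent Z4 th hn sca.

Lemma approx1_smooth_at v : (forall n, short (sc v n)) -> approx1 (fun n => smooth_at (sc v n)).
Proof.
move=> sv; have aA := @approx1_Av v.
have mA n := mulN_Av (sv n).
have tA n f : Tf f -> Tf (Av (sc v n) f) by exact: Tf_Av.
have H (T' : nat -> (R * R -> R) -> R * R -> R) : approx1 T' -> (forall n f, Tf f -> Tf (T' n f)) ->
    approx1 (fun n f => Av (sc v n) (T' n f)).
  by move=> aT tT; exact: (approx1_comp aA aT mA tT).
have a2 := H _ aA tA; have t2 n f (tf : Tf f) := tA n _ (tA n f tf).
have a3 := H _ a2 t2; have t3 n f (tf : Tf f) := tA n _ (t2 n f tf).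
have a4 : approx1 (fun n => Z4 (sc v n)) := H _ a3 t3.
apply: (@approx1_comp 1 4 (fun n => Z4 (sc v n)) (fun n => th (sc v n)) a4).
- move=> f tf; have [C0 C00 H0] := tr_small v tf.
  exists (2 * C0); first by rewrite mulr_ge0.
  move=> n; have tt := Tf_tr (sc v n) tf.
  have -> : th (sc v n) f - f = (-2) *: (tr (sc v n) f - f).
    rewrite /th /hn /sca trZ scalerBr scaleNr [RHS]addrC scaleNr opprK.
    rewrite addrAC; congr (_ + _).
    by rewrite -{2}(scale1r f) -scalerBl; congr (_ *: _); lra.
  rewrite nrmZ; last exact: TfB.
  by rewrite normrN ger0_norm// -mulrA ler_pM2l.
- by move=> n; exact: mulN_Z4.
- by move=> n f tf; have [c _ m] := mulN_th (sv n); exact: (mulN_T m).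
Qed.

Lemma approx1_smoothing : approx1 smoothing.
Proof.
apply: (@approx1_comp 5 5 (fun n => smooth_at (sc a n)) (fun n => smooth_at (sc b n))).
- exact: approx1_smooth_at (short_sca a b).
- exact: approx1_smooth_at (short_scb a b).
- by move=> n; exact: mulN_smooth_at ((short_sca a b) n).
- by move=> n f; exact: mulN_T (mulN_smooth_at ((short_scb a b) n)).
Qed.

(** The smoothings commute with derivatives, so they converge also in the norm
    N2; this lets the functional pass to the limit. *)
Lemma smoothing_N2 f : Tf f -> exists2 C0 : R, 0 <= C0 & forall n,
  N2 (smoothing n f - f) <= C0 * 2^-1 ^+ n.
Proof.
move=> tf.
have H (ij : 'I_2 * 'I_2) : exists C0 : R, 0 <= C0 /\ forall n,
    nrm (partial ij.1 (partial ij.2 (smoothing n f - f))) <= C0 * 2^-1 ^+ n.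
  have tp := Tf_partial ij.2 tf; have tpp := Tf_partial ij.1 tp.
  have [C0 C00 H] := approx1_smoothing tpp; exists C0; split => // n.
  have m := mulN_mult (mulN_smoothing n); have ts := mult_Tf m tf.
  rewrite (partialB _ (Tf_smooth ts) (Tf_smooth tf)) (mult_partial m _ tf).
  rewrite (partialB _ (Tf_smooth (mult_Tf m tp)) (Tf_smooth tp)) (mult_partial m _ tp).
  exact: H.
have [C0 HC] := choice H.
exists (\sum_(i : 'I_2) \sum_(j : 'I_2) C0 (i, j)).
  by apply: sumr_ge0 => i _; apply: sumr_ge0 => j _; case: (HC (i, j)).
move=> n; rewrite mulr_suml; apply: ler_sum => i _; rewrite mulr_suml; apply: ler_sum => j _.
by case: (HC (i, j)) => _; exact.
Qed.

End Estimate.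

(** * Squares, covers and partitions of unity *)

Section Squares.
Context {R : realType}.
Implicit Types (f g h : R * R -> R) (x z v w : R * R) (r s t e : R).
Implicit Types (K Om : set (R * R)).

Definition sq x r : set (R * R) := [set y | `|y.1 - x.1| <= r /\ `|y.2 - x.2| <= r].

Lemma sq_compact x r : compact (sq x r).
Proof.
have -> : sq x r = `[x.1 - r, x.1 + r]%classic `*` `[x.2 - r, x.2 + r]%classic.
  apply/seteqP; split => -[y1 y2] /=; rewrite !in_itv/= -!ler_distl; first by case.
  by case.
by apply: compact_setX; exact: segment_compact.
Qed.

Lemma compact_closed2 K : compact K -> closed K.
Proof. by apply: compact_closed; exact: norm_hausdorff. Qed.

Lemma sq_le x r s : r <= s -> sq x r `<=` sq x s.
Proof. by move=> rs y [h1 h2]; split; apply: le_trans rs. Qed.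

Lemma sq_center x r : 0 <= r -> sq x r x.
Proof. by move=> r0; split; rewrite subrr normr0. Qed.

Lemma sq_trans x (y : R * R) r s : sq x s y -> sq y r `<=` sq x (s + r).
Proof.
move=> [h1 h2] z [k1 k2].
have H (p q o : R) : `|q - p| <= s -> `|o - q| <= r -> `|o - p| <= s + r.
  by move=> a b; rewrite -(subrKA q) addrC (le_trans (ler_normD _ _))// lerD// addrC.
split; [exact: H h1 k1|exact: H h2 k2].
Qed.

Lemma sq_sym x (y : R * R) r : sq x r y -> sq y r x.
Proof. by move=> [h1 h2]; split; rewrite distrC. Qed.

Lemma sq_nbhs x r : 0 < r -> nbhs x (sq x r).
Proof.
move=> r0; apply/nbhs_ballP; exists r => // y /ball_pairE[h1 h2].
by split; rewrite distrC ltW.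
Qed.

Lemma nbhs_sq x K : nbhs x K -> exists2 r, 0 < r & sq x r `<=` K.
Proof.
move=> /nbhs_ballP[e /= e0 eK]; exists (e / 2); first by rewrite divr_gt0.
move=> y [h1 h2]; apply: eK; apply/ball_pairE.
by rewrite !(distrC x.1) !(distrC x.2); split; apply: le_lt_trans (_ : e / 2 < e); rewrite // ltr_pdivrMr// ltr_pMr// ltr1n.
Qed.

Lemma open_sq Om x : open Om -> Om x -> exists2 r, 0 < r & sq x r `<=` Om.
Proof. by move=> oO Ox; apply: nbhs_sq; exact: open_nbhs_nbhs. Qed.

Lemma compact_box K : compact K -> exists B, K `<=` box B.
Proof.
move=> /compact_bounded[M [Mr HM]]; exists (M + 1) => x Kx.
have := HM (M + 1) (ltr_pwDr ltr01 (lexx _)) x Kx.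
move=> /= H; split; apply: le_trans H; rewrite /Num.norm/= le_max lexx ?orbT//.
Qed.

(** The Lebesgue number of a cover, for a property of balls that passes to
    smaller radii. *)
Lemma lebesgue_number (X : pseudoMetricType R) (A : set X) (Q : X -> R -> Prop) :
  compact A -> (forall (y : X) r s, Q y s -> r <= s -> Q y r) ->
  (forall x : X, A x -> exists2 d, 0 < d & forall y : X, ball x d y -> Q y d) ->
  exists2 d, 0 < d & forall y : X, A y -> Q y d.
Proof.
move=> /compact_near_coveringP cA mQ HQ.
have := cA R (0^'+) (fun d y => Q y d) _.
have H : forall x : X, A x -> \forall x' \near x & i \near (0:R)^'+, Q x' i.
  move=> x /HQ[d d0 Hd]; exists (ball x d, [set i | i <= d]).
    split; first exact: nbhsx_ballx.
    by apply: nbhs_right_le.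
  by move=> [y i] /= [xy id]; apply: mQ id; exact: Hd.
move=> /(_ _ H) Hn.
have : \forall d \near (0:R)^'+, 0 < d /\ A `<=` Q^~ d.
  by near=> d; split; [near: d; exact: nbhs_right_gt|near: d; exact: Hn].
by move=> /filter_ex[d [d0 Hd]]; exists d.
Unshelve. all: by end_near.
Qed.

(** The difference of two translates of the step: a smooth hat at scale e. *)
Definition hat (e : R) (j : R) (t : R) : R := step (e^-1 * t - j) - step (e^-1 * t - (j + 1)).

Lemma Smooth1B (g k : R -> R) : Smooth1 g -> Smooth1 k -> Smooth1 (fun t => g t - k t).
Proof.
move=> sg sk; apply/Smooth1P.
exists (fun h : R -> R => exists g k : R -> R, [/\ Smooth1 g, Smooth1 k & h = fun t => g t - k t]).
  by exists g, k.
move=> h [g1 [k1 [sg1 sk1 ->]]].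
have [g' sg' dg] := Smooth1_derive sg1; have [k' sk' dk] := Smooth1_derive sk1.
exists (fun t => g' t - k' t); first by exists g', k'.
move=> x; have H := dD1 (dg x) (dZ1 (-1) (dk x)).
rewrite mulN1r in H.
by rewrite (_ : (fun t => _) = (fun y => g1 y + -1 * k1 y))//; apply/funext => y; rewrite mulN1r.
Qed.

Lemma Smooth1_hat e (j : R) : Smooth1 (hat e j).
Proof. by apply: Smooth1B; apply: Smooth1_affine; exact: Smooth1_step. Qed.

Lemma hat_eq0 e (j t : R) : 0 < e -> 2 * e < `|t - e * (j + 2^-1)| -> hat e j t = 0.
Proof.
move=> e0 H; rewrite /hat.
have e1 : e * e^-1 = 1 by rewrite divff// gt_eqF.
set u := e^-1 * t.
have et : t = e * u by rewrite /u mulrA e1 mul1r.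
move: H; rewrite et -mulrBr normrM (gtr0_norm e0) mulrC ltr_pM2l// => H.
move: H; rewrite lter_normr => /orP[h|h].
  rewrite !step_right ?subrr//; lra.
rewrite !step_left ?subrr//; lra.
Qed.

Lemma hat_sum e B : 0 < e -> exists n, forall t, `|t| <= B ->
  \sum_(k < n.*2) hat e (k%:R - n%:R) t = 1.
Proof.
move=> e0; pose n := Num.bound (e^-1 * B + 1).
have Hn : 0 <= B -> e^-1 * B + 1 < n%:R.
  move=> B0; apply: archi_boundP; rewrite addr_ge0// mulr_ge0// invr_ge0 ltW//.
exists n => t tB; have {}Hn := Hn (le_trans (normr_ge0 _) tB).
pose u := e^-1 * t.
have uB : `|u| <= e^-1 * B.
  by rewrite normrM gtr0_norm ?invr_gt0// ler_pM2l// invr_gt0.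
pose F (k : nat) : R := - step (u - (k%:R - n%:R)).
have T := telesc F n.*2.
have -> : \sum_(k < n.*2) hat e (k%:R - n%:R) t = \sum_(k < n.*2) (F k.+1 - F k).
  apply: eq_bigr => k _; rewrite /hat /F -/u opprK addrC; congr (- step (u - _) + _).
  by rewrite -natr1; lra.
have -> : \sum_(k < n.*2) (F k.+1 - F k) = F n.*2 - F 0%N by rewrite -T addrC addKr.
move: uB; rewrite ler_norml => /andP[h1 h2].
rewrite /F step_left ?step_right ?oppr0 ?sub0r ?opprK//; last first.
  by rewrite -addnn natrD; lra.
lra.
Qed.

(** Products of differences of translates of a smooth step form a partition of
    unity subordinate to a grid of squares. *)
Lemma grid_partition e B : 0 < e ->
  exists n (y : 'I_n * 'I_n -> R * R) (be : 'I_n * 'I_n -> R * R -> R),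
  (forall k, Smooth (be k)) /\ (forall k, zoff (sq (y k) e) (be k)) /\
  forall x, box B x -> \sum_k be k x = 1.
Proof.
move=> e0; have e20 : 0 < e / 2 by rewrite divr_gt0.
have [n Hn] := hat_sum B e20.
exists n.*2, (fun k : 'I_n.*2 * 'I_n.*2 => (e / 2 * (k.1%:R - n%:R + 2^-1), e / 2 * (k.2%:R - n%:R + 2^-1))).
exists (fun (k : 'I_n.*2 * 'I_n.*2) x => hat (e / 2) (k.1%:R - n%:R) x.1 * hat (e / 2) (k.2%:R - n%:R) x.2).
split; last split.
- move=> k.
  exact: smoothM (Smooth_fst (Smooth1_hat _ _)) (Smooth_snd (Smooth1_hat _ _)).
- move=> k x nx.
  have [h1|h1] := ltrP e `|x.1 - e / 2 * (k.1%:R - n%:R + 2^-1)|.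
    by rewrite hat_eq0 ?mul0r// mulrC divfK.
  have [h2|h2] := ltrP e `|x.2 - e / 2 * (k.2%:R - n%:R + 2^-1)|.
    by rewrite [X in _ * X]hat_eq0 ?mulr0// mulrC divfK.
  by exfalso; apply: nx; split.
move=> x [B1 B2].
rewrite -(pair_big xpredT xpredT (fun k l : 'I_n.*2 => hat (e / 2) (k%:R - n%:R) x.1 * hat (e / 2) (l%:R - n%:R) x.2))/=.
rewrite -[RHS](Hn _ B1); apply: eq_bigr => k _.
by rewrite -mulr_sumr (Hn _ B2) mulr1.
Qed.

End Squares.

(** * Functionals of order two *)

Opaque step.

Section Order2.
Context {R : realType}.
Implicit Types (f g h : R * R -> R) (i j : 'I_2) (x z v w : R * R) (r s t e B : R).
Implicit Types (K Om : set (R * R)) (u : (R * R -> R) -> R).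

(** The test functions of Om as plain functions of the plane. *)
Definition Tc Om f := Smooth f /\ exists K, [/\ compact K, K `<=` Om & zoff K f].

Lemma zoff_lin K a f g : zoff K f -> zoff K g -> zoff K (a *: f + g).
Proof. by move=> zf zg x Kx; rewrite -[LHS]/(a * f x + g x) zf// zg// mulr0 addr0. Qed.

Lemma zoffB K f g : zoff K f -> zoff K g -> zoff K (f - g).
Proof. by move=> zf zg x Kx; rewrite -[LHS]/(f x - g x) zf// zg// subr0. Qed.

Lemma zoffZ K (a : R) f : zoff K f -> zoff K (a *: f).
Proof. by move=> zf x Kx; rewrite -[LHS]/(a * f x) zf// mulr0. Qed.

Lemma zoffMl K f g : zoff K f -> zoff K (fun x => f x * g x).
Proof. by move=> zf x Kx; rewrite zf// mul0r. Qed.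

Lemma zoffMr K f g : zoff K g -> zoff K (fun x => f x * g x).
Proof. by move=> zf x Kx; rewrite [X in _ * X]zf// mulr0. Qed.

Lemma compact_Tf K f : compact K -> Smooth f -> zoff K f -> Tf f.
Proof.
move=> cK sf zf; split => //; have [B KB] := compact_box cK; exists B.
exact: zoff_sub zf.
Qed.

Lemma Tc_Tf Om f : Tc Om f -> Tf f.
Proof. by move=> [sf [K [cK _ zf]]]; exact: compact_Tf zf. Qed.

Lemma Tc_smooth Om f : Tc Om f -> Smooth f. Proof. by case. Qed.

Lemma Tc_sub Om Om' f : Om `<=` Om' -> Tc Om f -> Tc Om' f.
Proof.
move=> OO [sf [K [cK KO zf]]]; split => //; exists K; split => //.
exact: subset_trans OO.
Qed.

Lemma Tc_K Om K f : compact K -> K `<=` Om -> Smooth f -> zoff K f -> Tc Om f.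
Proof. by move=> cK KO sf zf; split => //; exists K. Qed.

Lemma Tc_lin Om (a : R) f g : Tc Om f -> Tc Om g -> Tc Om (a *: f + g).
Proof.
move=> [sf [K [cK KO zf]]] [sg [K' [cK' KO' zg]]]; split; first exact: Smooth_lin.
exists (K `|` K'); split; first exact: compactU.
  by move=> x [/KO|/KO'].
apply: zoff_lin; [apply: zoff_sub zf|apply: zoff_sub zg] => x; [by left|by right].
Qed.

Lemma Tc0 Om : Tc Om 0.
Proof.
split; first exact: Smooth0.
by exists set0; split => //; exact: compact0.
Qed.

Lemma TcD Om f g : Tc Om f -> Tc Om g -> Tc Om (f + g).
Proof. by move=> tf tg; rewrite -[f]scale1r; exact: Tc_lin. Qed.

Lemma TcZ Om (a : R) f : Tc Om f -> Tc Om (a *: f).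
Proof. by move=> tf; rewrite -[_ *: f]addr0; apply: Tc_lin => //; exact: Tc0. Qed.

Lemma TcB Om f g : Tc Om f -> Tc Om g -> Tc Om (f - g).
Proof. by move=> tf tg; rewrite -scaleN1r addrC; exact: Tc_lin. Qed.

Lemma Tc_partial Om i f : Tc Om f -> Tc Om (partial i f).
Proof.
move=> [sf [K [cK KO zf]]]; apply: (Tc_K cK KO); first exact: Smooth_partial.
by apply: zoff_partial zf; exact: compact_closed2.
Qed.

Lemma TcM Om f g : Smooth f -> Tc Om g -> Tc Om (fun x => g x * f x).
Proof.
move=> sf [sg [K [cK KO zg]]]; apply: (Tc_K cK KO); first exact: smoothM.
exact: zoffMl.
Qed.

Definition linear_on (P : (R * R -> R) -> Prop) u := forall (a : R) f g,
  P f -> P g -> u (a *: f + g) = a * u f + u g.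

Section LinearOn.
Variables (P : (R * R -> R) -> Prop) (u : (R * R -> R) -> R).
Hypotheses (P0 : P 0) (Plin : forall (a : R) f g, P f -> P g -> P (a *: f + g)).
Hypothesis lu : linear_on P u.

Lemma lin_on0 : u 0 = 0.
Proof. by have := lu (-1) P0 P0; rewrite scaler0 addr0; lra. Qed.

Lemma lin_onD f g : P f -> P g -> u (f + g) = u f + u g.
Proof. by move=> pf pg; rewrite -[f]scale1r lu// mul1r scale1r. Qed.

Lemma lin_onZ (a : R) f : P f -> u (a *: f) = a * u f.
Proof. by move=> pf; rewrite -[_ *: f]addr0 lu// lin_on0 addr0. Qed.

Lemma lin_onB f g : P f -> P g -> u (f - g) = u f - u g.
Proof. by move=> pf pg; rewrite -scaleN1r addrC lu// mulN1r addrC. Qed.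

Lemma P_sum (J : Type) (r : seq J) (F : J -> R * R -> R) :
  (forall k, P (F k)) -> P (\sum_(k <- r) F k).
Proof.
move=> tF; elim: r => [|k r IH]; first by rewrite big_nil.
by rewrite big_cons -[F k]scale1r; exact: Plin.
Qed.

Lemma lin_on_sum (J : Type) (r : seq J) (F : J -> R * R -> R) :
  (forall k, P (F k)) -> u (\sum_(k <- r) F k) = \sum_(k <- r) u (F k).
Proof.
move=> tF; elim: r => [|k r IH]; first by rewrite !big_nil lin_on0.
by rewrite !big_cons lin_onD// ?IH//; exact: P_sum.
Qed.

End LinearOn.

Lemma nrm_le2 f g : 0 <= nrm g -> ip f f <= ip g g -> nrm f <= nrm g.
Proof. by move=> _ H; rewrite ler_wsqrtr. Qed.

Lemma I_le f g : Tf f -> Tf g -> (forall x, f x <= g x) -> I f <= I g.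
Proof.
move=> tf tg H; rewrite -subr_ge0 -IB//; apply: I_ge0 => x.
by rewrite -[leRHS]/(g x - f x) subr_ge0.
Qed.

Lemma nrm_mul f (g : R * R -> R) (M : R) : Tf f -> Smooth g -> 0 <= M ->
  (forall x, f x != 0 -> `|g x| <= M) -> nrm (fun x => f x * g x) <= M * nrm f.
Proof.
move=> tf sg M0 H.
rewrite -(ger0_norm M0) -nrmZ//.
have t1 : Tf (fun x => f x * g x).
  rewrite (_ : (fun x => _) = (fun x => g x * f x)); first exact: TfM.
  by apply/funext => x; rewrite mulrC.
have t2 := TfZ M tf.
apply: nrm_le2; first exact: nrm_ge0.
apply: I_le; [exact: TfMM|exact: TfMM|move=> x].
rewrite -[leRHS]/((M * f x) * (M * f x)).
have [->|/H gM] := eqVneq (f x) 0; first by rewrite !mul0r mulr0 mul0r.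
rewrite (_ : _ * _ = g x ^+ 2 * f x ^+ 2); last by ring.
rewrite (_ : M * _ * _ = M ^+ 2 * f x ^+ 2); last by ring.
rewrite ler_wpM2r ?sqr_ge0// -[leLHS]real_normK ?num_real//.
by rewrite ler_pXn2r// nnegrE.
Qed.

Lemma dir_basis i f : dir (basis2 i) f = partial i f.
Proof.
apply/funext => x; rewrite dirE -[LHS]/((basis2 i).1 * partial 0 f x + (basis2 i).2 * partial 1 f x).
by have [->|->] := ord2P i; rewrite /basis2 /= ?mul1r ?mul0r ?addr0 ?add0r.
Qed.

Lemma disjoint_shift B i (f : R * R -> R) x : zoff (box B) f ->
  f x * tr ((2 * `|B| + 1) *: basis2 i) f x = 0.
Proof.
Transparent tr.
move=> zf; rewrite /tr.
have [bx|/zf->] := pselect (box B x); last by rewrite mul0r.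
have [by_|/zf->] := pselect (box B (x - (2 * `|B| + 1) *: basis2 i)); last by rewrite mulr0.
exfalso; have := ler_norm B; have := normr_ge0 B.
move: bx by_ => [a1 a2] [b1 b2].
rewrite !ler_norml in a1 a2 b1 b2.
have [ei|ei] := ord2P i; rewrite ei /basis2 /= in b1 b2; move: a1 a2 b1 b2.
  move=> /andP[a1 a2] _ /andP[b1 b2] _; move: a1 a2 b1 b2.
  by rewrite -[_ *: 1]/((2 * `|B| + 1) * 1) mulr1; lra.
move=> _ /andP[a1 a2] _ /andP[b1 b2]; move: a1 a2 b1 b2.
by rewrite -[_ *: 1]/((2 * `|B| + 1) * 1) mulr1; lra.
Qed.
Opaque tr.

(** A translate of f disjoint from f gives 2 |f|^2 = |f - tr v f|^2. *)
Lemma poincare f B i : Smooth f -> zoff (box B) f ->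
  nrm f <= (2 * `|B| + 1) * nrm (partial i f).
Proof.
move=> sf zf; have tf : Tf f by split => //; exists B.
pose v := (2 * `|B| + 1) *: basis2 i.
have tt := Tf_tr v tf; have tB := TfB tf tt.
apply: le_trans (_ : nrm (f - tr v f) <= _).
  apply: nrm_le2; first exact: nrm_ge0.
  rewrite (ipBl tf tt tB) (ipBr tf tt tf) (ipBr tf tt tt) (ip_tr v tf tf).
  have E : ip f (tr v f) = 0.
    rewrite -[LHS]/(I (fun x => f x * tr v f x)) (_ : (fun x => _) = 0) ?I0//.
    by apply/funext => x; exact: (disjoint_shift i x zf).
  rewrite (ipC (tr v f) f) E; have := ip_ge0 f; lra.
rewrite -(dir_AvE v sf) (dir_Av v v sf).
apply: le_trans (nrm_Av v (Tf_dir v tf)) _.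
have c0 : 0 <= 2 * `|B| + 1 by rewrite addr_ge0// mulr_ge0.
rewrite /v dir_scale dir_basis (nrmZ _ (Tf_partial i tf)) (ger0_norm c0).
exact: lexx.
Qed.

Lemma N2_ge0 f : 0 <= N2 f.
Proof. by rewrite /N2; apply: sumr_ge0 => i _; apply: sumr_ge0 => j _; exact: nrm_ge0. Qed.

Lemma le_sum2 i j (F : 'I_2 -> 'I_2 -> R) : (forall k l, 0 <= F k l) ->
  F i j <= \sum_k \sum_l F k l.
Proof.
move=> F0; rewrite (bigD1 i)//= (bigD1 j)//= -addrA lerDl addr_ge0//; apply: sumr_ge0 => k _ //.
by apply: sumr_ge0 => l _.
Qed.

Lemma nrm_N2 i j f : nrm (partial i (partial j f)) <= N2 f.
Proof.
exact: (le_sum2 _ _ (fun k l => nrm_ge0 (partial k (partial l f)))).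
Qed.

Lemma nrm1_le_N2 f B i : Smooth f -> zoff (box B) f ->
  nrm (partial i f) <= (2 * `|B| + 1) * N2 f.
Proof.
move=> sf zf; apply: le_trans (poincare 0 (Smooth_partial i sf) (zoff_partial i (@box_closed _ B) zf)) _.
by rewrite ler_wpM2l ?addr_ge0 ?mulr_ge0//; exact: nrm_N2.
Qed.

Lemma nrm_le_N2 f B : Smooth f -> zoff (box B) f ->
  nrm f <= (2 * `|B| + 1) * (2 * `|B| + 1) * N2 f.
Proof.
move=> sf zf; apply: le_trans (poincare 0 sf zf) _.
by rewrite -mulrA ler_wpM2l ?addr_ge0 ?mulr_ge0//; exact: nrm1_le_N2.
Qed.

Lemma N2D f g : Tf f -> Tf g -> N2 (f + g) <= N2 f + N2 g.
Proof.
move=> tf tg; rewrite /N2 -big_split; apply: ler_sum => i _.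
rewrite -big_split; apply: ler_sum => j _.
have tf' := Tf_partial j tf; have tg' := Tf_partial j tg.
rewrite (partialD _ (Tf_smooth tf) (Tf_smooth tg)) (partialD _ (Tf_smooth tf') (Tf_smooth tg')).
by apply: nrmD; exact: Tf_partial.
Qed.

Lemma N2Z (a : R) f : Tf f -> N2 (a *: f) = `|a| * N2 f.
Proof.
move=> tf; rewrite /N2 mulr_sumr; apply: eq_bigr => i _.
rewrite mulr_sumr; apply: eq_bigr => j _.
have tf' := Tf_partial j tf.
by rewrite (partialZ _ _ (Tf_smooth tf)) (partialZ _ _ (Tf_smooth tf')) nrmZ//; exact: Tf_partial.
Qed.

Lemma nrm_mul_box B g : Smooth g -> exists2 M : R, 0 <= M & forall k, Smooth k -> zoff (box B) k ->
  Tf (fun x => k x * g x) /\ nrm (fun x => k x * g x) <= M * nrm k.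
Proof.
move=> sg; have [M M0 HM] := bounded_box B (smooth_continuous sg).
exists M; first exact: ltW.
move=> k sk zk; split.
  by split; [exact: smoothM|exists B; exact: zoffMl].
apply: nrm_mul sg (ltW M0) _; first by split => //; exists B.
move=> x kx; apply: HM; apply: contrapT => nB; move/eqP: kx; apply; exact: zk.
Qed.

Lemma partial2M i j f g : Smooth f -> Smooth g ->
  partial i (partial j (fun x => f x * g x)) =
  ((fun x => f x * partial i (partial j g) x) + (fun x => partial i f x * partial j g x)) +
  ((fun x => partial j f x * partial i g x) + (fun x => partial i (partial j f) x * g x)).
Proof.
move=> sf sg; have sfj := Smooth_partial j sf; have sgj := Smooth_partial j sg.
rewrite (partialM j sf sg).
have -> : (fun x => f x * partial j g x + partial j f x * g x) =
          (fun x => f x * partial j g x) + (fun x => partial j f x * g x) by [].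
rewrite (partialD i (smoothM sf sgj) (smoothM sfj sg)) (partialM i sf sgj) (partialM i sfj sg).
reflexivity.
Qed.

Lemma chain_le (a b c d A B C D n0 n1 n2 E N : R) : 0 <= A -> 0 <= B -> 0 <= C -> 0 <= D ->
  a <= A * n0 -> b <= B * n1 -> c <= C * n2 -> d <= D * N ->
  n0 <= E * E * N -> n1 <= E * N -> n2 <= E * N ->
  a + b + (c + d) <= (A * (E * E) + B * E + (C * E + D)) * N.
Proof.
move=> A0 B0 C0 D0 aA bB cC dD h0 h1 h2.
rewrite !mulrDl; apply: lerD; apply: lerD => //.
- by apply: le_trans aA _; rewrite -mulrA ler_wpM2l.
- by apply: le_trans bB _; rewrite -mulrA ler_wpM2l.
- by apply: le_trans cC _; rewrite -mulrA ler_wpM2l.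
Qed.

(** The lower order terms of the product rule are absorbed by the Poincare
    inequality. *)
Lemma N2_mul B g : Smooth g -> exists2 C : R, 0 <= C & forall f, Smooth f -> zoff (box B) f ->
  N2 (fun x => f x * g x) <= C * N2 f.
Proof.
move=> sg; pose D := 2 * `|B| + 1.
have D0 : 0 <= D by rewrite /D addr_ge0// mulr_ge0.
have H (i j : 'I_2) : exists C : R, 0 <= C /\ forall f, Smooth f -> zoff (box B) f ->
    nrm (partial i (partial j (fun x => f x * g x))) <= C * N2 f.
  have [M0 M00 H0] := nrm_mul_box B sg.
  have [M1 M10 H1] := nrm_mul_box B (Smooth_partial i sg).
  have [M2 M20 H2] := nrm_mul_box B (Smooth_partial j sg).
  have [M3 M30 H3] := nrm_mul_box B (Smooth_partial i (Smooth_partial j sg)).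
  exists (M3 * (D * D) + M2 * D + (M1 * D + M0)); split.
    by apply: addr_ge0; apply: addr_ge0 => //; repeat apply: mulr_ge0.
  move=> f sf zf.
  have sfj := Smooth_partial j sf; have sfi := Smooth_partial i sf.
  have cB := @box_closed R B.
  have zi := zoff_partial i cB zf; have zj := zoff_partial j cB zf.
  rewrite (partial2M i j sf sg).
  have [t1 n1] := H3 f sf zf; have [t2 n2] := H2 _ sfi zi; have [t3 n3] := H1 _ sfj zj.
  have [t4 n4] := H0 _ (Smooth_partial i sfj) (zoff_partial i cB zj).
  apply: le_trans (nrmD (TfD t1 t2) (TfD t3 t4)) _.
  apply: le_trans (lerD (nrmD t1 t2) (nrmD t3 t4)) _.
  apply: (chain_le M30 M20 M10 M00 n1 n2 n3).
  - by apply: le_trans n4 _; rewrite ler_wpM2l// nrm_N2.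
  - exact: nrm_le_N2.
  - exact: nrm1_le_N2.
  - exact: nrm1_le_N2.
have [C00 [C000 H00]] := H 0 0; have [C01 [C010 H01]] := H 0 1.
have [C10 [C100 H10]] := H 1 0; have [C11 [C110 H11]] := H 1 1.
exists (C00 + C01 + (C10 + C11)); first by rewrite !addr_ge0.
move=> f sf zf; rewrite (N2E (fun x => f x * g x)) !mulrDl.
exact: lerD (lerD (H00 f sf zf) (H01 f sf zf)) (lerD (H10 f sf zf) (H11 f sf zf)).
Qed.

(** Distributions that are locally in H^{-2}: on test functions carried by a
    compact subset they are bounded by second derivatives. *)
Definition dist2 Om u := linear_on (Tc Om) u /\ forall K, compact K -> K `<=` Om ->
  exists2 C : R, 0 <= C & forall f, Smooth f -> zoff K f -> `|u f| <= C * N2 f.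

End Order2.

(** * Primitives on a square *)

Opaque bump.

Section Positivity.
Context {R : realType}.
Local Notation mu2 := (@lebesgue2 R).

Lemma box_measure_gt0 (B : R) : 0 < B -> 0 < fine (mu2 (box B)).
Proof.
move=> B0; apply: fine_gt0; rewrite box_measure andbT.
have -> : box B = `[- B, B]%classic `*` `[- B, B]%classic.
  apply/seteqP; split=> x; rewrite /box/= !in_itv/= -!ler_norml; first by case=> -> ->.
  by case.
rewrite /lebesgue2 product_measure1E//= !lebesgue_measure_itv/= lte_fin.
have h : - B < B by lra.
by rewrite h -EFinB -EFinM lte_fin mulr_gt0//; lra.
Qed.

Lemma I_pos (f : R * R -> R) (x0 : R * R) : Tf f -> (forall x, 0 <= f x) -> 0 < f x0 -> 0 < I f.
Proof.
move=> tf f0 fx0; rewrite -(I_tr (- x0) tf); set g := tr (- x0) f.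
have tg : Tf g by exact: Tf_tr.
have g0 x : 0 <= g x.
Transparent tr.
  exact: f0.
have gx0 : g 0 = f x0 by rewrite /g /tr sub0r opprK.
Opaque tr.
have fx2 : 0 < f x0 / 2 by rewrite divr_gt0.
have [d d0 Hd] := cont_ball 0 (smooth_continuous (Tf_smooth tg)) fx2.
have gd x : box (d / 2) x -> f x0 / 2 <= g x.
  move=> [h1 h2]; have d2 : d / 2 < d by rewrite ltr_pdivrMr// ltr_pMr// ltr1n.
  have := Hd x; rewrite /= !sub0r !normrN gx0 => /(_ (le_lt_trans h1 d2) (le_lt_trans h2 d2)).
  by rewrite ltr_norml => /andP[_]; lra.
have mB := box_measurable (d / 2).
apply: lt_le_trans (_ : \int[mu2]_(x in box (d / 2)) (f x0 / 2) <= _).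
  by rewrite Rintegral_cst// mulr_gt0 ?divr_gt0// box_measure_gt0// divr_gt0.
apply: le_trans (_ : \int[mu2]_(x in box (d / 2)) g x <= _).
  apply: le_Rintegral => //.
  - apply: (eq_integrable _ (cst (f x0 / 2)%:E)) => //.
    by apply/integrableP; split => //; rewrite integral_cst ?lte_mul_pinfty ?box_measure.
  - by apply: (integrableS measurableT) => //; exact: Tf_integrable.
rewrite Rintegral_mkcond; apply: le_Rintegral => //.
- have gi : mu2.-integrable (box (d / 2)) (EFin \o g).
    by apply: (integrableS measurableT) => //; exact: Tf_integrable.
  by rewrite -restrict_EFin; exact: ((integrable_mkcond _ mB).1 gi).
- exact: Tf_integrable.
by move=> x _; rewrite patchE; case: ifPn.
Qed.

End Positivity.

Section LocalPrimitive.
Context {R : realType}.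
Implicit Types (f g h : R * R -> R) (i j : 'I_2) (v w : R * R) (s t e B : R).
Implicit Types (K Om : set (R * R)) (u : (R * R -> R) -> R).

Definition co i x : R := if i == 0 then x.1 else x.2.

Lemma co_basis i j : co i (basis2 j : R * R) = (i == j)%:R.
Proof. by have [->|->] := ord2P i; have [->|->] := ord2P j. Qed.

Lemma coB i (x y : R * R) : co i (x - y) = co i x - co i y.
Proof. by have [->|->] := ord2P i. Qed.

Lemma coZ i (a : R) (x : R * R) : co i (a *: x) = a * co i x.
Proof. by have [->|->] := ord2P i. Qed.

Lemma sq_co (x y : R * R) s : sq x s y <-> forall i, `|co i y - co i x| <= s.
Proof.
split; first by move=> [h1 h2] i; have [->|->] := ord2P i.
by move=> H; split; [exact: (H 0)|exact: (H 1)].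
Qed.

Variables (z : R * R) (r : R).
Hypothesis r0 : 0 < r.

(* A smooth transition, in the i-th coordinate, just beyond the square of
   radius r around z. *)
Definition cut i x : R := step (2 / r * co i x + - (2 / r * (co i z + 2 * r))).
Definition dcut i x : R := 2 / r * (bump (2 / r * co i x + - (2 / r * (co i z + 2 * r))) / bump_prim 1).

Lemma cut_arg (a c : R) : 2 / r * a + - (2 / r * (c + 2 * r)) = 2 * ((a - c) / r) - 4.
Proof. by field; rewrite gt_eqF. Qed.

Lemma cut_left i x : co i x - co i z <= r -> cut i x = 0.
Proof.
move=> h; rewrite /cut step_left// cut_arg.
by have : (co i x - co i z) / r <= 1 by [rewrite ler_pdivrMr// mul1r]; lra.
Qed.

Lemma cut_right i x : 3 * r <= co i x - co i z -> cut i x = 1.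
Proof.
move=> h; rewrite /cut step_right// cut_arg.
by have : 3 <= (co i x - co i z) / r by [rewrite ler_pdivlMr]; lra.
Qed.

Lemma dcut_left i x : co i x - co i z <= r -> dcut i x = 0.
Proof.
move=> h; rewrite /dcut bump_eq0 ?mul0r ?mulr0// cut_arg ler_normr; apply/orP; right.
by have : (co i x - co i z) / r <= 1 by [rewrite ler_pdivrMr// mul1r]; lra.
Qed.

Lemma dcut_right i x : 3 * r <= co i x - co i z -> dcut i x = 0.
Proof.
move=> h; rewrite /dcut bump_eq0 ?mul0r ?mulr0// cut_arg ler_normr; apply/orP; left.
by have : 3 <= (co i x - co i z) / r by [rewrite ler_pdivlMr]; lra.
Qed.

Lemma Smooth_cut i : Smooth (cut i).
Proof.
have [->|->] := ord2P i.
  exact: (Smooth_fst (Smooth1_affine (2 / r) (- (2 / r * (co 0 z + 2 * r))) Smooth1_step)).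
exact: (Smooth_snd (Smooth1_affine (2 / r) (- (2 / r * (co 1 z + 2 * r))) Smooth1_step)).
Qed.

Lemma step_affine_derive (a c x : R) :
  is_derive x (1 : R) (fun t : R => step (a * t + c)) (a * (bump (a * x + c) / bump_prim 1)).
Proof.
have d1 : is_derive x (1 : R) (fun t : R => a * t + c) a.
  have := dD1 (dZ1 a (is_derive_id x (1 : R))) (is_derive_cst c x (1 : R)).
  by rewrite mulr1 addr0.
have d2 : is_derive (a * x + c) (1 : R) step (bump (a * x + c) / bump_prim 1).
Transparent step.
  have := dZ1 (bump_prim 1)^-1 (bump_prim_derive (a * x + c)).
  rewrite (mulrC (bump_prim 1)^-1 (bump _)).
  have -> : (fun y : R => (bump_prim 1)^-1 * bump_prim y) = step.
    by apply/funext => y; exact: mulrC.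
  by [].
exact: (dC1 (g := fun t : R => a * t + c) d1 d2).
Qed.
Opaque step.

Lemma partial_cut i : partial i (cut i) = dcut i.
Proof.
have [->|->] := ord2P i.
  exact: (partial_fst (step_affine_derive (2 / r) (- (2 / r * (co 0 z + 2 * r))))).1.
exact: (partial_snd (step_affine_derive (2 / r) (- (2 / r * (co 1 z + 2 * r))))).2.
Qed.

Lemma partial_cut_other i j : i != j -> partial j (cut i) = 0.
Proof.
have [->|->] := ord2P i; have [->|->] := ord2P j => // _.
  exact: (partial_fst (step_affine_derive (2 / r) (- (2 / r * (co 0 z + 2 * r))))).2.
exact: (partial_snd (step_affine_derive (2 / r) (- (2 / r * (co 1 z + 2 * r))))).1.
Qed.

Lemma Smooth_dcut i : Smooth (dcut i).
Proof. by rewrite -partial_cut; apply: Smooth_partial; exact: Smooth_cut. Qed.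

Lemma partial_dcut_other i j : i != j -> partial j (dcut i) = 0.
Proof.
by move=> ij; rewrite -partial_cut (partialC j i (Smooth_cut i)) partial_cut_other// partial0.
Qed.

(** With e the basis vector along axis i, Hp i f is a primitive of the difference
    of f and its translate by 4 r e, Gp i f keeps its part to the left of the
    transition, and Fp i f is what the transition contributes to the derivative
    of Gp i f. Hence f is the derivative of Gp i f plus Fp i f, and Fp i f
    vanishes when f is a derivative along axis i. *)
Definition Hp i f : R * R -> R := (4 * r) *: Av ((4 * r) *: basis2 i) f.
Definition Gp i f : R * R -> R := fun x => Hp i f x * (1 - cut i x).
Definition Fp i f : R * R -> R := fun x => Hp i f x * dcut i x.

Definition strip i : set (R * R) := [set x | `|co i x - co i z| <= r].

Lemma Smooth_ccut i : Smooth (fun x => 1 - cut i x).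
Proof.
have -> : (fun x => 1 - cut i x) = (fun y : R * R => (fun _ : R => 1 : R) y.1) - cut i by [].
exact: smoothB (Smooth_fst (Smooth1_cst 1)) (Smooth_cut i).
Qed.

Lemma Smooth_Hp i f : Smooth f -> Smooth (Hp i f).
Proof. by move=> sf; apply: smoothZ; exact: Smooth_Av. Qed.

Lemma Smooth_Gp i f : Smooth f -> Smooth (Gp i f).
Proof. by move=> sf; apply: smoothM; [exact: Smooth_Hp|exact: Smooth_ccut]. Qed.

Lemma Smooth_Fp i f : Smooth f -> Smooth (Fp i f).
Proof. by move=> sf; apply: smoothM; [exact: Smooth_Hp|exact: Smooth_dcut]. Qed.

Lemma partial_Hp i j f : Smooth f -> partial j (Hp i f) = Hp i (partial j f).
Proof.
by move=> sf; rewrite /Hp (partialZ _ _ (Smooth_Av _ sf)) (partial_Av _ _ sf).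
Qed.

Lemma partial_Hp_same i f : Smooth f -> partial i (Hp i f) = f - tr ((4 * r) *: basis2 i) f.
Proof.
move=> sf; rewrite -dir_AvE// dir_scale dir_basis /Hp (partialZ _ _ (Smooth_Av _ sf)).
reflexivity.
Qed.

Lemma tr4 i f x : tr ((4 * r) *: basis2 i) f x = f (x - (4 * r) *: basis2 i).
Proof. by []. Qed.

(* In the strip, f is untouched by the transition; its translate lies beyond. *)
Lemma strip_ccut i f x : zoff (strip i) f ->
  (f - tr ((4 * r) *: basis2 i) f) x * (1 - cut i x) = f x.
Proof.
move=> zf; rewrite -[(f - _) x]/(f x - tr _ f x) tr4.
have [h|h] := lerP (co i x - co i z) r.
  rewrite [X in _ - X]zf; first by rewrite subr0 cut_left// subr0 mulr1.
  rewrite /strip /= coB coZ co_basis eqxx mulr1 ler_norml => /andP[h1 _]; move: h1 h r0; lra.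
rewrite zf; last first.
  by rewrite /strip /= ler_norml => /andP[_]; rewrite leNgt h.
have [h3|h3] := lerP (3 * r) (co i x - co i z); first by rewrite cut_right// subrr mulr0.
rewrite zf ?subrr ?mul0r//.
rewrite /strip /= coB coZ co_basis eqxx mulr1 ler_norml => /andP[h1 _]; move: h1 h3; lra.
Qed.

Lemma strip_dcut i f x : zoff (strip i) f ->
  (f - tr ((4 * r) *: basis2 i) f) x * dcut i x = 0.
Proof.
move=> zf; rewrite -[(f - _) x]/(f x - tr _ f x) tr4.
have [h|h] := lerP (co i x - co i z) r; first by rewrite dcut_left// mulr0.
rewrite zf; last first.
  by rewrite /strip /= ler_norml => /andP[_]; rewrite leNgt h.
have [h3|h3] := lerP (3 * r) (co i x - co i z); first by rewrite dcut_right// mulr0.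
rewrite zf ?subrr ?mul0r//.
rewrite /strip /= coB coZ co_basis eqxx mulr1 ler_norml => /andP[h1 _]; move: h1 h3; lra.
Qed.

Lemma partial_ccut i j : partial j (fun x => 1 - cut i x) = - partial j (cut i).
Proof.
have -> : (fun x => 1 - cut i x) = (fun y : R * R => (fun _ : R => 1 : R) y.1) - cut i by [].
have sc : Smooth (fun y : R * R => (fun _ : R => 1 : R) y.1) by exact: (Smooth_fst (Smooth1_cst 1)).
rewrite (partialB _ sc (Smooth_cut i)).
have [p0 p1] := partial_fst (fun x : R => is_derive_cst (1 : R) x 1).
suff -> : partial j (fun y : R * R => (fun _ : R => 1 : R) y.1) = 0 by rewrite sub0r.
by have [->|->] := ord2P j.
Qed.

Lemma axis_split i f : Smooth f -> zoff (strip i) f -> f = partial i (Gp i f) + Fp i f.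
Proof.
move=> sf zf; rewrite /Gp (partialM i (Smooth_Hp i sf) (Smooth_ccut i)) partial_ccut partial_cut.
apply/funext => x; rewrite (partial_Hp_same _ sf).
rewrite -[RHS]/(Hp i f x * - dcut i x + (f - tr ((4 * r) *: basis2 i) f) x * (1 - cut i x) + Hp i f x * dcut i x).
by rewrite strip_ccut// mulrN addrAC addNr add0r.
Qed.

Lemma Gp_partial i f : Smooth f -> zoff (strip i) f -> Gp i (partial i f) = f.
Proof.
move=> sf zf; apply/funext => x; rewrite /Gp -partial_Hp// partial_Hp_same//.
exact: strip_ccut.
Qed.

Lemma Fp_partial i f : Smooth f -> zoff (strip i) f -> Fp i (partial i f) = 0.
Proof.
move=> sf zf; apply/funext => x; rewrite /Fp -partial_Hp// partial_Hp_same//.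
exact: strip_dcut.
Qed.

Lemma Gp_other i j f : i != j -> Smooth f -> Gp i (partial j f) = partial j (Gp i f).
Proof.
move=> ij sf; rewrite /Gp (partialM j (Smooth_Hp i sf) (Smooth_ccut i)) partial_ccut partial_cut_other//.
rewrite -partial_Hp//; apply/funext => x.
by rewrite -[(- 0) x]/(- (0 : R)) oppr0 mulr0 add0r.
Qed.

Lemma Fp_other i j f : i != j -> Smooth f -> Fp i (partial j f) = partial j (Fp i f).
Proof.
move=> ij sf; rewrite /Fp (partialM j (Smooth_Hp i sf) (Smooth_dcut i)) partial_dcut_other//.
rewrite -partial_Hp//; apply/funext => x.
by rewrite -[(0 : R * R -> R) x]/(0 : R) mulr0 add0r.
Qed.

Lemma Hp_lin i (a : R) f g : Smooth f -> Smooth g -> Hp i (a *: f + g) = a *: Hp i f + Hp i g.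
Proof.
move=> sf sg; have cf := smooth_continuous sf; have cg := smooth_continuous sg.
by rewrite /Hp (AvD _ (contZ (a:=a) cf) cg) (AvZ _ _ cf) scalerDr !scalerA (mulrC a).
Qed.

Lemma Gp_lin i (a : R) f g : Smooth f -> Smooth g -> Gp i (a *: f + g) = a *: Gp i f + Gp i g.
Proof.
move=> sf sg; apply/funext => x; rewrite /Gp Hp_lin//.
rewrite -[LHS]/((a * Hp i f x + Hp i g x) * (1 - cut i x)).
by rewrite -[RHS]/(a * (Hp i f x * (1 - cut i x)) + Hp i g x * (1 - cut i x)) mulrDl mulrA.
Qed.

Lemma Fp_lin i (a : R) f g : Smooth f -> Smooth g -> Fp i (a *: f + g) = a *: Fp i f + Fp i g.
Proof.
move=> sf sg; apply/funext => x; rewrite /Fp Hp_lin//.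
rewrite -[LHS]/((a * Hp i f x + Hp i g x) * dcut i x).
by rewrite -[RHS]/(a * (Hp i f x * dcut i x) + Hp i g x * dcut i x) mulrDl mulrA.
Qed.

Definition rect i (s t : R) : set (R * R) := [set x | - r <= co i x - co i z <= s /\
  forall j, j != i -> `|co j x - co j z| <= t].

Lemma Hp_zoff i t f x : zoff (rect i r t) f ->
  ~ (- r <= co i x - co i z /\ forall j, j != i -> `|co j x - co j z| <= t) -> Hp i f x = 0.
Proof.
move=> zf H; rewrite -[LHS]/(4 * r * Av _ f x) (@Av_cst_seg _ _ _ _ 0) ?mulr0// => a /andP[a0 a1].
apply: zf => -[/andP[h1 h2] h3]; apply: H; split.
  by move: h1; rewrite coB !coZ co_basis eqxx mulr1 => h1; apply: le_trans h1 _;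
    rewrite lerD2r lerBlDr lerDl mulr_ge0// mulr_ge0// ltW.
by move=> j ji; have := h3 j ji; rewrite coB !coZ co_basis (negbTE ji) !mulr0 subr0.
Qed.

Lemma Gp_zoff i t f : zoff (rect i r t) f -> zoff (rect i (3 * r) t) (Gp i f).
Proof.
move=> zf x H; rewrite /Gp.
have [h3|h3] := lerP (3 * r) (co i x - co i z); first by rewrite cut_right// subrr mulr0.
rewrite (Hp_zoff zf) ?mul0r// => -[k1 k2]; apply: H; split => //.
by rewrite k1 ltW.
Qed.

Lemma Fp_zoff i t f : zoff (rect i r t) f -> zoff (rect i (3 * r) t) (Fp i f).
Proof.
move=> zf x H; rewrite /Fp.
have [h3|h3] := lerP (3 * r) (co i x - co i z); first by rewrite dcut_right// mulr0.
rewrite (Hp_zoff zf) ?mul0r// => -[k1 k2]; apply: H; split => //.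
by rewrite k1 ltW.
Qed.

Lemma Av_scal_seg v (g h : R * R -> R) x (c : R) : continuous h ->
  (forall a : R, g (x - a *: v) = c * h (x - a *: v)) -> Av v g x = c * Av v h x.
Proof.
move=> ch E; rewrite -[RHS]/((c *: Av v h) x) -(AvZ v _ ch).
Transparent Av.
by apply: eq_Rintegral => a _; rewrite E.
Opaque Av.
Qed.

Lemma zoff_Av_box B v f : zoff (box B) f -> zoff (box (B + (`|v.1| + `|v.2|))) (Av v f).
Proof.
move=> zf x nx; apply: Av_cst_seg => a a01; apply: zf => H; apply: nx.
exact: box_shift H.
Qed.

Lemma N2_Av v f : Tf f -> N2 (Av v f) <= N2 f.
Proof.
move=> tf; rewrite /N2; apply: ler_sum => i _; apply: ler_sum => j _.
have tj := Tf_partial j tf.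
rewrite (partial_Av _ _ (Tf_smooth tf)) (partial_Av _ _ (Tf_smooth tj)).
exact: nrm_Av (Tf_partial i tj).
Qed.

Lemma Hp_mul_N2 i B (g : R * R -> R) : Smooth g -> exists2 C : R, 0 <= C & forall f, Smooth f ->
  zoff (box B) f -> N2 (fun x => Hp i f x * g x) <= C * N2 f.
Proof.
move=> sg; pose v : R * R := (4 * r) *: basis2 i.
have [C C0 HC] := N2_mul (B + (`|v.1| + `|v.2|)) sg.
exists (C * `|4 * r|); first by rewrite mulr_ge0.
move=> f sf zf; have tf : Tf f by split => //; exists B.
apply: le_trans (HC _ (Smooth_Hp i sf) _) _.
  by apply: zoffZ; exact: zoff_Av_box.
rewrite -mulrA ler_wpM2l// N2Z; last exact: Tf_Av.
apply: ler_wpM2l; first exact: normr_ge0.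
exact: (N2_Av v tf).
Qed.

Lemma zoff_rect_strip i s t f : r <= s -> s <= r -> zoff (rect i s t) f -> zoff (strip i) f.
Proof.
move=> h1 h2; apply: zoff_sub => x [/andP[k1 k2] _].
by rewrite /strip /= ler_norml k1 (le_trans k2).
Qed.

Lemma rect_sq i s t B : r <= B -> s <= B -> t <= B -> rect i s t `<=` sq z B.
Proof.
move=> rB sB tB x [/andP[k1 k2] k3]; apply/sq_co => j.
have [->|ji] := eqVneq j i.
  by rewrite ler_norml (le_trans k2)// andbT (le_trans _ k1)// lerN2.
exact: le_trans (k3 j ji) tB.
Qed.

Lemma sq_rect i s : s <= r -> sq z s `<=` rect i r s.
Proof.
move=> sr x /sq_co H; split => [|j _]; last exact: H.
by have := le_trans (H i) sr; rewrite ler_norml.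
Qed.

Definition Tk f := Smooth f /\ zoff (sq z r) f.

Lemma split_facts f : Tk f ->
  [/\ zoff (rect 0 r r) f, zoff (sq z (3 * r)) (Gp 0 f), zoff (sq z (3 * r)) (Fp 0 f),
      zoff (rect 1 r (3 * r)) (Fp 0 f) & 
      zoff (sq z (3 * r)) (Gp 1 (Fp 0 f)) /\ zoff (sq z (3 * r)) (Fp 1 (Fp 0 f))].
Proof.
move=> [sf zf]; have z0 : zoff (rect 0 r r) f by apply: zoff_sub zf; exact: sq_rect.
have r3 : r <= 3 * r by move: r0; lra.
have S i t : t <= 3 * r -> rect i (3 * r) t `<=` sq z (3 * r) by move=> t3; exact: rect_sq.
have zF := Fp_zoff z0.
have z1 : zoff (rect 1 r (3 * r)) (Fp 0 f).
  apply: zoff_sub zF => x [/andP[k1 k2] k3]; split.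
    by have := k3 1 isT; rewrite ler_norml.
  move=> j; have [->|->] := ord2P j => // _.
  by rewrite ler_norml k2 andbT (le_trans _ k1)// lerN2.
split => //.
- by apply: zoff_sub (Gp_zoff z0); exact: S.
- by apply: zoff_sub zF; exact: S.
- by split; [apply: zoff_sub (Gp_zoff z1)|apply: zoff_sub (Fp_zoff z1)]; exact: S.
Qed.

Section Existence.
Variables (Om : set (R * R)) (w : 'I_2 -> (R * R -> R) -> R).
Hypothesis dw : forall i, dist2 Om (w i).
Hypothesis curl0 : forall f, Tc Om f -> w 0 (partial 1 f) = w 1 (partial 0 f).
Hypothesis zOm : sq z (3 * r) `<=` Om.

Lemma Tc_sq f : Smooth f -> zoff (sq z (3 * r)) f -> Tc Om f.
Proof. by move=> sf zf; exact: (Tc_K (@sq_compact R z (3 * r)) zOm). Qed.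

(** The splitting f = d_0 (Gp 0 f) + d_1 (Gp 1 (Fp 0 f)) + Fp 1 (Fp 0 f) dictates
    the value of a primitive on f, once its value on the last term, a multiple of
    theta, is chosen to be 0. *)
Definition primitive f := - w 0 (Gp 0 f) - w 1 (Gp 1 (Fp 0 f)).

Lemma primitive_lin (a : R) f g : Tk f -> Tk g ->
  primitive (a *: f + g) = a * primitive f + primitive g.
Proof.
move=> tf tg; have [sf sg] := (tf.1, tg.1).
have [_ zf1 _ _ [zf2 _]] := split_facts tf; have [_ zg1 _ _ [zg2 _]] := split_facts tg.
have sFf := Smooth_Fp 0 sf; have sFg := Smooth_Fp 0 sg.
rewrite /primitive (Fp_lin 0 a sf sg) (Gp_lin 1 a sFf sFg) (Gp_lin 0 a sf sg).
rewrite (dw 0).1; [|exact: Tc_sq (Smooth_Gp 0 sf) zf1|exact: Tc_sq (Smooth_Gp 0 sg) zg1].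
rewrite (dw 1).1; [|exact: Tc_sq (Smooth_Gp 1 sFf) zf2|exact: Tc_sq (Smooth_Gp 1 sFg) zg2].
by ring.
Qed.

Lemma sq3_box : exists B, sq z (3 * r) `<=` box B.
Proof. exact: compact_box (@sq_compact R z (3 * r)). Qed.

Lemma sq_sub3 : sq z r `<=` sq z (3 * r).
Proof. by apply: sq_le; move: r0; lra. Qed.

Lemma primitive_bound : exists2 C : R, 0 <= C & forall f, Tk f -> `|primitive f| <= C * N2 f.
Proof.
have [B HB] := sq3_box; have cK := @sq_compact R z (3 * r).
have [C0 C00 H0] := (dw 0).2 _ cK zOm; have [C1 C10 H1] := (dw 1).2 _ cK zOm.
have [D0 D00 K0] := Hp_mul_N2 0 B (Smooth_ccut 0).
have [D1 D10 K1] := Hp_mul_N2 0 B (Smooth_dcut 0).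
have [D2 D20 K2] := Hp_mul_N2 1 B (Smooth_ccut 1).
exists (C0 * D0 + C1 * (D2 * D1)); first by rewrite addr_ge0// !mulr_ge0.
move=> f tf; have [_ zf1 zf3 _ [zf2 _]] := split_facts tf; have sf := tf.1.
have zB : zoff (box B) f by apply: zoff_sub tf.2; apply: subset_trans sq_sub3 HB.
have sF := Smooth_Fp 0 sf.
rewrite /primitive -opprD normrN (le_trans (ler_normD _ _))// mulrDl lerD//.
  apply: le_trans (H0 _ (Smooth_Gp 0 sf) zf1) _; rewrite -mulrA ler_wpM2l//.
  exact: K0 _ sf zB.
apply: le_trans (H1 _ (Smooth_Gp 1 sF) zf2) _; rewrite -!mulrA ler_wpM2l//.
apply: le_trans (K2 _ sF (zoff_sub HB zf3)) _; rewrite ler_wpM2l//.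
exact: K1 _ sf zB.
Qed.

Lemma primitive_partial i f : Tk f -> primitive (partial i f) = - w i f.
Proof.
move=> tf; have [z0 zf1 zf3 z1 [zf2 _]] := split_facts tf; have sf := tf.1.
have sF := Smooth_Fp 0 sf; have sG := Smooth_Gp 0 sf.
have str0 := zoff_rect_strip (lexx r) (lexx r) z0.
have str1 := zoff_rect_strip (lexx r) (lexx r) z1.
have cf : closed (sq z (3 * r)) by apply: compact_closed2; exact: sq_compact.
have [->|->] := ord2P i; rewrite /primitive.
  rewrite (Gp_partial sf str0) (Fp_partial sf str0).
  have -> : Gp 1 (0 : R * R -> R) = 0.
    have := @Gp_lin 1 (-1) 0 0 (@Smooth0 R) (@Smooth0 R).
    by rewrite scaler0 addr0 scaleN1r addNr.
  have -> : w 1 0 = 0 by exact: (lin_on0 (@Tc0 R Om) (dw 1).1).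
  by rewrite subr0.
have n01 : (0 : 'I_2) != 1 by [].
rewrite (Gp_other n01 sf) (Fp_other n01 sf) (Gp_partial sF str1).
rewrite curl0; last exact: Tc_sq.
rewrite -opprD -(lin_onD (dw 1).1).
- by rewrite -(axis_split sf str0).
- by apply: Tc_partial; exact: Tc_sq.
- exact: Tc_sq.
Qed.

End Existence.

(* The window on which the transitions in both coordinates take place. *)
Definition win : R * R := (z.1 + 2 * r, z.2 + 2 * r).

Lemma MVT_line0 (M : R * R -> R) (a b y : R) : Smooth M -> exists2 c : R, `|c| <= `|a - b| &
  M (a, y) - M (b, y) = partial 0 M (b + c, y) * (a - b).
Proof.
move=> sM; have [c cle E] := MVT0 (a - b) (fun t => partial_line0 (b, y) t sM).
by exists c => //; move: E; rewrite /= addr0 [b + (a - b)]addrC subrK.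
Qed.

Lemma MVT_line1 (M : R * R -> R) (a b y : R) : Smooth M -> exists2 c : R, `|c| <= `|a - b| &
  M (y, a) - M (y, b) = partial 1 M (y, b + c) * (a - b).
Proof.
move=> sM; have [c cle E] := MVT0 (a - b) (fun t => partial_line1 (y, b) t sM).
by exists c => //; move: E; rewrite /= addr0 [b + (a - b)]addrC subrK.
Qed.

Lemma HH_win f x : Tk f -> (forall i, `|co i x - co i win| < r) ->
  Hp 1 (Hp 0 f) x = Hp 1 (Hp 0 f) win.
Proof.
move=> tf wx; have sf := tf.1; have [z0 _ _ _ _] := split_facts tf.
pose M := Hp 1 (Hp 0 f); have sH := Smooth_Hp 0 sf; have sM : Smooth M by exact: Smooth_Hp.
have zw i : co i win = co i z + 2 * r by have [->|->] := ord2P i.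
have d0 y : `|co 0 y - co 0 win| < r -> partial 0 M y = 0.
  move=> yw; rewrite (partial_Hp _ _ sH) (partial_Hp_same _ sf).
  rewrite -[LHS]/(4 * r * Av _ _ y) (@Av_cst_seg _ _ _ _ 0) ?mulr0// => a _.
  rewrite -[LHS]/(f _ - tr _ f _) tr4.
  move: yw; rewrite zw ltr_norml => /andP[h1 h2].
  rewrite !tf.2 ?subrr// => -[+ _].
    rewrite -[X in `|X|]/(co 0 (y - a *: _ - _) - co 0 z) !coB !coZ !co_basis/= mulr0 mulr1.
    by rewrite ler_norml => /andP[k1 _]; move: k1 h2; lra.
  rewrite -[X in `|X|]/(co 0 (y - a *: _) - co 0 z) !coB !coZ !co_basis/= !mulr0.
  by rewrite ler_norml => /andP[_ k1]; move: k1 h1; lra.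
have d1 y : `|co 1 y - co 1 win| < r -> partial 1 M y = 0.
  move=> yw; rewrite (partial_Hp_same _ sH) -[LHS]/(Hp 0 f y - tr _ (Hp 0 f) y) tr4.
  move: yw; rewrite zw ltr_norml => /andP[h1 h2].
  rewrite !(Hp_zoff z0) ?subrr// => -[_ /(_ 1 isT)].
    by rewrite coB coZ co_basis/= mulr1 ler_norml => /andP[k1 _]; move: k1 h2; lra.
  by rewrite ler_norml => /andP[_ k1]; move: k1 h1; lra.
rewrite -/M.
have w0 := wx 0; have w1 := wx 1; rewrite -[X in `|X|]/(x.1 - win.1) in w0; rewrite -[X in `|X|]/(x.2 - win.2) in w1.
have e1 : M (x.1, x.2) = M (win.1, x.2).
  have [c cle E] := MVT_line0 x.1 win.1 x.2 sM.
  apply: subr0_eq; rewrite E (d0 (win.1 + c, x.2)); first exact: mul0r.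
  by rewrite -[X in `|X|]/(win.1 + c - win.1) addrAC subrr add0r (le_lt_trans cle).
have e2 : M (win.1, x.2) = M (win.1, win.2).
  have [c cle E] := MVT_line1 x.2 win.2 win.1 sM.
  apply: subr0_eq; rewrite E (d1 (win.1, win.2 + c)); first exact: mul0r.
  by rewrite -[X in `|X|]/(win.2 + c - win.2) addrAC subrr add0r (le_lt_trans cle).
have ex : x = (x.1, x.2) by exact: surjective_pairing.
apply: etrans (congr1 M ex) _; apply: etrans e1 _; exact: e2.
Qed.

Definition theta : R * R -> R := fun x => dcut 0 x * dcut 1 x.

(** On the window the double primitive of f no longer varies, so that only the
    two transition profiles remain. *)
Lemma FF_theta f : Tk f -> Fp 1 (Fp 0 f) = Hp 1 (Hp 0 f) win *: theta.
Proof.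
move=> tf; have sf := tf.1; apply/funext => x.
rewrite -[RHS]/(Hp 1 (Hp 0 f) win * (dcut 0 x * dcut 1 x)) -[LHS]/(Hp 1 (Fp 0 f) x * dcut 1 x).
have -> : Hp 1 (Fp 0 f) x = dcut 0 x * Hp 1 (Hp 0 f) x.
  rewrite -[LHS]/(4 * r * Av _ (Fp 0 f) x) -[Hp 1 (Hp 0 f) x]/(4 * r * Av _ (Hp 0 f) x) mulrCA.
  congr (_ * _); apply: Av_scal_seg; first exact: smooth_continuous (Smooth_Hp 0 sf).
  move=> a; rewrite -[LHS]/(Hp 0 f _ * dcut 0 _) mulrC; congr (_ * _).
  by rewrite /dcut coB !coZ co_basis/= !mulr0 subr0.
have [wx|nw] := pselect (forall i, `|co i x - co i win| < r).
  by rewrite (HH_win tf wx); ring.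
have H : dcut 0 x * dcut 1 x = 0.
  move/existsNP : nw => [i /negP]; rewrite -leNgt ler_normr.
  have -> : co i win = co i z + 2 * r by have [->|->] := ord2P i.
  have D : co i x - co i z <= r \/ 3 * r <= co i x - co i z -> dcut i x = 0.
    by case=> [/dcut_left|/dcut_right].
  move=> /orP h.
  have {}D : dcut i x = 0 by apply: D; case: h => h; [right|left]; move: h r0; lra.
  by move: D; have [->|->] := ord2P i => ->; rewrite ?mul0r ?mulr0.
by rewrite H mulr0 mulrAC H mul0r.
Qed.

Lemma theta_zoff : zoff (sq z (3 * r)) theta.
Proof.
move=> x nx.
have [i hi] : exists i, ~ `|co i x - co i z| <= 3 * r.
  by apply/existsNP => H; apply: nx; apply/sq_co.
have : dcut i x = 0.
  move/negP: hi; rewrite -ltNge ltr_normr => /orP[h|h].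
    by apply: dcut_right; exact: ltW.
  by apply: dcut_left; move: h r0; lra.
by rewrite /theta; have [->|->] := ord2P i => ->; rewrite ?mul0r ?mulr0.
Qed.

Lemma theta_Tf : Tf theta.
Proof.
apply: compact_Tf theta_zoff; first exact: sq_compact.
exact: smoothM (Smooth_dcut 0) (Smooth_dcut 1).
Qed.

Lemma dcut_ge0 i x : 0 <= dcut i x.
Proof. by rewrite mulr_ge0 ?divr_ge0 ?bump_ge0// ltW// bump_prim1_gt0. Qed.

Lemma dcut_win i : 0 < dcut i win.
Proof.
have -> : dcut i win = 2 / r * (bump 0 / bump_prim 1).
  rewrite /dcut; congr (_ * (bump _ / _)).
  have -> : co i win = co i z + 2 * r by have [->|->] := ord2P i.
  by rewrite subrr.
by rewrite mulr_gt0 ?divr_gt0 ?bump_prim1_gt0// bump_gt0// normr0.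
Qed.

Lemma I_theta_gt0 : 0 < I theta.
Proof.
apply: (I_pos (x0 := win)) theta_Tf _ _; first by move=> x; rewrite mulr_ge0// dcut_ge0.
by rewrite mulr_gt0// dcut_win.
Qed.

Section Uniqueness.
Variables (O : set (R * R)) (q : (R * R -> R) -> R).
Hypothesis lq : linear_on (Tc O) q.
Hypothesis dq : forall i f, Tc O f -> q (partial i f) = 0.
Hypothesis zO : sq z (3 * r) `<=` O.

Lemma split3 (V : zmodType) (p a b c d : V) : p = a + b -> b = c + d -> p = a + (c + d).
Proof. by move=> -> ->. Qed.

Lemma reduce_split (p g1 g2 t : R * R -> R) (k : R) : Tc O g1 -> Tc O g2 -> Tc O t ->
  p = partial 0 g1 + (partial 1 g2 + k *: t) -> q p = k * q t /\ I p = k * I t.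
Proof.
move=> t1 t2 tt ->.
have p1 := Tc_partial 0 t1; have p2 := Tc_partial 1 t2; have p3 := TcZ k tt.
have p23 := TcD p2 p3.
split.
  rewrite (lin_onD lq p1 p23) (lin_onD lq p2 p3) (dq 0 t1) (dq 1 t2) !add0r.
  exact: (lin_onZ (@Tc0 R O) lq).
rewrite (ID (Tc_Tf p1) (Tc_Tf p23)) (ID (Tc_Tf p2) (Tc_Tf p3)).
rewrite (I_partial 0 (Tc_Tf t1)) (I_partial 1 (Tc_Tf t2)) !add0r.
exact: IZ (Tc_Tf tt).
Qed.

Lemma q_reduce f : Tk f -> q f = Hp 1 (Hp 0 f) win * q theta /\ I f = Hp 1 (Hp 0 f) win * I theta.
Proof.
move=> tf; have sf := tf.1; have [z0 zf1 zf3 z1 [zf2 zf4]] := split_facts tf.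
have sF := Smooth_Fp 0 sf; have sG := Smooth_Gp 0 sf.
have str0 := zoff_rect_strip (lexx r) (lexx r) z0.
have str1 := zoff_rect_strip (lexx r) (lexx r) z1.
have TO g : Smooth g -> zoff (sq z (3 * r)) g -> Tc O g.
  by move=> sg zg; exact: (Tc_K (@sq_compact R z (3 * r)) zO).
have t1 := TO _ sG zf1; have t2 := TO _ (Smooth_Gp 1 sF) zf2.
have t4 := TO _ (Smooth_Fp 1 sF) zf4; have t3 := TO _ sF zf3.
have tth : Tc O theta.
  apply: TO; first exact: smoothM (Smooth_dcut 0) (Smooth_dcut 1).
  exact: theta_zoff.
have E0 := axis_split sf str0; have E1 := axis_split sF str1.
have ef : f = partial 0 (Gp 0 f) + (partial 1 (Gp 1 (Fp 0 f)) + Hp 1 (Hp 0 f) win *: theta).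
  by rewrite (FF_theta tf) in E1; exact: (split3 E0 E1).
exact: (reduce_split t1 t2 tth ef).
Qed.

(** A functional that kills all derivatives is a multiple of the integral: by
    the splitting along both axes every test function is a sum of derivatives
    and of a multiple of theta. *)
Lemma grad0_cst : exists k, forall f, Tk f -> q f = k * I f.
Proof.
exists (q theta / I theta) => f /q_reduce[-> ->].
by rewrite mulrCA divfK// gt_eqF// I_theta_gt0.
Qed.

End Uniqueness.

End LocalPrimitive.

(** * Monodromy *)

(** The function c is locally the coboundary of a function. It is summed along
    a path over N equal steps; the sum does not depend on N once the steps are
    short compared with the sets on which c is a coboundary, because the sum
    then telescopes on each step. *)
Section Monodromy.
Context {R : realType}.
Variables (Om : set (R * R)) (c : R * R -> R * R -> R).

Definition coboundary_on (V : set (R * R)) := exists k : R * R -> R,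
  forall y z, V y -> V z -> c y z = k y - k z.

Hypothesis oOm : open Om.
Hypothesis loc : forall x, Om x -> exists2 V, nbhs x V & coboundary_on V.

Lemma c_diag x : Om x -> c x x = 0.
Proof. by move=> /loc[V xV [k Hk]]; rewrite Hk ?subrr//; exact: nbhs_singleton. Qed.

Lemma fine_cover (X : pseudoMetricType R) (A : set X) (H : X -> R * R) :
  compact A -> {within A, continuous H} -> (forall p, A p -> Om (H p)) ->
  exists2 d : R, 0 < d & forall p, A p -> exists k : R * R -> R, forall q q', A q -> A q' ->
    ball p d q -> ball p d q' -> c (H q) (H q') = k (H q) - k (H q').
Proof.
move=> cA cH HO.
apply: (lebesgue_number (Q := fun p d => exists k : R * R -> R, forall q q', A q -> A q' ->
    ball p d q -> ball p d q' -> c (H q) (H q') = k (H q) - k (H q'))) => //.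
  move=> y r s [k Hk] rs; exists k => q q' Aq Aq' bq bq'.
  by apply: Hk => //; exact: le_ball bq || exact: le_ball bq'.
move=> x Ax; have [V xV [k Hk]] := loc (HO x Ax).
have := (subspace_continuousP A H).1 cH x Ax V xV.
rewrite /fmap/= /within/= => /nbhs_ballP[e /= e0 He].
exists (e / 2); first by rewrite divr_gt0.
move=> y xy; exists k => q q' Aq Aq' yq yq'; apply: Hk; apply: He => //.
  by rewrite (splitr e); exact: ball_triangle xy yq.
by rewrite (splitr e); exact: ball_triangle xy yq'.
Qed.

Definition path_sum (g : R -> R * R) (N : nat) : R :=
  \sum_(0 <= i < N) c (g (i.+1%:R / N%:R)) (g (i%:R / N%:R)).

Lemma frac01 (i N : nat) : (i <= N)%N -> `[0, 1]%classic (i%:R / N%:R : R).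
Proof.
move=> iN; rewrite /= in_itv/= divr_ge0//=.
case: N iN => [|N] iN; first by rewrite invr0 mulr0 ler01.
by rewrite ler_pdivrMr ?ltr0n// mul1r ler_nat.
Qed.

Lemma block_bound (i j N M : nat) (d : R) : (0 < N)%N -> (0 < M)%N -> (j <= M)%N -> N%:R^-1 < d ->
  ball (i%:R / N%:R : R) d ((i * M + j)%:R / (N * M)%:R).
Proof.
move=> N0 M0 jM Nd; rewrite /ball/= natrD !natrM.
have n0 : (0 : R) < N%:R by rewrite ltr0n. have m0 : (0 : R) < M%:R by rewrite ltr0n.
have -> : i%:R / N%:R - (i%:R * M%:R + j%:R) / (N%:R * M%:R) = - (j%:R / M%:R * N%:R^-1) :> R.
  by field; rewrite !gt_eqF.
rewrite normrN ger0_norm ?mulr_ge0 ?divr_ge0 ?invr_ge0//; apply: le_lt_trans Nd.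
by rewrite ler_piMl ?invr_ge0// ler_pdivrMr// mul1r ler_nat.
Qed.

Lemma path_sum_refine (g : R -> R * R) (d : R) N M : (0 < N)%N -> (0 < M)%N -> N%:R^-1 < d ->
  (forall p : R, `[0, 1]%classic p -> exists k : R * R -> R, forall q q' : R, `[0, 1]%classic q -> `[0, 1]%classic q' ->
    ball p d q -> ball p d q' -> c (g q) (g q') = k (g q) - k (g q')) ->
  path_sum g (N * M) = path_sum g N.
Proof.
move=> N0 M0 Nd Hd; rewrite /path_sum.
have nm : ((N * M)%:R : R) != 0 by rewrite pnatr_eq0 muln_eq0 negb_or -!lt0n N0.
suff H n : (n <= N)%N ->
  \sum_(0 <= i < n * M) c (g (i.+1%:R / (N * M)%:R)) (g (i%:R / (N * M)%:R)) =
  \sum_(0 <= i < n) c (g (i.+1%:R / N%:R)) (g (i%:R / N%:R)) by exact: H.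
elim: n => [|n IH] nN; first by rewrite mul0n !big_geq.
rewrite [in RHS]big_nat_recr//= -IH; last exact: ltnW.
rewrite (@big_cat_nat _ _ _ (n * M))//=; last by rewrite leq_mul2r leqnSn orbT.
congr (_ + _).
have [k Hk] := Hd _ (frac01 (ltnW nN)).
have E m : (n * M <= m <= n.+1 * M)%N -> exists2 j, (j <= M)%N & m = (n * M + j)%N.
  move=> /andP[h1 h2]; exists (m - n * M)%N; last by rewrite subnKC.
  by rewrite leq_subLR -mulSnr.
have B m : (n * M <= m <= n.+1 * M)%N ->
    ball (n%:R / N%:R : R) d (m%:R / (N * M)%:R) /\ `[0, 1]%classic (m%:R / (N * M)%:R : R).
  move=> hm; split; last first.
    apply: frac01; case/andP: hm => _ hm; apply: leq_trans hm _.
    by rewrite leq_mul2r nN orbT.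
  by have [j jM ->] := E m hm; exact: block_bound.
have -> : \sum_(n * M <= i < n.+1 * M) c (g (i.+1%:R / (N * M)%:R)) (g (i%:R / (N * M)%:R)) =
  \sum_(n * M <= i < n.+1 * M) (k (g (i.+1%:R / (N * M)%:R)) - k (g (i%:R / (N * M)%:R))).
  apply: eq_big_nat => i /andP[h1 h2].
  have [b1 a1] := B i (introT andP (conj h1 (ltnW h2))).
  have [b2 a2] := B i.+1 (introT andP (conj (leqW h1) h2)).
  exact: Hk.
rewrite (telescope_sumr (fun i : nat => k (g (i%:R / (N * M)%:R)))); last by rewrite leq_mul2r leqnSn orbT.
have e m : ((m * M)%:R / (N * M)%:R : R) = m%:R / N%:R.
  by rewrite !natrM -mulf_div divff ?mulr1// pnatr_eq0 -lt0n.
rewrite !e Hk//; [exact: frac01|exact: frac01 (ltnW nN)| |apply: ballxx].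
- have := @block_bound n 1 N 1 d N0 isT isT Nd.
  by rewrite !muln1 addn1.
- by apply: lt_trans Nd; rewrite invr_gt0 ltr0n.
Qed.

Lemma inv_small (d : R) : 0 < d -> exists N0, (0 < N0)%N /\ forall N, (N0 <= N)%N -> N%:R^-1 < d.
Proof.
move=> d0; exists (Num.bound d^-1).+1; split => // N HN.
have h : d^-1 < N%:R.
  apply: lt_le_trans (archi_boundP _) _; first by rewrite invr_ge0 ltW.
  by rewrite ler_nat (leq_trans _ HN).
by rewrite invf_plt ?posrE//; apply: lt_trans h; rewrite invr_gt0.
Qed.

Lemma path_value (g : R -> R * R) : {within `[0, 1], continuous g} -> g @` `[0, 1] `<=` Om ->
  exists v N0, forall N, (N0 <= N)%N -> path_sum g N = v.
Proof.
move=> cg gO.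
have [d d0 Hd] := fine_cover (@segment_compact R 0 1) cg (fun p hp => gO _ (ex_intro2 _ _ p hp erefl)).
have [N0 [N00 HN0]] := inv_small d0.
exists (path_sum g N0), N0 => N hN; have N1 : (0 < N)%N by exact: leq_trans hN.
rewrite -(path_sum_refine N1 N00 (HN0 N hN) Hd) mulnC.
exact: path_sum_refine N00 N1 (HN0 _ (leqnn _)) Hd.
Qed.

(** Between two neighbouring rows of a fine grid in the square of the homotopy,
    the difference of the sums telescopes, and the sides do not contribute
    because the homotopy is constant there. *)
Lemma homotopy_sum (H : R * R -> R * R) (x0 : R * R) :
  {within `[0, 1] `*` `[0, 1], continuous H} -> H @` (`[0, 1] `*` `[0, 1]) `<=` Om ->
  (forall t, `[0, 1]%classic t -> H (t, 0) = x0 /\ H (t, 1) = x0) ->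
  exists N0, forall N, (N0 <= N)%N -> path_sum (fun t => H (0, t)) N = path_sum (fun t => H (1, t)) N.
Proof.
move=> cH HO Hx.
have [d d0 Hd] := fine_cover (compact_setX (@segment_compact R 0 1) (@segment_compact R 0 1)) cH
  (fun p hp => HO _ (ex_intro2 _ _ p hp erefl)).
have [N0 [N00 HN0]] := inv_small d0.
exists N0 => N hN; have N1 : (0 < N)%N by exact: leq_trans hN.
have n0 : (0 : R) < N%:R by rewrite ltr0n.
have nd := HN0 N hN.
suff S j : (j <= N)%N -> path_sum (fun t => H (j%:R / N%:R, t)) N = path_sum (fun t => H (0, t)) N.
  by have := S N (leqnn N); rewrite divff ?gt_eqF//.
elim: j => [|j IH] jN; first by rewrite mul0r.
rewrite -IH; last exact: ltnW.
apply/eqP; rewrite -subr_eq0 /path_sum -sumrB; apply/eqP.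
pose D (i : nat) := c (H (j.+1%:R / N%:R, i%:R / N%:R)) (H (j%:R / N%:R, i%:R / N%:R)).
have bb (m : nat) : ball (m%:R / N%:R : R) d (m%:R / N%:R) /\ ball (m%:R / N%:R : R) d (m.+1%:R / N%:R).
  split; first exact: ballxx.
  by have := @block_bound m 1 N 1 d N1 isT isT nd; rewrite !muln1 addn1.
rewrite (eq_big_nat _ _ (F2 := fun i => D i.+1 - D i)); last first.
  move=> i /andP[_ iN].
  have [k Hk] := Hd (j%:R / N%:R, i%:R / N%:R) (conj (frac01 (ltnW jN)) (frac01 (ltnW iN))).
  have P a b : (a = j \/ a = j.+1) -> (b = i \/ b = i.+1) ->
     (`[0, 1] `*` `[0, 1])%classic (a%:R / N%:R : R, b%:R / N%:R : R) /\
     ball ((j%:R / N%:R, i%:R / N%:R) : R * R) d (a%:R / N%:R, b%:R / N%:R).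
    move=> ha hb; split.
      by split; apply: frac01; [case: ha => -> //; exact: ltnW|case: hb => -> //; exact: ltnW].
    by split; [case: ha => ->; [exact: (bb j).1|exact: (bb j).2]|case: hb => ->; [exact: (bb i).1|exact: (bb i).2]].
  have [p1 q1] := P j i (or_introl erefl) (or_introl erefl).
  have [p2 q2] := P j.+1 i (or_intror erefl) (or_introl erefl).
  have [p3 q3] := P j i.+1 (or_introl erefl) (or_intror erefl).
  have [p4 q4] := P j.+1 i.+1 (or_intror erefl) (or_intror erefl).
  rewrite /D (Hk _ _ p4 p2 q4 q2) (Hk _ _ p3 p1 q3 q1) (Hk _ _ p4 p3 q4 q3) (Hk _ _ p2 p1 q2 q1).
  by ring.
rewrite telescope_sumr// /D mul0r divff ?gt_eqF//.
have [e1 e2] := Hx _ (frac01 jN); have [e3 e4] := Hx _ (frac01 (ltnW jN)).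
by rewrite e1 e2 e3 e4 subrr.
Qed.

Hypothesis sc : simply_connected Om.

Lemma loop_sum (g : R -> R * R) : {within `[0, 1], continuous g} -> g @` `[0, 1] `<=` Om ->
  g 0 = g 1 -> exists N0, forall N, (N0 <= N)%N -> path_sum g N = 0.
Proof.
move=> cg gO g01; have [H [cH HO H1 H2]] := sc.2 g cg gO g01.
have m0 : (0 : R) \in `[0, 1] by rewrite in_itv/= lexx ler01.
have [N0 HN0] := homotopy_sum cH HO (fun t ht => H2 t ht).
exists N0.+1 => N hN; have N1 : (0 < N)%N by exact: leq_trans hN.
have Og : Om (g 0) by apply: gO; exists 0.
transitivity (path_sum (fun t => H (0, t)) N).
  rewrite /path_sum; apply: eq_big_nat => i /andP[_ iN].
  by rewrite !(H1 _ (frac01 _)).1// ltnW.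
rewrite HN0 ?(ltnW hN)// /path_sum big_nat big1// => i /andP[_ iN].
by rewrite !(H1 _ (frac01 _)).2 ?c_diag// ltnW.
Qed.

(** The retraction of the line to the unit interval, so that three paths can be
    concatenated by one continuous formula. *)
Definition clamp (t : R) : R := (`|t| - `|t - 1| + 1) / 2.

Lemma clamp_id t : 0 <= t <= 1 -> clamp t = t.
Proof.
by move=> /andP[t0 t1]; rewrite /clamp ger0_norm// ler0_norm; lra.
Qed.

Lemma clamp_le t : t <= 0 -> clamp t = 0.
Proof. by move=> t0; rewrite /clamp !ler0_norm; lra. Qed.

Lemma clamp_ge t : 1 <= t -> clamp t = 1.
Proof. by move=> t0; rewrite /clamp !ger0_norm; lra. Qed.

Lemma clamp01 t : `[0, 1]%classic (clamp t).
Proof.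
rewrite /= in_itv/=; have [t0|t0] := lerP t 0; first by rewrite clamp_le// lexx ler01.
have [t1|t1] := lerP 1 t; first by rewrite clamp_ge// lexx ler01.
by rewrite clamp_id ?ltW.
Qed.

Lemma clamp_lip (s t : R) : `|clamp s - clamp t| <= `|s - t|.
Proof.
have H1 := ler_dist_dist s t; have H2 := ler_dist_dist (s - 1) (t - 1).
have e : s - 1 - (t - 1) = s - t by ring.
rewrite e in H2.
rewrite (_ : clamp s - clamp t = (`|s| - `|t|) / 2 - (`|s - 1| - `|t - 1|) / 2); last first.
  by rewrite /clamp; field.
rewrite (le_trans (ler_normB _ _))// !normrM (ger0_norm (_ : 0 <= 2^-1))// ?invr_ge0//.
by move: H1 H2; lra.
Qed.

Lemma cont_clamp (g : R -> R * R) (a b : R) : {within `[0, 1], continuous g} ->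
  continuous (fun t => g (clamp (a * t + b))).
Proof.
move=> cg t V /= hV.
have := (subspace_continuousP (`[0, 1]%classic : set R) g).1 cg _ (clamp01 (a * t + b)) V hV.
rewrite /fmap/= /within/= => /nbhs_ballP[e /= e0 He].
have ct : continuous (fun t : R => a * t + b).
  move=> s; apply: cvgD; last exact: cvg_cst.
  by apply: cvgMr; exact: cvg_id.
have := ct t (ball (a * t + b) e) (nbhsx_ballx _ _ e0).
rewrite /fmap/= => Hn; apply: (@filterS _ (nbhs t) _ _ _ _ Hn) => s hs /=.
apply: He; last exact: clamp01.
by apply: le_lt_trans (clamp_lip _ _) _.
Qed.

Section Loop.
Variables (gy gz : R -> R * R) (x y z : R * R) (r : R).
Hypotheses (cy : {within `[0, 1], continuous gy}) (cz : {within `[0, 1], continuous gz}).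
Hypotheses (gy1 : gy 1 = y) (gz1 : gz 1 = z) (g0 : gy 0 = gz 0).
Hypotheses (Oy : gy @` `[0, 1] `<=` Om) (Oz : gz @` `[0, 1] `<=` Om).
Hypotheses (xy : sq x r y) (xz : sq x r z) (xO : sq x r `<=` Om).

(* From the base point to y along gy, straight to z, and back along gz. *)
Definition loop (t : R) : R * R :=
  gy (clamp (3 * t + 0)) + clamp (3 * t + (-1)) *: (z - y) + gz (clamp ((-3) * t + 3)) - z.

Lemma loop1 t : 0 <= t -> 3 * t <= 1 -> loop t = gy (3 * t).
Proof.
move=> t0 t1; rewrite /loop clamp_id; last by rewrite addr0 mulr_ge0.
rewrite clamp_le; last by lra.
by rewrite (@clamp_ge (_ + 3)) ?gz1 ?scale0r ?addr0 ?addrK//; lra.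
Qed.

Lemma loop2 t : 1 <= 3 * t -> 3 * t <= 2 -> loop t = y + (3 * t - 1) *: (z - y).
Proof.
move=> t0 t1; rewrite /loop clamp_ge ?gy1; last by lra.
rewrite clamp_id; last by apply/andP; split; lra.
by rewrite clamp_ge ?gz1 ?addrK//; lra.
Qed.

Lemma loop3 t : 2 <= 3 * t -> t <= 1 -> loop t = gz (3 - 3 * t).
Proof.
move=> t0 t1; rewrite /loop clamp_ge ?gy1; last by lra.
rewrite clamp_ge; last by lra.
rewrite clamp_id; last by apply/andP; split; lra.
rewrite scale1r [y + (z - y)]addrC subrK addrAC subrr add0r; congr gz; ring.
Qed.

Lemma loop_ends : loop 0 = loop 1.
Proof.
have e0 : 3 * 0 = 0 :> R by rewrite mulr0.
have e1 : 3 * 1 = 3 :> R by rewrite mulr1.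
have h1 : 3 * 0 <= 1 :> R by rewrite e0 ler01.
have h2 : 2 <= 3 * 1 :> R by rewrite e1; lra.
by rewrite (loop1 (lexx 0) h1) (loop3 h2 (lexx 1)) e0 e1 subrr.
Qed.

Lemma cont_loop : continuous loop.
Proof.
have cs : continuous (fun s : R => s *: (z - y)) by move=> s; exact: scalel_continuous.
have H1 := @cont_clamp _ 3 0 cy.
have H2 := @cont_clamp _ 3 (-1) (continuous_subspaceT cs).
have H3 := @cont_clamp _ (-3) 3 cz.
by move=> t; exact: (cvgB (cvgD (cvgD (H1 t) (H2 t)) (H3 t)) (cvg_cst z)).
Qed.

Lemma seg_sq (a : R) : 0 <= a <= 1 -> sq x r (y + a *: (z - y)).
Proof.
move=> /andP[a0 a1]; have H (p q o : R) : `|p - o| <= r -> `|q - o| <= r -> `|p + a * (q - p) - o| <= r.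
  move=> h1 h2; rewrite (_ : _ - o = (1 - a) * (p - o) + a * (q - o)); last by ring.
  rewrite (le_trans (ler_normD _ _))// !normrM (ger0_norm a0) ger0_norm ?subr_ge0//.
  have -> : r = (1 - a) * r + a * r by ring.
  by apply: lerD; apply: ler_wpM2l => //; rewrite subr_ge0.
by split; [exact: H xy.1 xz.1|exact: H xy.2 xz.2].
Qed.

Lemma loop_Om : loop @` `[0, 1] `<=` Om.
Proof.
move=> _ [t /= + <-]; rewrite in_itv/= => /andP[t0 t1].
have [h1|h1] := lerP (3 * t) 1.
  by rewrite loop1//; apply: Oy; exists (3 * t) => //; rewrite /= in_itv/= h1 mulr_ge0.
have [h2|h2] := lerP (3 * t) 2.
  rewrite loop2; [|exact: ltW|exact: h2].
  by apply: xO; apply: seg_sq; apply/andP; split; lra.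
rewrite loop3; [|exact: ltW|exact: t1]; apply: Oz; exists (3 - 3 * t) => //.
by rewrite /= in_itv/=; apply/andP; split; lra.
Qed.

Lemma loop_sum_split (k : R * R -> R) (N : nat) d : (0 < N)%N ->
  (forall p q, sq x r p -> sq x r q -> c p q = k p - k q) -> N%:R^-1 < d ->
  (forall p : R, `[0, 1]%classic p -> exists k : R * R -> R, forall q q' : R, `[0, 1]%classic q -> `[0, 1]%classic q' ->
    ball p d q -> ball p d q' -> c (gz q) (gz q') = k (gz q) - k (gz q')) ->
  path_sum loop (3 * N) = path_sum gy N + (k z - k y) - path_sum gz N.
Proof.
move=> N0 Hk Nd Hd; rewrite /path_sum.
have n0 : (0 : R) < N%:R by rewrite ltr0n.
have nn : (N%:R : R) != 0 by rewrite gt_eqF.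
have e3 (i : nat) : 3 * (i%:R / (3 * N)%:R) = i%:R / N%:R :> R.
  by rewrite natrM; field; rewrite nn.
have cat (F : nat -> R) : \sum_(0 <= i < 3 * N) F i =
    \sum_(0 <= i < N) F i + \sum_(N <= i < 2 * N) F i + \sum_(2 * N <= i < 3 * N) F i.
  by rewrite -!big_cat_nat// ?leq_pmull// leq_mul2r orbT.
rewrite cat; congr (_ + _ + _).
- apply: eq_big_nat => i /andP[_ iN].
  have H (j : nat) : (j <= N)%N -> loop (j%:R / (3 * N)%:R) = gy (j%:R / N%:R).
    by move=> jN; rewrite loop1 ?divr_ge0// e3// ler_pdivrMr// mul1r ler_nat.
  by rewrite !H// ltnW.
- have H (j : nat) : (N <= j <= 2 * N)%N -> loop (j%:R / (3 * N)%:R) = y + (j%:R / N%:R - 1) *: (z - y).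
    move=> /andP[h1 h2]; rewrite loop2 e3//.
      by rewrite ler_pdivlMr// mul1r ler_nat.
    by rewrite ler_pdivrMr// -natrM ler_nat.
  have S (j : nat) : (N <= j <= 2 * N)%N -> sq x r (y + (j%:R / N%:R - 1) *: (z - y)).
    move=> /andP[h1 h2]; apply: seg_sq; rewrite subr_ge0 lerBlDr ler_pdivlMr// mul1r ler_nat h1/=.
    by rewrite ler_pdivrMr// (_ : 1 + 1 = 2%:R :> R)// -natrM ler_nat.
  rewrite (eq_big_nat _ _ (F2 := fun i => k (y + (i.+1%:R / N%:R - 1) *: (z - y)) - k (y + (i%:R / N%:R - 1) *: (z - y)))).
    rewrite (telescope_sumr (fun i : nat => k (y + (i%:R / N%:R - 1) *: (z - y)))); last by rewrite leq_pmull.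
    rewrite divff// subrr scale0r addr0 natrM mulfK//.
    by rewrite (_ : 2 - 1 = 1 :> R) ?scale1r; [rewrite [y + (z - y)]addrC subrK|ring].
  move=> i /andP[h1 h2]; have a1 : (N <= i <= 2 * N)%N by rewrite h1 ltnW.
  have a2 : (N <= i.+1 <= 2 * N)%N by rewrite h2 leqW.
  by rewrite !H// Hk//; exact: S.
- have H (j : nat) : (j <= N)%N -> loop ((2 * N + j)%:R / (3 * N)%:R) = gz ((N - j)%:R / N%:R).
    move=> jN; rewrite loop3 ?e3.
    + by congr gz; rewrite natrB// natrD natrM; field.
    + by rewrite ler_pdivlMr// -natrM ler_nat leq_addr.
    + rewrite ler_pdivrMr ?ltr0n ?muln_gt0// mul1r ler_nat.
      by rewrite (mulnDl 2 1 N) mul1n leq_add2l.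
  rewrite -{1}(addn0 (2 * N)%N) (_ : (3 * N = N + 2 * N)%N); last by rewrite (mulnDl 1 2 N) mul1n.
  rewrite addn0 -{1}(add0n (2 * N)%N) big_addn addnK.
  rewrite big_nat_rev/= -sumrN; apply: eq_big_nat => i /andP[_ iN].
  rewrite add0n.
  have -> : (N - i.+1 + 2 * N)%N.+1 = (2 * N + (N - i))%N by rewrite -addSn subnSK// addnC.
  have -> : (N - i.+1 + 2 * N)%N = (2 * N + (N - i.+1))%N by rewrite addnC.
  rewrite !H ?leq_subr// !subKn ?(ltnW iN)//.
  have [k' Hk'] := Hd _ (frac01 (ltnW iN)).
  have b1 : ball (i%:R / N%:R : R) d (i%:R / N%:R) by apply: ballxx; apply: lt_trans Nd; rewrite invr_gt0.
  have b2 : ball (i%:R / N%:R : R) d (i.+1%:R / N%:R).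
    by have := @block_bound i 1 N 1 d N0 isT isT Nd; rewrite !muln1 addn1.
  rewrite !Hk' ?opprB//; first [exact: frac01|exact: (frac01 (ltnW iN))].
Qed.

End Loop.

(** On a simply connected set, the value at x of the global potential is the sum
    of c along any path from a base point to x. For nearby y and z the path to y,
    the segment from y to z and the path back from z form a loop, whose sum is
    zero. *)
Lemma monodromy : exists b : R * R -> R, forall x, Om x -> exists2 V, nbhs x V &
  forall y z, V y -> V z -> c y z = b y - b z.
Proof.
have [[x0 Ox0]|O0] := pselect (Om !=set0); last first.
  by exists (fun=> 0) => x Ox; exfalso; apply: O0; exists x.
pose Q x (b : R * (R -> R * R)) := [/\ {within `[0, 1], continuous b.2},
    b.2 @` `[0, 1] `<=` Om, b.2 0 = x0, b.2 1 = x &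
    exists N0, forall N, (N0 <= N)%N -> path_sum b.2 N = b.1].
have P x : exists b, Om x -> Q x b.
  have [Ox|nO] := pselect (Om x); last by exists (0, fun=> 0).
  have [g [cg gO g0 g1]] := sc.1 x0 x Ox0 Ox.
  by have [v Hv] := path_value cg gO; exists (v, g).
have [B HB] := choice P.
exists (fun x => (B x).1) => x Ox.
have [V xV [k Hk]] := loc Ox.
have [r r0 rV] := nbhs_sq (filterI xV (open_nbhs_nbhs (conj oOm Ox))).
exists (sq x r); first exact: sq_nbhs.
have rO : sq x r `<=` Om by move=> p /rV[].
move=> y z xy xz.
have [cy Oy y0 y1 [Ny HNy]] := HB y (rO _ xy); have [cz Oz z0 z1 [Nz HNz]] := HB z (rO _ xz).
have g0 : (B y).2 0 = (B z).2 0 by rewrite y0 z0.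
have lO := @loop_Om _ _ x y z r y1 z1 Oy Oz xy xz rO.
have cl := @cont_loop _ _ y z cy cz.
have l01 : loop (B y).2 (B z).2 y z 0 = loop (B y).2 (B z).2 y z 1.
  exact: (@loop_ends _ _ y z y1 z1 g0).
have [Nl HNl] := loop_sum (continuous_subspaceT cl) lO l01.
have [d d0 Hd] := fine_cover (@segment_compact R 0 1) cz (fun p hp => Oz _ (ex_intro2 _ _ p hp erefl)).
have [N0 [N00 HN0]] := inv_small d0.
pose N := maxn (maxn N0 Ny) (maxn Nz Nl).
have h0 : (N0 <= N)%N by rewrite /N !leq_max leqnn.
have N1 : (0 < N)%N by exact: leq_trans h0.
have hk p q : sq x r p -> sq x r q -> c p q = k p - k q.
  by move=> /rV[vp _] /rV[vq _]; exact: Hk.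
have := @loop_sum_split _ _ x y z r y1 z1 xy xz k N d N1 hk (HN0 _ h0) Hd.
rewrite HNl; last by apply: leq_trans (_ : N <= _)%N; [rewrite /N !leq_max leqnn !orbT|rewrite leq_pmull].
rewrite HNy ?HNz; last 2 first.
- by rewrite /N !leq_max leqnn !orbT.
- by rewrite /N !leq_max leqnn !orbT.
rewrite hk//; lra.
Qed.

End Monodromy.

(** * Normalization of the local primitives *)

Opaque theta primitive I.

Section ConvexUniqueness.
Context {R : realType}.
Implicit Types (f g h : R * R -> R) (x y v : R * R) (r s : R).

Definition osq x r : set (R * R) := [set y | `|y.1 - x.1| < r /\ `|y.2 - x.2| < r].

Lemma osq_nbhs x r : 0 < r -> nbhs x (osq x r).
Proof.
move=> r0; apply/nbhs_ballP; exists r => // y /ball_pairE[h1 h2].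
by split; rewrite distrC.
Qed.

Lemma osq_open x r : open (osq x r).
Proof.
move=> y [h1 h2]; apply/nbhs_ballP.
exists (Num.min (r - `|y.1 - x.1|) (r - `|y.2 - x.2|)); first by rewrite /= lt_min !subr_gt0 h1.
move=> p /ball_pairE; rewrite !lt_min => -[/andP[a1 _] /andP[_ a2]].
have H (a b c : R) : `|b - a| < r - `|b - c| -> `|a - c| < r.
  move=> h; rewrite (_ : a - c = (b - c) - (b - a)); last by ring.
  by apply: le_lt_trans (ler_normB _ _) _; move: h; lra.
by split; [exact: H a1|exact: H a2].
Qed.

Lemma osq_sub_sq x r : osq x r `<=` sq x r.
Proof. by move=> y [h1 h2]; split; exact: ltW. Qed.

Lemma sq_osq x y r s : 0 <= s -> sq y s `<=` osq x r ->
  `|y.1 - x.1| + s < r /\ `|y.2 - x.2| + s < r.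
Proof.
move=> s0 H.
have C (a : R * R) : `|a.1| <= s -> `|a.2| <= s -> osq x r (y + a).
  by move=> a1 a2; apply: H; split; rewrite /= addrAC subrr add0r.
have ps : `|s| <= s by rewrite ger0_norm.
have ns : `|- s| <= s by rewrite normrN.
have [p1 p2] := C (s, s) ps ps; have [n1 n2] := C (- s, - s) ns ns.
rewrite /= in p1 p2 n1 n2.
have A (a c : R) : `|a + s - c| < r -> `|a - s - c| < r -> `|a - c| + s < r.
  rewrite !ltr_norml => /andP[u1 u2] /andP[v1 v2].
  by have [h|h] := lerP 0 (a - c); [rewrite ger0_norm//|rewrite ltr0_norm//]; lra.
by split; [exact: A p1 n1|exact: A p2 n2].
Qed.

(** The open squares leave room around the compact squares that they contain, so
    that a sliding square stays at a positive distance from their boundary. *)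
Lemma osq_slide x r y v s : 0 <= s -> sq y s `<=` osq x r -> sq (y + v) s `<=` osq x r ->
  exists2 t, sq x t `<=` osq x r & forall f, zoff (sq y s) f -> zoff (sq x t) (Av v f).
Proof.
move=> s0 H H'; have [h1 h2] := sq_osq s0 H; have [k1 k2] := sq_osq s0 H'.
rewrite /= in k1 k2.
pose M := Num.max (Num.max `|y.1 - x.1| `|y.2 - x.2|) (Num.max `|y.1 + v.1 - x.1| `|y.2 + v.2 - x.2|).
have Mr : M + s < r by rewrite -ltrBrDr /M !gt_max !ltrBrDr h1 h2 k1 k2.
exists (M + s); first by move=> p [p1 p2]; split; apply: le_lt_trans Mr.
move=> f zf p np; apply: Av_cst_seg => a /andP[a0 a1]; apply: zf => -[q1 q2]; apply: np.
have C (yi vi xi pi : R) : `|yi - xi| <= M -> `|yi + vi - xi| <= M -> `|pi - a * vi - yi| <= s ->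
    `|pi - xi| <= M + s.
  move=> e1 e2 e3.
  rewrite (_ : pi - xi = (1 - a) * (yi - xi) + a * (yi + vi - xi) + (pi - a * vi - yi)); last by ring.
  apply: le_trans (ler_normD _ _) _; apply: lerD e3.
  apply: le_trans (ler_normD _ _) _; rewrite !normrM (ger0_norm a0) ger0_norm ?subr_ge0//.
  have -> : M = (1 - a) * M + a * M by ring.
  by apply: lerD; apply: ler_wpM2l => //; rewrite subr_ge0.
split; [apply: (C y.1 v.1) q1|apply: (C y.2 v.2) q2]; by rewrite /M !le_max lexx ?orbT.
Qed.

Section Overlap.
Variables (x x' : R * R) (r r' : R) (q : (R * R -> R) -> R).
Let O := osq x r `&` osq x' r'.
Hypothesis lq : linear_on (Tc O) q.
Hypothesis dq : forall i f, Tc O f -> q (partial i f) = 0.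

Lemma Tc_overlap t t' f : sq x t `<=` osq x r -> sq x' t' `<=` osq x' r' -> Smooth f ->
  zoff (sq x t) f -> zoff (sq x' t') f -> Tc O f.
Proof.
move=> h h' sf z z'; split => //; exists (sq x t `&` sq x' t'); split.
- by apply: compact_closedI; [exact: sq_compact|apply: compact_closed2; exact: sq_compact].
- by move=> p [/h ? /h' ?].
- by move=> p /not_andP[/z|/z'].
Qed.

Lemma q_dir v f : Tc O f -> q (dir v f) = 0.
Proof.
move=> tf; have t0 := Tc_partial 0 tf; have t1 := Tc_partial 1 tf.
rewrite dirE lq; [|exact: t0|exact: TcZ].
by rewrite (lin_onZ (@Tc0 R O) lq _ t1) (dq 0 tf) (dq 1 tf) !mulr0 addr0.
Qed.

(** Translating a test function inside a convex set changes it by a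
    derivative along the translation. *)
Lemma q_slide y v s f : 0 <= s -> sq y s `<=` O -> sq (y + v) s `<=` O -> Smooth f ->
  zoff (sq y s) f -> q (tr v f) = q f.
Proof.
move=> s0 H H' sf zf.
have [t ht zt] := osq_slide s0 (subset_trans H (@subIsetl _ _ _)) (subset_trans H' (@subIsetl _ _ _)).
have [t' ht' zt'] := osq_slide s0 (subset_trans H (@subIsetr _ _ _)) (subset_trans H' (@subIsetr _ _ _)).
have tA : Tc O (Av v f) by exact: (Tc_overlap ht ht' (Smooth_Av v sf) (zt f zf) (zt' f zf)).
have tf : Tc O f by exact: (Tc_K (@sq_compact R y s) H).
have := q_dir v tA; rewrite dir_AvE//.
have ttr : Tc O (tr v f).
  apply: (Tc_K (@sq_compact R (y + v) s) H'); first exact: Smooth_tr.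
Transparent tr.
  move=> p np; apply: zf => -[h1 h2]; apply: np.
  by split; rewrite /= opprD addrA -[X in `|X|]addrAC.
Opaque tr.
by rewrite (lin_onB lq tf ttr) => /eqP; rewrite subr_eq0 => /eqP.
Qed.

Lemma small_bump y s : 0 < s -> exists f, [/\ Smooth f, zoff (sq y s) f & 0 < I f].
Proof.
move=> s0; have s3 : 0 < s / 3 by rewrite divr_gt0.
exists (theta y (s / 3)); split; first exact: Tf_smooth (theta_Tf y s3).
  by move=> p np; apply: (theta_zoff s3); rewrite mulrC divfK.
exact: I_theta_gt0.
Qed.

(** The intersection O of two open squares is convex, and every small bump can be
    slid to any place in it; so the local multiples of the integral agree. *)
Lemma overlap_cst : exists k, forall y s, 0 < s -> sq y (3 * s) `<=` O ->
  forall f, Smooth f -> zoff (sq y s) f -> q f = k * I f.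
Proof.
have [[y0 [s0 [s00 H0]]]|no] := pselect (exists y s, 0 < s /\ sq y (3 * s) `<=` O); last first.
  by exists 0 => y s ss H; exfalso; apply: no; exists y, s.
have [k Hk] := grad0_cst s00 lq dq H0; exists k => y s ss H f sf zf.
have [k' Hk'] := grad0_cst ss lq dq H.
rewrite (Hk' f (conj sf zf)); congr (_ * _).
pose t := Num.min s s0; have t0 : 0 < t by rewrite lt_min ss.
have [g [sg zg Ig]] := small_bump y t0.
have ts : t <= s by rewrite ge_min lexx. have ts0 : t <= s0 by rewrite ge_min lexx orbT.
have e : y + (y0 - y) = y0 by rewrite addrC subrK.
have t3 : t <= 3 * s by move: ts ss; lra.
have H0t : sq (y + (y0 - y)) t `<=` O.
  by rewrite e; apply: subset_trans H0; apply: sq_le; move: ts0 s00; lra.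
have E := q_slide (ltW t0) (subset_trans (sq_le t3) H) H0t sg zg.
have zg1 : zoff (sq y s) g by apply: zoff_sub zg; exact: sq_le.
have tg : Tf g by apply: compact_Tf zg; first exact: sq_compact.
have zg2 : zoff (sq y0 s0) (tr (y0 - y) g).
Transparent tr.
  move=> p np; apply: zg => -[h1 h2]; apply: np; apply: (sq_le ts0).
  split; [move: h1|move: h2]; rewrite /= opprB => h; apply: le_trans h; rewrite le_eqVlt;
    apply/orP; left; apply/eqP; congr (`|_|); ring.
Opaque tr.
rewrite (Hk' g (conj sg zg1)) (Hk _ (conj (Smooth_tr _ sg) zg2)) (I_tr _ tg) in E.
have Ig0 : I g != 0 by rewrite gt_eqF.
exact: esym (mulIf Ig0 E).
Qed.

End Overlap.

End ConvexUniqueness.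

Section GlobalPrimitive.
Context {R : realType}.
Implicit Types (f g h : R * R -> R) (x y v : R * R) (s t e : R).
Variables (Om : set (R * R)) (w : 'I_2 -> (R * R -> R) -> R).
Hypothesis dw : forall i, dist2 Om (w i).
Hypothesis curl0 : forall f, Tc Om f -> w 0 (partial 1 f) = w 1 (partial 0 f).
Hypothesis oOm : open Om.
Hypothesis sc : simply_connected Om.

Lemma I_lin (a : R) f g : Tf f -> Tf g -> I (a *: f + g) = a * I f + I g.
Proof. by move=> tf tg; rewrite (ID (TfZ a tf) tg) (IZ a tf). Qed.

Lemma radius_ex : exists rad : R * R -> R, forall x, Om x -> 0 < rad x /\ sq x (3 * rad x) `<=` Om.
Proof.
have P x : exists r : R, Om x -> 0 < r /\ sq x (3 * r) `<=` Om.
  have [Ox|nO] := pselect (Om x); last by exists 0.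
  have [r r0 H] := open_sq oOm Ox; exists (r / 3) => _.
  by rewrite divr_gt0// mulrC divfK.
by have [ra Hra] := choice P; exists ra.
Qed.

Definition rad := projT1 (cid radius_ex).
Lemma rad_gt0 x : Om x -> 0 < rad x.
Proof. by move=> Ox; have [] := projT2 (cid radius_ex) x Ox. Qed.
Lemma rad_sub3 x : Om x -> sq x (3 * rad x) `<=` Om.
Proof. by move=> Ox; have [] := projT2 (cid radius_ex) x Ox. Qed.
Lemma rad_sub x : Om x -> sq x (rad x) `<=` Om.
Proof.
move=> Ox; apply: subset_trans (rad_sub3 Ox); apply: sq_le.
by have := rad_gt0 Ox; lra.
Qed.

Definition pl x := primitive x (rad x) w.
Definition U x := osq x (rad x).

Lemma Tc_U x f : Tc (U x) f -> Tk x (rad x) f.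
Proof.
move=> [sf [K [_ KU zf]]]; split => //; apply: zoff_sub zf.
by apply: subset_trans KU _; exact: osq_sub_sq.
Qed.

Lemma pl_lin x : Om x -> linear_on (Tk x (rad x)) (pl x).
Proof. by move=> Ox a f g; exact: (primitive_lin (rad_gt0 Ox) dw (rad_sub3 Ox)). Qed.

Lemma pl_partial x i f : Om x -> Tk x (rad x) f -> pl x (partial i f) = - w i f.
Proof. by move=> Ox; exact: (primitive_partial (rad_gt0 Ox) dw curl0 (rad_sub3 Ox)). Qed.

Lemma diff_lin x y (k : R) : Om x -> Om y -> linear_on (Tc (U y `&` U x)) (fun f => pl y f - pl x f + k * I f).
Proof.
move=> Ox Oy a f g tf tg.
have fx := Tc_U (Tc_sub (@subIsetr _ _ _) tf); have gx := Tc_U (Tc_sub (@subIsetr _ _ _) tg).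
have fy := Tc_U (Tc_sub (@subIsetl _ _ _) tf); have gy := Tc_U (Tc_sub (@subIsetl _ _ _) tg).
rewrite (pl_lin Ox _ fx gx) (pl_lin Oy _ fy gy).
have -> : I (a *: f + g) = a * I f + I g by exact: I_lin (Tc_Tf tf) (Tc_Tf tg).
move: (pl y f) (pl y g) (pl x f) (pl x g) (I f) (I g) => *; ring.
Qed.

Lemma diff_partial x y (k : R) : Om x -> Om y -> forall i f, Tc (U y `&` U x) f ->
  pl y (partial i f) - pl x (partial i f) + k * I (partial i f) = 0.
Proof.
move=> Ox Oy i f tf.
have fx := Tc_U (Tc_sub (@subIsetr _ _ _) tf); have fy := Tc_U (Tc_sub (@subIsetl _ _ _) tf).
by rewrite (pl_partial i Ox fx) (pl_partial i Oy fy) subrr add0r (I_partial i (Tc_Tf tf)) mulr0.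
Qed.

(* The difference of two local primitives is a constant on the overlap. *)
Lemma pl_overlap x y : Om x -> Om y -> exists k, forall z s, 0 < s ->
  sq z (3 * s) `<=` U y `&` U x -> forall f, Smooth f -> zoff (sq z s) f ->
  pl y f - pl x f = k * I f.
Proof.
move=> Ox Oy; have [k Hk] := overlap_cst (diff_lin 0 Ox Oy) (diff_partial 0 Ox Oy).
exists k => z s s0 H f sf zf; rewrite -(Hk z s s0 H f sf zf) mul0r addr0.
reflexivity.
Qed.

(** The constant by which the primitives around y and x differ, in units of the
    integral. *)
Definition jump x y : R := xget 0 [set k | forall z s, 0 < s ->
  sq z (3 * s) `<=` U y `&` U x -> forall f, Smooth f -> zoff (sq z s) f ->
  pl y f - pl x f = k * I f].

Lemma jumpP x y : Om x -> Om y -> forall z s, 0 < s ->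
  sq z (3 * s) `<=` U y `&` U x -> forall f, Smooth f -> zoff (sq z s) f ->
  pl y f - pl x f = jump x y * I f.
Proof. by move=> Ox Oy; have := xgetPex 0 (pl_overlap Ox Oy). Qed.

Lemma U_open x : open (U x). Proof. exact: osq_open. Qed.

Lemma U_self x : Om x -> U x x.
Proof. by move=> /rad_gt0 r0; split; rewrite subrr normr0. Qed.

Lemma small_in (O : set (R * R)) y : open O -> O y -> exists2 s, 0 < s & sq y (3 * s) `<=` O.
Proof.
move=> oO Oy; have [s s0 H] := open_sq oO Oy; exists (s / 3); first by rewrite divr_gt0.
by rewrite mulrC divfK.
Qed.

(** Three local primitives near y are compared: the jumps from x and x' differ
    by the jump between x and x', which does not involve y. *)
Lemma jump_cocycle x x' y z : Om x -> Om x' -> Om y -> Om z -> U x y -> U x' y -> U x z -> U x' z ->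
  jump x y - jump x z = jump x' y - jump x' z.
Proof.
move=> Ox Ox' Oy Oz xy x'y xz x'z.
have H p : Om p -> U x p -> U x' p -> jump x p - jump x' p = jump x x'.
  move=> Op xp x'p.
  have oO : open (U p `&` (U x `&` U x')) := openI (@U_open p) (openI (@U_open x) (@U_open x')).
  have [s s0 sO] := small_in oO (conj (U_self Op) (conj xp x'p)).
  have [f [sf zf If]] := small_bump p s0.
  have e1 := jumpP Ox Op s0 (subset_trans sO (fun q m => conj m.1 m.2.1)) sf zf.
  have e2 := jumpP Ox' Op s0 (subset_trans sO (fun q m => conj m.1 m.2.2)) sf zf.
  have e3 := jumpP Ox Ox' s0 (subset_trans sO (fun q m => conj m.2.2 m.2.1)) sf zf.
  have If0 : I f != 0 by rewrite gt_eqF.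
  apply: (mulIf If0); rewrite mulrBl -e1 -e2 -e3; ring.
by have := H y Oy xy x'y; have := H z Oz xz x'z; lra.
Qed.

(** By the cocycle property every center x of comparison gives the same value. *)
Definition coc y z : R := xget 0 [set k | exists x, [/\ Om x, U x y, U x z & k = jump x y - jump x z]].

Lemma cocE x y z : Om x -> Om y -> Om z -> U x y -> U x z -> coc y z = jump x y - jump x z.
Proof.
move=> Ox Oy Oz xy xz.
have : exists k, [set k | exists x, [/\ Om x, U x y, U x z & k = jump x y - jump x z]] k.
  by exists (jump x y - jump x z), x.
move=> /(xgetPex 0)[x' [Ox' x'y x'z]]; rewrite -/(coc y z) => ->.
exact: jump_cocycle.
Qed.

(** Subtracting suitable constants makes the local primitives agree. *)
Lemma normalized : exists (rho kap : R * R -> R), forall x, Om x ->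
  [/\ 0 < rho x, rho x <= rad x & forall x', Om x' -> forall z s, 0 < s ->
     sq z (3 * s) `<=` osq x (rho x) `&` osq x' (rho x') -> forall f, Smooth f -> zoff (sq z s) f ->
     pl x f + kap x * I f = pl x' f + kap x' * I f].
Proof.
have loc x : Om x -> exists2 V, nbhs x V & coboundary_on coc V.
  move=> Ox; exists (U x); first by apply: osq_nbhs; exact: rad_gt0.
  exists (jump x) => y z xy xz; apply: cocE => //; apply: (rad_sub Ox); exact: osq_sub_sq.
have [b Hb] := monodromy oOm loc sc.
have R0 x : exists r, Om x -> [/\ 0 < r, r <= rad x & forall y z, osq x r y -> osq x r z -> coc y z = b y - b z].
  have [Ox|nO] := pselect (Om x); last by exists 0.
  have [V xV HV] := Hb x Ox; have [r r0 rV] := nbhs_sq xV.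
  exists (Num.min r (rad x)) => _; split; first by rewrite lt_min r0 rad_gt0.
    by rewrite ge_min lexx orbT.
  have S y : osq x (Num.min r (rad x)) y -> V y.
    by move=> [+ +]; rewrite !lt_min => /andP[h _] /andP[h' _]; apply: rV; split; exact: ltW.
  by move=> y z /S Vy /S Vz; exact: HV.
have [rho Hrho] := choice R0.
exists rho, (fun x => jump x x - b x) => x Ox; have [r0 rr Hc] := Hrho x Ox; split => //.
move=> x' Ox' z s s0 H f sf zf.
have [r0' rr' Hc'] := Hrho x' Ox'.
have [zx zx'] := H z (@sq_center R z (3 * s) (mulr_ge0 (ler0n _ 3) (ltW s0))).
have OU y : Om y -> rho y <= rad y -> osq y (rho y) `<=` U y.
  by move=> Oy ry p [h1 h2]; split; apply: lt_le_trans ry.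
have Oz : Om z by apply: (rad_sub Ox); apply: osq_sub_sq; exact: (OU x).
have oO : open (U z `&` (U x `&` U x')) := openI (@U_open z) (openI (@U_open x) (@U_open x')).
have zz : (U z `&` (U x `&` U x')) z by split; [exact: U_self|split; [exact: (OU x)|exact: (OU x')]].
have [t t0 tO] := small_in oO zz.
have [g [sg zg Ig]] := small_bump z t0.
have e1 := jumpP Ox Oz t0 (subset_trans tO (fun q m => conj m.1 m.2.1)) sg zg.
have e2 := jumpP Ox' Oz t0 (subset_trans tO (fun q m => conj m.1 m.2.2)) sg zg.
have k1 : jump x z - jump x x = b z - b x.
  rewrite -(Hc z x) ?(cocE Ox Oz Ox)//; [exact: (OU x)|exact: U_self|].
  by split; rewrite subrr normr0.
have k2 : jump x' z - jump x' x' = b z - b x'.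
  rewrite -(Hc' z x') ?(cocE Ox' Oz Ox')//; [exact: (OU x')|exact: U_self|].
  by split; rewrite subrr normr0.
have [k Hk] := overlap_cst (diff_lin (jump x x - b x - (jump x' x' - b x')) Ox' Ox)
  (diff_partial (jump x x - b x - (jump x' x' - b x')) Ox' Ox).
have kg := Hk z t t0 (subset_trans tO (fun q m => conj m.2.1 m.2.2)) g sg zg.
have k0 : k = 0.
  have Ig0 : I g != 0 by rewrite gt_eqF.
  apply: (mulIf Ig0); rewrite -kg mul0r.
  rewrite (_ : pl x g - pl x' g = jump x' z * I g - jump x z * I g); last by rewrite -e1 -e2; ring.
  have -> : jump x' z = jump x' x' + (b z - b x') by rewrite -k2; ring.
  have -> : jump x z = jump x x + (b z - b x) by rewrite -k1; ring.
  ring.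
have HU : sq z (3 * s) `<=` U x `&` U x'.
  by move=> p /H[h h']; split; [exact: (OU x)|exact: (OU x')].
have E := Hk z s s0 HU f sf zf; rewrite k0 mul0r in E.
apply: subr0_eq; rewrite -E.
move: (pl x f) (pl x' f) (jump x x - b x) (jump x' x' - b x') (I f) => A1 A2 A3 A4 A5; ring.
Qed.

End GlobalPrimitive.

(** * Gluing *)

Section Gluing.
Context {R : realType}.
Implicit Types (f g h : R * R -> R) (x y : R * R) (s t e v : R) (K : set (R * R)).
Variables (Om : set (R * R)) (B : R) (P : R * R -> (R * R -> R) -> R) (rho : R * R -> R).
Hypothesis OB : Om `<=` box B.
Hypothesis rho0 : forall x, Om x -> 0 < rho x.
Hypothesis rhoO : forall x, Om x -> sq x (rho x) `<=` Om.
Hypothesis Plin : forall x, Om x -> linear_on (Tk x (rho x)) (P x).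
Hypothesis Pbound : forall x, Om x -> exists2 C : R, 0 <= C &
  forall f, Tk x (rho x) f -> `|P x f| <= C * N2 f.
Hypothesis Pagree : forall x x', Om x -> Om x' -> forall z s, 0 < s ->
  sq z (3 * s) `<=` sq x (rho x) `&` sq x' (rho x') -> forall f, Tk z s f -> P x f = P x' f.

Lemma Tk0 z s : Tk z s (0 : R * R -> R). Proof. by split; [exact: Smooth0|]. Qed.

Lemma Tk_sub z s z' s' f : sq z s `<=` sq z' s' -> Tk z s f -> Tk z' s' f.
Proof. by move=> H [sf zf]; split => //; exact: zoff_sub zf. Qed.

Lemma P0 x : Om x -> P x 0 = 0.
Proof. by move=> Ox; exact: (lin_on0 (@Tk0 x (rho x)) (Plin Ox)). Qed.

Definition glue_data f v := exists x z s, [/\ Om x, 0 < s, sq z (10 * s) `<=` sq x (rho x), Tk z s f & v = P x f].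

(** The common value of all local functionals on a function carried by a square
    that is small compared with the squares of the cover. *)
Definition glue_val f : R := xget 0 (glue_data f).

Lemma glue_data_uniq f v v' : glue_data f v -> glue_data f v' -> v = v'.
Proof.
have W x z s x' z' s' : Om x -> Om x' -> 0 < s -> s <= s' ->
    sq z (10 * s) `<=` sq x (rho x) -> sq z' (10 * s') `<=` sq x' (rho x') ->
    Tk z s f -> Tk z' s' f -> P x f = P x' f.
  move=> Ox Ox' s0 ss H H' tf tf'.
  have [[p [pz pz']]|no] := pselect (exists p, sq z s p /\ sq z' s' p); last first.
    suff -> : f = 0 by rewrite !P0.
    apply/funext => p; have [h|h] := pselect (sq z s p); last exact: tf.2.
    by apply: tf'.2 => h'; apply: no; exists p.
  apply: (Pagree Ox Ox' s0 _ tf) => q qz; split.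
    by apply: H; apply: (sq_le (_ : 3 * s <= 10 * s)) qz; move: s0; lra.
  apply: H'; apply: (sq_le (_ : s' + (s + 3 * s) <= 10 * s')); first by move: s0 ss; lra.
  by apply: (sq_trans pz'); apply: (sq_trans (sq_sym pz)).
move=> [x [z [s [Ox s0 H tf ->]]]] [x' [z' [s' [Ox' s0' H' tf' ->]]]].
have [ss|/ltW ss] := lerP s s'; first exact: (W x z s x' z' s').
by apply/esym; exact: (W x' z' s' x z s).
Qed.

Lemma glue_valE f x z s : Om x -> 0 < s -> sq z (10 * s) `<=` sq x (rho x) -> Tk z s f ->
  glue_val f = P x f.
Proof.
move=> Ox s0 H tf; have D : glue_data f (P x f) by exists x, z, s.
exact: glue_data_uniq (xgetPex 0 (ex_intro _ _ D)) D.
Qed.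

Lemma glue_val0 : glue_val 0 = 0.
Proof.
rewrite /glue_val; case: xgetP => // v -> [x [z [s [Ox _ _ _ ->]]]].
exact: P0.
Qed.

(** The scale e is fine on K when each square of radius e that meets K lies well
    inside some square of the cover. The factor 10 leaves room for the triple
    squares on which the local functionals are compared. *)
Definition fine_at K e := 0 < e /\ forall z, (exists2 p, K p & sq z e p) ->
  exists2 x, Om x & sq z (10 * e) `<=` sq x (rho x).

Lemma fine_ex K : compact K -> K `<=` Om -> exists2 e0, 0 < e0 & forall e, 0 < e -> e <= e0 -> fine_at K e.
Proof.
move=> cK KO.
have [d d0 Hd] : exists2 d, 0 < d & forall p, K p -> exists2 x, Om x & sq p d `<=` sq x (rho x).
  apply: (lebesgue_number (Q := fun p d => exists2 x, Om x & sq p d `<=` sq x (rho x)) cK).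
    by move=> p r s [x Ox H] rs; exists x => //; apply: subset_trans H; exact: sq_le.
  move=> x Kx; have Ox := KO x Kx; have r0 := rho0 Ox.
  exists (rho x / 2); first by rewrite divr_gt0.
  move=> y /ball_pairE[h1 h2]; exists x => //.
  have xy : sq x (rho x / 2) y by split; rewrite distrC ltW.
  by apply: subset_trans (sq_trans xy) _; rewrite -splitr.
exists (d / 11); first by rewrite divr_gt0.
move=> e e0 ed; split => // z [p Kp zp]; have [x Ox H] := Hd p Kp; exists x => //.
apply: subset_trans H; apply: subset_trans (sq_trans (sq_sym zp)) _.
by apply: sq_le; move: ed; rewrite ler_pdivlMr//; lra.
Qed.

Definition Tz K z e f := Smooth f /\ zoff (K `&` sq z e) f.

Lemma Tz_zero K z e f : ~ (exists2 p, K p & sq z e p) -> Tz K z e f -> f = 0.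
Proof.
by move=> no [_ zf]; apply/funext => p; apply: zf => -[Kp zp]; apply: no; exists p.
Qed.

Lemma Tz_Tk K z e f : Tz K z e f -> Tk z e f.
Proof. by move=> [sf zf]; split => //; apply: zoff_sub zf; exact: subIsetr. Qed.

Lemma Tz0 K z e : Tz K z e 0. Proof. by split; [exact: Smooth0|]. Qed.

Lemma Tz_lin K z e (a : R) f g : Tz K z e f -> Tz K z e g -> Tz K z e (a *: f + g).
Proof. by move=> [sf zf] [sg zg]; split; [exact: Smooth_lin|exact: zoff_lin]. Qed.

Lemma glue_val_lin K z e : fine_at K e -> linear_on (Tz K z e) glue_val.
Proof.
move=> [e0 He] a f g tf tg.
have [ex|no] := pselect (exists2 p, K p & sq z e p); last first.
  by rewrite (Tz_zero no tf) (Tz_zero no tg) scaler0 addr0 glue_val0 mulr0 addr0.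
have [x Ox H] := He z ex.
have kf := Tz_Tk tf; have kg := Tz_Tk tg; have kfg := Tz_Tk (Tz_lin a tf tg).
rewrite (glue_valE Ox e0 H kf) (glue_valE Ox e0 H kg) (glue_valE Ox e0 H kfg).
have S : sq z e `<=` sq x (rho x) by apply: subset_trans H; apply: sq_le; move: e0; lra.
exact: (Plin Ox a (Tk_sub S kf) (Tk_sub S kg)).
Qed.

Lemma grid_ex : exists G : R -> {n : nat & (('I_n * 'I_n -> R * R) * ('I_n * 'I_n -> R * R -> R))%type},
  forall e, 0 < e -> [/\ forall k, Smooth ((projT2 (G e)).2 k),
    forall k, zoff (sq ((projT2 (G e)).1 k) e) ((projT2 (G e)).2 k) &
    forall x, box B x -> \sum_k (projT2 (G e)).2 k x = 1].
Proof.
have H e : exists D : {n : nat & (('I_n * 'I_n -> R * R) * ('I_n * 'I_n -> R * R -> R))%type},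
    0 < e -> [/\ forall k, Smooth ((projT2 D).2 k),
    forall k, zoff (sq ((projT2 D).1 k) e) ((projT2 D).2 k) &
    forall x, box B x -> \sum_k (projT2 D).2 k x = 1].
  have [e0|e0] := ltrP 0 e; last by exists (existT _ 0%N ((fun=> 0), (fun=> 0))) => //.
  have [n [y [be [h1 [h2 h3]]]]] := grid_partition B e0.
  by exists (existT _ n (y, be)).
by have [G HG] := choice H; exists G.
Qed.

Definition grid := projT1 (cid grid_ex).
Definition gn e := projT1 (grid e).
Definition gy e : 'I_(gn e) * 'I_(gn e) -> R * R := (projT2 (grid e)).1.
Definition gb e : 'I_(gn e) * 'I_(gn e) -> R * R -> R := (projT2 (grid e)).2.
Arguments gy : clear implicits.
Arguments gb : clear implicits.

Lemma gridP e : 0 < e -> [/\ forall k, Smooth (gb e k), forall k, zoff (sq (gy e k) e) (gb e k) &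
    forall x, box B x -> \sum_k gb e k x = 1].
Proof. by move=> e0; exact: (projT2 (cid grid_ex) e e0). Qed.

Definition piece e k f : R * R -> R := fun x => f x * gb e k x.

Lemma piece_Tz K e k f : 0 < e -> Smooth f -> zoff K f -> Tz K (gy e k) e (piece k f).
Proof.
move=> e0 sf zf; have [h1 h2 h3] := gridP e0; split; first exact: smoothM (h1 k).
move=> x nx; rewrite /piece; have [Kx|/zf->] := pselect (K x); last by rewrite mul0r.
by rewrite [X in _ * X]h2 ?mulr0// => sx; apply: nx.
Qed.

Lemma sum_piece K e f : 0 < e -> K `<=` Om -> zoff K f -> \sum_k @piece e k f = f.
Proof.
move=> e0 KO zf; have [h1 h2 h3] := gridP e0; apply/funext => x.
rewrite fct_sumE /piece -mulr_sumr.
have [Kx|/zf->] := pselect (K x); last by rewrite mul0r.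
by rewrite h3 ?mulr1//; apply: OB; exact: KO.
Qed.

Definition glue_sum e f : R := \sum_k glue_val (@piece e k f).

Lemma lin_sum_Tz K z e (J : finType) (F : J -> R * R -> R) : fine_at K e ->
  (forall k, Tz K z e (F k)) -> glue_val (\sum_k F k) = \sum_k glue_val (F k).
Proof.
move=> fe tF; exact: (lin_on_sum (@Tz0 K z e) (@Tz_lin K z e) (glue_val_lin fe) _ tF).
Qed.

Lemma piece_sub K z e e' (k : 'I_(gn e') * 'I_(gn e')) f : 0 < e' -> Tz K z e f -> Tz K z e (piece k f).
Proof.
move=> e0 [sf zf]; have [h1 _ _] := gridP e0; split; first exact: smoothM (h1 k).
exact: zoffMl.
Qed.

Lemma glue_sum_small K z e e' f : K `<=` Om -> fine_at K e -> 0 < e' -> Tz K z e f ->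
  glue_sum e' f = glue_val f.
Proof.
move=> KO fe e0 tf; rewrite /glue_sum -(lin_sum_Tz (z := z) fe); last by move=> k; exact: piece_sub.
congr glue_val; apply: (@sum_piece K) => //; apply: zoff_sub tf.2; exact: subIsetl.
Qed.

Lemma pieceC e e' (k : 'I_(gn e) * 'I_(gn e)) (l : 'I_(gn e') * 'I_(gn e')) f :
  piece l (piece k f) = piece k (piece l f).
Proof. by apply/funext => x; rewrite /piece mulrAC. Qed.

(** Cutting by the two partitions of unity at once gives both sums. *)
Lemma glue_sum_indep K e e' f : K `<=` Om -> fine_at K e -> fine_at K e' -> Smooth f -> zoff K f ->
  glue_sum e f = glue_sum e' f.
Proof.
move=> KO fe fe' sf zf; have [e0 e0'] := (fe.1, fe'.1).
rewrite /glue_sum.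
under eq_bigr => k _ do rewrite -(glue_sum_small KO fe e0' (piece_Tz k e0 sf zf)).
under [RHS]eq_bigr => k _ do rewrite -(glue_sum_small KO fe' e0 (piece_Tz k e0' sf zf)).
rewrite /glue_sum exchange_big; apply: eq_bigr => k _; apply: eq_bigr => l _.
by rewrite pieceC.
Qed.

(** The sum over the pieces of a partition of unity, for any fine scale. *)
Definition glue f : R := xget 0 [set v | exists2 e0, 0 < e0 & forall e, 0 < e -> e <= e0 -> glue_sum e f = v].

Lemma glueE K e f : compact K -> K `<=` Om -> fine_at K e -> Smooth f -> zoff K f -> glue f = glue_sum e f.
Proof.
move=> cK KO fe sf zf; have [e1 e10 H1] := fine_ex cK KO.
have : exists v, [set v | exists2 e0, 0 < e0 & forall e, 0 < e -> e <= e0 -> glue_sum e f = v] v.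
  exists (glue_sum e f); exists e1 => // e' e0' ee'.
  exact: (glue_sum_indep KO (H1 _ e0' ee') fe sf zf).
move=> /(xgetPex 0)[e2 e20 H2].
have m0 : 0 < Num.min e1 e2 by rewrite lt_min e10.
have m1 : Num.min e1 e2 <= e1 by rewrite ge_min lexx.
have m2 : Num.min e1 e2 <= e2 by rewrite ge_min lexx orbT.
rewrite /glue -(H2 _ m0 m2); exact: (glue_sum_indep KO (H1 _ m0 m1) fe sf zf).
Qed.

Lemma glue_small K z e f : compact K -> K `<=` Om -> fine_at K e -> Tz K z e f ->
  glue f = glue_val f.
Proof.
move=> cK KO fe tf; have zf : zoff K f by apply: zoff_sub tf.2; exact: subIsetl.
rewrite (glueE cK KO fe tf.1 zf); exact: (glue_sum_small KO fe fe.1 tf).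
Qed.

Lemma pieceL e k (a : R) f g : @piece e k (a *: f + g) = a *: piece k f + piece k g.
Proof.
apply/funext => x; rewrite -[LHS]/((a * f x + g x) * gb e k x).
by rewrite -[RHS]/(a * (f x * gb e k x) + g x * gb e k x) mulrDl mulrA.
Qed.

Lemma glue_lin : linear_on (Tc Om) glue.
Proof.
move=> a f g [sf [K1 [cK1 KO1 zf]]] [sg [K2 [cK2 KO2 zg]]].
pose K := K1 `|` K2; have cK : compact K by exact: compactU.
have KO : K `<=` Om by move=> p [/KO1|/KO2].
have {}zf : zoff K f by apply: zoff_sub zf => p; left.
have {}zg : zoff K g by apply: zoff_sub zg => p; right.
have [e e0 He] := fine_ex cK KO; have fe := He e e0 (lexx e).
rewrite (glueE cK KO fe sf zf) (glueE cK KO fe sg zg).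
rewrite (glueE cK KO fe (Smooth_lin a sf sg) (zoff_lin a zf zg)).
rewrite /glue_sum mulr_sumr -big_split; apply: eq_bigr => k _.
rewrite pieceL; exact: (glue_val_lin fe a (piece_Tz k e0 sf zf) (piece_Tz k e0 sg zg)).
Qed.

Lemma glue_dist2 : dist2 Om glue.
Proof.
split; first exact: glue_lin.
move=> K cK KO; have [e e0 He] := fine_ex cK KO; have fe := He e e0 (lexx e).
have [h1 h2 h3] := gridP e0.
have H k : exists C : R, 0 <= C /\ forall f, Smooth f -> zoff K f -> `|glue_val (@piece e k f)| <= C * N2 f.
  have [ex|no] := pselect (exists2 p, K p & sq (gy e k) e p); last first.
    exists 0; split => // f sf zf.
    by rewrite (Tz_zero no (piece_Tz k e0 sf zf)) glue_val0 normr0 mul0r.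
  have [x Ox Hx] := fe.2 _ ex; have [C C0 HC] := Pbound Ox.
  have [D D0 HD] := N2_mul B (h1 k).
  exists (C * D); split; first exact: mulr_ge0.
  move=> f sf zf; have tk := Tz_Tk (piece_Tz k e0 sf zf).
  rewrite (glue_valE Ox e0 Hx tk).
  have S : sq (gy e k) e `<=` sq x (rho x) by apply: subset_trans Hx; apply: sq_le; move: e0; lra.
  apply: le_trans (HC _ (Tk_sub S tk)) _; rewrite -mulrA ler_wpM2l//.
  apply: HD => //; apply: zoff_sub zf; exact: subset_trans OB.
have [C HC] := choice H.
exists (\sum_k C k); first by apply: sumr_ge0 => k _; case: (HC k).
move=> f sf zf; rewrite (glueE cK KO fe sf zf) /glue_sum mulr_suml.
apply: le_trans (ler_norm_sum _ _ _) _; apply: ler_sum => k _; exact: (HC k).2.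
Qed.

(** Functionals that agree on overlaps glue to one of order two. *)
Lemma gluing : exists2 p, dist2 Om p & forall K, compact K -> K `<=` Om -> exists2 e, 0 < e &
  forall z, (forall f, Tz K z e f -> f = 0) \/
    exists2 x, Om x & forall f, Tz K z e f -> Tk x (rho x) f /\ p f = P x f.
Proof.
exists glue; first exact: glue_dist2.
move=> K cK KO; have [e e0 He] := fine_ex cK KO; have fe := He e e0 (lexx e).
exists e => // z.
have [ex|no] := pselect (exists2 p, K p & sq z e p); last by left => f; exact: Tz_zero.
right; have [x Ox Hx] := fe.2 _ ex; exists x => // f tf.
have S : sq z e `<=` sq x (rho x) by apply: subset_trans Hx; apply: sq_le; move: e0; lra.
split => //; first exact: Tk_sub S (Tz_Tk tf).
by rewrite (glue_small cK KO fe tf); exact: (glue_valE Ox e0 Hx (Tz_Tk tf)).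
Qed.

End Gluing.

(** * The Poincare lemma and the compatibility condition of Saint-Venant *)

Opaque pl rad.

Section PoincareLemma.
Context {R : realType}.
Implicit Types (f g h : R * R -> R) (x y : R * R) (K : set (R * R)) (i j k : 'I_2).
Variables (Om : set (R * R)) (B : R).
Hypothesis OB : Om `<=` box B.
Hypothesis oOm : open Om.
Hypothesis sc : simply_connected Om.

Lemma I_le_N2 : exists2 C : R, 0 <= C & forall f, Smooth f -> zoff (box B) f -> `|I f| <= C * N2 f.
Proof.
have [n [y [be [h1 [h2 h3]]]]] := grid_partition B (@ltr01 R).
pose chi := \sum_k be k.
have tchi : Tf chi.
  by apply: Tf_sum => k _; apply: (compact_Tf (@sq_compact R (y k) 1)).
exists (nrm chi * ((2 * `|B| + 1) * (2 * `|B| + 1))).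
  by rewrite mulr_ge0 ?nrm_ge0// mulr_ge0// addr_ge0// mulr_ge0.
move=> f sf zf; have tf : Tf f by split => //; exists B.
have -> : I f = ip f chi.
  Transparent ip.
  rewrite /ip; congr I; apply/funext => x; rewrite /chi fct_sumE.
  Opaque ip.
  by have [bx|/zf->] := pselect (box B x); [rewrite h3// mulr1|rewrite mul0r].
apply: le_trans (cauchy_schwarz tf tchi) _; rewrite mulrC -mulrA ler_wpM2l ?nrm_ge0//.
exact: nrm_le_N2.
Qed.

(** Local primitives exist on squares, are normalized to agree on overlaps, and
    are glued. *)
Lemma poincare_lemma (w : 'I_2 -> (R * R -> R) -> R) :
  (forall i, dist2 Om (w i)) -> (forall f, Tc Om f -> w 0 (partial 1 f) = w 1 (partial 0 f)) ->
  exists2 p, dist2 Om p & forall i f, Tc Om f -> p (partial i f) = - w i f.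
Proof.
move=> dw c0; have [rho [kap H]] := normalized dw c0 oOm sc.
pose P x f := pl w oOm x f + kap x * I f; pose rh x := rho x / 2.
have rh0 x : Om x -> 0 < rh x by move=> /H[r0 _ _]; rewrite divr_gt0.
have rhr x : Om x -> sq x (rh x) `<=` sq x (rad oOm x).
  by move=> /H[r0 rr _]; apply: sq_le; rewrite /rh; move: r0 rr; lra.
have rho_s x : Om x -> sq x (rh x) `<=` osq x (rho x).
  move=> /H[r0 _ _] p [p1 p2].
  by have h : rh x < rho x by [rewrite /rh; move: r0; lra]; split; apply: le_lt_trans h.
have Tr x f : Om x -> Tk x (rh x) f -> Tk x (rad oOm x) f by move=> Ox; apply: Tk_sub; exact: rhr.
have TT x f : Tk x (rh x) f -> Tf f by move=> [sf zf]; apply: compact_Tf sf zf; exact: sq_compact.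
have TB x f : Om x -> Tk x (rh x) f -> zoff (box B) f.
  move=> Ox [_ zf]; apply: zoff_sub zf.
  by apply: subset_trans OB; apply: subset_trans (rad_sub Ox); exact: rhr.
have [C0 C00 HC0] := I_le_N2.
have [] := @gluing R Om B P rh OB rh0.
- move=> x Ox a f g tf tg; rewrite /P (pl_lin dw Ox a (Tr _ _ Ox tf) (Tr _ _ Ox tg)).
  rewrite (I_lin a (TT _ _ tf) (TT _ _ tg)).
  by move: (pl w oOm x f) (pl w oOm x g) (I f) (I g) (kap x) => *; ring.
- move=> x Ox; have [C1 C10 HC1] := primitive_bound (rad_gt0 oOm Ox) dw (rad_sub3 Ox).
  exists (C1 + `|kap x| * C0); first by rewrite addr_ge0// mulr_ge0.
  move=> f tf; apply: le_trans (ler_normD _ _) _; rewrite mulrDl; apply: lerD.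
    exact: HC1 (Tr _ _ Ox tf).
  by rewrite normrM -mulrA ler_wpM2l//; apply: HC0 tf.1 (TB _ _ Ox tf).
- move=> x x' Ox Ox' z s s0 sO f tf.
  have [_ _ Ha] := H x Ox; apply: (Ha x' Ox' z s s0 _ f tf.1 tf.2) => p /sO[a b].
  by split; exact: rho_s.
move=> p dp Hp; exists p => // i f [sf [K [cK KO zf]]].
have [e e0 He] := Hp K cK KO.
have [n [y [be [h1 [h2 h3]]]]] := grid_partition B e0.
pose F (k : 'I_n * 'I_n) : R * R -> R := fun x => f x * be k x.
have sF (k : 'I_n * 'I_n) : Smooth (F k) by exact: smoothM.
have zF (k : 'I_n * 'I_n) : zoff (K `&` sq (y k) e) (F k).
  move=> x nx; rewrite /F; have [Kx|/zf->] := pselect (K x); last by rewrite mul0r.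
  by rewrite [X in _ * X]h2 ?mulr0// => sx; apply: nx.
have tF (k : 'I_n * 'I_n) : Tc Om (F k) by apply: (Tc_K cK KO (sF k)); apply: zoff_sub (zF k); exact: subIsetl.
have fE : f = \sum_k F k.
  apply/funext => x; rewrite fct_sumE /F -mulr_sumr.
  have [Kx|/zf->] := pselect (K x); last by rewrite mul0r.
  by rewrite h3 ?mulr1//; apply: OB; exact: KO.
have cKz z : closed (K `&` sq z e).
  by apply: closedI; apply: compact_closed2 => //; exact: sq_compact.
have L0 := @Tc0 R Om; have LL := @Tc_lin R Om.
rewrite fE (partial_sum i _ sF) (lin_on_sum L0 LL dp.1); last by move=> k; exact: Tc_partial.
rewrite (lin_on_sum L0 LL (dw i).1)// -sumrN; apply: eq_bigr => k _.
have tz : Tz K (y k) e (F k) by split.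
have tz' : Tz K (y k) e (partial i (F k)).
  by split; [exact: Smooth_partial|exact: (zoff_partial i (cKz (y k)) (zF k))].
have [H0|[x Ox Hx]] := He (y k).
  by rewrite (H0 _ tz) partial0 (lin_on0 L0 dp.1) (lin_on0 L0 (dw i).1) oppr0.
have [tk _] := Hx _ tz; have [_ ->] := Hx _ tz'.
rewrite /P (pl_partial dw c0 i Ox (Tr _ _ Ox tk)) (I_partial i (TT _ _ tk)).
by rewrite mulr0 addr0.
Qed.

Lemma dist2_comb (u1 u2 : (R * R -> R) -> R) (a : R) : dist2 Om u1 -> dist2 Om u2 ->
  dist2 Om (fun f => u1 f + a * u2 f).
Proof.
move=> [l1 b1] [l2 b2]; split.
  by move=> c f g tf tg; rewrite l1// l2//; ring.
move=> K cK KO; have [C1 C10 H1] := b1 K cK KO; have [C2 C20 H2] := b2 K cK KO.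
exists (C1 + `|a| * C2); first by rewrite addr_ge0// mulr_ge0.
move=> f sf zf; apply: le_trans (ler_normD _ _) _; rewrite normrM mulrDl -mulrA.
by apply: lerD; [exact: H1|rewrite ler_wpM2l//; exact: H2].
Qed.

Section SaintVenant.
Variables (s : 'I_2 -> 'I_2 -> (R * R -> R) -> R) (C : R).
Hypothesis C0 : 0 <= C.
Hypothesis ds : forall i j, dist2 Om (s i j).
Hypothesis ssym : forall f, Tc Om f -> s 0 1 f = s 1 0 f.
Hypothesis s1 : forall i j k f, Tc Om f -> `|s i j (partial k f)| <= C * N2 f.

Definition rot_row i f : R := s i 0 (partial 1 f) - s i 1 (partial 0 f).

Hypothesis rotrot0 : forall f, Tc Om f -> rot_row 0 (partial 1 f) = rot_row 1 (partial 0 f).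

Lemma rot_row_bound i f : Tc Om f -> `|rot_row i f| <= (C + C) * N2 f.
Proof.
by move=> tf; apply: le_trans (ler_normB _ _) _; rewrite mulrDl; apply: lerD; exact: s1.
Qed.

Lemma dist2_rot_row i : dist2 Om (rot_row i).
Proof.
split.
  move=> a f g tf tg; have [sf sg] := (Tc_smooth tf, Tc_smooth tg).
  have P k : partial k (a *: f + g) = a *: partial k f + partial k g.
    by rewrite (partialD _ (smoothZ a sf) sg) partialZ.
  rewrite /rot_row !P (ds i 0).1 ?(ds i 1).1; try exact: Tc_partial.
  by move: (s i 0 _) (s i 0 _) (s i 1 _) (s i 1 _) => *; ring.
move=> K cK KO; exists (C + C); first exact: addr_ge0.
by move=> f sf zf; apply: rot_row_bound; exact: Tc_K cK KO sf zf.
Qed.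

(** A symmetric tensor with vanishing double rotation is a symmetric gradient:
    the Poincare lemma is applied to the rotation of the rows, then to the rows
    corrected by a skew-symmetric field. *)
Lemma saint_venant : exists u : 'I_2 -> (R * R -> R) -> R,
  [/\ forall i, dist2 Om (u i),
      forall i j f, Tc Om f -> u i (partial j f) + u j (partial i f) = - 2 * s i j f &
      exists2 C' : R, 0 <= C' & forall k i j f, Tc Om f -> `|u k (partial i (partial j f))| <= C' * N2 f].
Proof.
have [p dp Hp] := poincare_lemma dist2_rot_row rotrot0.
pose chi (i j : 'I_2) : R := if i == j then 0 else if i == 0 then -1 else 1.
pose W i j f := s i j f + chi i j * p f.
have dW i j : dist2 Om (W i j) by exact: dist2_comb.
have cW i f : Tc Om f -> W i 0 (partial 1 f) = W i 1 (partial 0 f).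
  move=> tf; rewrite /W (Hp 0 f tf) (Hp 1 f tf) /chi /rot_row.
  by have [->|->] := ord2P i; rewrite /=; ring.
have E i : exists q, dist2 Om q /\ forall j f, Tc Om f -> q (partial j f) = - W i j f.
  by have [q dq Hq] := poincare_lemma (dW i) (cW i); exists q.
have [u Hu] := choice E.
exists u; split; first by move=> i; case: (Hu i).
- move=> i j f tf; rewrite (Hu i).2// (Hu j).2// /W /chi.
  have := ssym tf; have [->|->] := ord2P i; have [->|->] := ord2P j; rewrite /= => e; rewrite ?e; ring.
exists (C + (C + C)); first by rewrite !addr_ge0.
move=> k i j f tf; rewrite partialC; last exact: Tc_smooth tf.
rewrite (Hu k).2; last exact: Tc_partial.
rewrite normrN /W (Hp i f tf) mulrDl; apply: le_trans (ler_normD _ _) _; apply: lerD; first exact: s1.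
rewrite normrM normrN; apply: le_trans (rot_row_bound i tf).
rewrite ler_piMl// /chi; case: ifP => _; rewrite ?normr0//.
by case: ifP => _; rewrite ?normrN normr1.
Qed.

End SaintVenant.
End PoincareLemma.

(** * The L2 estimate on a cone patch *)

Opaque smoothing N2.

Lemma N2_tr {R : realType} (v : R * R) (f : R * R -> R) : Tf f -> N2 (tr v f) = N2 f.
Proof.
move=> tf; rewrite !N2E !partial_tr.
have n i j : nrm (tr v (partial i (partial j f))) = nrm (partial i (partial j f)).
  by apply: nrm_tr; do 2 apply: Tf_partial.
exact: (congr2 (fun p q : R => p + q) (congr2 (fun p q : R => p + q) (n 0 0) (n 0 1)) (congr2 (fun p q : R => p + q) (n 1 0) (n 1 1))).
Qed.

Lemma cancel2 (V : zmodType) (p q r : V) : p - q - r + (q + r) = p.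
Proof. by rewrite [q + r]addrC addrA !subrK. Qed.

Lemma cancel4 {R : realType} (p q r : R) : p - q = r - q - (r - p).
Proof. ring. Qed.

Lemma cancel5 {R : realType} (p q r : R) : p = p - 2 * q + r + 2 * q - r.
Proof. ring. Qed.

Lemma cancel3 (V : zmodType) (p q r : V) : p + q + r - p = q + r.
Proof. by rewrite addrC !addrA addNr add0r. Qed.

Lemma le_wmul {R : realType} (A k p q : R) : A <= k * p -> 0 <= k -> p <= q -> A <= k * q.
Proof. by move=> h k0 pq; apply: le_trans h _; exact: ler_wpM2l. Qed.

Lemma base_arith {R : realType} (X Y Z M D N n : R) : 0 <= M -> 0 <= D ->
  `|X| <= M * N -> `|Y| <= D * N -> `|Z| <= D * N -> N <= n ->
  `|X + 2 * Y - Z| <= (M + (2 * D + D)) * n.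
Proof.
move=> M0 D0 hX hY hZ Nn.
apply: (@le_wmul _ _ _ N) => //; last by rewrite !addr_ge0// mulr_ge0.
have -> : (M + (2 * D + D)) * N = M * N + (2 * (D * N) + D * N) by ring.
rewrite -addrA; apply: le_trans (ler_normD _ _) _; apply: lerD => //.
apply: le_trans (ler_normB _ _) _; apply: lerD => //.
by rewrite normrM ger0_norm// ler_wpM2l.
Qed.

(** Near x0, the directions a and b are so inclined that moving along them stays
    inside Om, and moving by one or two steps of c leads into a fixed compact
    subset F. *)
Section Patch.
Context {R : realType}.
Implicit Types (f g h : R * R -> R) (x y p : R * R) (K : set (R * R)) (i j k : 'I_2).
Variables (Om : set (R * R)) (u : (R * R -> R) -> R) (C : R).
Hypothesis du : dist2 Om u.
Hypothesis C0 : 0 <= C.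
Hypothesis u2 : forall i j f, Tc Om f -> `|u (partial i (partial j f))| <= C * N2 f.

Lemma msum_compact (A A' : set (R * R)) : compact A -> compact A' -> compact (msum A A').
Proof.
move=> cA cA'; have -> : msum A A' = (fun p : (R * R) * (R * R) => p.1 + p.2) @` (A `*` A').
  apply/seteqP; split => [_ [x Ax [y Ay <-]]|_ [[x y] [/= Ax Ay] <-]]; first by exists (x, y).
  by exists x => //; exists y.
apply: continuous_compact; last exact: compact_setX.
apply: continuous_subspaceT => p; apply: cvgD; [exact: cvg_fst|exact: cvg_snd].
Qed.

Lemma cone_rect_compact (a b : R * R) (r t : R) : compact (cone_rect a b r t).
Proof.
have -> : cone_rect a b r t = (fun p : R * R => p.1 *: a + p.2 *: b) @` (`[0, r]%classic `*` `[0, t]%classic).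
  apply/seteqP; split => [_ [al Ha [be Hb <-]]|_ [[al be] [/= Ha Hb] <-]]; first by exists (al, be).
  by exists al => //; exists be.
apply: continuous_compact; last by apply: compact_setX; exact: segment_compact.
apply: continuous_subspaceT => p; apply: cvgD.
  by apply: (continuous_comp (g := fun s : R => s *: a)); [exact: cvg_fst|exact: scalel_continuous].
by apply: (continuous_comp (g := fun s : R => s *: b)); [exact: cvg_snd|exact: scalel_continuous].
Qed.

Lemma u_dirdir v : exists2 M : R, 0 <= M & forall g, Tc Om g -> `|u (dir v (dir v g))| <= M * N2 g.
Proof.
pose a1 : R := `|v.1|; pose a2 : R := `|v.2|.
have a10 : 0 <= a1 by exact: normr_ge0. have a20 : 0 <= a2 by exact: normr_ge0.
exists ((a1 * (a1 * C + a2 * C)) + (a2 * (a1 * C + a2 * C))).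
  by rewrite addr_ge0// mulr_ge0// addr_ge0// mulr_ge0.
move=> g tg; have sg := Tc_smooth tg.
have L := lin_onZ (@Tc0 R Om) du.1; have LD := lin_onD du.1.
have tp i j : Tc Om (partial i (partial j g)) by do 2 apply: Tc_partial.
have D (w1 w2 : R) (g1 g2 : R * R -> R) (M1 M2 : R) : Tc Om g1 -> Tc Om g2 -> `|u g1| <= M1 -> `|u g2| <= M2 ->
    `|u (w1 *: g1 + w2 *: g2)| <= `|w1| * M1 + `|w2| * M2.
  move=> t1 t2 h1 h2; rewrite (LD _ _ (TcZ w1 t1) (TcZ w2 t2)) (L _ _ t1) (L _ _ t2).
  by apply: le_trans (ler_normD _ _) _; rewrite !normrM lerD// ler_wpM2l.
have E i : partial i (dir v g) = v.1 *: partial i (partial 0 g) + v.2 *: partial i (partial 1 g).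
  have s0 := Smooth_partial 0 sg; have s1 := Smooth_partial 1 sg.
  by rewrite dirE (partialD _ (smoothZ _ s0) (smoothZ _ s1)) (partialZ _ _ s0) (partialZ _ _ s1).
have td i : Tc Om (partial i (dir v g)) by rewrite E; apply: TcD; apply: TcZ.
have B i : `|u (partial i (dir v g))| <= a1 * (C * N2 g) + a2 * (C * N2 g).
  by rewrite E; apply: D => //; exact: u2.
rewrite dirE; apply: le_trans (D _ _ _ _ _ _ (td 0) (td 1) (B 0) (B 1)) _.
by rewrite -/a1 -/a2 !mulrDl !mulrDr !mulrDl !mulrA.
Qed.

Variables (a b c : R * R) (x0 : R * R) (dl : R) (F : set (R * R)).
Hypothesis ab_indep : a.1 * b.2 - a.2 * b.1 != 0.
Hypothesis G1 : forall p (al be ga : R), Om p -> sq x0 dl p -> 0 <= al <= 30 -> 0 <= be <= 30 ->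
  0 <= ga <= 2 -> Om (p + (al *: a + be *: b) + ga *: c).
Hypotheses (cF : compact F) (FO : F `<=` Om).
Hypothesis G2 : forall p (al be ga : R), sq x0 dl p -> 0 <= al <= 10 -> 0 <= be <= 10 ->
  1 <= ga <= 2 -> F (p + (al *: a + be *: b) + ga *: c).

Section OneFunction.
Variables (f : R * R -> R) (K : set (R * R)).
Hypotheses (cK : compact K) (KO : K `<=` Om) (Kx : K `<=` sq x0 dl).
Hypotheses (sf : Smooth f) (zf : zoff K f).

Lemma cone_Om (r : R) : r <= 30 -> msum K (cone_rect a b r r) `<=` Om.
Proof.
move=> r30 _ [p Kp [_ [al + [be + <-]] <-]]; rewrite /= !in_itv/= => /andP[a0 a1] /andP[b0 b1].
have := @G1 p al be 0 (KO Kp) (Kx Kp); rewrite scale0r addr0; apply.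
- by rewrite a0 (le_trans a1).
- by rewrite b0 (le_trans b1).
- by rewrite lexx ler0n.
Qed.

Lemma cone_Tc (r : R) g : r <= 30 -> Tf g -> zoff (msum K (cone_rect a b r r)) g -> Tc Om g.
Proof.
move=> r30 tg zg; apply: (Tc_K _ (cone_Om r30) (Tf_smooth tg) zg).
by apply: msum_compact => //; exact: cone_rect_compact.
Qed.

Let tf : Tf f. Proof. exact: compact_Tf cK sf zf. Qed.

Lemma smoothing_zoff n : zoff (msum K (cone_rect a b 10 10)) (smoothing a b n f).
Proof. exact: (mulN_zoff (mulN_smoothing a b n) zf). Qed.

Lemma smoothing_Tc n : Tc Om (smoothing a b n f).
Proof.
apply: (@cone_Tc 10); [lra|exact: (mulN_T (mulN_smoothing a b n) tf)|exact: smoothing_zoff].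
Qed.

Lemma f_Tc : Tc Om f. Proof. exact: Tc_K cK KO sf zf. Qed.

(** The functional is bounded by the L2 norm on the smoothing error, which is a
    sum of second derivatives of potentials with bounded N2 norm. *)
Lemma u_smoothing0 (Ma Mb C1 : R) : 0 <= Ma -> 0 <= Mb ->
  (forall g, Tc Om g -> `|u (dir a (dir a g))| <= Ma * N2 g) ->
  (forall g, Tc Om g -> `|u (dir b (dir b g))| <= Mb * N2 g) ->
  (forall n, exists psi1 psi2,
    [/\ Tf psi1, Tf psi2,
      smoothing a b n f = smoothing a b 0 f + dir a (dir a psi1) + dir b (dir b psi2),
      N2 psi1 <= C1 * nrm f /\ N2 psi2 <= C1 * nrm f &
      forall K, zoff K f -> zoff (msum K (cone_rect a b 30 30)) psi1 /\
                            zoff (msum K (cone_rect a b 30 30)) psi2]) ->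
  `|u f - u (smoothing a b 0 f)| <= (Ma + Mb) * (C1 * nrm f).
Proof.
move=> Ma0 Mb0 Ha Hb Hpsi.
have D n : `|u (smoothing a b n f) - u (smoothing a b 0 f)| <= (Ma + Mb) * (C1 * nrm f).
  have [p1 [p2 [t1 t2 E [n1 n2] /(_ K zf)[z1 z2]]]] := Hpsi n.
  have tc1 : Tc Om p1 by exact: (cone_Tc (lexx _) t1 z1).
  have tc2 : Tc Om p2 by exact: (cone_Tc (lexx _) t2 z2).
  have dd v g : Tc Om g -> Tc Om (dir v g).
    by move=> tg; rewrite dirE; apply: TcD; apply: TcZ; exact: Tc_partial.
  have d1 := dd a _ (dd a _ tc1); have d2 := dd b _ (dd b _ tc2); have s0 := smoothing_Tc 0.
  rewrite E (lin_onD du.1 (TcD s0 d1) d2) (lin_onD du.1 s0 d1).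
  rewrite cancel3.
  apply: le_trans (ler_normD _ _) _; rewrite mulrDl; apply: lerD.
    exact: (le_wmul (Ha _ tc1) Ma0 n1).
  exact: (le_wmul (Hb _ tc2) Mb0 n2).
pose K' := msum K (cone_rect a b 10 10) `|` K.
have cK' : compact K'.
  by apply: compactU => //; apply: msum_compact => //; exact: cone_rect_compact.
have KO' : K' `<=` Om by move=> p [/(@cone_Om 10 _)|/KO//]; apply; lra.
have [C2 C20 H2] := du.2 K' cK' KO'.
have [C3 C30 H3] := smoothing_N2 a b tf.
rewrite -subr_le0; apply: (@small_le0 _ _ (C2 * C3)) => n.
rewrite lerBlDl.
have ts := smoothing_Tc n.
have E : u f - u (smoothing a b 0 f) = u (smoothing a b n f) - u (smoothing a b 0 f) - u (smoothing a b n f - f).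
  by rewrite (lin_onB du.1 ts f_Tc) -cancel4.
rewrite E; apply: le_trans (ler_normB _ _) _; apply: lerD; first exact: D.
apply: le_trans (H2 _ _ _) _.
- exact: smoothB (Tc_smooth ts) sf.
- by apply: zoffB; [apply: zoff_sub (smoothing_zoff n) => p; left|apply: zoff_sub zf => p; right].
- by rewrite -mulrA ler_wpM2l.
Qed.

Lemma shift_zoff (A : set (R * R)) v g : zoff A g -> (forall p, A p -> F (p + v)) -> zoff F (tr v g).
Proof.
Transparent tr.
by move=> zg H p np; apply: zg => Ap; apply: np; rewrite -(subrK v p); exact: H.
Opaque tr.
Qed.

(* The second difference in the direction c moves the smoothed function into a
   fixed compact subset. *)
Lemma u_base (Mc C1 C2 : R) : 0 <= Mc -> 0 <= C2 ->
  (forall g, Tc Om g -> `|u (dir c (dir c g))| <= Mc * N2 g) ->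
  (forall g, Smooth g -> zoff F g -> `|u g| <= C2 * N2 g) ->
  N2 (smoothing a b 0 f) <= C1 * nrm f ->
  `|u (smoothing a b 0 f)| <= (Mc + (2 * C2 + C2)) * (C1 * nrm f).
Proof.
move=> Mc0 C20 Hc HF H0; set g := smoothing a b 0 f.
have tg : Tf g by exact: (mulN_T (mulN_smoothing a b 0) tf).
have zg := smoothing_zoff 0; rewrite -/g in zg.
have tcg := smoothing_Tc 0; rewrite -/g in tcg.
have sg := Tf_smooth tg.
pose psi := Av c (Av c g).
have tpsi : Tc Om psi.
  pose A := msum K (cone_rect a b 10 10); pose A2 := msum A ((fun s : R => s *: c) @` `[0, 2]).
  have cA2 : compact A2.
    apply: msum_compact; first by apply: msum_compact => //; exact: cone_rect_compact.
    apply: continuous_compact; last exact: segment_compact.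
    by apply: continuous_subspaceT; exact: scalel_continuous.
  have AO : A2 `<=` Om.
    move=> _ [_ [p Kp [_ [al + [be + <-]] <-]] [_ [ga + <-] <-]].
    rewrite /= !in_itv/= => /andP[a0 a1] /andP[b0 b1] /andP[g0 g1].
    apply: G1 => //; [exact: KO|exact: Kx|..]; apply/andP; split => //; lra.
  apply: (Tc_K cA2 AO); first by do 2 apply: Smooth_Av.
  move=> p np; apply: Av_cst_seg => s /andP[s0 s1]; apply: Av_cst_seg => s' /andP[s'0 s'1].
  apply: zg => Aq; apply: np; exists (p - s *: c - s' *: c) => //.
  exists ((s + s') *: c); last by rewrite scalerDl cancel2.
  by exists (s + s') => //; rewrite /= in_itv/=; apply/andP; split; lra.
have t1 := Tf_tr c tg; have t2 := Tf_tr c t1.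
have FA v (ga : R) p : v = ga *: c -> 1 <= ga <= 2 -> msum K (cone_rect a b 10 10) p -> F (p + v).
  move=> -> hg [q Kq [_ [al + [be + <-]] <-]]; rewrite /= !in_itv/= => ha hb.
  by apply: G2 => //; exact: Kx.
have F1 : zoff F (tr c g).
  by apply: (shift_zoff zg) => p; apply: (FA c 1); rewrite ?scale1r// lexx ler1n.
have F2 : zoff F (tr c (tr c g)).
  rewrite tr_tr; apply: (shift_zoff zg) => p; apply: (FA _ 2); last by rewrite lexx andbT ler1n.
  by rewrite scaler_nat mulr2n.
have N1 : N2 (tr c g) = N2 g := N2_tr c tg.
have N1' : N2 (tr c (tr c g)) = N2 g := etrans (N2_tr c t1) (N2_tr c tg).
have tc1 : Tc Om (tr c g) by exact: Tc_K cF FO (Tf_smooth t1) F1.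
have tc2 : Tc Om (tr c (tr c g)) by exact: Tc_K cF FO (Tf_smooth t2) F2.
have E : u g = u (dir c (dir c psi)) + 2 * u (tr c g) - u (tr c (tr c g)).
  rewrite (dir2_Av2 c tg) (lin_onD du.1 (TcB tcg (TcZ 2 tc1)) tc2) (lin_onB du.1 tcg (TcZ 2 tc1)).
  by rewrite (lin_onZ (@Tc0 R Om) du.1 2 tc1) -cancel5.
have N0 : N2 psi <= N2 g := le_trans (N2_Av c (Tf_Av c tg)) (N2_Av c tg).
have b1 := HF _ (Tf_smooth t1) F1; have b2 := HF _ (Tf_smooth t2) F2; rewrite N1 in b1; rewrite N1' in b2.
have b0 : `|u (dir c (dir c psi))| <= Mc * N2 g := le_wmul (Hc _ tpsi) Mc0 N0.
rewrite E; exact: (base_arith Mc0 C20 b0 b1 b2 H0).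
Qed.

End OneFunction.

Lemma patch : exists2 C' : R, 0 <= C' & forall f, Tc Om f -> zoff (sq x0 dl) f -> `|u f| <= C' * nrm f.
Proof.
have [Ma Ma0 Ha] := u_dirdir a; have [Mb Mb0 Hb] := u_dirdir b; have [Mc Mc0 Hc] := u_dirdir c.
have [C1 C10 H1] := multiscale ab_indep; have [C2 C20 H2] := smoothing0_bound ab_indep.
have [C3 C30 H3] := du.2 F cF FO.
exists ((Ma + Mb) * C1 + (Mc + (2 * C3 + C3)) * C2).
  by rewrite addr_ge0 ?mulr_ge0 ?addr_ge0// mulr_ge0.
move=> f [sf [K0 [cK0 KO0 zf0]]] zx.
pose K := K0 `&` sq x0 dl.
have cK : compact K by apply: compact_closedI => //; apply: compact_closed2; exact: sq_compact.
have KO : K `<=` Om by move=> p [/KO0].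
have Kx : K `<=` sq x0 dl by move=> p [].
have zf : zoff K f by move=> p /not_andP[/zf0|/zx].
have tf := compact_Tf cK sf zf.
have e1 := u_smoothing0 cK KO Kx sf zf Ma0 Mb0 Ha Hb (fun n => H1 n f tf).
have e2 := u_base cK KO Kx sf zf Mc0 C30 Hc H3 (H2 f tf).
rewrite -(subrK (u (smoothing a b 0 f)) (u f)) mulrDl -!mulrA.
by apply: le_trans (ler_normD _ _) _; exact: lerD.
Qed.

End Patch.

(** * The L2 estimate up to a Lipschitz boundary *)

Section Lipschitz.
Context {R : realType}.
Variable Om : set (R * R).
Implicit Types (p q x : R * R).

Definition rct (a b : R * R) : set (R * R) :=
  [set p | (a.1 <= p.1 <= b.1) /\ (a.2 <= p.2 <= b.2)].

Lemma rct_compact a b : compact (rct a b).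
Proof.
have -> : rct a b = `[a.1, b.1]%classic `*` `[a.2, b.2]%classic.
  by apply/seteqP; split => -[p1 p2] /=; rewrite !in_itv.
by apply: compact_setX; exact: segment_compact.
Qed.

(** Near each point of the closure, there are a parallelogram of directions that
    keeps Om inside itself, and a longer translation into a compact subset. *)
Definition patch_at x := exists a b c : R * R, exists (dl : R) (F : set (R * R)),
  [/\ 0 < dl, a.1 * b.2 - a.2 * b.1 != 0, compact F, F `<=` Om &
    (forall p (al be ga : R), Om p -> sq x dl p -> 0 <= al <= 30 -> 0 <= be <= 30 ->
      0 <= ga <= 2 -> Om (p + (al *: a + be *: b) + ga *: c)) /\
    (forall p (al be ga : R), sq x dl p -> 0 <= al <= 10 -> 0 <= be <= 10 ->
      1 <= ga <= 2 -> F (p + (al *: a + be *: b) + ga *: c))].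

Lemma patch_interior x : open Om -> Om x -> patch_at x.
Proof.
move=> oOm Ox; have [r r0 rO] := open_sq oOm Ox; pose d : R := r / 31.
have d0 : 0 < d by rewrite divr_gt0.
exists (d, 0), (0, d), 0, d, (sq x r); split => //=.
- by rewrite mul0r subr0 mulf_neq0// gt_eqF.
- exact: sq_compact.
have H p (al be ga : R) : sq x d p -> 0 <= al <= 30 -> 0 <= be <= 30 ->
    sq x r (p + (al *: (d, 0) + be *: (0, d)) + ga *: 0).
  move=> [p1 p2] /andP[a0 a1] /andP[b0 b1]; rewrite scaler0 addr0.
  have A (t p' x' : R) : 0 <= t -> t <= 30 -> `|p' - x'| <= d -> `|p' + t * d - x'| <= r.
    move=> t0 t1 h; rewrite addrAC; apply: le_trans (ler_normD _ _) _.
    have -> : r = d + 30 * d by rewrite /d; field.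
    apply: lerD => //; rewrite ger0_norm ?mulr_ge0//; last exact: ltW.
    by apply: ler_wpM2r => //; exact: ltW.
  split.
    rewrite -[X in `|X|]/(p.1 + (al * d + be * 0) - x.1) mulr0 addr0; exact: A.
  rewrite -[X in `|X|]/(p.2 + (al * 0 + be * d) - x.2) mulr0 add0r; exact: A.
split => p al be ga.
  by move=> _ px ha hb _; apply: rO; exact: H.
by move=> px /andP[a0 a1] /andP[b0 b1] _; apply: H => //; apply/andP; split => //; lra.
Qed.

Lemma lipschitz_bound (f : R -> R) : lipschitz f -> exists2 L : R, 0 <= L &
  forall s t, `|f s - f t| <= L * `|s - t|.
Proof.
rewrite /lipschitz_on => H.
have [L L0 HL] := pinfty_ex_gt0 H.
exists L; first exact: ltW.
by move=> s t; exact: (HL (s, t)).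
Qed.

Lemma abs_move (d k al be t : R) : 0 <= d -> 0 <= k -> k <= 1 -> 0 <= al -> al <= t ->
  0 <= be -> be <= t -> `|d * k * (al - be)| <= t * d.
Proof.
move=> d0 k0 k1 a0 a1 b0 b1; rewrite normrM ger0_norm ?mulr_ge0// mulrC.
have ab : `|al - be| <= t by rewrite ler_norml; apply/andP; split; lra.
by apply: ler_pM => //; [exact: mulr_ge0|exact: ler_piMr].
Qed.

Lemma move_small (d k al be : R) : 0 <= d -> 0 <= k -> k <= 1 -> 0 <= al -> al <= 30 ->
  0 <= be -> be <= 30 -> `|d * k * (al - be)| <= 30 * d /\ 0 <= d * (al + be) <= 60 * d.
Proof.
move=> d0 k0 k1 a0 a1 b0 b1; split; first exact: abs_move.
by rewrite mulr_ge0 ?addr_ge0//= mulrC ler_wpM2r//; lra.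
Qed.

Lemma lip_move (L d k al be : R) : 0 <= d -> 0 <= k -> L * k <= 1 -> 0 <= al -> 0 <= be ->
  L * `|d * k * (al - be)| <= d * (al + be).
Proof.
move=> d0 k0 Lk a0 b0; rewrite normrM ger0_norm ?mulr_ge0//.
rewrite (_ : L * _ = (L * k) * (d * `|al - be|)); last by ring.
apply: le_trans (_ : 1 * (d * `|al - be|) <= _); first by rewrite ler_wpM2r// mulr_ge0.
rewrite mul1r ler_wpM2l//; apply: le_trans (ler_normB _ _) _.
by rewrite !ger0_norm.
Qed.

Section Chart.
Variables (x : R * R) (cs sn r h : R) (f : R -> R) (L : R).
Hypotheses (cs1 : cs ^+ 2 + sn ^+ 2 = 1) (r0 : 0 < r) (h0 : 0 < h) (L0 : 0 <= L).
Hypothesis Lf : forall s t, `|f s - f t| <= L * `|s - t|.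
Hypothesis Hf : forall y1 y2 : R, `|y1| < r -> `|y2| < h ->
  Om (x.1 + (cs * y1 - sn * y2), x.2 + (sn * y1 + cs * y2)) <-> f y1 < y2.

Definition Y1 p : R := cs * (p.1 - x.1) + sn * (p.2 - x.2).
Definition Y2 p : R := - sn * (p.1 - x.1) + cs * (p.2 - x.2).
Definition chart (y : R * R) : R * R := (x.1 + (cs * y.1 - sn * y.2), x.2 + (sn * y.1 + cs * y.2)).

Lemma chartK p : chart (Y1 p, Y2 p) = p.
Proof.
rewrite /chart /Y1 /Y2 /=.
rewrite (_ : x.1 + _ = p.1); last first.
  transitivity (x.1 + (cs ^+ 2 + sn ^+ 2) * (p.1 - x.1)); first by ring.
  by rewrite cs1; ring.
rewrite (_ : x.2 + _ = p.2) -?surjective_pairing//.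
transitivity (x.2 + (cs ^+ 2 + sn ^+ 2) * (p.2 - x.2)); first by ring.
by rewrite cs1; ring.
Qed.

Lemma Om_chart p : `|Y1 p| < r -> `|Y2 p| < h -> Om p <-> f (Y1 p) < Y2 p.
Proof. by move=> h1 h2; rewrite -[p in Om p]chartK; exact: Hf. Qed.

Lemma cs_le1 : `|cs| <= 1 /\ `|sn| <= 1.
Proof.
have H (a b : R) : a ^+ 2 + b ^+ 2 = 1 -> `|a| <= 1.
  move=> E; rewrite -(ler_pXn2r (n := 2))// ?nnegrE// expr1n real_normK ?num_real// -E lerDl.
  exact: sqr_ge0.
by split; [exact: H cs1|apply: (H _ cs); rewrite addrC].
Qed.

Lemma Y_bound d p : sq x d p -> `|Y1 p| <= 2 * d /\ `|Y2 p| <= 2 * d.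
Proof.
move=> [p1 p2]; have [c1 s1] := cs_le1.
have H (a b u v : R) : `|a| <= 1 -> `|b| <= 1 -> `|u| <= d -> `|v| <= d -> `|a * u + b * v| <= 2 * d.
  move=> a1 b1 u1 v1; apply: le_trans (ler_normD _ _) _; rewrite !normrM.
  have : `|a| * `|u| <= 1 * d by apply: ler_pM.
  have : `|b| * `|v| <= 1 * d by apply: ler_pM.
  lra.
by split; apply: H; rewrite ?normrN.
Qed.

(** The point x has coordinates 0, and it is a limit of points above the graph. *)
Lemma f0_le0 : closure Om x -> f 0 <= 0.
Proof.
move=> clx; rewrite leNgt; apply/negP => f0.
pose M : R := 2 * L + 4; have M0 : 0 < M by rewrite /M ltr_wpDl// mulr_ge0.
pose d : R := Num.min (f 0 / M) (Num.min (r / 4) (h / 4)).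
have d0 : 0 < d by rewrite !lt_min !divr_gt0.
have d1 : d * M <= f 0 by rewrite -ler_pdivlMr// ge_min lexx.
have d2 : d <= r / 4 by rewrite !ge_min lexx orbT.
have d3 : d <= h / 4 by rewrite !ge_min lexx !orbT.
have [p [Op px]] := clx _ (sq_nbhs x d0).
have [y1 y2] := Y_bound px.
have := (Om_chart (_ : `|Y1 p| < r) (_ : `|Y2 p| < h)).1 Op.
have a1 : `|Y1 p| < r by move: y1 d2 r0; lra.
have a2 : `|Y2 p| < h by move: y2 d3 h0; lra.
move=> /(_ a1 a2) E.
have l1 := Lf (Y1 p) 0; rewrite subr0 in l1.
have l2 : L * `|Y1 p| <= L * (2 * d) by rewrite ler_wpM2l.
have l3 := ler_norm (Y2 p).
have l4 : f 0 - f (Y1 p) <= `|f (Y1 p) - f 0| by rewrite distrC ler_norm.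
have l5 : d * M = L * (2 * d) + 4 * d by rewrite /M; ring.
move: E l1 l2 l3 l4 l5 d1 y2 d0; lra.
Qed.

Lemma continuous_chart : continuous chart.
Proof.
have -> : chart = (fun y => x + (y.1 *: (cs, sn) + y.2 *: (- sn, cs))).
  apply/funext => y; rewrite /chart; congr (_, _).
    by rewrite -[RHS]/(x.1 + (y.1 * cs + y.2 * - sn)); ring.
  by rewrite -[RHS]/(x.2 + (y.1 * sn + y.2 * cs)); ring.
move=> y; apply: cvgD; first exact: cvg_cst.
apply: cvgD.
  by apply: (continuous_comp (g := fun s : R => s *: (cs, sn))); [exact: cvg_fst|exact: scalel_continuous].
by apply: (continuous_comp (g := fun s : R => s *: (- sn, cs))); [exact: cvg_snd|exact: scalel_continuous].
Qed.

(** In the chart, a and b point upwards with a slope larger than the Lipschitz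
    constant of the graph, and c points straight up. *)
Lemma patch_chart : closure Om x -> patch_at x.
Proof.
move=> clx; have f0 := f0_le0 clx.
pose mu : R := Num.min r h / 4; have mu0 : 0 < mu by rewrite divr_gt0// lt_min r0.
have mr : 4 * mu <= r by rewrite /mu mulrC divfK// ge_min lexx.
have mh : 4 * mu <= h by rewrite /mu mulrC divfK// ge_min lexx orbT.
pose M : R := L + 1; have M1 : 1 <= M by rewrite /M lerDr. have M0 : 0 < M by exact: lt_le_trans M1.
pose d : R := mu / (100 * M); have d0 : 0 < d by rewrite divr_gt0// mulr_gt0.
have dM : M * d = mu / 100 by rewrite /d; field; rewrite gt_eqF.
have dmu : d <= mu / 100 by rewrite -dM; apply: ler_peMl => //; exact: ltW.
have Ld : L * d <= mu / 100 by rewrite -dM /M mulrDl mul1r lerDl ltW.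
pose k : R := M^-1; have k0 : 0 < k by rewrite invr_gt0.
have k1 : k <= 1 by rewrite invf_le1.
have Lk : L * k <= 1 by rewrite /k ler_pdivrMr// mul1r /M lerDl ler01.
exists (d * (- sn + k * cs), d * (cs + k * sn)), (d * (- sn - k * cs), d * (cs - k * sn)).
exists (- mu * sn, mu * cs), d.
exists (chart @` rct (- (12 * d), mu - 2 * d) (12 * d, 2 * mu + 22 * d)).
have Yq p (al be ga : R) :
    let q := p + (al *: (d * (- sn + k * cs), d * (cs + k * sn)) +
      be *: (d * (- sn - k * cs), d * (cs - k * sn))) + ga *: (- mu * sn, mu * cs) in
    Y1 q = Y1 p + d * k * (al - be) /\ Y2 q = Y2 p + d * (al + be) + ga * mu.
  move=> q; split.
    rewrite /Y1 -[q.1]/(p.1 + (al * (d * (- sn + k * cs)) + be * (d * (- sn - k * cs))) + ga * (- mu * sn)).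
    rewrite -[q.2]/(p.2 + (al * (d * (cs + k * sn)) + be * (d * (cs - k * sn))) + ga * (mu * cs)).
    transitivity (cs * (p.1 - x.1) + sn * (p.2 - x.2) + (cs ^+ 2 + sn ^+ 2) * (d * k * (al - be))); first by ring.
    by rewrite cs1 mul1r.
  rewrite /Y2 -[q.1]/(p.1 + (al * (d * (- sn + k * cs)) + be * (d * (- sn - k * cs))) + ga * (- mu * sn)).
  rewrite -[q.2]/(p.2 + (al * (d * (cs + k * sn)) + be * (d * (cs - k * sn))) + ga * (mu * cs)).
  transitivity (- sn * (p.1 - x.1) + cs * (p.2 - x.2) + (cs ^+ 2 + sn ^+ 2) * (d * (al + be) + ga * mu)); first by ring.
  by rewrite cs1 mul1r addrA.
split => //.
- rewrite -[X in X != 0]/(d * (- sn + k * cs) * (d * (cs - k * sn)) - d * (cs + k * sn) * (d * (- sn - k * cs))).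
  have -> : d * (- sn + k * cs) * (d * (cs - k * sn)) - d * (cs + k * sn) * (d * (- sn - k * cs)) =
    (2 * k * d ^+ 2) * (cs ^+ 2 + sn ^+ 2) by ring.
  by rewrite cs1 mulr1 gt_eqF// mulr_gt0 ?exprn_gt0// mulr_gt0.
- apply: continuous_compact; last exact: rct_compact.
  exact: continuous_subspaceT continuous_chart.
- move=> _ [[y1 y2] [/= /andP[a1 a2] /andP[b1 b2]] <-]; apply/Hf.
  + by apply: le_lt_trans (_ : 12 * d < r); [rewrite ler_norml a1|lra].
  + by rewrite /= ltr_norml; apply/andP; split; move: mu0 dmu mh b1 b2; lra.
  rewrite /=; have l1 := Lf y1 0; rewrite subr0 in l1.
  have l2 : L * `|y1| <= L * (12 * d) by rewrite ler_wpM2l// ler_norml a1.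
  have l3 : f y1 - f 0 <= `|f y1 - f 0| by exact: ler_norm.
  by move: l1 l2 l3 Ld dmu b1 f0 mu0; rewrite mulrCA; lra.
split => p al be ga.
  move=> Op px /andP[a0 a1] /andP[b0 b1] /andP[g0 g1].
  have [E1 E2] := Yq p al be ga; rewrite /= in E1 E2.
  have [y1 y2] := Y_bound px.
  have [n1 /andP[n2 n3]] := move_small (ltW d0) (ltW k0) k1 a0 a1 b0 b1.
  have g2 : 0 <= ga * mu <= 2 * mu by rewrite mulr_ge0 ?(ltW mu0)//= ler_wpM2r// ltW.
  have P1 : `|Y1 p| < r by lra.
  have P2 : `|Y2 p| < h by lra.
  have fy := (Om_chart P1 P2).1 Op.
  apply/Om_chart; rewrite ?E1 ?E2.
  + by apply: le_lt_trans (ler_normD _ _) _; lra.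
  + move: y2 g2; rewrite ler_norml ltr_norml => /andP[u1 u2] /andP[v1 v2].
    by apply/andP; split; lra.
  have l1 := Lf (Y1 p + d * k * (al - be)) (Y1 p); have e : Y1 p + d * k * (al - be) - Y1 p = d * k * (al - be) by rewrite addrAC subrr add0r.
  rewrite e in l1.
  have l2 := lip_move (ltW d0) (ltW k0) Lk a0 b0.
  have l3 := ler_norm (f (Y1 p + d * k * (al - be)) - f (Y1 p)).
  by move: g2 => /andP[v1 v2]; lra.
move=> px /andP[a0 a1] /andP[b0 b1] /andP[g0 g1].
have [E1 E2] := Yq p al be ga; rewrite /= in E1 E2.
have [y1 y2] := Y_bound px.
have n1 : `|d * k * (al - be)| <= 10 * d by exact: abs_move (ltW d0) (ltW k0) k1 a0 a1 b0 b1.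
have n2 : 0 <= d * (al + be) <= 20 * d.
  rewrite mulr_ge0 ?(ltW d0) ?addr_ge0//= mulrC ler_wpM2r ?(ltW d0)//; lra.
have g2 : mu <= ga * mu <= 2 * mu by rewrite ler_peMl ?(ltW mu0)//= ler_wpM2r// ltW.
exists (Y1 p + d * k * (al - be), Y2 p + d * (al + be) + ga * mu).
  move: y1 y2 n1; rewrite /rct /= !ler_norml => /andP[u1 u2] /andP[v1 v2] /andP[w1 w2].
  by move: n2 g2 => /andP[z1 z2] /andP[t1 t2]; split; apply/andP; split; lra.
by rewrite -E1 -E2; exact: chartK.
Qed.

End Chart.

Lemma patch_ex x : open Om -> lipschitz_boundary Om -> closure Om x -> patch_at x.
Proof.
move=> oOm lOm clx; have [Ox|nO] := pselect (Om x); first exact: patch_interior.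
have bx : boundary Om x by split => // /(@interior_subset _ Om).
have [cs [sn [r [h [f [cs1 r0 h0 lf Hf]]]]]] := lOm x bx.
have [L L0 HL] := lipschitz_bound lf.
exact: (patch_chart cs1 r0 h0 L0 HL Hf clx).
Qed.

End Lipschitz.

Section Global.
Context {R : realType}.
Implicit Types (f g h : R * R -> R) (x y p : R * R) (i j : 'I_2).
Variables (Om : set (R * R)) (B : R) (u : (R * R -> R) -> R) (C : R).
Hypothesis oOm : open Om.
Hypothesis lOm : lipschitz_boundary Om.
Hypothesis OB : Om `<=` box B.
Hypothesis du : dist2 Om u.
Hypothesis C0 : 0 <= C.
Hypothesis u2 : forall i j f, Tc Om f -> `|u (partial i (partial j f))| <= C * N2 f.

(** The patches around the points of the compact closure of Om are combined by a
    partition of unity at the scale of a Lebesgue number. *)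
Lemma l2_estimate : exists2 C' : R, 0 <= C' & forall f, Tc Om f -> `|u f| <= C' * nrm f.
Proof.
have clB : closure Om `<=` box B.
  rewrite [X in _ `<=` X](closure_id (box B)).1; last exact: box_closed.
  exact: closureS.
have cK : compact (closure Om).
  by apply: subclosed_compact clB; [exact: closed_closure|exact: box_compact].
pose Q p d := exists2 C' : R, 0 <= C' & forall f, Tc Om f -> zoff (sq p d) f -> `|u f| <= C' * nrm f.
have [d d0 Hd] : exists2 d, 0 < d & forall p, closure Om p -> Q p d.
  apply: (lebesgue_number (Q := Q) cK).
    move=> p r s [C' C'0 H] rs; exists C' => // f tf zf; apply: H => //.
    by apply: zoff_sub zf; exact: sq_le.
  move=> x clx; have [a [b [c [dl [F [dl0 ab cF FO [G1 G2]]]]]]] := patch_ex oOm lOm clx.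
  have [C' C'0 H] := patch du C0 u2 ab G1 cF FO G2.
  exists (dl / 2); first by rewrite divr_gt0.
  move=> y /ball_pairE[h1 h2]; exists C' => // f tf zf; apply: H => //.
  have xy : sq x (dl / 2) y by split; rewrite distrC ltW.
  by apply: zoff_sub zf; apply: subset_trans (sq_trans xy) _; rewrite -splitr.
have d20 : 0 < d / 2 by rewrite divr_gt0.
have [n [y [be [h1 [h2 h3]]]]] := grid_partition B d20.
have H (k : 'I_n * 'I_n) : exists C' : R, 0 <= C' /\ forall f, Tc Om f ->
    `|u (fun x => f x * be k x)| <= C' * nrm f.
  have L0 := @Tc0 R Om.
  have [[p [clp yp]]|no] := pselect (exists p, closure Om p /\ sq (y k) (d / 2) p).
    have [C' C'0 HC] := Hd p clp; have [M M0 HM] := nrm_mul_box B (h1 k).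
    exists (C' * M); split; first exact: mulr_ge0.
    move=> f tf; have [sf [K [cK' KO zf]]] := tf.
    have zB : zoff (box B) f by apply: zoff_sub zf; exact: subset_trans OB.
    have [_ nf] := HM f sf zB.
    rewrite -mulrA; apply: le_trans (HC _ (TcM (h1 k) tf) _) _.
      apply: zoffMr; apply: zoff_sub (h2 k).
      by apply: subset_trans (sq_trans (sq_sym yp)) _; rewrite -splitr.
    exact: ler_wpM2l.
  exists 0; split => // f [sf [K [_ KO zf]]].
  rewrite (_ : (fun x => _) = 0) ?(lin_on0 L0 du.1) ?normr0 ?mul0r//.
  apply/funext => x; have [Kx|/zf->] := pselect (K x); last by rewrite mul0r.
  rewrite [X in _ * X]h2 ?mulr0// => sx; apply: no; exists x; split => //.
  by apply: subset_closure; exact: KO.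
have [C' HC'] := choice H.
exists (\sum_k C' k); first by apply: sumr_ge0 => k _; case: (HC' k).
move=> f tf; have [sf [K [_ KO zf]]] := tf.
have fE : f = \sum_k (fun x => f x * be k x).
  apply/funext => x; rewrite fct_sumE -mulr_sumr.
  have [Kx|/zf->] := pselect (K x); last by rewrite mul0r.
  by rewrite h3 ?mulr1//; apply: OB; exact: KO.
rewrite {1}fE (lin_on_sum (@Tc0 R Om) (@Tc_lin R Om) du.1); last by move=> k; exact: TcM.
rewrite mulr_suml; apply: le_trans (ler_norm_sum _ _ _) _; apply: ler_sum => k _.
exact: (HC' k).2.
Qed.

End Global.

(** * Square integrable functions and the Riesz representation *)

Section Completeness.
Context d (T : measurableType d) (R : realType) (mu : {measure set T -> \bar R}).

Lemma le_amgm (a t : R) : 0 < t -> `|a| <= t + t^-1 * a ^+ 2.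
Proof.
move=> t0; rewrite -(real_normK (num_real a)); set b := `|a|.
have h : t^-1 * (t * b) <= t^-1 * (t ^+ 2 + b ^+ 2).
  by rewrite ler_pM2l ?invr_gt0//; nra.
move: h; rewrite mulKf ?gt_eqF// mulrDr expr2 mulKf ?gt_eqF//.
Qed.

Lemma half_gt0 n : (0 : R) < 2^-1 ^+ n.
Proof. by rewrite exprn_gt0// invr_gt0. Qed.

(** Each increment is at most 2^-k plus 2^k times its square, so the increments
    are summable. *)
Lemma weighted_cvg (f : nat -> R) :
  (\sum_(0 <= k <oo) (2 ^+ k * (f k.+1 - f k) ^+ 2)%:E < +oo)%E -> cvgn f.
Proof.
move=> h.
have c1 : cvgn (series (fun k => 2 ^+ k * (f k.+1 - f k) ^+ 2 : R)).
  apply: nnseries_is_cvg => // k.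
  by apply: mulr_ge0; [rewrite exprn_ge0|rewrite sqr_ge0].
have c2 : cvgn (series (geometric (1 : R) 2^-1)).
  by apply: is_cvg_geometric_series; rewrite gtr0_norm ?invr_gt0// invf_lt1// ltr1n.
have c3 : cvgn (series (geometric (1 : R) 2^-1) +
   series (fun k => 2 ^+ k * (f k.+1 - f k) ^+ 2 : R)) by exact: is_cvgD.
have c4 : cvgn [normed series (telescope f)].
  apply: (@series_le_cvg R _ (geometric (1 : R) 2^-1 +
      (fun k => 2 ^+ k * (f k.+1 - f k) ^+ 2 : R))) => [k|k|k|].
  - exact: normr_ge0.
  - rewrite -[X in _ <= X]/(1 * 2^-1 ^+ k + 2 ^+ k * (f k.+1 - f k) ^+ 2).
    apply: addr_ge0; first by rewrite mul1r ltW// half_gt0.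
    by apply: mulr_ge0; [rewrite exprn_ge0|rewrite sqr_ge0].
  - apply: le_trans (le_amgm _ (half_gt0 k)) _.
    rewrite -[X in _ <= X]/(1 * 2^-1 ^+ k + 2 ^+ k * (f k.+1 - f k) ^+ 2).
    by rewrite -exprVn invrK mul1r.
  - by rewrite seriesD.
have c5 := normed_cvg c4.
have -> : f = (fun n => f 0%N + series (telescope f) n).
  by apply/funext => n; rewrite -eq_sum_telescope.
by apply: is_cvgD => //; exact: is_cvg_cst.
Qed.

Lemma sum_half (n : nat) : \sum_(0 <= k < n) (2^-1 : R) ^+ k = 2 * (1 - 2^-1 ^+ n).
Proof.
elim: n => [|n IH]; first by rewrite big_nil expr0 subrr mulr0.
by rewrite big_nat_recr//= IH exprS; field.
Qed.

Lemma nneseries_le (u : nat -> \bar R) (M : \bar R) : (forall k, (0 <= u k)%E) ->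
  (forall n, (\sum_(0 <= k < n) u k <= M)%E) -> (\sum_(0 <= k <oo) u k <= M)%E.
Proof.
move=> u0 h; apply: lime_le; first by apply: is_cvg_nneseries.
exact: nearW.
Qed.

Lemma limn_einf_le (u : nat -> \bar R) (M : \bar R) : (forall k, (u k <= M)%E) ->
  (limn_einf u <= M)%E.
Proof.
move=> h; rewrite limn_einf_lim; apply: lime_le; first exact: is_cvg_einfs.
apply: nearW => n; apply: le_trans (h n).
by apply: ereal_inf_lbound; exists n => /=.
Qed.

Lemma limn_einf_ge0 (u : nat -> \bar R) : (forall k, (0 <= u k)%E) -> (0 <= limn_einf u)%E.
Proof.
move=> h; rewrite limn_einf_lim; apply: lime_ge; first exact: is_cvg_einfs.
apply: nearW => n; apply: le_ereal_inf_tmp => _ [k _ <-]; exact: h.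
Qed.

Lemma esqr_measurable (f : T -> R) : measurable_fun setT f ->
  measurable_fun setT (fun x => (f x ^+ 2)%:E).
Proof. by move=> mf; apply/measurable_EFinP; exact: measurable_funX. Qed.

(** The limit exists almost everywhere because the weighted sum of the squared
    increments has a finite integral; the upper limit, made finite, is a measurable
    representative, and the estimate follows from the lemma of Fatou. *)
Lemma L2_complete (f : nat -> T -> R) (K : R) : 0 <= K ->
  (forall n, measurable_fun setT (f n)) ->
  (forall n m, (n <= m)%N ->
     (\int[mu]_x ((f m x - f n x) ^+ 2)%:E <= (K * 4^-1 ^+ n)%:E)%E) ->
  exists2 g : T -> R, measurable_fun setT g &
    forall n, (\int[mu]_x ((g x - f n x) ^+ 2)%:E <= (K * 4^-1 ^+ n)%:E)%E.
Proof.
move=> K0 mf hf.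
pose S x := (\sum_(0 <= k <oo) (2 ^+ k * (f k.+1 x - f k x) ^+ 2)%:E)%E.
have t0 k x : (0 <= (2 ^+ k * (f k.+1 x - f k x) ^+ 2)%:E :> \bar R)%E.
  by rewrite lee_fin; apply: mulr_ge0; [rewrite exprn_ge0|rewrite sqr_ge0].
have md n m : measurable_fun setT (fun x => f m x - f n x).
  exact: measurable_funB.
have mt k : measurable_fun setT (fun x => (2 ^+ k * (f k.+1 x - f k x) ^+ 2)%:E).
  apply/measurable_EFinP; apply: measurable_funM; first exact: measurable_cst.
  exact: measurable_funX.
have mS : measurable_fun setT S.
  by apply: ge0_emeasurable_sum => // k x _ _; exact: t0.
have iS : (\int[mu]_x S x <= (2 * K)%:E)%E.
  rewrite integral_nneseries//.
  apply: nneseries_le => [k|n]; first by apply: integral_ge0 => x _; exact: t0.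
  apply: (@le_trans _ _ (\sum_(0 <= k < n) (K * 2^-1 ^+ k)%:E)%E).
    apply: lee_sum => k _.
    under eq_integral do rewrite EFinM.
    rewrite ge0_integralZl//; last 2 first.
    - exact: esqr_measurable.
    - by move=> x _; rewrite lee_fin sqr_ge0.
    have e : K * 2^-1 ^+ k = 2 ^+ k * (K * 4^-1 ^+ k) :> R.
      rewrite mulrCA; congr (_ * _); rewrite -exprMn; congr (_ ^+ _); by field.
    rewrite e EFinM; apply: lee_pmul => //.
      by apply: integral_ge0 => x _; rewrite lee_fin sqr_ge0.
    exact: (hf k k.+1).
  rewrite sumEFin lee_fin -mulr_sumr sum_half mulrCA ler_pM2l// ler_piMr//.
have S0 x : (0 <= S x)%E by apply: nneseries_ge0 => k _ _; exact: t0.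
have aeS : \forall x \ae mu, setT x -> S x \is a fin_num.
  apply: integrable_ae => //; apply/integrableP; split => //.
  under eq_integral do rewrite gee0_abs//.
  by apply: le_lt_trans iS _; rewrite ltry.
pose g x := fine (limn_esup (fun n => (f n x)%:E)).
have mg : measurable_fun setT g.
  apply: measurableT_comp => //; apply: measurable_fun_limn_esup => n.
  exact/measurable_EFinP.
have cg x : S x \is a fin_num -> f n x @[n --> \oo] --> g x.
  move=> Sx; have cf : cvgn (f ^~ x) by apply: weighted_cvg; rewrite ltey_eq Sx.
  rewrite /g; have -> : limn_esup (fun n => (f n x)%:E) = (limn (f ^~ x))%:E.
    have cE : (f n x)%:E @[n --> \oo] --> (limn (f ^~ x))%:E.
      by apply: cvg_EFin; [exact: nearW|exact: cf].
    by have [_ ->] := cvg_limn_einf_sup cE.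
  exact: cf.
exists g => // n.
have mgn : measurable_fun setT (fun x => ((g x - f n x) ^+ 2)%:E).
  by apply: esqr_measurable; exact: measurable_funB.
have mi : measurable_fun setT
    (fun x => limn_einf (fun m => ((f (m + n)%N x - f n x) ^+ 2)%:E)).
  under eq_fun do rewrite -[limn_einf _]oppeK -limn_esupN.
  apply: measurableT_comp => //; apply: measurable_fun_limn_esup => m.
  by apply: measurableT_comp => //; exact: esqr_measurable.
rewrite (@ge0_ae_eq_integral _ _ _ mu setT _
  (fun x => limn_einf (fun m => ((f (m + n)%N x - f n x) ^+ 2)%:E)))//.
- apply: (@le_trans _ _ (limn_einf (fun m => \int[mu]_x ((f (m + n)%N x - f n x) ^+ 2)%:E)))%E.
    apply: fatou => // [m|m x _]; first exact: esqr_measurable.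
    by rewrite lee_fin sqr_ge0.
  by apply: limn_einf_le => m; apply: hf; rewrite leq_addl.
- by move=> x _; rewrite lee_fin sqr_ge0.
- move=> x _; apply: limn_einf_ge0 => m; by rewrite lee_fin sqr_ge0.
apply: filterS aeS => x /(_ Logic.I) Sx _.
have c : ((f (m + n)%N x - f n x) ^+ 2)%:E @[m --> \oo] --> ((g x - f n x) ^+ 2)%:E.
  have c0 : f (m + n)%N x @[m --> \oo] --> g x by apply: cvg_comp (cg x Sx); exact: cvg_addnr.
  have c1 : f (m + n)%N x - f n x @[m --> \oo] --> g x - f n x.
    by apply: cvgB => //; exact: cvg_cst.
  apply: cvg_EFin; first exact: nearW.
  rewrite expr2; under eq_fun do rewrite /= expr2.
  exact: cvgM.
by have [-> _] := cvg_limn_einf_sup c.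
Qed.

End Completeness.

Section SquareIntegrable.
Context {R : realType}.
Implicit Types (f g : R * R -> R) (i j : 'I_2) (Om : set (R * R)).
Local Notation mu2 := (@lebesgue2 R).
Local Notation MP := (measurableTypeR R * measurableTypeR R)%type.
Local Notation L2f := (Lfun mu2 2%:E).

(** The square of the L2 norm, with values in the extended reals. *)
Definition Q f : \bar R := (\int[mu2]_x (f x ^+ 2)%:E)%E.

Definition norm2 f : R := fine ('N[mu2]_2%:E[EFin \o f])%E.

Lemma Q_ge0 f : (0 <= Q f)%E.
Proof. by apply: integral_ge0 => x _; rewrite lee_fin sqr_ge0. Qed.

Lemma Lnorm2E f : ('N[mu2]_2%:E[EFin \o f] = Q f `^ 2^-1)%E.
Proof.
rewrite unlock /Q; congr (_ `^ _)%E; apply: eq_integral => x _.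
by rewrite /= -[2]/(2%:R) powR_mulrn// real_normK// num_real.
Qed.

Lemma sqrt_sqr (x : \bar R) : (0 <= x)%E -> ((x `^ 2^-1) ^+ 2 = x)%E.
Proof.
move=> x0; rewrite expe2 -poweRD//; last first.
  by rewrite /poweRD_def; apply/implyP => /eqP; lra.
by rewrite (_ : 2^-1 + 2^-1 = 1 :> R) ?poweRe1//; lra.
Qed.

Lemma Lnorm2_sqr f : ('N[mu2]_2%:E[EFin \o f] ^+ 2 = Q f)%E.
Proof. by rewrite Lnorm2E sqrt_sqr// Q_ge0. Qed.

Lemma L2norm_sqr Om g : (L2norm Om g ^+ 2 = Q (g \_ Om))%E.
Proof. exact: Lnorm2_sqr. Qed.

Lemma Lfun2P f : f \in L2f <-> measurable_fun (setT : set MP) f /\ (Q f < +oo)%E.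
Proof.
have e : (Q f < +oo)%E <-> finite_norm mu2 2%:E f.
  rewrite /finite_norm -Lnorm2_sqr; split => [|h]; last by rewrite expe2 lte_mul_pinfty// ?Lnorm_ge0// ge0_fin_numE// Lnorm_ge0.
  by case: ('N[mu2]_2%:E[EFin \o f])%E => [r||]//=; rewrite ?ltry// expe2.
split.
  by case/andP; rewrite !inE /= => mf h; split => //; exact/e.
by case=> mf h; apply/andP; rewrite !inE /=; split => //; exact/e.
Qed.

Lemma norm2_ge0 f : 0 <= norm2 f.
Proof. by apply: fine_ge0; exact: Lnorm_ge0. Qed.

Lemma norm2E f : f \in L2f -> ('N[mu2]_2%:E[EFin \o f] = (norm2 f)%:E)%E.
Proof.
case/andP => _; rewrite inE /= /finite_norm => h; rewrite fineK//.
by rewrite ge0_fin_numE// Lnorm_ge0.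
Qed.

Lemma norm2_sqr f : f \in L2f -> Q f = (norm2 f ^+ 2)%:E.
Proof. by move=> lf; rewrite -Lnorm2_sqr norm2E// EFin_expe. Qed.

Lemma norm2_le f (a : R) : 0 <= a -> f \in L2f -> (Q f <= (a ^+ 2)%:E)%E -> norm2 f <= a.
Proof.
move=> a0 lf; rewrite norm2_sqr// lee_fin => h.
by rewrite -(@ler_pXn2r _ 2)// ?nnegrE// norm2_ge0.
Qed.

Lemma Q_Tf f : Tf f -> Q f = (nrm f ^+ 2)%:E.
Proof.
move=> tf; rewrite nrm_sqr.
Transparent ip I.
rewrite /ip /I /Q fineK; first by apply: eq_integral => x _; rewrite expr2.
by apply: integrable_fin_num => //; exact: Tf_integrable (TfMM tf tf).
Qed.
Opaque ip I.

Lemma Tf_Lfun f : Tf f -> f \in L2f.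
Proof.
move=> tf; apply/Lfun2P; split; last by rewrite Q_Tf// ltry.
by apply: continuous_measurable2; apply: smooth_continuous; exact: Tf_smooth.
Qed.

Lemma norm2_Tf f : Tf f -> norm2 f = nrm f.
Proof.
move=> tf; have := norm2_sqr (Tf_Lfun tf); rewrite Q_Tf// => -[] /eqP.
by rewrite eqrXn2// ?nrm_ge0 ?norm2_ge0// => /eqP ->.
Qed.

Lemma mul_integrable f g : f \in L2f -> g \in L2f ->
  mu2.-integrable setT (EFin \o (fun x => f x * g x)).
Proof. by move=> lf lg; apply/Lfun1_integrable; exact: Lfun2_mul_Lfun1. Qed.

(** The L2 pairing; on test functions it is the inner product ip. *)
Definition pair f g : R := (\int[mu2]_x (f x * g x)).

Lemma pair_le f g : f \in L2f -> g \in L2f -> `|pair f g| <= norm2 f * norm2 g.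
Proof.
move=> lf lg; have ig := mul_integrable lf lg.
apply: le_trans (le_normr_Rintegral measurableT ig) _.
rewrite -lee_fin EFinM -norm2E// -norm2E//.
have [mf _] := Lfun2P f. have [mf1 _] := mf lf.
have [mg _] := Lfun2P g. have [mg1 _] := mg lg.
apply: le_trans (hoelder mu2 mf1 mg1 _ _ _) => //; last by lra.
rewrite Lnorm1 fineK//.
have /integrableP[mh h] := ig; rewrite ge0_fin_numE//.
by apply: integral_ge0.
Qed.

Lemma pairDl f g h : f \in L2f -> g \in L2f -> h \in L2f -> pair (f + g) h = pair f h + pair g h.
Proof.
move=> lf lg lh; rewrite /pair -RintegralD//; [|exact: mul_integrable..].
by apply: eq_Rintegral => x _; rewrite -mulrDl.
Qed.

Lemma pair_ip f g : pair f g = ip f g.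
Proof. by []. Qed.

Lemma patch_zoff Om f : zoff Om f -> f \_ Om = f.
Proof.
move=> zf; apply/funext => x; rewrite patchE; case: ifPn => // /negP h.
by rewrite zf// => /mem_set.
Qed.

Lemma Tc_zoff Om f : Tc Om f -> zoff Om f.
Proof. by move=> [_ [K [_ KO zf]]]; exact: zoff_sub zf. Qed.

Lemma distr_ofE Om g (phi : testfun Om) : zoff Om phi ->
  distr_of Om g phi = pair (g \_ Om) phi.
Proof.
move=> z; rewrite /distr_of /pair [LHS]Rintegral_mkcond.
apply: eq_Rintegral => x _; rewrite !patchE; case: ifPn => //.
by move=> _; rewrite mul0r.
Qed.

End SquareIntegrable.

Section AbstractRiesz.
Context {R : realType}.
Variables (P : (R * R -> R) -> Prop) (B : (R * R -> R) -> (R * R -> R) -> R).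
Hypotheses (P0 : P 0) (Plin : forall (a : R) f g, P f -> P g -> P (a *: f + g)).
Hypotheses (Blin : forall h, P h -> linear_on P (fun f => B f h)).
Hypotheses (BC : forall f g, B f g = B g f) (B0 : forall f, 0 <= B f f).
Implicit Types (f g h : R * R -> R).

Lemma form_expand f g (a : R) : P f -> P g ->
  B (a *: f + g) (a *: f + g) = a ^+ 2 * B f f + 2 * a * B g f + B g g.
Proof.
move=> pf pg; have ps := Plin a pf pg.
rewrite (Blin ps a pf pg) (BC f) (BC g (_ + _)) (Blin pf a pf pg) (Blin pg a pf pg).
rewrite (BC f g); ring.
Qed.

Lemma energy_lower (q C x : R) : 0 <= q -> `|x| <= C * q -> - C ^+ 2 <= q ^+ 2 - 2 * x.
Proof.
move=> q0 h; have h2 := le_trans (ler_norm x) h.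
have : 0 <= (q - C) ^+ 2 by exact: sqr_ge0.
by rewrite sqrrB; lra.
Qed.

Lemma le_of_sqr (s c : R) : 0 <= c -> s ^+ 2 <= c * s -> s <= c.
Proof.
move=> c0 h; case: (leP s 0) => [s0|s0]; first exact: le_trans c0.
by move: h; rewrite expr2 ler_pM2r.
Qed.

(** The Riesz theorem for a form on an incomplete space: the representing vector
    is replaced by a minimizing sequence of B f f - 2 F f. At an almost minimal
    point the quadratic inequality in the size of a perturbation bounds the
    residual B (phi n) - F. *)
Lemma riesz_sequence (F : (R * R -> R) -> R) (C : R) :
  linear_on P F -> (forall f, P f -> `|F f| <= C * Num.sqrt (B f f)) ->
  exists phi : nat -> R * R -> R, forall n, P (phi n) /\
    forall f, P f -> `|B (phi n) f - F f| <= 2^-1 ^+ n * Num.sqrt (B f f).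
Proof.
move=> lF bF; pose J f : R := B f f - 2 * F f.
have Jlb f : P f -> - C ^+ 2 <= J f.
  move=> pf; rewrite /J -(sqr_sqrtr (B0 f)).
  by apply: energy_lower; [exact: sqrtr_ge0|exact: bF].
pose S := [set J f | f in P].
have hS : has_inf S.
  split; first by exists (J 0), 0.
  by exists (- C ^+ 2) => _ [f pf <-]; exact: Jlb.
have E n : exists f, P f /\ J f < inf S + 4^-1 ^+ n.
  have p4 : (0 : R) < 4^-1 ^+ n by rewrite exprn_gt0// invr_gt0.
  by have [_ [f pf <-] h] := inf_adherent p4 hS; exists f.
have [phi hphi] := choice E; exists phi => n; have [pn Jn] := hphi n.
(* J (t f + phi n) is at least the infimum for every t: take the discriminant. *)
split => // f pf; set b := _ - _.
have e4 : (4^-1 : R) ^+ n = (2^-1 ^+ n) ^+ 2.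
  by rewrite -exprM mulnC exprM; congr (_ ^+ _); field.
have h : b ^+ 2 <= 4^-1 ^+ n * B f f.
  apply: quad_disc => [| |t]; [by rewrite ltW// exprn_gt0// invr_gt0|exact: B0|].
  have ps := Plin t pf pn.
  have : inf S <= J (t *: f + phi n) by apply: ge_inf; [exact: hS.2|exists (t *: f + phi n)].
  move: Jn; rewrite /J (form_expand t pf pn) (lF t f _ pf pn) /b.
  move: (inf S) (B _ _) (B f f) (B _ f) (F f) (F (phi n)) (4^-1 ^+ n) => *; nra.
rewrite -(@ler_pXn2r _ 2)// ?nnegrE ?normr_ge0//.
by rewrite real_normK ?num_real// exprMn -e4 sqr_sqrtr.
Qed.

Lemma riesz_cauchy (F : (R * R -> R) -> R) f g (a b : R) : 0 <= a + b -> P f -> P g ->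
  (forall h, P h -> `|B f h - F h| <= a * Num.sqrt (B h h)) ->
  (forall h, P h -> `|B g h - F h| <= b * Num.sqrt (B h h)) ->
  Num.sqrt (B (g - f) (g - f)) <= a + b.
Proof.
move=> ab pf pg hf hg.
have e : g - f = (- 1) *: f + g by rewrite scaleN1r addrC.
have ph : P (g - f) by rewrite e; exact: Plin.
apply: le_of_sqr => //; rewrite sqr_sqrtr//.
have E : B (g - f) (g - f) = B g (g - f) - B f (g - f).
  by rewrite {1}e (Blin ph (- 1) pf pg) mulN1r addrC.
rewrite [X in X <= _]E; apply: (@le_trans _ _ (`|B g (g - f) - F (g - f)| + `|B f (g - f) - F (g - f)|)).
  apply: le_trans (ler_normB _ _); apply: le_trans (ler_norm _).
  by rewrite opprB addrA subrK.
by rewrite addrC mulrDl; apply: lerD; [exact: hf|exact: hg].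
Qed.

End AbstractRiesz.

Section Limits.
Context {R : realType}.
Implicit Types (f g : R * R -> R) (i j : 'I_2) (Om : set (R * R)).
Local Notation mu2 := (@lebesgue2 R).
Local Notation MP := (measurableTypeR R * measurableTypeR R)%type.
Local Notation L2f := (Lfun mu2 2%:E).

Lemma Lfun_sub f g : f \in L2f -> g \in L2f -> f - g \in L2f.
Proof. move=> lf lg; have p1 : (1 <= 2%:E :> \bar R)%E by rewrite lee_fin ler1n.
have h := @Lfun_submod_closed _ _ _ mu2 _ p1.
have [_ hl] := h; rewrite (_ : f - g = (- 1) *: g + f); first exact: hl.
by rewrite scaleN1r addrC.
Qed.

Lemma Lfun_of_sub f g : f - g \in L2f -> g \in L2f -> f \in L2f.
Proof. move=> lf lg; have p1 : (1 <= 2%:E :> \bar R)%E by rewrite lee_fin ler1n.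
have h := @Lfun_submod_closed _ _ _ mu2 _ p1.
have [_ hl] := h; rewrite (_ : f = 1 *: (f - g) + g); first exact: hl.
by rewrite scale1r subrK.
Qed.

Lemma pairBl f g h : f \in L2f -> g \in L2f -> h \in L2f ->
  pair (f - g) h = pair f h - pair g h.
Proof.
move=> lf lg lh; apply/esym/eqP; rewrite subr_eq -(pairDl (Lfun_sub lf lg) lg lh).
by rewrite subrK.
Qed.

Lemma measurable_patch Om f : open Om -> measurable_fun (setT : set MP) f ->
  measurable_fun (setT : set MP) (f \_ Om).
Proof.
move=> oOm mf; apply/(measurable_restrictT f (open_measurable2 oOm)).
exact: measurable_funTS.
Qed.

(** The limit is cut off outside Om, which the approximating functions do not
    see. *)
Lemma test_complete Om (phi : nat -> R * R -> R) (K : R) : open Om -> 0 <= K ->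
  (forall n, Tc Om (phi n)) ->
  (forall n m, (n <= m)%N -> nrm (phi m - phi n) <= K * 2^-1 ^+ n) ->
  exists g, [/\ g \in L2f, g \_ Om = g &
    forall n, norm2 (g - phi n) <= K * 2^-1 ^+ n].
Proof.
move=> oOm K0 tphi hphi.
have TB n m : Tf (phi m - phi n) by apply: TfB; apply: Tc_Tf (tphi _).
have mphi n : measurable_fun (setT : set MP) (phi n).
  by apply: continuous_measurable2; apply: smooth_continuous; exact: Tc_smooth (tphi n).
have e4 n : (K ^+ 2 * 4^-1 ^+ n = (K * 2^-1 ^+ n) ^+ 2 :> R).
  by rewrite exprMn; congr (_ * _); rewrite -exprM mulnC exprM; congr (_ ^+ _); field.
have a0 n : 0 <= K * 2^-1 ^+ n by rewrite mulr_ge0// ltW// half_gt0.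
have [|n m nm|g0 mg0 hg0] := @L2_complete _ MP R mu2 phi (K ^+ 2) _ mphi.
- exact: sqr_ge0.
- have -> : (\int[mu2]_x ((phi m x - phi n x) ^+ 2)%:E)%E = Q (phi m - phi n) by [].
  rewrite (Q_Tf (TB n m)) lee_fin e4.
  by apply: lerXn2r; rewrite ?nnegrE ?nrm_ge0 ?a0//; exact: hphi.
pose g : R * R -> R := g0 \_ Om.
have mg : measurable_fun (setT : set MP) g by exact: measurable_patch.
have gphi n : (Q (g - phi n)%R <= ((K * 2^-1 ^+ n) ^+ 2)%:E)%E.
  rewrite -e4; apply: le_trans (hg0 n); apply: ge0_le_integral => //.
  - by move=> x _; rewrite lee_fin sqr_ge0.
  - by apply: esqr_measurable; exact: measurable_funB.
  - by apply: esqr_measurable; exact: measurable_funB.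
  - move=> x _; rewrite lee_fin -[(g - phi n) x]/(g x - phi n x) /g patchE.
    case: ifPn => // /negP xO; have -> : phi n x = 0.
      by apply: (Tc_zoff (tphi n)) => Ox; apply: xO; exact: mem_set.
    by rewrite subr0 expr0n sqr_ge0.
have lphi n : phi n \in L2f by apply: Tf_Lfun; exact: Tc_Tf (tphi n).
have lgn n : g - phi n \in L2f.
  apply/Lfun2P; split; first exact: measurable_funB.
  by apply: le_lt_trans (gphi n) _; rewrite ltry.
have lg : g \in L2f by exact: (Lfun_of_sub (lgn 0%N) (lphi 0%N)).
exists g; split => //; first by rewrite /g -patch_setI setIid.
by move=> n; apply: norm2_le.
Qed.

Lemma pair_approx f g h (a : R) : f \in L2f -> Tf g -> Tf h -> norm2 (f - g) <= a ->
  `|pair f h - ip g h| <= a * nrm h.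
Proof.
move=> lf tg th le; have lg := Tf_Lfun tg; have lh := Tf_Lfun th.
rewrite -pair_ip -(pairBl lf lg lh); apply: le_trans (pair_le (Lfun_sub lf lg) lh) _.
by rewrite (norm2_Tf th); apply: ler_wpM2r => //; exact: nrm_ge0.
Qed.

Lemma eq_limit (x y : R) (z : nat -> R) (a b : R) :
  (forall n, `|x - z n| <= a * 2^-1 ^+ n) -> (forall n, `|z n - y| <= b * 2^-1 ^+ n) ->
  x = y.
Proof.
move=> hx hy; apply/eqP; rewrite -subr_eq0 -normr_le0.
apply: (@small_le0 _ _ (a + b)) => n; rewrite mulrDl.
by apply: le_trans (lerD (hx n) (hy n)); apply: le_trans (ler_normD _ _); rewrite addrA subrK.
Qed.

Lemma le_limit (x c : R) (z : nat -> R) (a : R) :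
  (forall n, `|x - z n| <= a * 2^-1 ^+ n) -> (forall n, `|z n| <= c) -> `|x| <= c.
Proof.
move=> hx hz; rewrite -subr_le0; apply: (@small_le0 _ _ a) => n.
rewrite lerBlDr; apply: le_trans (lerD (hx n) (hz n)).
by apply: le_trans (ler_normD _ _); rewrite subrK.
Qed.

End Limits.

(** * Sobolev norms and the biharmonic energy *)

Section SobolevNorms.
Context {R : realType}.
Implicit Types (f g : R * R -> R) (i j : 'I_2) (Om : set (R * R)).
Local Notation mu2 := (@lebesgue2 R).
Local Notation L2f := (Lfun mu2 2%:E).

Definition D a b f := iter a (partial 0) (iter b (partial 1) f).

Lemma D_Tc Om a b f : Tc Om f -> Tc Om (D a b f).
Proof.
have itr i n g : Tc Om g -> Tc Om (iter n (partial i) g).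
  by elim: n => //= n IH tg; apply: Tc_partial; exact: IH.
by move=> tf; exact: (itr 0 a _ (itr 1 b _ tf)).
Qed.

Lemma sqr_sqrt_e (c : R) : 0 <= c -> (((c ^+ 2)%:E `^ 2^-1) = c%:E)%E.
Proof.
by move=> c0; rewrite poweR_EFin -powR_mulrn// -powRrM divff// powRr1.
Qed.

Lemma sobolev_normE Om k (h : nat -> nat -> R * R -> R) : sobolev_norm Om k h =
  ((\sum_(a < k.+1) \sum_(b < k.+1 | (a + b <= k)%N) Q (h a b \_ Om)) `^ 2^-1)%E.
Proof.
rewrite /sobolev_norm; congr (_ `^ _)%E.
by apply: eq_bigr => a _; apply: eq_bigr => b _; rewrite L2norm_sqr.
Qed.

Lemma sobolev_term Om k h (a b : nat) : (a + b <= k)%N ->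
  (Q (h a b \_ Om) `^ 2^-1 <= sobolev_norm Om k h)%E.
Proof.
move=> abk; rewrite sobolev_normE; apply: gt0_ler_poweR => //.
- by rewrite in_itv /= Q_ge0 leey.
- rewrite in_itv /= leey andbT; apply: sume_ge0 => ? _.
  by apply: sume_ge0 => ? _; exact: Q_ge0.
have ak : (a < k.+1)%N by rewrite ltnS; apply: leq_trans abk; exact: leq_addr.
have bk : (b < k.+1)%N by rewrite ltnS; apply: leq_trans abk; exact: leq_addl.
rewrite (bigD1 (Ordinal ak))//= (bigD1 (Ordinal bk))//= -addeA leeDl//.
apply: adde_ge0; first by apply: sume_ge0 => ? _; exact: Q_ge0.
by apply: sume_ge0 => ? _; apply: sume_ge0 => ? _; exact: Q_ge0.
Qed.

Lemma sobolev_le Om k h (c : R) : 0 <= c ->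
  (forall a b, (a + b <= k)%N -> (Q (h a b \_ Om) <= (c ^+ 2)%:E)%E) ->
  (sobolev_norm Om k h <= (k.+1%:R * c)%:E)%E.
Proof.
move=> c0 hc; have kc : 0 <= k.+1%:R * c by rewrite mulr_ge0.
rewrite sobolev_normE -(sqr_sqrt_e kc); apply: gt0_ler_poweR => //.
- rewrite in_itv /= leey andbT; apply: sume_ge0 => ? _.
  by apply: sume_ge0 => ? _; exact: Q_ge0.
- by rewrite in_itv /= leey andbT lee_fin sqr_ge0.
apply: (@le_trans _ _ (\sum_(a < k.+1) \sum_(b < k.+1) (c ^+ 2)%:E)%E).
  apply: lee_sum => a _; rewrite [X in (_ <= X)%E](bigID (fun b : 'I_k.+1 => (a + b <= k)%N))/=.
  apply: (@le_trans _ _ (\sum_(b < k.+1 | (a + b <= k)%N) (c ^+ 2)%:E)%E).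
    by apply: lee_sum => b; exact: hc.
  by apply: leeDl; apply: sume_ge0 => ? _; rewrite lee_fin sqr_ge0.
rewrite !sumEFin lee_fin; under eq_bigr do rewrite sumr_const card_ord.
rewrite sumr_const card_ord -(mulr_natl (c ^+ 2) k.+1) -(mulr_natl (_ * _) k.+1).
by rewrite mulrA -expr2 -exprMn.
Qed.

Lemma test_derivsE Om (phi : testfun Om) a b : test_derivs phi a b = D a b phi.
Proof. by []. Qed.

End SobolevNorms.

Section TestFunctionsOfOm.
Context {R : realType} (Om : set (R * R)).
Implicit Types (f g : R * R -> R) (i j : 'I_2) (phi : testfun Om) (T : testfun Om -> R).

Lemma is_testP f : is_test Om f <-> Tc Om f.
Proof.
split=> [[sf cf fO]|[sf [K [cK KO zf]]]].
  split; first by rewrite SmoothE.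
  exists (supp f); split => // x xs; apply/eqP; apply: contra_notT xs.
  exact: (@subset_closure _ [set x | f x != 0]).
have sK : supp f `<=` K.
  rewrite /supp [X in _ `<=` X](closure_id K).1; last exact: compact_closed2.
  apply: closureS => x /= fx; apply: contrapT => xK; move: fx; by rewrite zf ?eqxx.
split; first by rewrite -SmoothE.
  exact: (sub_supp_compact cK).
exact: subset_trans KO.
Qed.

Lemma testfun_Tc phi : Tc Om phi.
Proof. by apply/is_testP; exact: (set_mem (testfunP phi)). Qed.

Definition mk_test f (tf : Tc Om f) : testfun Om :=
  TestFun (mem_set ((is_testP f).2 tf) : f \in testfun_pred Om).

(** A distribution as a functional on plain functions, where no proof of
    membership is carried along; 0 is a default value. *)
Definition ext T f : R :=
  if pselect (Tc Om f) is left tf then T (mk_test tf) else 0.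

Lemma ext_mk T f (tf : Tc Om f) : ext T f = T (mk_test tf).
Proof.
rewrite /ext; case: pselect => // tf'; congr (T _); exact: val_inj.
Qed.

Lemma extE T phi : ext T phi = T phi.
Proof. by rewrite (ext_mk T (testfun_Tc phi)); congr (T _); exact: val_inj. Qed.

Lemma ext_linear T : scalar T -> linear_on (Tc Om) (ext T).
Proof.
move=> lT a f g tf tg; rewrite (ext_mk T (Tc_lin a tf tg)) (ext_mk T tf) (ext_mk T tg).
by rewrite -[RHS]lT; congr (T _); exact: val_inj.
Qed.

Lemma scalar_ext (u : (R * R -> R) -> R) :
  linear_on (Tc Om) u -> scalar (fun phi => u phi).
Proof. by move=> lu a f g; exact: (lu a _ _ (testfun_Tc f) (testfun_Tc g)). Qed.

Lemma Q_test f : Tc Om f -> Q (f \_ Om) = (nrm f ^+ 2)%:E.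
Proof. by move=> tf; rewrite (patch_zoff (Tc_zoff tf)) Q_Tf//; exact: Tc_Tf tf. Qed.

(** The estimate is put in a form that does not mention the norm of H^k: the
    bound M of the derivatives up to order k stands for it. *)
Lemma Hminus_ext k T : Hminus k T -> linear_on (Tc Om) (ext T) /\
  exists2 C : R, 0 <= C & forall f (M : R), Tc Om f -> 0 <= M ->
    (forall a b, (a + b <= k)%N -> nrm (D a b f) <= M) -> `|ext T f| <= C * M.
Proof.
move=> [lT [C hC]]; split; first exact: ext_linear.
exists (`|C| * k.+1%:R) => [|f M tf M0 hM]; first by rewrite mulr_ge0.
rewrite (ext_mk T tf) -lee_fin; apply: le_trans (hC _) _.
rewrite -mulrA EFinM.
apply: (@le_trans _ _ (`|C|%:E * sobolev_norm Om k (test_derivs (mk_test tf)))%E).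
  by apply: lee_wpmul2r; [exact: poweR_ge0|rewrite lee_fin ler_norm].
apply: lee_wpmul2l; first by rewrite lee_fin.
apply: sobolev_le => // a b ab; rewrite test_derivsE Q_test; last exact: D_Tc.
by rewrite lee_fin; apply: lerXn2r; rewrite ?nnegrE ?nrm_ge0//; exact: hM.
Qed.

Lemma nrm_le_sobolev k phi a b : (a + b <= k)%N ->
  ((nrm (D a b phi))%:E <= sobolev_norm Om k (test_derivs phi))%E.
Proof.
move=> ab; have := sobolev_term Om (test_derivs phi) ab.
rewrite test_derivsE Q_test ?sqr_sqrt_e ?nrm_ge0//; apply: D_Tc; exact: testfun_Tc.
Qed.

Lemma Hminus_intro k (u : (R * R -> R) -> R) (C : R) : linear_on (Tc Om) u -> 0 <= C ->
  (forall f (M : R), Tc Om f -> 0 <= M ->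
    (forall a b, (a + b <= k)%N -> nrm (D a b f) <= M) -> `|u f| <= C * M) ->
  Hminus k (fun phi : testfun Om => u phi).
Proof.
move=> lu C0 hu; split; first exact: scalar_ext.
exists (C + 1) => phi; set S := sobolev_norm _ _ _.
have S0 : (0 <= S)%E by exact: poweR_ge0.
have h a b ab : ((nrm (D a b phi))%:E <= S)%E := @nrm_le_sobolev k phi a b ab.
case: S S0 h => [s||] // S0 h; last by rewrite gt0_muley ?leey// lte_fin; lra.
rewrite -EFinM lee_fin; apply: (@le_trans _ _ (C * s)); last first.
  by apply: ler_wpM2r => //; lra.
apply: (hu phi s (testfun_Tc phi)) => [|a b ab]; first by rewrite -lee_fin.
by rewrite -lee_fin; exact: h.
Qed.

End TestFunctionsOfOm.

Section Order2Energy.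
Context {R : realType} (Om : set (R * R)) (B : R).
Hypotheses (OB : Om `<=` box B) (oOm : open Om).
Implicit Types (f g : R * R -> R) (i j k : 'I_2).

(** The square of the constant of the Poincare inequality in the box. It is at
    least 1, so that CB N2 f bounds the L2 norms of f and of its derivatives of
    order at most two. *)
Definition CB : R := (2 * `|B| + 1) * (2 * `|B| + 1).

Lemma CB_ge1 : 1 <= 2 * `|B| + 1 /\ 2 * `|B| + 1 <= CB.
Proof.
have b0 : 0 <= `|B| by exact: normr_ge0.
rewrite /CB; split; first by lra.
by nra.
Qed.

Lemma Tc_box f : Tc Om f -> zoff (box B) f.
Proof. by move=> tf; apply: zoff_sub OB _; exact: Tc_zoff tf. Qed.

Lemma const_trans (a b c N : R) : 0 <= N -> a <= b * N -> b <= c -> a <= c * N.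
Proof. by move=> N0 h bc; apply: le_trans h _; exact: ler_wpM2r. Qed.

Lemma D_le_N2 a b f : Tc Om f -> (a + b <= 2)%N -> nrm (D a b f) <= CB * N2 f.
Proof.
move=> tf; have sf := Tc_smooth tf; have zf := Tc_box tf.
have [c1 c2] := CB_ge1.
have h2 i j : nrm (partial i (partial j f)) <= CB * N2 f.
  apply: (@const_trans _ 1); [exact: N2_ge0| |exact: le_trans c2].
  by rewrite mul1r; exact: nrm_N2.
have h1 i : nrm (partial i f) <= CB * N2 f.
  by apply: const_trans c2; [exact: N2_ge0|exact: nrm1_le_N2].
have h0 : nrm f <= CB * N2 f by exact: nrm_le_N2.
move: a b => [|[|[|a]]] [|[|[|b]]] ab; try (exfalso; by move: ab; rewrite ?addSn ?addnS).
- exact: h0.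
- exact: (h1 1).
- exact: (h2 1 1).
- exact: (h1 0).
- exact: (h2 0 1).
- exact: (h2 0 0).
Qed.

Lemma D_partial_le_N2 a b k f : Tc Om f -> (a + b <= 1)%N ->
  nrm (D a b (partial k f)) <= CB * N2 f.
Proof.
move=> tf; have sf := Tc_smooth tf; have zf := Tc_box tf.
have [c1 c2] := CB_ge1.
have h2 i j : nrm (partial i (partial j f)) <= CB * N2 f.
  apply: (@const_trans _ 1); [exact: N2_ge0| |exact: le_trans c2].
  by rewrite mul1r; exact: nrm_N2.
have h1 i : nrm (partial i f) <= CB * N2 f.
  by apply: const_trans c2; [exact: N2_ge0|exact: nrm1_le_N2].
move: a b => [|[|a]] [|[|b]] ab; try (exfalso; by move: ab; rewrite ?addSn ?addnS).
- exact: (h1 k).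
- exact: (h2 1 k).
- exact: (h2 0 k).
Qed.

(** The inner product of second derivatives: after integration by parts, the
    pairing of f with the bilaplacian of g. *)
Definition energy f g : R := \sum_(i : 'I_2) \sum_(j : 'I_2)
  ip (partial i (partial j f)) (partial i (partial j g)).

Lemma energyC f g : energy f g = energy g f.
Proof. by apply: eq_bigr => i _; apply: eq_bigr => j _; exact: ipC. Qed.

Lemma energy_ge0 f : 0 <= energy f f.
Proof. by apply: sumr_ge0 => i _; apply: sumr_ge0 => j _; exact: ip_ge0. Qed.

Lemma energy_lin h : Tc Om h -> linear_on (Tc Om) (fun f => energy f h).
Proof.
move=> th a f g tf tg; rewrite /energy mulr_sumr -big_split; apply: eq_bigr => i _.
rewrite mulr_sumr -big_split; apply: eq_bigr => j _.
have tt u : Tc Om u -> Tf (partial i (partial j u)).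
  by move=> tu; apply: Tf_partial; apply: Tf_partial; exact: Tc_Tf tu.
have -> : partial i (partial j (a *: f + g)) =
   a *: partial i (partial j f) + partial i (partial j g).
  have sf := Tc_smooth tf; have sg := Tc_smooth tg.
  rewrite (partialD j (smoothZ a sf) sg) (partialZ j a sf).
  rewrite (partialD i (smoothZ a (Smooth_partial j sf)) (Smooth_partial j sg)).
  by rewrite (partialZ i a (Smooth_partial j sf)).
rewrite (ipDl (TfZ a (tt f tf)) (tt g tg) (tt h th)).
by rewrite (ipZl a (tt f tf) (tt h th)).
Qed.

Lemma sum4_sqr (a b c d : R) :
  (a + b + (c + d)) ^+ 2 <= 4 * (a ^+ 2 + b ^+ 2 + (c ^+ 2 + d ^+ 2)).
Proof.
have h := sqr_ge0 (a - b); have h1 := sqr_ge0 (c - d); have h2 := sqr_ge0 (a - c).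
have h3 := sqr_ge0 (a - d); have h4 := sqr_ge0 (b - c); have h5 := sqr_ge0 (b - d).
by nra.
Qed.

Lemma sum4_congr (a b c d a' b' c' d' : R) : a = a' -> b = b' -> c = c' -> d = d' ->
  a + b + (c + d) = a' + b' + (c' + d').
Proof. by move=> -> -> -> ->. Qed.

Lemma energyE f : energy f f =
  nrm (partial 0 (partial 0 f)) ^+ 2 + nrm (partial 0 (partial 1 f)) ^+ 2 +
  (nrm (partial 1 (partial 0 f)) ^+ 2 + nrm (partial 1 (partial 1 f)) ^+ 2).
Proof.
rewrite /energy (eq_bigr _ (fun i _ => sum_ord2 _)) sum_ord2.
exact: (sum4_congr (esym (nrm_sqr _)) (esym (nrm_sqr _)) (esym (nrm_sqr _)) (esym (nrm_sqr _))).
Qed.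

Lemma N2_le_energy f : N2 f <= 2 * Num.sqrt (energy f f).
Proof.
have e0 := energy_ge0 f.
rewrite -(@ler_pXn2r _ 2)// ?nnegrE ?N2_ge0//.
rewrite exprMn sqr_sqrtr// energyE N2E.
have -> : 2 ^+ 2 = 4 :> R by ring.
exact: sum4_sqr.
Qed.

Lemma N2_cauchy (phi : nat -> R * R -> R) (F : (R * R -> R) -> R) :
  (forall n, Tc Om (phi n)) ->
  (forall n f, Tc Om f -> `|energy (phi n) f - F f| <= 2^-1 ^+ n * Num.sqrt (energy f f)) ->
  forall n m, (n <= m)%N -> N2 (phi m - phi n) <= 4 * 2^-1 ^+ n.
Proof.
move=> tphi hphi n m nm; apply: le_trans (N2_le_energy _) _.
have p n' : (0 : R) <= 2^-1 ^+ n' by rewrite ltW// half_gt0.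
have le2 : Num.sqrt (energy (phi m - phi n) (phi m - phi n)) <= 2^-1 ^+ n + 2^-1 ^+ m.
  apply: (@riesz_cauchy _ (Tc Om) energy (@Tc_lin _ Om) energy_lin energy_ge0 F) => //.
  - exact: hphi.
  - exact: hphi.
have hm : (2^-1 : R) ^+ m <= 2^-1 ^+ n.
  by rewrite ler_wiXn2l ?invr_ge0// invf_le1// ler1n.
by lra.
Qed.

End Order2Energy.

(** * Limits of test functions *)

Section H02.
Context {R : realType} (Om : set (R * R)) (B : R).
Hypotheses (OB : Om `<=` box B) (oOm : open Om).
Implicit Types (f g : R * R -> R) (i j k : 'I_2) (psi : testfun Om) (T : testfun Om -> R).
Local Notation mu2 := (@lebesgue2 R).
Local Notation L2f := (Lfun mu2 2%:E).

(** Convergence of test functions to a distribution, at dyadic rate on each test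
    function; it passes to derivatives, and it determines the limit. *)
Definition tends_to T (chi : nat -> R * R -> R) := forall psi : testfun Om,
  exists C : R, forall n, `|T psi - ip (chi n) psi| <= C * 2^-1 ^+ n.

Lemma Tc_Tf_test psi : Tf psi.
Proof. by apply: Tc_Tf; exact: testfun_Tc. Qed.

Lemma opp_diff (a b : R) : `|- a - - b| = `|a - b|.
Proof. by rewrite -opprD normrN. Qed.

Lemma tends_to_partial T chi i : (forall n, Tf (chi n)) -> tends_to T chi ->
  tends_to (distr_partial i T) (fun n => partial i (chi n)).
Proof.
move=> tc h psi; have [C hC] := h (testfun_partial i psi); exists C => n.
have -> : ip (partial i (chi n)) psi = - ip (chi n) (partial i psi).
  exact: (ip_partial i (tc n) (Tc_Tf_test psi)).
by rewrite -[X in `|X - _|]/(- T (testfun_partial i psi)) opp_diff; exact: hC.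
Qed.

Lemma tends_to_derivs T chi a b : (forall n, Tc Om (chi n)) -> tends_to T chi ->
  tends_to (distr_derivs T a b) (fun n => D a b (chi n)).
Proof.
move=> tc h; have ht c d n : Tf (D c d (chi n)) by exact: Tc_Tf (D_Tc c d (tc n)).
elim: a => [|a IH]; last first.
  by apply: tends_to_partial => // n; exact: ht.
elim: b => [|b IH]; first exact: h.
by apply: tends_to_partial => // n; exact: (ht 0%N).
Qed.

Lemma tends_to_unique T T' chi : tends_to T chi -> tends_to T' chi -> T = T'.
Proof.
move=> h h'; apply/funext => psi; have [C hC] := h psi; have [C' hC'] := h' psi.
apply: (@eq_limit _ _ _ (fun n => ip (chi n) psi) C C') => [n|n]; first exact: hC.
by rewrite distrC; exact: hC'.
Qed.

Lemma distr_of_pair f psi : distr_of Om f psi = pair (f \_ Om) psi.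
Proof. by apply: distr_ofE; apply: Tc_zoff; exact: testfun_Tc. Qed.

Lemma distr_of_patch f : distr_of Om (f \_ Om) = distr_of Om f.
Proof.
apply/funext => psi; rewrite !distr_of_pair.
by rewrite -patch_setI setIid.
Qed.

Lemma tends_to_approx f chi (K : R) : f \in L2f -> f \_ Om = f -> (forall n, Tf (chi n)) ->
  (forall n, norm2 (f - chi n) <= K * 2^-1 ^+ n) -> tends_to (distr_of Om f) chi.
Proof.
move=> lf pf tc h psi; exists (K * nrm psi) => n; rewrite distr_of_pair pf.
rewrite mulrAC; apply: pair_approx => //; exact: Tc_Tf_test.
Qed.

(** The elements of H^2_0, as limits of test functions that are Cauchy in the
    norm of H^2. *)
Record h2lim w (phi : nat -> R * R -> R) (K : R) : Prop := H2Lim {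
  h2_L2 : w \in L2f;
  h2_patch : w \_ Om = w;
  h2_K : 0 <= K;
  h2_test : forall n, Tc Om (phi n);
  h2_cauchy : forall n m, (n <= m)%N -> N2 (phi m - phi n) <= K * 2^-1 ^+ n;
  h2_lim : forall n, norm2 (w - phi n) <= K * 2^-1 ^+ n }.

Lemma iter_partialB i n f g : Smooth f -> Smooth g ->
  iter n (partial i) (f - g) = iter n (partial i) f - iter n (partial i) g.
Proof.
move=> sf sg; have sit (h : R * R -> R) : Smooth h -> forall m, Smooth (iter m (partial i) h).
  by move=> sh; elim=> //= m IH; exact: Smooth_partial.
by elim: n => //= n ->; rewrite (partialB i (sit f sf n) (sit g sg n)).
Qed.

Lemma DB a b f g : Tc Om f -> Tc Om g -> D a b (f - g) = D a b f - D a b g.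
Proof.
move=> tf tg; rewrite /D (iter_partialB 1 b (Tc_smooth tf) (Tc_smooth tg)).
exact: (iter_partialB 0 a (Tc_smooth (D_Tc 0 b tf)) (Tc_smooth (D_Tc 0 b tg))).
Qed.

Lemma patch_sub f g : f \_ Om = f -> g \_ Om = g -> (f - g) \_ Om = f - g.
Proof.
move=> pf pg; apply/funext => x; rewrite patchE; case: ifPn => // xO.
have z (h : R * R -> R) : h \_ Om = h -> h x = 0.
  by move=> ph; rewrite -ph patchE (negbTE xO).
by rewrite -[RHS]/(f x - g x) z// z// subrr.
Qed.

Lemma small_pow (C e : R) : 0 < e -> exists n, C * 2^-1 ^+ n < e.
Proof.
move=> e0; apply: contrapT => h; suff : e <= 0 by rewrite leNgt e0.
by apply: (@small_le0 _ _ C) => n; rewrite leNgt; apply/negP => hn; apply: h; exists n.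
Qed.

(** By the Poincare inequality the derivatives of order at most two are Cauchy
    too, and their limits are the weak derivatives of w. *)
Lemma h2lim_exists (phi : nat -> R * R -> R) (K : R) : 0 <= K -> (forall n, Tc Om (phi n)) ->
  (forall n m, (n <= m)%N -> N2 (phi m - phi n) <= K * 2^-1 ^+ n) ->
  exists w K', h2lim w phi K' /\ H0 Om 2 w.
Proof.
move=> K0 tphi cphi.
have CB0 : 0 <= CB B by have [c1 c2] := CB_ge1 B; lra.
have CK0 : 0 <= CB B * K by exact: mulr_ge0.
have E (p : nat * nat) : exists g, (p.1 + p.2 <= 2)%N -> [/\ g \in L2f, g \_ Om = g &
    forall n, norm2 (g - D p.1 p.2 (phi n)) <= CB B * K * 2^-1 ^+ n].
  case: (boolP (p.1 + p.2 <= 2)%N) => [ab|_]; last by exists 0.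
  have [|n m nm|g hg] := @test_complete R Om (fun n => D p.1 p.2 (phi n)) _ oOm CK0.
  - by move=> n; exact: D_Tc.
  - rewrite -(DB _ _ (tphi m) (tphi n)).
    apply: le_trans (D_le_N2 OB (TcB (tphi m) (tphi n)) ab) _.
    by rewrite -mulrA; apply: ler_wpM2l => //; exact: cphi.
  by exists g.
have [G hG] := choice E; pose w := G (0, 0)%N.
have [lw pw hw] := hG (0, 0)%N isT.
have K1 : 0 <= K + CB B * K by exact: addr_ge0.
exists w, (K + CB B * K); split.
  split => // [n m nm|n].
    apply: le_trans (cphi n m nm) _; rewrite mulrDl lerDl.
    by rewrite mulr_ge0// ltW// half_gt0.
  apply: le_trans (hw n) _; rewrite mulrDl lerDr.
  by rewrite mulr_ge0// ltW// half_gt0.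
split; first by rewrite /L2 pw.
exists (fun a b => G (a, b)) => [a b ab|e e0].
  have [lg pg hg] := hG (a, b) ab; split; first by rewrite /L2 pg.
  have t1 : tends_to (distr_of Om (G (a, b))) (fun n => D a b (phi n)).
    by apply: tends_to_approx hg => // n; apply: Tc_Tf; exact: D_Tc.
  have t0 : tends_to (distr_of Om w) phi.
    by apply: tends_to_approx hw => // n; exact: Tc_Tf (tphi n).
  by apply: tends_to_unique t1 _; exact: tends_to_derivs.
have [n hn] := small_pow (3%:R * (CB B * K)) e0.
exists (mk_test (tphi n)); set c := CB B * K * 2^-1 ^+ n.
have c0 : 0 <= c by rewrite mulr_ge0// ltW// half_gt0.
apply: (@le_lt_trans _ _ (3%:R * c)%:E); last by rewrite lte_fin mulrA.
apply: sobolev_le => // a b ab.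
have [lg pg hg] := hG (a, b) ab.
have tD := D_Tc a b (tphi n).
have -> : (G (a, b) \- test_derivs (mk_test (tphi n)) a b)%R \_ Om = G (a, b) - D a b (phi n).
  by apply: patch_sub => //; apply: patch_zoff; exact: Tc_zoff tD.
have ld : G (a, b) - D a b (phi n) \in L2f.
  by apply: Lfun_sub => //; apply: Tf_Lfun; exact: Tc_Tf tD.
rewrite (norm2_sqr ld) lee_fin; apply: lerXn2r; rewrite ?nnegrE ?norm2_ge0//.
Qed.

Lemma measurable_Lfun f : f \in L2f ->
  measurable_fun (setT : set (measurableTypeR R * measurableTypeR R)%type) f.
Proof. by move=> lf; have [h _] := Lfun2P f; have [] := h lf. Qed.

Lemma norm2_triangle f g : f \in L2f -> g \in L2f -> norm2 (f - g) <= norm2 f + norm2 g.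
Proof.
move=> lf lg; rewrite -lee_fin EFinD -!norm2E//; last exact: Lfun_sub.
have mf := measurable_Lfun lf; have mg := measurable_Lfun lg.
have mg' : measurable_fun (setT : set (measurableTypeR R * measurableTypeR R)%type) (- g).
  exact: measurable_funN.
have e : 'N[mu2]_2%:E[EFin \o (- g)%R]%E = 'N[mu2]_2%:E[EFin \o g]%E.
  by rewrite !Lnorm2E; congr (_ `^ _)%E; apply: eq_integral => x _; rewrite sqrrN.
rewrite -e; by apply: eminkowski => //; rewrite lee_fin ler1n.
Qed.

Lemma sub_sub_cancel (x y z : R * R -> R) : (z - x) - (z - y) = y - x.
Proof. by rewrite opprB addrC addrA subrK. Qed.

(** Two test functions close to the same function are close to each other. *)
Lemma nrm_between f g h : f \in L2f -> Tf g -> Tf h ->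
  nrm (h - g) <= norm2 (f - g) + norm2 (f - h).
Proof.
move=> lf tg th; rewrite -(norm2_Tf (TfB th tg)) -(sub_sub_cancel g h f).
by apply: norm2_triangle; apply: Lfun_sub => //; exact: Tf_Lfun.
Qed.

Lemma h2lim_of_H0 v : H0 Om 2 v -> exists w phi K,
  h2lim w phi K /\ distr_of Om v = distr_of Om w.
Proof.
move=> [_ [g wg hg]].
have E n : exists f, Tc Om f /\ forall a b, (a + b <= 2)%N ->
    norm2 (g a b \_ Om - D a b f) <= 2^-1 ^+ n.
  have [phi hphi] := hg (2^-1 ^+ n) (half_gt0 R n).
  have tphi := testfun_Tc phi; exists phi; split => // a b ab.
  have [lg _] := wg a b ab.
  rewrite -lee_fin -norm2E; last first.
    by apply: Lfun_sub => //; apply: Tf_Lfun; apply: Tc_Tf (D_Tc a b tphi).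
  rewrite Lnorm2E; apply: le_trans (ltW hphi).
  have -> : g a b \_ Om - D a b phi = (g a b \- test_derivs phi a b)%R \_ Om.
    apply/funext => x; rewrite -[LHS]/((g a b \_ Om) x - D a b phi x) !patchE.
    case: ifPn => // /negP xO; rewrite (Tc_zoff (D_Tc a b tphi)) ?subr0//.
    by move=> Ox; apply: xO; exact: mem_set.
  exact: (sobolev_term Om (fun a b => g a b \- test_derivs phi a b)%R ab).
have [phi hphi] := choice E.
have tphi n := (hphi n).1.
pose w := g 0%N 0%N \_ Om.
have [lw ew] := wg 0%N 0%N isT.
have p0 n : (0 : R) <= 2^-1 ^+ n by rewrite ltW// half_gt0.
have hn n m a b : (n <= m)%N -> (a + b <= 2)%N ->
    nrm (D a b (phi m - phi n)) <= 2 * 2^-1 ^+ n.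
  move=> nm ab; rewrite (DB a b (tphi m) (tphi n)).
  have [lg _] := wg a b ab.
  apply: le_trans (nrm_between lg (Tc_Tf (D_Tc a b (tphi n))) (Tc_Tf (D_Tc a b (tphi m)))) _.
  have h1 := (hphi n).2 a b ab; have h2 := (hphi m).2 a b ab.
  have h3 : (2^-1 : R) ^+ m <= 2^-1 ^+ n.
    by rewrite ler_wiXn2l ?invr_ge0// invf_le1// ler1n.
  by lra.
exists w, phi, 8%:R; split; last first.
  by rewrite /w distr_of_patch; exact: (esym ew).
split => // [|n m nm|n].
- by rewrite /w -patch_setI setIid.
- rewrite N2E (partialC 1 0 (Tc_smooth (TcB (tphi m) (tphi n)))).
  have h1 := hn n m 2%N 0%N nm isT; have h2 := hn n m 1%N 1%N nm isT.
  have h3 := hn n m 0%N 2%N nm isT; have h4 := p0 n.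
  have e : 8%:R * 2^-1 ^+ n = 2 * 2^-1 ^+ n + 2 * 2^-1 ^+ n + (2 * 2^-1 ^+ n + 2 * 2^-1 ^+ n) :> R by ring.
  by rewrite e; exact: (lerD (lerD h1 h2) (lerD h2 h3)).
- apply: le_trans ((hphi n).2 0%N 0%N isT) _; rewrite ler_peMl ?p0// ler1n//.
Qed.

End H02.

(** * The differential operators on test functions *)

Section DifferentialFormulas.
Context {R : realType} {Om : set (R * R)}.
Implicit Types (i j : 'I_2) (psi : testfun Om) (T : testfun Om -> R).
Local Notation tp := testfun_partial.

Lemma curlcurlE T psi :
  [/\ curl2_rows (curl2 T) 0 0 psi = T (tp 1 (tp 1 psi)),
      curl2_rows (curl2 T) 0 1 psi = - T (tp 1 (tp 0 psi)),
      curl2_rows (curl2 T) 1 0 psi = - T (tp 0 (tp 1 psi)) &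
      curl2_rows (curl2 T) 1 1 psi = T (tp 0 (tp 0 psi))].
Proof.
have d i (S : testfun Om -> R) x : distr_partial i S x = - S (tp i x) by [].
have o (S : testfun Om -> R) x : (- S) x = - S x by [].
by split; rewrite !mxE /= ?o !d ?o ?d ?opprK.
Qed.

Lemma rotrotE (tau : 'M[testfun Om -> R]_2) psi : rot2 (rot2_rows tau) psi =
  tau 0 0 (tp 1 (tp 1 psi)) - tau 0 1 (tp 0 (tp 1 psi)) -
  (tau 1 0 (tp 1 (tp 0 psi)) - tau 1 1 (tp 0 (tp 0 psi))).
Proof.
have d i (S : testfun Om -> R) x : distr_partial i S x = - S (tp i x) by [].
have r (u : 'cV[testfun Om -> R]_2) x : rot2 u x = - u 1 0 (tp 0 x) + u 0 0 (tp 1 x).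
  by rewrite -[LHS]/(distr_partial 0 (u 1 0) x - distr_partial 1 (u 0 0) x) !d opprK.
rewrite r !mxE !r !mxE; ring.
Qed.

Lemma sym_gradE (u : 'cV[testfun Om -> R]_2) i j psi :
  sym_grad u i j psi = 2^-1 * (- u i 0 (tp j psi) - u j 0 (tp i psi)).
Proof. by rewrite !mxE. Qed.

End DifferentialFormulas.

Section Representation.
Context {R : realType} (Om : set (R * R)) (B : R).
Hypotheses (OB : Om `<=` box B) (oOm : open Om).
Implicit Types (f g : R * R -> R) (i j k : 'I_2) (psi : testfun Om) (T : testfun Om -> R).
Local Notation mu2 := (@lebesgue2 R).
Local Notation L2f := (Lfun mu2 2%:E).

(** The minimizing sequence for the L2 inner product converges by completeness. *)
Lemma riesz_L2 (u : (R * R -> R) -> R) (C : R) : linear_on (Tc Om) u ->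
  (forall f, Tc Om f -> `|u f| <= C * nrm f) ->
  exists U, [/\ U \in L2f, U \_ Om = U & forall f, Tc Om f -> pair U f = u f].
Proof.
move=> lu hu.
have ilin (h : R * R -> R) : Tc Om h -> linear_on (Tc Om) (fun f => ip f h).
  move=> th a f g tf tg; have th' := Tc_Tf th; have tf' := Tc_Tf tf; have tg' := Tc_Tf tg.
  by rewrite (ipDl (TfZ a tf') tg' th') (ipZl a tf' th').
have [phi hphi] := @riesz_sequence _ (Tc Om) ip (@Tc0 _ Om) (@Tc_lin _ Om) ilin (@ipC R) (@ip_ge0 R) u C lu hu.
have p n : (0 : R) <= 2^-1 ^+ n by rewrite ltW// half_gt0.
have cphi n m : (n <= m)%N -> nrm (phi m - phi n) <= 2 * 2^-1 ^+ n.
  move=> nm; have [tn hn] := hphi n; have [tm hm] := hphi m.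
  apply: le_trans (@riesz_cauchy _ (Tc Om) ip (@Tc_lin _ Om) ilin (@ip_ge0 R) u _ _ _ _ _ tn tm hn hm) _.
    exact: addr_ge0.
  have h3 : (2^-1 : R) ^+ m <= 2^-1 ^+ n.
    by rewrite ler_wiXn2l ?invr_ge0// invf_le1// ler1n.
  by lra.
have [U [lU pU hU]] := test_complete oOm (ler0n _ 2) (fun n => (hphi n).1) cphi.
exists U; split => // f tf.
apply: (@eq_limit _ _ _ (fun n => ip (phi n) f) (2 * nrm f) (nrm f)) => n.
  rewrite mulrAC; apply: pair_approx => //; [exact: Tc_Tf (hphi n).1|exact: Tc_Tf tf].
by rewrite mulrC; exact: ((hphi n).2 f tf).
Qed.

Lemma partial_lin i (a : R) f g : Smooth f -> Smooth g ->
  partial i (a *: f + g) = a *: partial i f + partial i g.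
Proof. by move=> sf sg; rewrite (partialD i (smoothZ a sf) sg) (partialZ i a sf). Qed.

Lemma linear_partial i (u : (R * R -> R) -> R) : linear_on (Tc Om) u ->
  linear_on (Tc Om) (fun f => u (partial i f)).
Proof.
move=> lu a f g tf tg; rewrite (partial_lin i a (Tc_smooth tf) (Tc_smooth tg)).
exact: (lu a _ _ (Tc_partial i tf) (Tc_partial i tg)).
Qed.

Lemma pair_linear w : w \in L2f -> linear_on (Tc Om) (pair w).
Proof.
move=> lw a f g tf tg.
have tf' := Tc_Tf tf; have tg' := Tc_Tf tg.
have pC (h k : R * R -> R) : pair h k = pair k h.
  by apply: eq_Rintegral => x _; rewrite mulrC.
rewrite pC (pairDl (Tf_Lfun (TfZ a tf')) (Tf_Lfun tg') lw) (pC g); congr (_ + _).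
rewrite pC /pair -RintegralZl//; last exact: (mul_integrable lw (Tf_Lfun tf')).
by apply: eq_Rintegral => x _; rewrite -[(a *: f) x]/(a * f x) mulrCA.
Qed.

Lemma ip_partial2 i j f g : Tf f -> Tf g ->
  ip f (partial i (partial j g)) = ip (partial j (partial i f)) g.
Proof.
move=> tf tg; rewrite (ip_partial j (Tf_partial i tf) tg) (ip_partial i tf (Tf_partial j tg)).
by rewrite opprK.
Qed.

Section Limit.
Variables (w : R * R -> R) (phi : nat -> R * R -> R) (K : R).
Hypothesis H : h2lim Om w phi K.

Lemma pair_limit f : Tf f -> exists C : R, forall n, `|pair w f - ip (phi n) f| <= C * 2^-1 ^+ n.
Proof.
move=> tf; exists (K * nrm f) => n; rewrite mulrAC.
by apply: (pair_approx (h2_L2 H) _ tf (h2_lim H n)); exact: Tc_Tf (h2_test H n).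
Qed.

Lemma pair_limit2 i j f : Tc Om f -> exists C : R, forall n,
  `|pair w (partial i (partial j f)) - ip (partial j (partial i (phi n))) f| <= C * 2^-1 ^+ n.
Proof.
move=> tf; have tf' := Tc_Tf tf.
have [C hC] := pair_limit (Tf_partial i (Tf_partial j tf')); exists C => n.
by rewrite -(ip_partial2 i j (Tc_Tf (h2_test H n)) tf').
Qed.

Lemma N2_bounded : exists2 C : R, 0 <= C & forall n, N2 (phi n) <= C.
Proof.
exists (K + N2 (phi 0%N)); first by rewrite addr_ge0 ?N2_ge0//; exact: h2_K H.
move=> n; have t0 := Tc_Tf (h2_test H 0%N); have tn := Tc_Tf (h2_test H n).
have e : phi n = (phi n - phi 0%N) + phi 0%N by rewrite subrK.
rewrite {1}e; apply: le_trans (N2D (TfB tn t0) t0) _; apply: lerD => //.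
by have := h2_cauchy H (leq0n n); rewrite expr0 mulr1.
Qed.

(** The second derivatives of an element of H^2_0 are square integrable: both
    derivatives are moved to the approximating sequence. *)
Lemma pair2_bounded : exists2 C : R, 0 <= C & forall i j f, Tc Om f ->
  `|pair w (partial i (partial j f))| <= C * nrm f.
Proof.
have [C C0 hC] := N2_bounded; exists C => // i j f tf.
have [C' hC'] := pair_limit2 i j tf.
apply: (le_limit hC') => n.
have tn := Tc_Tf (h2_test H n).
apply: le_trans (cauchy_schwarz (Tf_partial j (Tf_partial i tn)) (Tc_Tf tf)) _.
apply: ler_wpM2r; first exact: nrm_ge0.
exact: le_trans (nrm_N2 j i (phi n)) (hC n).
Qed.

(** The bilaplacian of w as a distribution, in the order of derivatives that the
    double rotation of curlcurl produces. *)
Definition bilaplace f : R :=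
  pair w (partial 1 (partial 1 (partial 1 (partial 1 f)))) +
  pair w (partial 1 (partial 0 (partial 0 (partial 1 f)))) +
  (pair w (partial 0 (partial 1 (partial 1 (partial 0 f)))) +
   pair w (partial 0 (partial 0 (partial 0 (partial 0 f))))).

Lemma sum4_limit (a b c d a' b' c' d' A A' A2 A3 e : R) :
  `|a - a'| <= A * e -> `|b - b'| <= A' * e -> `|c - c'| <= A2 * e -> `|d - d'| <= A3 * e ->
  `|(d + c + (b + a)) - (a' + b' + (c' + d'))| <= (A + A' + (A2 + A3)) * e.
Proof.
move=> ha hb hc hd.
have -> : d + c + (b + a) - (a' + b' + (c' + d')) = (a - a') + (b - b') + ((c - c') + (d - d')).
  by ring.
rewrite !mulrDl; apply: le_trans (ler_normD _ _) _; apply: lerD.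
  by apply: le_trans (ler_normD _ _) _; apply: lerD.
by apply: le_trans (ler_normD _ _) _; apply: lerD.
Qed.

Lemma bilaplace_limit f : Tc Om f -> exists C : R, forall n,
  `|bilaplace f - energy (phi n) f| <= C * 2^-1 ^+ n.
Proof.
move=> tf.
have [A hA] := @pair_limit2 0 0 _ (Tc_partial 0 (Tc_partial 0 tf)).
have [A' hA'] := @pair_limit2 0 1 _ (Tc_partial 1 (Tc_partial 0 tf)).
have [A2 hA2] := @pair_limit2 1 0 _ (Tc_partial 0 (Tc_partial 1 tf)).
have [A3 hA3] := @pair_limit2 1 1 _ (Tc_partial 1 (Tc_partial 1 tf)).
exists (A + A' + (A2 + A3)) => n.
have -> : energy (phi n) f =
    ip (partial 0 (partial 0 (phi n))) (partial 0 (partial 0 f)) +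
    ip (partial 1 (partial 0 (phi n))) (partial 1 (partial 0 f)) +
    (ip (partial 0 (partial 1 (phi n))) (partial 0 (partial 1 f)) +
     ip (partial 1 (partial 1 (phi n))) (partial 1 (partial 1 f))).
  rewrite /energy exchange_big (eq_bigr _ (fun i _ => sum_ord2 _)).
  exact: sum_ord2.
exact: (sum4_limit (hA n) (hA' n) (hA2 n) (hA3 n)).
Qed.

End Limit.

End Representation.

(** * Existence of the decomposition *)

Section Decomposition.
Context {R : realType} (Om : set (R * R)) (B : R).
Hypotheses (OB : Om `<=` box B) (oOm : open Om).
Implicit Types (f g : R * R -> R) (i j k : 'I_2) (psi : testfun Om) (T : testfun Om -> R).
Local Notation mu2 := (@lebesgue2 R).
Local Notation L2f := (Lfun mu2 2%:E).

(** The entries of curl curl of w, as functionals. *)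
Definition curlcurl w i j f : R :=
  if i == 0 then
    if j == 0 then pair w (partial 1 (partial 1 f)) else - pair w (partial 1 (partial 0 f))
  else
    if j == 0 then - pair w (partial 0 (partial 1 f)) else pair w (partial 0 (partial 0 f)).

Lemma curlcurl_distr w i j psi : w \_ Om = w ->
  curl2_rows (curl2 (distr_of Om w)) i j psi = curlcurl w i j psi.
Proof.
move=> pw; have [e1 e2 e3 e4] := curlcurlE (distr_of Om w) psi.
have dp (chi : testfun Om) : distr_of Om w chi = pair w chi by rewrite distr_of_pair pw.
have [->|->] := ord2P i; have [->|->] := ord2P j.
- exact: (etrans e1 (dp _)).
- exact: (etrans e2 (congr1 (fun x => - x) (dp _))).
- exact: (etrans e3 (congr1 (fun x => - x) (dp _))).
- exact: (etrans e4 (dp _)).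
Qed.

Lemma linear_opp (u : (R * R -> R) -> R) : linear_on (Tc Om) u ->
  linear_on (Tc Om) (fun f => - u f).
Proof. by move=> lu a f g tf tg; rewrite (lu a f g tf tg) opprD mulrN. Qed.

Lemma linear_sub (u v : (R * R -> R) -> R) : linear_on (Tc Om) u -> linear_on (Tc Om) v ->
  linear_on (Tc Om) (fun f => u f - v f).
Proof.
move=> lu lv a f g tf tg; rewrite (lu a f g tf tg) (lv a f g tf tg).
by move: (u f) (u g) (v f) (v g) => *; ring.
Qed.

Lemma curlcurl_linear w i j : w \in L2f -> linear_on (Tc Om) (curlcurl w i j).
Proof.
move=> lw; have h k l : linear_on (Tc Om) (fun f => pair w (partial k (partial l f))).
  exact: (@linear_partial R Om l (fun g => pair w (partial k g))
    (linear_partial k (pair_linear (Om := Om) lw))).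
rewrite /curlcurl; case: (i == 0); case: (j == 0).
- exact: (h 1 1).
- exact: (linear_opp (h 1 0)).
- exact: (linear_opp (h 0 1)).
- exact: (h 0 0).
Qed.

Lemma curlcurl_sym w f : Tc Om f -> curlcurl w 0 1 f = curlcurl w 1 0 f.
Proof. by move=> tf; rewrite /curlcurl /= (partialC 1 0 (Tc_smooth tf)). Qed.

Lemma curlcurl_le w (C : R) i j f :
  (forall k l, `|pair w (partial k (partial l f))| <= C * nrm f) ->
  `|curlcurl w i j f| <= C * nrm f.
Proof.
by move=> h; rewrite /curlcurl; case: (i == 0); case: (j == 0); rewrite ?normrN; exact: h.
Qed.

Lemma add4_opp (a b c d : R) : a - - b - (- c - d) = a + b + (c + d).
Proof. by ring. Qed.

Lemma rotrot_curlcurl w f :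
  curlcurl w 0 0 (partial 1 (partial 1 f)) - curlcurl w 0 1 (partial 0 (partial 1 f)) -
  (curlcurl w 1 0 (partial 1 (partial 0 f)) - curlcurl w 1 1 (partial 0 (partial 0 f))) =
  bilaplace w f.
Proof.
exact: add4_opp.
Qed.

Lemma dist2_of (u : (R * R -> R) -> R) (C : R) : linear_on (Tc Om) u -> 0 <= C ->
  (forall f, Tc Om f -> `|u f| <= C * N2 f) -> dist2 Om u.
Proof.
move=> lu C0 h; split => // K cK KO; exists C => // f sf zf; apply: h.
exact: (Tc_K cK KO sf zf).
Qed.

Lemma Hminus1_bound T : Hminus 1 T -> exists2 C : R, 0 <= C & forall f, Tc Om f ->
  `|ext T f| <= C * N2 f /\ forall k, `|ext T (partial k f)| <= C * N2 f.
Proof.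
move=> /Hminus_ext[_ [C C0 hC]].
have cb : 0 <= CB B by have [c1 c2] := CB_ge1 B; lra.
exists (C * CB B) => [|f tf]; first exact: mulr_ge0.
have n0 : 0 <= CB B * N2 f by apply: mulr_ge0 => //; exact: N2_ge0.
rewrite -mulrA; split => [|k].
  apply: (hC _ _ tf n0) => a b ab; apply: (D_le_N2 OB tf).
  exact: leq_trans ab _.
by apply: (hC _ _ (Tc_partial k tf) n0) => a b ab; exact: (D_partial_le_N2 OB k tf ab).
Qed.

Lemma Hminus2_bound T : Hminus 2 T -> exists2 C : R, 0 <= C & forall f, Tc Om f ->
  `|ext T f| <= C * N2 f.
Proof.
move=> /Hminus_ext[_ [C C0 hC]].
have cb : 0 <= CB B by have [c1 c2] := CB_ge1 B; lra.
exists (C * CB B) => [|f tf]; first exact: mulr_ge0.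
have n0 : 0 <= CB B * N2 f by apply: mulr_ge0 => //; exact: N2_ge0.
by rewrite -mulrA; apply: (hC _ _ tf n0) => a b ab; exact: (D_le_N2 OB tf).
Qed.

(** The weak solution of the biharmonic equation with clamped boundary. *)
Lemma biharmonic_solution F (C : R) : linear_on (Tc Om) F -> 0 <= C ->
  (forall f, Tc Om f -> `|F f| <= C * N2 f) ->
  exists w phi K, [/\ h2lim Om w phi K, H0 Om 2 w & forall f, Tc Om f -> bilaplace w f = F f].
Proof.
move=> lF C0 hF.
have hF' f : Tc Om f -> `|F f| <= (C * 2) * Num.sqrt (energy f f).
  move=> tf; apply: le_trans (hF f tf) _; rewrite -mulrA; apply: ler_wpM2l => //.
  exact: N2_le_energy.
have [phi hphi] := @riesz_sequence _ (Tc Om) energy (@Tc0 _ Om) (@Tc_lin _ Om)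
  (@energy_lin _ Om) (@energyC R) (@energy_ge0 R) F _ lF hF'.
have tphi n := (hphi n).1.
have cphi := N2_cauchy tphi (fun n => (hphi n).2).
have [w [K [hw Hw]]] := h2lim_exists OB oOm (ler0n _ 4) tphi cphi.
exists w, phi, K; split => // f tf.
have [A hA] := bilaplace_limit hw tf.
apply: (eq_limit hA) => n; rewrite mulrC; exact: ((hphi n).2 f tf).
Qed.

Lemma sub_rearr (a b c d a' b' c' d' : R) :
  a - b - (c - d) = a' - b' - (c' - d') ->
  (a - a') - (b - b') = (c - c') - (d - d').
Proof. by move=> h; lra. Qed.

Lemma half_sum (s a b : R) : a + b = - 2 * s -> 2^-1 * (- a - b) = s.
Proof. by move=> h; lra. Qed.

Lemma add_of_sub (x c t : R) : x = t - c -> x + c = t.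
Proof. by move=> ->; rewrite subrK. Qed.

(** The remainder s = tau - curl curl w has vanishing double rotation, so it is a
    symmetric gradient. The second derivatives of the displacement u are first
    derivatives of s, which are of order two up to the boundary, so u is square
    integrable. *)
Lemma decompose (tau : 'M[testfun Om -> R]_2) : simply_connected Om -> lipschitz_boundary Om ->
  Hrotrot Om tau -> exists (U : 'I_2 -> R * R -> R) w,
  [/\ forall i, L2 Om (U i), H0 Om 2 w &
      sym_grad (\col_i distr_of Om (U i)) + curl2_rows (curl2 (distr_of Om w)) = tau].
Proof.
move=> sc lb [tsym t1 t2].
have [C C0 hC] := Hminus2_bound t2.
have [w [phi [K [hw Hw bw]]]] := biharmonic_solution (Hminus_ext t2).1 C0 hC.
have [M M0 hM] := pair2_bounded hw.
have [C1 C10 hC1] : exists2 C1 : R, 0 <= C1 & forall i j f, Tc Om f ->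
    `|ext (tau i j) f| <= C1 * N2 f /\ forall k, `|ext (tau i j) (partial k f)| <= C1 * N2 f.
  have E (p : 'I_2 * 'I_2) : exists c : R, 0 <= c /\ forall f, Tc Om f ->
      `|ext (tau p.1 p.2) f| <= c * N2 f /\
      forall k, `|ext (tau p.1 p.2) (partial k f)| <= c * N2 f.
    by have [c c0 hc] := Hminus1_bound (t1 p.1 p.2); exists c.
  have [c hc] := choice E; exists (\sum_p c p) => [|i j f tf].
    by apply: sumr_ge0 => p _; exact: (hc p).1.
  have le : c (i, j) <= \sum_p c p.
    by rewrite (bigD1 (i, j))//= lerDl; apply: sumr_ge0 => p _; exact: (hc p).1.
  have [h1 h2] := (hc (i, j)).2 f tf; have n0 := N2_ge0 f.
  by split => [|k]; [exact: const_trans n0 h1 le|exact: const_trans n0 (h2 k) le].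
pose s i j f := ext (tau i j) f - curlcurl w i j f.
have cb : 0 <= CB B by have [c1 c2] := CB_ge1 B; lra.
(* The entries of tau are of order one by assumption, those of curl curl w of
   order zero. *)
pose C2 := C1 + M * CB B.
have C20 : 0 <= C2 by apply: addr_ge0 => //; exact: mulr_ge0.
have cc i j f (N : R) : Tc Om f -> nrm f <= CB B * N -> `|curlcurl w i j f| <= M * CB B * N.
  move=> tf hN; apply: le_trans (curlcurl_le i j (fun k l => hM k l f tf)) _.
  by rewrite -mulrA; exact: ler_wpM2l.
have s0 i j f : Tc Om f -> `|s i j f| <= C2 * N2 f.
  move=> tf; apply: le_trans (ler_normB _ _) _; rewrite mulrDl; apply: lerD.
    exact: (hC1 i j f tf).1.
  by apply: cc => //; exact: (@D_le_N2 _ _ _ OB 0%N 0%N f tf isT).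
have ss i j k f : Tc Om f -> `|s i j (partial k f)| <= C2 * N2 f.
  move=> tf; apply: le_trans (ler_normB _ _) _; rewrite mulrDl; apply: lerD.
    exact: ((hC1 i j f tf).2 k).
  apply: cc; first exact: Tc_partial.
  exact: (@D_partial_le_N2 _ _ _ OB 0%N 0%N k f tf isT).
have ls i j : linear_on (Tc Om) (s i j).
  apply: linear_sub; first exact: (Hminus_ext (t1 i j)).1.
  exact: (curlcurl_linear i j (h2_L2 hw)).
have ds i j : dist2 Om (s i j) := dist2_of (ls i j) C20 (s0 i j).
have ssym f : Tc Om f -> s 0 1 f = s 1 0 f.
  move=> tf; rewrite /s (curlcurl_sym w tf).
  by have -> : tau 0 1 = tau 1 0 by rewrite -{1}tsym mxE.
have rr f : Tc Om f -> rot_row s 0 (partial 1 f) = rot_row s 1 (partial 0 f).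
  move=> tf; apply: sub_rearr; rewrite rotrot_curlcurl (bw f tf) (ext_mk _ tf) rotrotE.
  by rewrite -!extE.
have [u [du hu [C' C'0 hC']]] := saint_venant OB oOm sc C20 ds ssym ss rr.
have E i : exists U, [/\ U \in L2f, U \_ Om = U & forall f, Tc Om f -> pair U f = u i f].
  have [A A0 hA] := l2_estimate oOm lb OB (du i) C'0 (hC' i).
  exact: (riesz_L2 oOm (du i).1 hA).
have [U hU] := choice E; exists U, w; split => // [i|].
  by have [lU pU _] := hU i; rewrite /L2 pU.
apply/matrixP => i j; apply/funext => psi.
rewrite mxE -[LHS]/(sym_grad (\col_k distr_of Om (U k)) i j psi +
  curl2_rows (curl2 (distr_of Om w)) i j psi).
rewrite (curlcurl_distr i j psi (h2_patch hw)) sym_gradE !mxE.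
have tpsi := testfun_Tc psi.
have [lUi pUi hUi] := hU i; have [lUj pUj hUj] := hU j.
rewrite !distr_of_pair pUi pUj.
have e1 := hUi _ (Tc_partial j tpsi); have e2 := hUj _ (Tc_partial i tpsi).
rewrite -(extE (tau i j)); apply: add_of_sub; apply: half_sum.
exact: (etrans (congr2 (fun x y : R => x + y) e1 e2) (hu i j _ tpsi)).
Qed.

End Decomposition.

(** * The sum is contained in the space and is direct *)

Section Composition.
Context {R : realType} (Om : set (R * R)) (B : R).
Hypotheses (OB : Om `<=` box B) (oOm : open Om).
Implicit Types (f g : R * R -> R) (i j k : 'I_2) (psi : testfun Om) (T : testfun Om -> R).
Local Notation mu2 := (@lebesgue2 R).
Local Notation L2f := (Lfun mu2 2%:E).

(** The entries of the symmetric gradient of U, as functionals. *)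
Definition strain (U : 'I_2 -> R * R -> R) i j f : R :=
  2^-1 * (- pair (U i) (partial j f) - pair (U j) (partial i f)).

Lemma strain_distr (U : 'I_2 -> R * R -> R) i j psi :
  sym_grad (\col_k distr_of Om (U k)) i j psi = strain (fun k => U k \_ Om) i j psi.
Proof. by rewrite sym_gradE !mxE !distr_of_pair. Qed.

Lemma strain_cancel (a b a3 a4 b2 b4 : R) : a3 = a -> a4 = a -> b2 = b -> b4 = b ->
  2^-1 * (- a - a) - 2^-1 * (- a3 - b) - (2^-1 * (- b2 - a4) - 2^-1 * (- b4 - b4)) = 0.
Proof. by move=> -> -> -> ->; lra. Qed.

Lemma rotrot_strain U f : Tc Om f ->
  strain U 0 0 (partial 1 (partial 1 f)) - strain U 0 1 (partial 0 (partial 1 f)) -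
  (strain U 1 0 (partial 1 (partial 0 f)) - strain U 1 1 (partial 0 (partial 0 f))) = 0.
Proof.
move=> tf; have sf := Tc_smooth tf; have s1 i := Smooth_partial i sf.
have e1 := partialC 1 0 (s1 1); have e0 := partialC 1 0 sf.
have e2 := etrans (congr1 (partial 1) e0) e1.
have e3 := congr1 (partial 0) e0.
have e4 := etrans (partialC 1 0 (s1 0)) e3.
exact: (strain_cancel (congr1 (pair (U 0)) e1) (congr1 (pair (U 0)) e2)
  (congr1 (pair (U 1)) e3) (congr1 (pair (U 1)) e4)).
Qed.

Lemma linear_add (u v : (R * R -> R) -> R) : linear_on (Tc Om) u -> linear_on (Tc Om) v ->
  linear_on (Tc Om) (fun f => u f + v f).
Proof.
move=> lu lv a f g tf tg; rewrite (lu a f g tf tg) (lv a f g tf tg).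
by move: (u f) (u g) (v f) (v g) => *; ring.
Qed.

Lemma linear_scale (c : R) (u : (R * R -> R) -> R) : linear_on (Tc Om) u ->
  linear_on (Tc Om) (fun f => c * u f).
Proof. by move=> lu a f g tf tg; rewrite (lu a f g tf tg); move: (u f) (u g) => *; ring. Qed.

Lemma strain_linear (U : 'I_2 -> R * R -> R) i j : (forall k, U k \in L2f) ->
  linear_on (Tc Om) (strain U i j).
Proof.
move=> lU; apply: linear_scale; apply: linear_sub.
  exact: (linear_opp (linear_partial j (pair_linear (Om := Om) (lU i)))).
exact: (linear_partial i (pair_linear (Om := Om) (lU j))).
Qed.

Lemma strain_bound (a b m n M x y : R) : `|a| <= m * x -> `|b| <= n * y ->
  0 <= m -> 0 <= n -> x <= M -> y <= M -> `|2^-1 * (- a - b)| <= (m + n) * M.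
Proof.
move=> ha hb m0 n0 hx hy.
have h1 := ler_wpM2l m0 hx; have h2 := ler_wpM2l n0 hy.
have -> : 2^-1 * (- a - b) = - (2^-1 * (a + b)) by ring.
rewrite normrN normrM ger0_norm ?invr_ge0//.
apply: (@le_trans _ _ `|a + b|); first by rewrite ler_piMl// invf_le1// ler1n.
apply: le_trans (ler_normD a b) _; rewrite mulrDl.
by apply: lerD; [exact: le_trans ha h1|exact: le_trans hb h2].
Qed.

Lemma strain_le (U : 'I_2 -> R * R -> R) i j f (M : R) : (forall k, U k \in L2f) ->
  Tc Om f -> (forall k, nrm (partial k f) <= M) ->
  `|strain U i j f| <= (norm2 (U i) + norm2 (U j)) * M.
Proof.
move=> lU tf hM; have tp k := Tc_Tf (Tc_partial k tf).
have h k l := pair_le (lU k) (Tf_Lfun (tp l)).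
apply: (strain_bound (h i j) (h j i)); [exact: norm2_ge0|exact: norm2_ge0| |].
  by rewrite (norm2_Tf (tp j)); exact: hM.
by rewrite (norm2_Tf (tp i)); exact: hM.
Qed.

Lemma bilaplace_linear w : w \in L2f -> linear_on (Tc Om) (bilaplace w).
Proof.
move=> lw; have l2 i j u : linear_on (Tc Om) u ->
    linear_on (Tc Om) (fun f => u (partial i (partial j f))).
  by move=> lu; exact: (@linear_partial R Om j (fun g => u (partial i g)) (linear_partial i lu)).
have l4 i j k l : linear_on (Tc Om)
    (fun f => pair w (partial i (partial j (partial k (partial l f))))).
  exact: (l2 k l _ (l2 i j _ (pair_linear (Om := Om) lw))).
apply: linear_add; apply: linear_add; exact: l4.
Qed.

Lemma norm_sum4_le (a b c d M : R) : `|a| <= M -> `|b| <= M -> `|c| <= M -> `|d| <= M ->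
  `|a + b + (c + d)| <= 4 * M.
Proof.
move=> ha hb hc hd; have h1 := ler_normD (a + b) (c + d).
have h2 := ler_normD a b; have h3 := ler_normD c d; lra.
Qed.

Lemma bilaplace_le w (C M : R) f : 0 <= C -> Tc Om f ->
  (forall i j g, Tc Om g -> `|pair w (partial i (partial j g))| <= C * nrm g) ->
  (forall i j, nrm (partial i (partial j f)) <= M) -> `|bilaplace w f| <= 4 * C * M.
Proof.
move=> C0 tf hC hM; have h i j k l : `|pair w (partial i (partial j (partial k (partial l f))))| <= C * M.
  apply: le_trans (hC i j _ (Tc_partial k (Tc_partial l tf))) _.
  by apply: ler_wpM2l => //; exact: hM.
by rewrite -mulrA; apply: norm_sum4_le; exact: h.
Qed.

Lemma strain_sym (U : 'I_2 -> R * R -> R) i j f : strain U i j f = strain U j i f.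
Proof. exact: (congr1 (fun x : R => 2^-1 * x) (addrC _ _)). Qed.

Lemma curlcurl_swap w i j f : Tc Om f -> curlcurl w i j f = curlcurl w j i f.
Proof.
move=> tf; have e := curlcurl_sym w tf.
have [->|->] := ord2P i; have [->|->] := ord2P j.
- exact: erefl.
- exact: e.
- exact: (esym e).
- exact: erefl.
Qed.

Lemma rotrot_add (a b c d a' b' c' d' : R) :
  a + a' - (b + b') - ((c + c') - (d + d')) = (a - b - (c - d)) + (a' - b' - (c' - d')).
Proof. by ring. Qed.

(** The double rotation of the sum is the bilaplacian of v, which pairs the square
    integrable second derivatives of v with those of the test function. *)
Lemma compose (U : 'I_2 -> R * R -> R) v : (forall i, L2 Om (U i)) -> H0 Om 2 v ->
  Hrotrot Om (sym_grad (\col_i distr_of Om (U i)) + curl2_rows (curl2 (distr_of Om v))).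
Proof.
move=> lU Hv; have [w [phi [K [hw ->]]]] := h2lim_of_H0 Hv.
set tau := _ + _; pose V k := U k \_ Om.
pose e i j f := strain V i j f + curlcurl w i j f.
have tauE i j psi : tau i j psi = e i j psi.
  rewrite /tau mxE -[LHS]/(sym_grad (\col_k distr_of Om (U k)) i j psi +
    curl2_rows (curl2 (distr_of Om w)) i j psi).
  by rewrite strain_distr (curlcurl_distr _ _ _ (h2_patch hw)).
have [C C0 hC] := pair2_bounded hw.
split.
- apply/matrixP => i j; apply/funext => psi; rewrite mxE !tauE /e.
  exact: (congr2 (fun x y : R => x + y) (strain_sym V j i psi)
    (curlcurl_swap w j i (testfun_Tc psi))).
- move=> i j; have -> : tau i j = (fun psi : testfun Om => e i j psi).
    by apply/funext => psi; exact: tauE.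
  apply: (@Hminus_intro R Om 1 (e i j) (norm2 (V i) + norm2 (V j) + C)) => [||f M tf M0 hM].
  + apply: linear_add; first exact: strain_linear.
    exact: (curlcurl_linear (Om := Om) i j (h2_L2 hw)).
  + by rewrite !addr_ge0 ?norm2_ge0.
  apply: le_trans (ler_normD _ _) _; rewrite mulrDl; apply: lerD.
    apply: strain_le => // k; have [->|->] := ord2P k.
      exact: (hM 1%N 0%N isT).
    exact: (hM 0%N 1%N isT).
  apply: le_trans (curlcurl_le i j (fun k l => hC k l f tf)) _.
  by apply: ler_wpM2l => //; exact: (hM 0%N 0%N isT).
- have -> : rot2 (rot2_rows tau) = (fun psi : testfun Om => bilaplace w psi).
    apply/funext => psi; rewrite rotrotE !tauE /e.
    rewrite rotrot_add (rotrot_strain V (testfun_Tc psi)) add0r.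
    exact: rotrot_curlcurl.
  apply: (@Hminus_intro R Om 2 (bilaplace w) (4 * C)) => [||f M tf M0 hM].
  + exact: (bilaplace_linear (h2_L2 hw)).
  + exact: mulr_ge0.
  apply: (bilaplace_le C0 tf hC) => i j.
  have sf := Tc_smooth tf; have [->|->] := ord2P i; have [->|->] := ord2P j.
  + exact: (hM 2%N 0%N isT).
  + exact: (hM 1%N 1%N isT).
  + rewrite (partialC 1 0 sf); exact: (hM 1%N 1%N isT).
  + exact: (hM 0%N 2%N isT).
Qed.

Lemma sum4_prod (a b c d a' b' c' d' : R) : 0 <= a -> 0 <= b -> 0 <= c -> 0 <= d ->
  0 <= a' -> 0 <= b' -> 0 <= c' -> 0 <= d' ->
  a * a' + b * b' + (c * c' + d * d') <= (a + b + (c + d)) * (a' + b' + (c' + d')).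
Proof.
move=> a0 b0 c0 d0 a1 b1 c1 d1.
have h x y : 0 <= x -> 0 <= y -> 0 <= x * y :> R by exact: mulr_ge0.
have := h a b' a0 b1; have := h a c' a0 c1; have := h a d' a0 d1.
have := h b a' b0 a1; have := h b c' b0 c1; have := h b d' b0 d1.
have := h c a' c0 a1; have := h c b' c0 b1; have := h c d' c0 d1.
have := h d a' d0 a1; have := h d b' d0 b1; have := h d c' d0 c1.
lra.
Qed.

Lemma sum4_norm (a b c d x y z t : R) : `|a| <= x -> `|b| <= y -> `|c| <= z -> `|d| <= t ->
  `|a + b + (c + d)| <= x + y + (z + t).
Proof.
move=> ha hb hc hd; have h1 := ler_normD (a + b) (c + d).
have h2 := ler_normD a b; have h3 := ler_normD c d; lra.
Qed.

Lemma energy_cauchy_schwarz f g : Tc Om f -> Tc Om g -> `|energy f g| <= N2 f * N2 g.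
Proof.
move=> tf tg; have cs i j := cauchy_schwarz (Tf_partial i (Tf_partial j (Tc_Tf tf)))
  (Tf_partial i (Tf_partial j (Tc_Tf tg))).
have -> : energy f g = ip (partial 0 (partial 0 f)) (partial 0 (partial 0 g)) +
    ip (partial 0 (partial 1 f)) (partial 0 (partial 1 g)) +
    (ip (partial 1 (partial 0 f)) (partial 1 (partial 0 g)) +
     ip (partial 1 (partial 1 f)) (partial 1 (partial 1 g))).
  rewrite /energy (eq_bigr _ (fun i _ => sum_ord2 _)); exact: sum_ord2.
rewrite !N2E; apply: le_trans (sum4_norm (cs 0 0) (cs 0 1) (cs 1 0) (cs 1 1)) _.
by apply: sum4_prod; exact: nrm_ge0.
Qed.

Lemma energy_tail (E a b c d : R) : E = a + b -> `|a| <= c -> `|0 - b| <= d -> E - c <= d.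
Proof.
move=> -> ha; rewrite sub0r normrN => hb.
by have := ler_norm a; have := ler_norm b; lra.
Qed.

Lemma sub_add_cancel (x y : R) : x = - y + x + y.
Proof. by ring. Qed.

Lemma sqr_bound (x y A N m e C : R) : `|x - y| <= A * e -> `|y| <= N * m ->
  N ^+ 2 <= C * e -> 0 <= e -> e <= 1 ->
  x ^+ 2 <= (2 * A ^+ 2 + 2 * m ^+ 2 * C) * e.
Proof.
move=> h1 h2 h3 e0 e1.
have k1 : (x - y) ^+ 2 <= (A * e) ^+ 2.
  rewrite -(real_normK (num_real (x - y))); apply: lerXn2r => //; rewrite nnegrE//.
  by apply: le_trans h1.
have k2 : y ^+ 2 <= (N * m) ^+ 2.
  rewrite -(real_normK (num_real y)); apply: lerXn2r => //; rewrite nnegrE//.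
  by apply: le_trans h2.
have k3 : x ^+ 2 <= 2 * (x - y) ^+ 2 + 2 * y ^+ 2.
  by have := sqr_ge0 (x - 2 * y); nra.
have k4 : (A * e) ^+ 2 <= A ^+ 2 * e.
  rewrite exprMn; apply: ler_wpM2l; [exact: sqr_ge0|by rewrite expr2 ler_piMl].
have k5 : (N * m) ^+ 2 <= m ^+ 2 * C * e.
  rewrite exprMn mulrC -mulrA; apply: ler_wpM2l => //; exact: sqr_ge0.
by rewrite mulrDl; lra.
Qed.

(** The energy of the approximating functions tends to zero: it is the value of
    the vanishing bilaplacian up to a Cauchy difference. *)
Lemma biharmonic0 w (phi : nat -> R * R -> R) (K : R) : h2lim Om w phi K ->
  (forall f, Tc Om f -> bilaplace w f = 0) ->
  forall i j f, Tc Om f -> pair w (partial i (partial j f)) = 0.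
Proof.
move=> H hb; have [C C0 hC] := N2_bounded H; have tphi := h2_test H.
have p n : (0 : R) <= 2^-1 ^+ n by rewrite ltW// half_gt0.
have hE m : energy (phi m) (phi m) <= K * C * 2^-1 ^+ m.
  have [A hA] := bilaplace_limit H (tphi m).
  rewrite -subr_le0; apply: (@small_le0 _ _ (A * 2^-1 ^+ m)) => n.
  rewrite -(mulrA A) -exprD; set q := (m + n)%N.
  have mq : (m <= q)%N by exact: leq_addr.
  have := hA q; rewrite (hb _ (tphi m)); apply: (energy_tail (a := energy (phi m - phi q) (phi m))).
    rewrite (_ : phi m - phi q = (- 1) *: phi q + phi m); last by rewrite scaleN1r addrC.
    rewrite (energy_lin (tphi m) (- 1) (tphi q) (tphi m)) mulN1r.
    exact: sub_add_cancel.
  apply: le_trans (energy_cauchy_schwarz (TcB (tphi m) (tphi q)) (tphi m)) _.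
  have -> : N2 (phi m - phi q) = N2 (phi q - phi m).
    rewrite (_ : phi m - phi q = (- 1) *: (phi q - phi m)); last by rewrite scaleN1r opprB.
    by rewrite (N2Z (- 1) (TfB (Tc_Tf (tphi q)) (Tc_Tf (tphi m)))) normrN1 mul1r.
  by rewrite mulrAC; apply: ler_pM; [exact: N2_ge0|exact: N2_ge0|exact: (h2_cauchy H mq)|exact: hC].
move=> i j f tf; have [A hA] := pair_limit2 H i j tf.
apply/eqP; rewrite -sqrf_eq0; apply/eqP/le_anti; rewrite sqr_ge0 andbT.
apply: (@small_le0 _ _ (2 * A ^+ 2 + 2 * nrm f ^+ 2 * (4 * (K * C)))) => n.
have tn := Tc_Tf (tphi n).
apply: (sqr_bound (N := N2 (phi n)) (hA n)) => //.
- apply: le_trans (cauchy_schwarz (Tf_partial j (Tf_partial i tn)) (Tc_Tf tf)) _.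
  apply: ler_wpM2r; first exact: nrm_ge0.
  exact: nrm_N2 j i (phi n).
- have h2 : N2 (phi n) ^+ 2 <= (2 * Num.sqrt (energy (phi n) (phi n))) ^+ 2.
    apply: lerXn2r; [exact: N2_ge0| |exact: N2_le_energy].
    by rewrite nnegrE mulr_ge0// sqrtr_ge0.
  apply: le_trans h2 _; rewrite exprMn sqr_sqrtr ?energy_ge0// -natrX -mulrA.
  by apply: ler_wpM2l => //; exact: hE.
- by rewrite exprn_ile1// invf_le1// ler1n.
Qed.

Lemma bounded_set_box : bounded_set Om -> exists C : R, Om `<=` box C.
Proof.
move=> [M [Mr HM]]; exists (M + 1) => x Ox.
have := HM (M + 1) (ltr_pwDr ltr01 (lexx _)) x Ox.
by move=> /= H; split; apply: le_trans H; rewrite /Num.norm/= le_max lexx ?orbT//.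
Qed.

End Composition.

Theorem mainTheorem5 (R : realType) (Om : set (R * R)) :
  bounded_lipschitz_domain Om -> simply_connected Om ->
  connected (boundary Om) ->
  direct_sum (Hrotrot Om) (sym_grad_L2 Om) (curl_curl_H02 Om).
Proof.
move=> [_ oOm _ bOm lOm] sc _.
have [B OB] := bounded_set_box bOm.
have curlcurl0 w phi K : h2lim Om w phi K -> (forall f, Tc Om f -> bilaplace w f = 0) ->
    curl2_rows (curl2 (distr_of Om w)) = 0.
  move=> hw hb; have h := biharmonic0 hw hb.
  apply/matrixP => i j; rewrite [RHS]mxE; apply/funext => psi.
  have tpsi := testfun_Tc psi.
  rewrite (curlcurl_distr _ _ _ (h2_patch hw)) /curlcurl.
  by case: (i == 0); case: (j == 0); rewrite h ?oppr0.
split.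
  apply/seteqP; split => [tau Htau|_ [_ [U lU <-] [_ [v Hv <-] <-]]].
    have [U [w [lU Hw e]]] := decompose OB oOm sc lOm Htau.
    by exists (sym_grad (\col_i distr_of Om (U i))); [exists U|exists
      (curl2_rows (curl2 (distr_of Om w))); [exists w|]].
  exact: compose.
apply/seteqP; split => [_ [[U lU <-] [v Hv e]]|_ ->].
  have [w [phi [K [hw ew]]]] := h2lim_of_H0 Hv.
  rewrite /= -e ew; apply: (curlcurl0 _ _ _ hw) => f tf.
  (* curl curl w is a symmetric gradient, whose double rotation vanishes. *)
  have e' := etrans (esym (congr1 (fun T => curl2_rows (curl2 T)) ew)) e.
  have cs i j g : Tc Om g -> curlcurl w i j g = strain (fun k => U k \_ Om) i j g.
    move=> tg; have e1 := curlcurl_distr i j (mk_test tg) (h2_patch hw).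
    have e2 := congr1 (fun M : 'M[testfun Om -> R]_2 => M i j (mk_test tg)) e'.
    exact: (etrans (esym e1) (etrans e2 (strain_distr U i j (mk_test tg)))).
  have t2 i j := Tc_partial i (Tc_partial j tf).
  rewrite -rotrot_curlcurl (cs 0 0 _ (t2 1 1)) (cs 0 1 _ (t2 0 1)).
  by rewrite (cs 1 0 _ (t2 1 0)) (cs 1 1 _ (t2 0 0)); exact: rotrot_strain tf.
split.
  have p0 : (0 : R * R -> R) \_ Om = 0 by exact: patch_zoff.
  exists (fun _ => 0); first by move=> i; rewrite /L2 p0; apply: Tf_Lfun; exact: Tf0.
  apply/matrixP => i j; apply/funext => psi; rewrite strain_distr /strain p0.
  have h g : pair 0 g = 0 :> R by rewrite pair_ip ip0l.
  by rewrite !h oppr0 addr0 mulr0 mxE.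
(* For 0 in the second space, a solution of the homogeneous problem will do. *)
have [||w [phi [K [hw Hw hb]]]] := @biharmonic_solution R Om B OB oOm (fun _ => 0) 0 _ (lexx _).
- by move=> a f g _ _; rewrite mulr0 addr0.
- by move=> f _; rewrite normr0 mul0r.
by exists w => //; exact: (curlcurl0 _ _ _ hw).
Qed.
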